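(* Let $M$ be a contact sub-Riemannian manifold and $p_0\in M$, and let $\delta_\epsilon$ be the non-homogeneous dilations defined in some set of adapted coordinates in a neighbourhood of $p_0$. For the generic $p\in M$ sufficiently close to $p_0$ (that is, for all $p$ in a neighbourhood of $p_0$ outside a set of measure zero), $$\hat\nu(p)\le\liminf_{\epsilon\to0}\nu(\delta_\epsilon(p)).$$
   Context: A contact sub-Riemannian manifold is a connected $(2n+1)$-dimensional manifold $M$ with a rank $2n$ distribution $\mathcal D\subset TM$, locally $\mathcal D=\ker\alpha$ for a one-form $\alpha$ with $d\alpha|_{\mathcal D}$ non-degenerate, and a smooth metric on $\mathcal D$. A geodesic is a non-constant Lipschitz curve $\gamma:[0,1]\to M$, tangent to $\mathcal D$ a.e., which is locally a minimizer of the energy $\frac12\int\|\dot\gamma\|^2dt$ between its endpoints. Coordinates $(x,z)\in\mathbb{R}^{2n}\times\mathbb{R}$ on a neighbourhood $U$ of $p_0$ are adapted at $p_0$ if they are centred at $p_0$ and $\mathcal D_{p_0}=\operatorname{span}\{\partial_{x_1},\dots,\partial_{x_{2n}}\}$. In these coordinates $\delta_\epsilon(x,z)=(\epsilon x,\epsilon^2z)$, $\epsilon>0$. Let $f_1,\dots,f_{2n}$ be an orthonormal frame for $\mathcal D$ on $U$ (the coordinate representations being bounded with all derivatives). The nilpotent approximation at $p_0$ is the sub-Riemannian structure on $\mathbb{R}^{2n+1}$ for which the vector fields $\hat f_i=\lim_{\epsilon\to0}\epsilon\,(\delta_{1/\epsilon})_*f_i$, $i=1,\dots,2n$, form an orthonormal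 frame (it is a contact Carnot group). $\nu(p)$ denotes the number of (local) geodesics of $M$ joining $p_0$ and $p$, i.e. geodesics whose image is contained in the coordinate chart $U$ of $p_0$; $\hat\nu(p)$ denotes the number of geodesics joining the origin and $p$ (identified with its coordinates) for the nilpotent approximation. *)

(* Defs.v *)
From HB Require Import structures.
From mathcomp Require Import all_boot all_order all_algebra.
From mathcomp Require Import all_classical all_reals all_analysis.

Set Implicit Arguments.
Unset Strict Implicit.
Unset Printing Implicit Defensive.
Import Order.TTheory GRing.Theory Num.Theory.
Import numFieldNormedType.Exports.
Local Open Scope classical_set_scope.
Local Open Scope ring_scope.

Section euclidean.
Context {R : realType} {d : nat}.

Definition partials (V : normedModType R) (s : seq 'I_d) (f : 'rV[R]_d -> V) :
    'rV[R]_d -> V :=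
  foldr (fun i (g : 'rV[R]_d -> V) => 'D_(delta_mx 0 i) g) f s.

(* C^oo on a set O, always used with O open *)
Definition smooth_on (V : normedModType R) (O : set 'rV[R]_d)
    (f : 'rV[R]_d -> V) : Prop :=
  forall (s : seq 'I_d) x, O x ->
    {for x, continuous (partials s f)} /\
    forall i, derivable (partials s f) x (delta_mx 0 i).

Definition bounded_with_derivatives (V : normedModType R) (O : set 'rV[R]_d)
    (f : 'rV[R]_d -> V) : Prop :=
  forall s : seq 'I_d, exists K : R, forall x, O x -> `|partials s f x| <= K.

(* N has d-dimensional Lebesgue (outer) measure zero *)
Definition lebesgue_null (N : set 'rV[R]_d) : Prop :=
  forall e : R, 0 < e -> exists a b : nat -> 'rV[R]_d,
    [/\ forall k i, a k 0 i <= b k 0 i,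
        N `<=` \bigcup_k [set x | forall i, a k 0 i <= x 0 i <= b k 0 i] &
        (\sum_(0 <= k <oo) (\prod_(i < d) (b k 0 i - a k 0 i))%:E <= e%:E)%E].

(* A one-form on an open subset of R^d is given by its coefficients. *)
Definition one_form_ev (alpha : 'rV[R]_d -> 'rV[R]_d) (x v : 'rV[R]_d) : R :=
  \sum_(i < d) alpha x 0 i * v 0 i.

Definition ext_deriv (alpha : 'rV[R]_d -> 'rV[R]_d) (x v w : 'rV[R]_d) : R :=
  \sum_(i < d) \sum_(j < d)
    ('D_(delta_mx 0 i) (fun y => alpha y 0 j) x
     - 'D_(delta_mx 0 j) (fun y => alpha y 0 i) x) * v 0 i * w 0 j.

Definition vf_pushforward (phi phi_inv f : 'rV[R]_d -> 'rV[R]_d) :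
    'rV[R]_d -> 'rV[R]_d :=
  fun y => 'd phi (phi_inv y) (f (phi_inv y)).

End euclidean.

(* ccoord is meaningful on cdom only, and cinv on ccoord @` cdom only. *)
Record chart (R : realType) (M : Type) (d : nat) := Chart {
  cdom : set M;
  ccoord : M -> 'rV[R]_d;
  cinv : 'rV[R]_d -> M }.

Section smooth_manifold.
Context {R : realType} {M : topologicalType} {d : nat}.
Implicit Types c : chart R M d.

Definition cimg c : set 'rV[R]_d := ccoord c @` cdom c.

Definition chart_wf c : Prop :=
  [/\ open (cdom c), open (cimg c),
      forall p, cdom c p -> cinv c (ccoord c p) = p,
      forall p, cdom c p -> {for p, continuous (ccoord c)} &
      forall x, cimg c x -> {for x, continuous (cinv c)}].

Definition transition c1 c2 : 'rV[R]_d -> 'rV[R]_d := ccoord c2 \o cinv c1.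

Definition smoothly_compatible c1 c2 : Prop :=
  smooth_on (ccoord c1 @` (cdom c1 `&` cdom c2)) (transition c1 c2).

(* M is a d-dimensional smooth manifold with maximal atlas A. *)
Definition smooth_manifold (A : set (chart R M d)) : Prop :=
  [/\ hausdorff_space M, @second_countable M,
      A `<=` chart_wf /\ (forall p, exists2 c, A c & cdom c p),
      forall c1 c2, A c1 -> A c2 -> smoothly_compatible c1 c2 &
      forall c, chart_wf c ->
        (forall c', A c' ->
           smoothly_compatible c c' /\ smoothly_compatible c' c) -> A c].

Definition measure_zero (A : set (chart R M d)) (N : set M) : Prop :=
  forall c, A c -> lebesgue_null (ccoord c @` (N `&` cdom c)).

End smooth_manifold.

(* Tangent vectors at p are handled through their components v in a chart c
   around p: sr_distr c p v means that v represents a vector of D_p, and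
   sr_metric c p is the scalar product of D_p, meaningful on sr_distr c p
   only. *)
Record sr_data (R : realType) (M : topologicalType) (d : nat) := SRData {
  sr_atlas : set (chart R M d);
  sr_distr : chart R M d -> M -> set 'rV[R]_d;
  sr_metric : chart R M d -> M -> 'rV[R]_d -> 'rV[R]_d -> R }.

Section sub_riemannian.
Context {R : realType} {M : topologicalType} {d : nat}.
Variable S : sr_data R M d.
Local Notation A := (sr_atlas S).
Local Notation D := (sr_distr S).
Local Notation g := (sr_metric S).

(* The components in the various charts transform as tangent vectors do. *)
Definition sr_coherent : Prop :=
  forall c1 c2 p, A c1 -> A c2 -> cdom c1 p -> cdom c2 p ->
    let J := 'd (transition c1 c2) (ccoord c1 p) in
    (forall v, D c1 p v <-> D c2 p (J v)) /\
    (forall v w, D c1 p v -> D c1 p w -> g c1 p v w = g c2 p (J v) (J w)).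

Definition sr_rank (k : nat) : Prop :=
  forall c p, A c -> cdom c p -> exists2 B : 'M[R]_(k, d),
    \rank B = k & D c p = [set v | (v <= B)%MS].

Definition sr_contact : Prop :=
  forall p, exists c W (alpha : 'rV[R]_d -> 'rV[R]_d),
    [/\ A c, open W /\ W `<=` cdom c, W p, smooth_on (ccoord c @` W) alpha &
        forall q, W q ->
          D c q = [set v | one_form_ev alpha (ccoord c q) v = 0] /\
          forall v, D c q v -> v != 0 ->
            exists2 w, D c q w & ext_deriv alpha (ccoord c q) v w != 0].

Definition sr_smooth_metric : Prop :=
  (forall c p, A c -> cdom c p ->
    [/\ forall a u v w, D c p u -> D c p v -> D c p w ->
          g c p (a *: u + v) w = a * g c p u w + g c p v w,
        forall u v, D c p u -> D c p v -> g c p u v = g c p v u &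
        forall v, D c p v -> v != 0 -> 0 < g c p v v]) /\
  (forall c (O : set 'rV[R]_d) (X Y : 'rV[R]_d -> 'rV[R]_d),
    A c -> open O -> O `<=` cimg c -> smooth_on O X -> smooth_on O Y ->
    (forall x, O x -> D c (cinv c x) (X x) /\ D c (cinv c x) (Y x)) ->
    smooth_on O (fun x => g c (cinv c x) (X x) (Y x) : R^o)).

(* Curves [a, b] -> M are maps R -> M of which only the values on [a, b]
   matter. *)
Definition velocity (c : chart R M d) (gamma : R -> M) (t : R) : 'rV[R]_d :=
  derive1 (ccoord c \o gamma) t.

(* As [a, b] is compact, this is the Lipschitz property for (any) Riemannian
   distance on M. *)
Definition lipschitz_curve (a b : R) (gamma : R -> M) : Prop :=
  forall t, t \in `[a, b] -> exists c (e K : R),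
    [/\ A c, 0 < e & forall s s', s \in `[a, b] -> s' \in `[a, b] ->
      `|s - t| < e -> `|s' - t| < e ->
      [/\ cdom c (gamma s), cdom c (gamma s') &
          `|ccoord c (gamma s) - ccoord c (gamma s')| <= K * `|s - s'|]].

Definition tangent_at (gamma : R -> M) (t : R) : Prop :=
  exists c, [/\ A c, cdom c (gamma t), derivable (ccoord c \o gamma) t 1 &
                D c (gamma t) (velocity c gamma t)].

Definition horizontal (a b : R) (gamma : R -> M) : Prop :=
  lipschitz_curve a b gamma /\
  {ae lebesgue_measure, forall t : R, t \in `[a, b] -> tangent_at gamma t}.

(* squared norm of the velocity; all charts around gamma t give the same
   value *)
Definition speed_sq (gamma : R -> M) (t : R) : R :=
  get [set r : R | exists c, [/\ A c, cdom c (gamma t) &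
    r = g c (gamma t) (velocity c gamma t) (velocity c gamma t)]].

Definition energy (a b : R) (gamma : R -> M) : \bar R :=
  ((2^-1)%:E *
   \int[lebesgue_measure]_(t in [set` `[a, b]]) (speed_sq gamma t)%:E)%E.

Definition energy_minimizer (a b : R) (gamma : R -> M) : Prop :=
  forall eta, horizontal a b eta -> eta a = gamma a -> eta b = gamma b ->
    (energy a b gamma <= energy a b eta)%E.

Definition geodesic (gamma : R -> M) : Prop :=
  [/\ horizontal 0 1 gamma,
      exists s t, [/\ s \in `[0, 1], t \in `[0, 1] & gamma s <> gamma t] &
      forall t, t \in `[0, 1] -> exists2 e : R, 0 < e &
        forall a b, a \in `[0, 1] -> b \in `[0, 1] -> a < b ->
          `|a - t| < e -> `|b - t| < e -> energy_minimizer a b gamma].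

(* The last clause selects exactly one map R -> M for each curve
   [0, 1] -> M. *)
Definition geodesics_joining (U : set M) (p q : M) : set (R -> M) :=
  [set gamma | [/\ geodesic gamma, gamma 0 = p, gamma 1 = q,
    forall t, t \in `[0, 1] -> U (gamma t) &
    (forall t, t <= 0 -> gamma t = gamma 0) /\
    (forall t, 1 <= t -> gamma t = gamma 1)]].

(* an extended real: a natural number or +oo *)
Definition num_geodesics (U : set M) (p q : M) : \bar R :=
  counting (geodesics_joining U p q).

End sub_riemannian.

Definition contact_sub_riemannian (R : realType) (M : topologicalType)
    (n : nat) (S : sr_data R M (2 * n + 1)) : Prop :=
  [/\ smooth_manifold (sr_atlas S) /\ connected [set: M],
      sr_coherent S, sr_rank S (2 * n), sr_contact S & sr_smooth_metric S].

Section frames.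
Context {R : realType} {k d : nat}.
Implicit Types f : 'I_k -> 'rV[R]_d -> 'rV[R]_d.

Definition frame_mx f (x : 'rV[R]_d) : 'M[R]_(k, d) := \matrix_(i < k) f i x.

(* f is the coordinate representation, in the chart c, of an orthonormal frame
   of the distribution on the domain of c. *)
Definition orthonormal_frame (M : topologicalType) (S : sr_data R M d)
    (c : chart R M d) f : Prop :=
  (forall i, smooth_on (cimg c) (f i)) /\
  forall x, cimg c x ->
    sr_distr S c (cinv c x) = [set v | (v <= frame_mx f x)%MS] /\
    forall i j, sr_metric S c (cinv c x) (f i x) (f j x) = (i == j)%:R.

(* The sub-Riemannian structure on R^d with orthonormal frame f:
   v *m pinvmx (frame_mx f x) is the row of the components, in the frame, of a
   vector v of the distribution at x. *)
Definition frame_structure f : sr_data R 'rV[R]_d d :=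
  SRData [set Chart setT id id]
    (fun _ x => [set v | (v <= frame_mx f x)%MS])
    (fun _ x v w =>
       \sum_(i < k) (v *m pinvmx (frame_mx f x)) 0 i *
                    (w *m pinvmx (frame_mx f x)) 0 i).

End frames.

Section nilpotent_approximation.
Context {R : realType} {n : nat}.
Local Notation E := 'rV[R]_(2 * n + 1).

Definition adapted (M : topologicalType) (S : sr_data R M (2 * n + 1))
    (p0 : M) (c : chart R M (2 * n + 1)) : Prop :=
  [/\ sr_atlas S c, cdom c p0, ccoord c p0 = 0 &
      sr_distr S c p0 = [set row_mx u 0 | u in [set: 'rV[R]_(2 * n)]]].

Definition dilation (eps : R) (x : E) : E :=
  row_mx (eps *: lsubmx x) (eps ^+ 2 *: rsubmx x).

Definition nilpotent_frame (f : 'I_(2 * n) -> E -> E) : 'I_(2 * n) -> E -> E :=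
  fun i x =>
    lim ((eps *: vf_pushforward (dilation eps^-1) (dilation eps) (f i) x)
           @[eps --> 0^'+]).

Definition nilpotent_approximation (f : 'I_(2 * n) -> E -> E) :
    sr_data R E (2 * n + 1) :=
  frame_structure (nilpotent_frame f).

End nilpotent_approximation.

(* Main.v *)
(* The nilpotent approximation is a step two structure, so the Lagrange
   multiplier rule shows that each of its geodesics is the projection of a
   solution of the Hamiltonian system of its frame [hat f].  The
   endpoint of such a solution is a function of its initial covector, and
   outside of its critical values, a null set by Sard's theorem, the derivative
   of the endpoint map is invertible.  The frame [eps (delta_(1/eps))_* f]
   converges to [hat f] in C^1 on compact sets, so a Newton iteration turns each
   geodesic of the nilpotent approximation ending at a regular value into a
   solution for the rescaled frame with the same endpoints, uniformly close to
   it for small [eps].  Scaling back by [delta_eps] gives an extremal of [f], and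
   a second variation estimate on short intervals shows that extremals are
   geodesics of M.  Finitely many distinct geodesics of the nilpotent
   approximation thus persist as distinct geodesics ending at [delta_eps p]. *)
Require Import Defs.
From HB Require Import structures.
From mathcomp Require Import all_boot all_order all_algebra.
From mathcomp Require Import all_classical all_reals all_analysis.
From mathcomp Require Import measurable_realfun ring lra.
Import Order.TTheory GRing.Theory Num.Theory.
Import numFieldNormedType.Exports.
Local Open Scope classical_set_scope.
Local Open Scope ring_scope.

(** * Lipschitz functions and their almost everywhere derivatives *)

(** Two obstacles shape the proof. The first is regularity: horizontal curves are only Lipschitz,
    and the speed of a competitor is not known to be measurable. Calculus is therefore done on pairs
    made of a Lipschitz function and an a.e. derivative, all comparisons resting on one monotonicity
    lemma, and energies are bounded through inequalities valid almost everywhere. The second is that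
    the Hamiltonian fields are not globally Lipschitz, so no endpoint map is at hand on an open set.
    Estimates are stated for pairs of solutions staying in a common cube, and the form of Sard's
    theorem used here asks only for a uniform second order expansion on an arbitrary bounded set.
    Since a geodesic minimizes only locally, the multiplier rule gives one multiplier per short
    interval, and these have to be shown to agree. Local optimality of extremals compares controls
    directly. It must also confine the competitor, which may leave the chart: doing so costs more
    energy than the extremal spends. *)

Section interval_tools.
Context {R : realType}.
Implicit Types (a b s t u : R) (F G f g : R -> R).
Local Notation mu := (@lebesgue_measure R).

(** Cousin's covering lemma, that is, compactness of the interval for a gauge [e] depending on the
    tag [t]. The supremum of the reachable right ends is itself reachable, and short intervals
    around it reach further unless it is [b]. *)
Lemma cousin a b (P : R -> R -> Prop) : a <= b ->
  (forall s t u, a <= s -> s <= t -> t <= u -> u <= b ->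
    P s t -> P t u -> P s u) ->
  (forall t, a <= t -> t <= b -> exists2 e : R, 0 < e &
    forall s u, a <= s -> s <= t -> t <= u -> u <= b ->
      t - e < s -> u < t + e -> P s u) ->
  P a b.
Proof.
move=> ab Ptr Ploc.
pose E := [set s | a <= s /\ s <= b /\ P a s].
have Ea : E a.
  by split=> //; split=> //; have [e e0] := Ploc _ (lexx a) ab; apply; lra.
have hE : has_sup E.
  by split; [exists a | exists b => s [_ []]].
set t := sup E.
have aT : a <= t by apply: ub_le_sup Ea; case: hE.
have Tb : t <= b by apply: ge_sup; [exists a | move=> s [_ []]].
have [e e0 He] := Ploc t aT Tb.
have [s [as_ [sb Pas]] es] := sup_adherent e0 hE.
have sT : s <= t by apply: ub_le_sup; [case: hE | split].
have Pat : P a t.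
  by apply: (Ptr _ s) => //; apply: He => //; rewrite ltrDl.
have [tb|] := ltP t b; last by move=> bt; have -> : b = t by lra.
have [bte|tbe] := ltP b (t + e).
  by apply: (Ptr _ t) => //; apply: He => //; rewrite ?ltrBlDr ?ltrDl.
have : E (t + e / 2).
  split; first by lra.
  split; first by lra.
  apply: (Ptr _ t) => //; try lra.
  by apply: He; lra.
by move=> /(ub_le_sup hE.2); rewrite -/t; lra.
Qed.

Definition lip_on a b F :=
  exists K : R, forall s t, a <= s -> s <= t -> t <= b ->
    `|F t - F s| <= K * (t - s).

(** The straddle lemma: the first order errors from [s] to [t] and from [t] to [u] add up because
    both lengths are at most [u - s]. This is the local input required by [cousin]. *)
Lemma derivable_increments F t l (eta : R) : is_derive t 1 F l -> 0 < eta ->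
  exists2 e : R, 0 < e & forall s u, s <= t -> t <= u ->
    t - e < s -> u < t + e -> `|F u - F s - l * (u - s)| <= eta * (u - s).
Proof.
move=> dF eta0.
have /cvgrPdist_le/(_ _ eta0) : h^-1 *: (F (h *: 1 + t) - F t) @[h --> 0^'] --> l.
  have [dr <-] := dF; exact: dr.
move=> [e /= e0 He]; exists e => //.
have H h : `|h| < e -> `|F (h + t) - F t - l * h| <= eta * `|h|.
  move=> he; have [->|h0] := eqVneq h 0; first by rewrite add0r subrr !mulr0 subr0 normr0 mulr0.
  have := He h; rewrite /ball/= sub0r normrN => /(_ he h0).
  rewrite [_ *: 1]mulr1 distrC /GRing.scale/= => H1.
  have -> : F (h + t) - F t - l * h = (h^-1 * (F (h + t) - F t) - l) * h.
    by rewrite mulrBl mulrAC mulVf// mul1r.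
  by rewrite normrM ler_wpM2r.
move=> s u st tu es ue.
have H1 : `|u - t| < e by rewrite ger0_norm; lra.
have H2 : `|s - t| < e by rewrite ler0_norm; lra.
have := H _ H1; have := H _ H2; rewrite !subrK.
rewrite (ger0_norm (_ : 0 <= u - t)) ?subr_ge0//.
rewrite (ler0_norm (_ : s - t <= 0)) ?subr_le0//.
rewrite !ler_norml => /andP[? ?] /andP[? ?]; apply/andP; split; lra.
Qed.

Definition dae a b F f := {ae mu, forall t, a < t -> t < b -> is_derive t 1 F (f t)}.

Lemma ae_and (P Q : R -> Prop) :
  {ae mu, forall t, P t} -> {ae mu, forall t, Q t} -> {ae mu, forall t, P t /\ Q t}.
Proof. by move=> hP hQ; apply: (@filterI _ _ (ae_filter_ringOfSetsType mu)). Qed.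

Lemma ae_impl (P Q : R -> Prop) :
  (forall t, P t -> Q t) -> {ae mu, forall t, P t} -> {ae mu, forall t, Q t}.
Proof. by move=> PQ; apply: (@filterS _ _ (ae_filter_ringOfSetsType mu)). Qed.

Lemma ae_all (P : R -> Prop) : (forall t, P t) -> {ae mu, forall t, P t}.
Proof. by move=> hP; apply: aeW. Qed.

(** On the exceptional null set nothing is known but the Lipschitz bound. That set is enclosed in an
    open [W] of small measure, where the bound costs at most [K] times the measure of [W]; elsewhere
    the straddle lemma applies. [cousin] adds up the local inequalities. *)
Lemma lip_ae_nondecreasing a b F f : a <= b -> lip_on a b F -> dae a b F f ->
  {ae mu, forall t, a < t -> t < b -> 0 <= f t} -> F a <= F b.
Proof.
move=> ab [K0 HK0] dF f0.
pose K := `|K0|.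
have HK s t : a <= s -> s <= t -> t <= b -> `|F t - F s| <= K * (t - s).
  move=> h1 h2 h3; apply: (le_trans (HK0 _ _ h1 h2 h3)).
  by rewrite ler_wpM2r ?subr_ge0// ler_norm.
have [N [mN N0 HN]] := ae_and _ _ dF f0.
apply/ler_addgt0Pr => eta eta0.
(* The endpoints are added because derivatives are only given in the open interval. *)
pose D := N `|` [set a] `|` [set b].
have mD : measurable D by apply: measurableU; [apply: measurableU|].
have D0 : mu D = 0%E.
  apply: measure_negligible => //; apply: negligibleU; first apply: negligibleU.
  - by exists N; split => //; exact: subset_refl.
  - by exists [set a]; split => //; exact: lebesgue_measure_set1.
  - by exists [set b]; split => //; exact: lebesgue_measure_set1.
pose e1 := eta / 2 / (K + 1).
have Kge0 : 0 <= K := normr_ge0 K0.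
have K1 : 0 < K + 1 by lra.
have e10 : 0 < e1 by rewrite !divr_gt0.
have Dfin : (mu D < +oo)%E by rewrite D0 ltry.
have [W [oW DO OD]] := lebesgue_regularity_outer mD Dfin e10.
pose eta1 := eta / 2 / (b - a + 1).
have ba1 : 0 < b - a + 1 by lra.
have eta10 : 0 < eta1 by rewrite !divr_gt0.
have mW : measurable W by exact: measurable_realfun.open_measurable.
(* The share of [W] in an interval is additive, so the inequality with the penalty [K * m s u] is
   transitive as [cousin] demands. *)
pose m s u := fine (mu (W `&` `]s, u]%classic)).
have mfin s u : mu (W `&` `]s, u]) \is a fin_num.
  rewrite ge0_fin_numE//; apply: (@le_lt_trans _ _ (mu `]s, u]%classic)).
    by apply: le_measure; rewrite ?inE//; exact: measurableI.
  by rewrite lebesgue_measure_itv/=; case: ifP => _; rewrite ?ltry// -EFinB ltry.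
have mD2 s t u : s <= t -> t <= u -> m s u = m s t + m t u.
  move=> st tu; rewrite /m -fineD//; congr fine.
  rewrite -measureU//; try exact: measurableI.
    rewrite -setIUr; congr (mu (_ `&` _)); apply/seteqP; split => x /=; rewrite !in_itv/=.
      by move=> /andP[sx xu]; case: (leP x t) => xt; [left|right]; rewrite ?sx ?xt.
    by case=> /andP[h1 h2]; apply/andP; split; lra.
  apply/seteqP; split => x //= -[[_ +] [_]]; rewrite !in_itv/=; lra.
have m0 s u : 0 <= m s u by rewrite fine_ge0.
have : 0 <= F b - F a + eta1 * (b - a) + K * m a b.
  apply: (@cousin a b (fun s u => 0 <= F u - F s + eta1 * (u - s) + K * m s u)) => //.
    by move=> s t u as_ st tu ub; rewrite (mD2 s t u)// mulrDr; lra.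
  move=> t at_ tb.
  have [Dt|nDt] := pselect (D t).
    have /nbhs_ballP[e /= e0 He] : nbhs t W.
      by rewrite nbhsE; exists W => //; split => //; exact: DO.
    exists e => // s u as_ st tu ub es ue.
    have -> : m s u = u - s.
      rewrite /m (_ : W `&` _ = `]s, u]%classic); last first.
        apply/seteqP; split => x /=; first by case.
        rewrite in_itv/= => xsu; split => //; apply: He.
        by rewrite /ball/= ltr_norml; lra.
      rewrite lebesgue_measure_itv/= lte_fin; case: ltP => // us.
      by have -> : u = s; [lra | rewrite subrr].
    have := HK s u as_ (le_trans st tu) ub; rewrite ler_norml => /andP[].
    have : 0 <= eta1 * (u - s) by rewrite mulr_ge0//; lra.
    lra.
  have at1 : a < t.
    by rewrite lt_neqAle at_ andbT; apply/eqP => E; apply: nDt; left; right.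
  have tb1 : t < b.
    by rewrite lt_neqAle tb andbT; apply/eqP => E; apply: nDt; right.
  have [dt ft] : is_derive t 1 F (f t) /\ 0 <= f t.
    apply: contrapT => H; apply: nDt; left; left; apply: HN => /= -[h1 h2].
    by apply: H; split; [exact: h1|exact: h2].
  have [e e0 He] := derivable_increments _ _ _ _ dt eta10.
  exists e => // s u as_ st tu ub es ue.
  have := He s u st tu es ue; rewrite ler_norml => /andP[+ _].
  have : 0 <= f t * (u - s) by rewrite mulr_ge0//; lra.
  have : 0 <= K * m s u by rewrite mulr_ge0.
  lra.
have me1 : m a b <= e1.
  rewrite -lee_fin fineK//; apply: (@le_trans _ _ (mu W)).
    by apply: le_measure; rewrite ?inE//; exact: measurableI.
  have := @measureU2 _ _ _ mu (W `\` D) D (measurableD mW mD) mD.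
  by rewrite [X in (_ <= _ + X)%E -> _]D0 adde0 setUC setDUK// => /le_trans; apply; exact: ltW.
have : K * m a b <= eta / 2.
  apply: (@le_trans _ _ ((K + 1) * e1)).
    by apply: ler_pM => //; lra.
  by rewrite /e1 mulrC divfK// gt_eqF.
have : eta1 * (b - a) <= eta / 2.
  apply: (@le_trans _ _ (eta1 * (b - a + 1))); first by rewrite ler_pM2l//; lra.
  by rewrite /eta1 divfK// gt_eqF.
lra.
Qed.

End interval_tools.

Section ac_calculus.
Context {R : realType}.
Implicit Types (a b s t u : R) (F G f g : R -> R).
Local Notation mu := (@lebesgue_measure R).

Lemma lip_onS a b s u F : a <= s -> u <= b -> lip_on a b F -> lip_on s u F.
Proof.
move=> as_ ub [K HK]; exists K => x y sx xy yu.
by apply: HK => //; [exact: le_trans sx | exact: le_trans ub].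
Qed.

Lemma lip_on_bounded a b F : lip_on a b F ->
  exists B : R, forall t, a <= t -> t <= b -> `|F t| <= B.
Proof.
move=> [K HK]; exists (`|F a| + `|K| * (b - a)) => t at_ tb.
have := HK a t (lexx a) at_ tb.
have : K * (t - a) <= `|K| * (b - a) by apply: (le_trans (ler_norm _)); rewrite normrM ler_pM// ger0_norm; lra.
have := ler_normD (F t - F a) (F a); rewrite subrK; lra.
Qed.

Lemma lip_on_cst a b (k : R) : lip_on a b (fun=> k).
Proof. by exists 0 => *; rewrite subrr normr0 mul0r. Qed.

Lemma lip_on_id a b : lip_on a b id.
Proof. by exists 1 => s t _ st _; rewrite mul1r ger0_norm//; lra. Qed.

Lemma lip_onD a b F G : lip_on a b F -> lip_on a b G -> lip_on a b (fun t => F t + G t).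
Proof.
move=> [K HK] [L HL]; exists (K + L) => s t h1 h2 h3.
have := HK s t h1 h2 h3; have := HL s t h1 h2 h3.
have := ler_normD (F t - F s) (G t - G s).
by rewrite (_ : F t - F s + _ = F t + G t - (F s + G s)); [lra|ring].
Qed.

Lemma lip_onM a b F G : lip_on a b F -> lip_on a b G -> lip_on a b (fun t => F t * G t).
Proof.
move=> lF lG; have [A HA] := lip_on_bounded _ _ _ lF; have [B HB] := lip_on_bounded _ _ _ lG.
move: lF lG => [K HK] [L HL]; exists (K * B + A * L) => s t h1 h2 h3.
have -> : F t * G t - F s * G s = (F t - F s) * G t + F s * (G t - G s) by ring.
apply: (le_trans (ler_normD _ _)); rewrite !normrM mulrDl; apply: lerD.
  rewrite mulrAC; apply: ler_pM => //; first exact: HK.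
  by apply: HB => //; exact: le_trans h2.
by rewrite -mulrA; apply: ler_pM => //; [apply: HA => //; exact: le_trans h3|exact: HL].
Qed.

Lemma lip_on_sum a b (n : nat) (F : 'I_n -> R -> R) : (forall i, lip_on a b (F i)) ->
  lip_on a b (fun t => \sum_(i < n) F i t).
Proof.
elim: n F => [|n IH] F HF.
  by exists 0 => *; rewrite !big_ord0 subrr normr0 mul0r.
have := lip_onD _ _ _ _ (IH _ (fun i => HF (widen_ord (leqnSn n) i))) (HF ord_max).
by move=> [K HK]; exists K => s t; rewrite !big_ord_recr/=; exact: HK.
Qed.

Lemma lip_onN a b F : lip_on a b F -> lip_on a b (fun t => - F t).
Proof.
move=> [K HK]; exists K => s t h1 h2 h3.
by rewrite -opprD normrN; exact: HK.
Qed.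

Lemma lip_onB a b F G : lip_on a b F -> lip_on a b G -> lip_on a b (fun t => F t - G t).
Proof. by move=> lF lG; apply: lip_onD => //; exact: lip_onN. Qed.

Lemma daeS a b s u F f : a <= s -> u <= b -> dae a b F f -> dae s u F f.
Proof.
move=> as_ ub; apply: ae_impl => t H st tu; apply: H.
  exact: le_lt_trans st.
exact: lt_le_trans ub.
Qed.

Lemma is_derive_ext F G t (k l : R) : is_derive t 1 F k -> F =1 G -> k = l -> is_derive t 1 G l.
Proof. by move=> h /funext <- <-. Qed.

Lemma is_derive_near F G t (k : R) : is_derive t 1 F k -> (\near t, F t = G t) -> is_derive t 1 G k.
Proof.
move=> [dF <-] FG; split; first exact: near_eq_derivable dF.
by apply/esym/near_eq_derive.
Qed.

Lemma is_deriveMl F G t (k l : R) : is_derive t 1 F k -> is_derive t 1 G l ->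
  is_derive t 1 (fun x => F x * G x) (k * G t + F t * l).
Proof.
move=> dF dG; apply: (is_derive_ext _ _ _ _ _ (is_deriveM dF dG)) => //.
by rewrite addrC /GRing.scale/= mulrC.
Qed.

Lemma is_deriveDl F G t (k l : R) : is_derive t 1 F k -> is_derive t 1 G l ->
  is_derive t 1 (fun x => F x + G x) (k + l).
Proof. by move=> dF dG; apply: (is_derive_ext _ _ _ _ _ (is_deriveD dF dG)). Qed.

Lemma is_deriveBl F G t (k l : R) : is_derive t 1 F k -> is_derive t 1 G l ->
  is_derive t 1 (fun x => F x - G x) (k - l).
Proof. by move=> dF dG; apply: (is_derive_ext _ _ _ _ _ (is_deriveB dF dG)). Qed.

Lemma is_derive_cstl t (k : R) : is_derive t 1 (fun=> k) 0.
Proof. exact: is_derive_cst. Qed.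

Lemma is_derive_idl t : is_derive t 1 (fun x => x) 1.
Proof. exact: is_derive_id. Qed.

Lemma is_derive_suml t (n : nat) (F : 'I_n -> R -> R) (f : 'I_n -> R) :
  (forall i, is_derive t 1 (F i) (f i)) ->
  is_derive t 1 (fun x => \sum_(i < n) F i x) (\sum_(i < n) f i).
Proof.
move=> dF; apply: (is_derive_ext _ _ _ _ _ (is_derive_sum dF)) => // x.
by rewrite fct_sumE.
Qed.

(** Stands in for absolute continuity with derivative [f]. No measurability of [f] is asked: two
    such pairs are compared through [lip_ae_nondecreasing], without integrating [f]. *)
Definition ac a b F f := lip_on a b F /\ dae a b F f.

Lemma acS a b s u F f : a <= s -> u <= b -> ac a b F f -> ac s u F f.
Proof. by move=> as_ ub [l d]; split; [exact: lip_onS l|exact: daeS d]. Qed.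

Lemma acD a b F G f g : ac a b F f -> ac a b G g ->
  ac a b (fun t => F t + G t) (fun t => f t + g t).
Proof.
move=> [lF dF] [lG dG]; split; first exact: lip_onD.
apply: ae_impl (ae_and _ _ dF dG) => t [h1 h2] at_ tb.
by apply: is_deriveDl; [exact: h1|exact: h2].
Qed.

Lemma acB a b F G f g : ac a b F f -> ac a b G g ->
  ac a b (fun t => F t - G t) (fun t => f t - g t).
Proof.
move=> [lF dF] [lG dG]; split; first exact: lip_onB.
apply: ae_impl (ae_and _ _ dF dG) => t [h1 h2] at_ tb.
by apply: is_deriveBl; [exact: h1|exact: h2].
Qed.

Lemma acM a b F G f g : ac a b F f -> ac a b G g ->
  ac a b (fun t => F t * G t) (fun t => f t * G t + F t * g t).
Proof.
move=> [lF dF] [lG dG]; split; first exact: lip_onM.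
apply: ae_impl (ae_and _ _ dF dG) => t [h1 h2] at_ tb.
by apply: is_deriveMl; [exact: h1|exact: h2].
Qed.

Lemma ac_cst a b (k : R) : ac a b (fun=> k) (fun=> 0).
Proof. by split; [exact: lip_on_cst|apply: ae_all => t _ _; exact: is_derive_cstl]. Qed.

Lemma ac_id a b : ac a b (fun t => t) (fun=> 1).
Proof. by split; [exact: lip_on_id|apply: ae_all => t _ _; exact: is_derive_idl]. Qed.

Lemma acZ a b (k : R) F f : ac a b F f -> ac a b (fun t => k * F t) (fun t => k * f t).
Proof.
move=> h; have [l d] := acM _ _ _ _ _ _ (ac_cst a b k) h; split => //.
by apply: ae_impl d => t; rewrite mul0r add0r.
Qed.

Lemma ae_forall_ord (n : nat) (P : 'I_n -> R -> Prop) :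
  (forall i, {ae mu, forall t, P i t}) -> {ae mu, forall t, forall i, P i t}.
Proof.
elim: n P => [|n IH] P HP; first by apply: ae_all => t [].
apply: ae_impl (ae_and _ _ (IH _ (fun i => HP (lift ord0 i))) (HP ord0)) => t [h1 h2] i.
by case: (unliftP ord0 i) => [j|] ->.
Qed.

Lemma ac_sum a b (n : nat) (F f : 'I_n -> R -> R) : (forall i, ac a b (F i) (f i)) ->
  ac a b (fun t => \sum_(i < n) F i t) (fun t => \sum_(i < n) f i t).
Proof.
move=> H; split; first by apply: lip_on_sum => i; case: (H i).
apply: ae_impl (ae_forall_ord _ _ (fun i => (H i).2)) => t h at_ tb.
by apply: is_derive_suml => i; exact: h.
Qed.

Lemma ac_ae a b F f g : ac a b F f ->
  {ae mu, forall t, a < t -> t < b -> f t = g t} -> ac a b F g.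
Proof.
move=> [l d] fg; split => //; apply: ae_impl (ae_and _ _ d fg) => t [h1 h2] at_ tb.
by rewrite -h2//; exact: h1.
Qed.

Lemma ac_le a b F G f g : a <= b -> ac a b F f -> ac a b G g ->
  {ae mu, forall t, a < t -> t < b -> f t <= g t} -> F b - F a <= G b - G a.
Proof.
move=> ab hF hG fg; have [l d] := acB _ _ _ _ _ _ hG hF.
have := lip_ae_nondecreasing _ _ _ _ ab l d.
suff H : {ae mu, forall t, a < t -> t < b -> 0 <= g t - f t} by move=> /(_ H); lra.
by apply: ae_impl fg => t h at_ tb; rewrite subr_ge0 h.
Qed.

Lemma ac_eq a b F G f g : a <= b -> ac a b F f -> ac a b G g ->
  {ae mu, forall t, a < t -> t < b -> f t = g t} -> F b - F a = G b - G a.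
Proof.
move=> ab hF hG fg; apply/eqP; rewrite eq_le; apply/andP; split;
  apply: (ac_le _ _ _ _ _ _ ab); eauto; apply: ae_impl fg => t h at_ tb;
  by rewrite h.
Qed.

Lemma ac_C1 a b F f : {within `[a, b], continuous F} ->
  (forall t, a < t -> t < b -> is_derive t 1 F (f t)) ->
  (exists K : R, forall t, a < t -> t < b -> `|f t| <= K) -> ac a b F f.
Proof.
move=> cF dF [K HK]; split; last by apply: ae_all.
exists K => s t as_; rewrite le_eqVlt => /predU1P[->|st] tb.
  by rewrite !subrr normr0 mulr0.
have [||x] := @MVT R F f s t st.
- by move=> x; rewrite in_itv/= => /andP[sx xt]; apply: dF; lra.
- by apply: continuous_subspaceW cF => x /=; rewrite !in_itv/=; lra.
rewrite in_itv/= => /andP[sx xt] ->; rewrite normrM (ger0_norm (_ : 0 <= t - s)); last lra.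
by rewrite ler_wpM2r//; [lra|apply: HK; lra].
Qed.

End ac_calculus.

(** * Bounded measurable functions and their primitives *)

Section bounded_measurable.
Context {R : realType}.
Implicit Types (a b s t u : R) (F G f g : R -> R).
Local Notation mu := (@lebesgue_measure R).

(** Composition with this retraction extends a function from [a, b] by constants, so that statements
    about functions on the whole line apply to curves controlled on [a, b] only. *)
Definition clamp a b t : R := Num.max a (Num.min b t).

Lemma clamp_ge a b t : a <= clamp a b t.
Proof. by rewrite /clamp le_max lexx. Qed.

Lemma clamp_le a b t : a <= b -> clamp a b t <= b.
Proof. by move=> ab; rewrite /clamp ge_max ab/= ge_min lexx. Qed.

Lemma clamp_id a b t : a <= t -> t <= b -> clamp a b t = t.
Proof. by move=> at_ tb; rewrite /clamp (min_idPr tb) (max_idPr at_). Qed.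

Lemma clamp_mono a b s t : s <= t -> clamp a b s <= clamp a b t.
Proof.
move=> st; rewrite /clamp ge_max !le_max lexx/= le_min !ge_min lexx st.
by rewrite !orbT.
Qed.

Lemma clamp_lip a b s t : `|clamp a b t - clamp a b s| <= `|t - s|.
Proof.
wlog st : s t / s <= t.
  move=> H; case: (leP s t) => [|/ltW]; first exact: H.
  by move=> ts; rewrite distrC (distrC t); exact: H.
rewrite !ger0_norm ?subr_ge0//; last exact: clamp_mono.
rewrite /clamp !maxElt !minElt.
case: (ltP b t) => ?; case: (ltP b s) => ?.
- by rewrite subrr; lra.
- by case: (ltP a b) => ?; case: (ltP a s) => ?; lra.
- by case: (ltP a t) => ?; case: (ltP a b) => ?; lra.
- by case: (ltP a t) => ?; case: (ltP a s) => ?; lra.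
Qed.

Lemma lip_continuous F (K : R) :
  (forall s t, `|F t - F s| <= K * `|t - s|) -> continuous F.
Proof.
move=> HK t; apply/cvgrPdist_le => e e0; near=> s.
rewrite distrC; apply: (le_trans (HK t s)).
have K1 : 0 < `|K| + 1 by rewrite ltr_pwDr.
apply: (@le_trans _ _ ((`|K| + 1) * `|s - t|)).
  by rewrite ler_wpM2r// (le_trans (ler_norm K))// lerDl.
rewrite mulrC -ler_pdivlMr// distrC; near: s.
by apply: cvgr_dist_le => //; rewrite divr_gt0.
Unshelve. all: by end_near. Qed.

Lemma clamp_continuous a b : continuous (clamp a b).
Proof. by apply: (@lip_continuous _ 1) => s t; rewrite mul1r clamp_lip. Qed.

Lemma lip_on_clamp a b F : a <= b -> lip_on a b F ->
  exists2 K : R, 0 <= K & forall s t, `|F (clamp a b t) - F (clamp a b s)| <= K * `|t - s|.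
Proof.
move=> ab [K HK]; exists `|K| => // s t.
wlog st : s t / s <= t.
  move=> H; case: (leP s t) => [|/ltW]; first exact: H.
  by move=> ts; rewrite distrC (distrC t); exact: H.
apply: (le_trans (HK _ _ (clamp_ge a b s) (clamp_mono _ _ _ _ st) (clamp_le _ _ _ ab))).
apply: (le_trans (ler_norm _)); rewrite normrM ler_wpM2l//; exact: clamp_lip.
Qed.

Lemma lip_on_clamp_continuous a b F : a <= b -> lip_on a b F -> continuous (F \o clamp a b).
Proof. by move=> ab /(lip_on_clamp _ _ _ ab)[K _ HK]; exact: lip_continuous HK. Qed.

Definition bmf f := measurable_fun setT f /\ exists K : R, forall t, `|f t| <= K.

Lemma bmf_cst (k : R) : bmf (fun=> k).
Proof. by split; [exact: measurable_cst|exists `|k|]. Qed.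

Lemma bmfD f g : bmf f -> bmf g -> bmf (fun t => f t + g t).
Proof.
move=> [mf [K HK]] [mg [L HL]]; split; first exact: measurable_funD.
exists (K + L) => t; apply: (le_trans (ler_normD _ _)); exact: lerD.
Qed.

Lemma bmfM f g : bmf f -> bmf g -> bmf (fun t => f t * g t).
Proof.
move=> [mf [K HK]] [mg [L HL]]; split; first exact: measurable_funM.
by exists (K * L) => t; rewrite normrM ler_pM.
Qed.

Lemma bmfZ (k : R) f : bmf f -> bmf (fun t => k * f t).
Proof. by move=> hf; exact: bmfM (bmf_cst k) hf. Qed.

Lemma bmfB f g : bmf f -> bmf g -> bmf (fun t => f t - g t).
Proof.
move=> [mf [K HK]] [mg [L HL]]; split; first exact: measurable_funB.
exists (K + L) => t; apply: (le_trans (ler_normB _ _)); exact: lerD.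
Qed.

Lemma bmf_sum (n : nat) (f : 'I_n -> R -> R) : (forall i, bmf (f i)) ->
  bmf (fun t => \sum_(i < n) f i t).
Proof.
elim: n f => [|n IH] f Hf.
  rewrite (_ : (fun _ => _) = fun=> 0); first exact: bmf_cst.
  by apply/funext => t; rewrite big_ord0.
rewrite (_ : (fun _ => _) = (fun t => \sum_(i < n) f (widen_ord (leqnSn n) i) t + f ord_max t)).
  by apply: bmfD => //; exact: IH.
by apply/funext => t; rewrite big_ord_recr.
Qed.

Lemma bmf_norm f : bmf f -> bmf (fun t => `|f t|).
Proof.
move=> [mf [K HK]]; split; first exact: measurableT_comp.
by exists K => t; rewrite normr_id.
Qed.

Lemma bmf_clamp a b f : a <= b -> continuous (f \o clamp a b) -> bmf (f \o clamp a b).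
Proof.
move=> ab cf; split; first exact: continuous_measurable_fun.
have [|c _ Hc] := @EVT_max R (fun t => `|f (clamp a b t)|) a b ab.
  apply: continuous_subspaceT => t; apply: (@continuous_comp _ _ _ (f \o clamp a b) (fun x : R => `|x|)) => //.
    exact: cf.
  exact: norm_continuous.
exists `|f (clamp a b c)| => t.
have := Hc (clamp a b t); rewrite in_itv/= clamp_ge clamp_le// => /(_ isT).
by rewrite (clamp_id a b (clamp a b t)) ?clamp_ge ?clamp_le.
Qed.

Lemma bmf_lip a b F : a <= b -> lip_on a b F -> bmf (F \o clamp a b).
Proof. by move=> ab lF; apply: bmf_clamp => //; exact: lip_on_clamp_continuous. Qed.

(** The domain is empty for [x < a], so the primitive is then 0 and stays Lipschitz on the whole
    line. *)
Definition prim a f x : R := \int[mu]_(t in `[a, x]) f t.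

Lemma itv_finite a b : (mu `[a, b]%classic < +oo)%E.
Proof. by rewrite lebesgue_measure_itv/=; case: ifP => _; rewrite ?ltry// -EFinB ltry. Qed.

Lemma bmf_integrable f (i : interval R) : (mu [set` i] < +oo)%E -> bmf f ->
  mu.-integrable [set` i] (EFin \o f).
Proof.
move=> ifin [mf [K HK]]; apply: measurable_bounded_integrable => //.
  exact: measurable_funS mf.
by exists K; split; rewrite ?num_real // => x Kx y _ /=; exact: le_trans (ltW Kx).
Qed.

Lemma prim_lip a f (K : R) : bmf f -> (forall t, `|f t| <= K) ->
  forall s t, s <= t -> `|prim a f t - prim a f s| <= K * (t - s).
Proof.
move=> bf HK s t st.
have K0 : 0 <= K by apply: le_trans (HK 0).
have [ta|at_] := ltP t a.
  rewrite /prim !set_itv_ge ?bnd_simp -?ltNge ?(le_lt_trans st)//.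
  by rewrite !Rintegral_set0 subrr normr0 mulr_ge0//; lra.
have int : mu.-integrable `[a, t] (EFin \o f).
  by apply: bmf_integrable => //; exact: itv_finite.
have bound x y : x <= y -> `|\int[mu]_(t in `]x, y]) f t| <= K * (y - x).
  move=> xy.
  have fin : (mu `]x, y]%classic < +oo)%E.
    by rewrite lebesgue_measure_itv/=; case: ifP => _; rewrite ?ltry// -EFinB ltry.
  have i1 : mu.-integrable `]x, y] (EFin \o f) by exact: bmf_integrable.
  apply: (le_trans (le_normr_Rintegral _ i1)) => //.
  apply: (@le_trans _ _ (\int[mu]_(t in `]x, y]) K)).
    apply: le_Rintegral => //.
      by apply: (@bmf_integrable (fun t => `|f t|)) => //; exact: bmf_norm.
    by apply: (@bmf_integrable (fun=> K)) => //; exact: bmf_cst.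
  rewrite Rintegral_cst// (_ : fine _ = y - x)//.
  rewrite [X in fine X]lebesgue_measure_itv/= lte_fin; case: ltP => //= yx.
  lra.
have [sa|as_] := ltP s a.
  rewrite {2}/prim set_itv_ge ?bnd_simp -?ltNge// Rintegral_set0 subr0 /prim.
  rewrite -(@Rintegral_itv_obnd_cbnd _ a (BRight t)); last first.
    apply: bmf_integrable => //.
    by rewrite lebesgue_measure_itv/=; case: ifP => _; rewrite ?ltry// -EFinB ltry.
  by apply: (le_trans (bound _ _ at_)); rewrite ler_wpM2l//; lra.
by rewrite /prim (Rintegral_itvB int) ?bnd_simp//; exact: bound.
Qed.

Lemma prim_ac a b f : bmf f -> ac a b (prim a f) f.
Proof.
move=> bf; have [mf [K HK]] := bf; split.
  by exists K => s t _ st _; exact: prim_lip.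
have H1 y : mu.-integrable [set` Interval (BLeft a) (BRight y)] (EFin \o f).
  by apply: bmf_integrable => //; exact: itv_finite.
have H2 : locally_integrable [set: R] f.
  split => //; first exact: openT.
  move=> A _ cA; have /integrableP[_] : mu.-integrable A (EFin \o f).
    apply: measurable_bounded_integrable => //.
    - exact: compact_measurable.
    - exact: compact_finite_measure.
    - exact: measurable_funS mf.
    - by exists K; split; rewrite ?num_real // => x Kx y _ /=; exact: le_trans (ltW Kx).
  by [].
have := FTC1 H1 H2; apply: ae_impl => t H at_ tb.
have [|h1 h2] := H; first by rewrite ?bnd_simp ?ltW.
by split; [exact: h1|exact: etrans (esym (derive1E _ _)) h2].
Qed.

Lemma prim_start a f : prim a f a = 0.
Proof. by rewrite /prim set_itv1 Rintegral_set1. Qed.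

Lemma integral_prim a b f : bmf f -> (\int[mu]_(t in `[a, b]) (f t)%:E = (prim a f b)%:E)%E.
Proof.
move=> bf; rewrite /prim /Rintegral fineK//; apply: integrable_fin_num => //.
by apply: bmf_integrable => //; exact: itv_finite.
Qed.

Lemma prim_derive a b f t : bmf f -> a < t -> {for t, continuous f} ->
  is_derive t 1 (prim a f) (f t).
Proof.
move=> bf at_ cf.
have [||h1 h2] := @continuous_FTC1_closed R f a t (t + 1) _ _ at_ cf.
- by rewrite ltrDl.
- by apply: bmf_integrable => //; exact: itv_finite.
by split; [exact: h1|exact: etrans (esym (derive1E _ _)) h2].
Qed.

(** The derivative of a Lipschitz function exists a.e. at best. The upper limit of the difference
    quotients with step 1/(n+1) is defined everywhere, measurable, and equal to the derivative where
    there is one; clamping to [-K, K] makes it bounded at all points. *)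
Lemma lip_derivative_rep a b F : a < b -> lip_on a b F ->
  exists2 g, bmf g & forall t l, a < t -> t < b -> is_derive t 1 F l -> g t = l.
Proof.
move=> ab lF; have [K K0 HK] := lip_on_clamp _ _ _ (ltW ab) lF.
pose G := F \o clamp a b.
pose h (n : nat) t : R := n.+1%:R * (G (t + n.+1%:R^-1) - G t).
have hK n t : `|h n t| <= K.
  rewrite /h normrM; apply: (@le_trans _ _ (n.+1%:R * (K * n.+1%:R^-1))).
    rewrite ger0_norm// ler_wpM2l//; apply: (le_trans (HK _ _)).
    by rewrite addrAC subrr add0r ger0_norm.
  by rewrite mulrCA mulfV// mulr1.
have cG : continuous G by exact: lip_on_clamp_continuous (ltW ab) lF.
have mh n : measurable_fun setT (h n).
  apply: measurable_funM => //; apply: measurable_funB; last exact: continuous_measurable_fun.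
  apply: continuous_measurable_fun => t.
  apply: (@continuous_comp _ _ _ (fun t => t + n.+1%:R^-1) G); last exact: cG.
  by apply: cvgD; [exact: cvg_id|exact: cvg_cst].
exists (fun t => clamp (- K) K (limn_sup (h^~ t))).
  split.
    apply: (@measurableT_comp _ _ _ _ _ _ (clamp (- K) K)).
      by apply: continuous_measurable_fun; exact: clamp_continuous.
    apply: measurable_fun_limn_sup => // t _.
      by exists K => _ [n _ <-]; exact: le_trans (ler_norm _) (hK n t).
    by exists (- K) => _ [n _ <-]; have := hK n t; rewrite ler_norml => /andP[].
  exists K => t; rewrite ler_norml clamp_ge clamp_le//; lra.
move=> t l at_ tb dF.
have dG : is_derive t 1 G l.
  apply: is_derive_near dF _; near=> x.
  rewrite /G/= clamp_id//; apply: ltW; near: x; [exact: lt_nbhsr|exact: lt_nbhsl].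
have cvh : h^~ t @ \oo --> l.
  have [/cvg_ex[l' Hl'] dGl] := dG.
  have El : l' = l by rewrite -dGl /derive; apply/esym/cvg_lim.
  rewrite El in Hl'.
  have Hs : (fun n : nat => n.+1%:R^-1 : R) @ \oo --> 0^'.
    move=> A [e /= e0 He]; have /cvgrPdist_lt/(_ _ e0) := @cvg_harmonic R.
    apply: filterS => n Hn; apply: He => //.
  have := cvg_comp _ _ Hs Hl'; apply: cvg_trans; apply: near_eq_cvg; near=> n.
  by rewrite /h /= invrK [_ *: 1]mulr1 (addrC t).
have lK : `|l| <= K.
  rewrite -(cvg_lim _ cvh)//; have <- : limn (fun n => `|h n t|) = `|limn (h^~ t)|.
    by apply/cvg_lim => //; rewrite (cvg_lim _ cvh)//; exact: cvg_norm.
  apply: limr_le; last by near=> n; exact: hK.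
  by apply/cvg_ex; exists `|l|; exact: cvg_norm.
have -> : limn_sup (h^~ t) = l.
  have cv : cvgn (h^~ t : (R^o)^nat) by exact: cvgP cvh.
  by rewrite (cvg_limn_supE cv) (cvg_lim _ cvh).
by rewrite clamp_id//; move: lK; rewrite ler_norml => /andP[].
Unshelve. all: by end_near. Qed.

End bounded_measurable.

(** * Comparison of integrals without measurability *)

Section nonmeasurable_integral.
Import HBNNSimple.
Context {R : realType}.
Implicit Types (a b s t u : R).
Local Notation mu := (@lebesgue_measure R).

(** The integral of a nonnegative function is a supremum over simple functions below it. Cutting
    such a simple function to 0 on the exceptional null set preserves its integral and puts it below
    [g] everywhere. *)
Lemma le_integral_nonmeas (f g : R -> \bar R) :
  (forall t, (0 <= f t)%E) -> (forall t, (0 <= g t)%E) ->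
  {ae mu, forall t, (f t <= g t)%E} ->
  (\int[mu]_t f t <= \int[mu]_t g t)%E.
Proof.
move=> f0 g0 [N [mN N0 HN]].
rewrite !ge0_integralTE//; apply: ge_ereal_sup => _ [h /= hf <-].
pose h' := proj_nnsfun h (measurableC mN).
have h'E t : h' t = h t * \1_(~` N) t by rewrite /h'/= mindicE.
have hh' : sintegral mu h = sintegral mu h'.
  rewrite -!integralT_nnsfun; apply: ge0_ae_eq_integral => //.
  - by apply/measurable_EFinP.
  - by apply/measurable_EFinP.
  - by move=> x _; rewrite lee_fin.
  - by move=> x _; rewrite lee_fin.
  - exists N; split => // t /= Ht; apply: contrapT => Nt; apply: Ht => _.
    by congr EFin; apply: (etrans _ (esym (h'E t))); rewrite indicE mem_set ?mulr1.
rewrite hh'; apply: ereal_sup_ubound; exists h' => // t.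
rewrite h'E indicE; case: (pselect (N t)) => Nt.
  by have -> : (t \in ~` N) = false; [apply: memNset; apply | rewrite mulr0].
rewrite mem_set// mulr1; apply: (le_trans (hf t)).
by apply: contrapT => H; apply: Nt; apply: HN.
Qed.

Lemma ae_ne (x : R) : {ae mu, forall t : R, t <> x}.
Proof.
exists [set x]; split => //; first exact: lebesgue_measure_set1.
by move=> t /= H; apply: contrapT.
Qed.

Lemma ae_itv a b (P : R -> Prop) : {ae mu, forall t, a < t -> t < b -> P t} ->
  {ae mu, forall t, a <= t -> t <= b -> P t}.
Proof.
move=> H; apply: ae_impl (ae_and _ _ H (ae_and _ _ (ae_ne a) (ae_ne b))) => t [h [ta tb]] at1 tb1.
by apply: h; rewrite lt_neqAle ?at1 ?tb1 andbT; apply/eqP => // E; apply: ta.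
Qed.

(** Bounds the energy of a competitor from below by its part up to the time [s] at which it leaves a
    cube. The negative part of [sp] vanishes a.e. and so has integral 0. *)
Lemma integral_ge_ae a s b (sp e : R -> R) : a <= s -> s <= b -> bmf e ->
  (forall t, 0 <= e t) ->
  {ae mu, forall t, a < t -> t < s -> e t <= sp t} ->
  {ae mu, forall t, a < t -> t < b -> 0 <= sp t} ->
  ((prim a e s)%:E <= \int[mu]_(t in `[a, b]) (sp t)%:E)%E.
Proof.
move=> as_ sb be e0 /ae_itv esp /ae_itv sp0.
rewrite -integral_prim// [leRHS]integralE.
have -> : (\int[mu]_(x in `[a, b]) ((fun t => (sp t)%:E)^\- x) = 0)%E.
  apply/eqP; rewrite eq_le; apply/andP; split; last by apply: integral_ge0.
  rewrite integral_mkcond -(@integral0 _ _ _ mu setT).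
  apply: le_integral_nonmeas => //; first by move=> t; apply: erestrict_ge0.
  apply: ae_impl sp0 => t H; rewrite patchE; case: ifPn => //.
  rewrite inE/= in_itv/= => /andP[h1 h2]; rewrite funenegE -EFinN.
  by rewrite ge_max lexx andbT lee_fin lerNl oppr0 H.
rewrite sube0 [leLHS]integral_mkcond [leRHS]integral_mkcond.
apply: le_integral_nonmeas.
- by move=> t; apply: erestrict_ge0 => x _; rewrite lee_fin.
- by move=> t; apply: erestrict_ge0.
apply: ae_impl esp => t H; rewrite !patchE; case: ifPn; last first.
  by move=> _; case: ifPn => // _; rewrite funeposE le_max lexx orbT.
rewrite inE/= in_itv/= => /andP[h1 h2]; rewrite mem_set/=; last by rewrite in_itv/=; lra.
by rewrite funeposE le_max lee_fin H.
Qed.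

Lemma integral_eq_ae a b (sp e : R -> R) : a <= b -> bmf e ->
  (forall t, 0 <= e t) ->
  {ae mu, forall t, a < t -> t < b -> sp t = e t} ->
  (\int[mu]_(t in `[a, b]) (sp t)%:E = (prim a e b)%:E)%E.
Proof.
move=> ab be e0 spe; apply/eqP; rewrite eq_le; apply/andP; split; last first.
  apply: integral_ge_ae => //; first by apply: ae_impl spe => t H h1 h2; rewrite H.
  by apply: ae_impl spe => t H h1 h2; rewrite H.
rewrite -integral_prim// integralE.
apply: (@le_trans _ _ (\int[mu]_(x in `[a, b]) ((fun t => (sp t)%:E)^\+ x))%E).
  rewrite leeBlDr; last first.
    suff -> : (\int[mu]_(x in `[a, b]) ((fun t => (sp t)%:E)^\- x) = 0)%E by [].
    move/ae_itv : spe => spe.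
    apply/eqP; rewrite eq_le; apply/andP; split; last by apply: integral_ge0.
    rewrite integral_mkcond -(@integral0 _ _ _ mu setT).
    apply: le_integral_nonmeas => //; first by move=> t; apply: erestrict_ge0.
    apply: ae_impl spe => t H; rewrite patchE; case: ifPn => //.
    rewrite inE/= in_itv/= => /andP[h1 h2]; rewrite funenegE -EFinN.
    by rewrite ge_max lexx andbT lee_fin lerNl oppr0 H.
  by rewrite leeDl// integral_ge0.
rewrite [leLHS]integral_mkcond [leRHS]integral_mkcond.
apply: le_integral_nonmeas.
- by move=> t; apply: erestrict_ge0.
- by move=> t; apply: erestrict_ge0 => x _; rewrite lee_fin.
apply: ae_impl (ae_itv _ _ _ spe) => t H; rewrite !patchE; case: ifPn => //.
rewrite inE/= in_itv/= => /andP[h1 h2].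
by rewrite funeposE ge_max !lee_fin H// e0 lexx.
Qed.

End nonmeasurable_integral.

(** * Ordinary differential equations *)

Lemma continuous_at_sum {R : realType} {T : topologicalType} (n : nat)
    (f : 'I_n -> T -> R) (t : T) : (forall i, {for t, continuous (f i)}) ->
  {for t, continuous (fun s => \sum_(i < n) f i s)}.
Proof.
elim: n f => [|n IH] f H.
  rewrite (_ : (fun _ => _) = fun=> 0); first exact: cvg_cst.
  by apply/funext => s; rewrite big_ord0.
rewrite (_ : (fun _ => _) = fun s => \sum_(i < n) f (widen_ord (leqnSn n) i) s + f ord_max s).
  by apply: cvgD; [apply: IH => i; exact: H|exact: H].
by apply/funext => s; rewrite big_ord_recr.
Qed.

Section rv_norm.
Context {R : realType} {N : nat}.
Implicit Types (x y : 'rV[R]_N).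

Lemma rv_norm_ge x i : `|x 0 i| <= `|x|.
Proof.
rewrite [leRHS]/Num.Def.normr/= mx_normrE.
exact: (le_bigmax _ (fun ij : 'I_1 * 'I_N => `|x ij.1 ij.2|) (0, i)).
Qed.

Lemma rv_norm_le x (e : R) : 0 <= e -> (forall i, `|x 0 i| <= e) -> `|x| <= e.
Proof.
move=> e0 H; rewrite /Num.Def.normr/= mx_normrE; apply: bigmax_le => //= -[i j] _ /=.
by rewrite (ord1 i).
Qed.

Lemma rv_continuousP (T : topologicalType) (f : T -> 'rV[R]_N) :
  (forall i, continuous (fun t => f t 0 i)) -> continuous f.
Proof.
move=> H t; apply/cvgrPdist_le => e e0; near=> s.
apply: rv_norm_le (ltW e0) _ => i; rewrite !mxE.
by move: i; near: s; apply: filter_forall => i; have /cvgrPdist_le := H i t; apply.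
Unshelve. all: by end_near. Qed.

Lemma rv_continuous_comp (T : topologicalType) (f : T -> 'rV[R]_N) i (t : T) :
  {for t, continuous f} -> {for t, continuous (fun t => f t 0 i)}.
Proof.
move=> H; apply/cvgrPdist_le => e e0; have /cvgrPdist_le/(_ _ e0) := H.
apply: filterS => s; apply: le_trans; rewrite (_ : _ - _ = (f t - f s) 0 i).
  exact: rv_norm_ge.
by rewrite !mxE.
Qed.

End rv_norm.

Section ivp.
Context {R : realType} {N : nat}.
Implicit Types (y : R -> 'rV[R]_N) (s t : R).

(** Nested intervals: [u k - 2 * C * 2^-1 ^+ k] increases, [u k + 2 * C * 2^-1 ^+ k] decreases, and
    the supremum of the former lies in all of them. The explicit rate serves both Picard's and
    Newton's iteration. *)
Lemma geometric_limit (u : nat -> R) (C : R) :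
  (forall k, `|u k.+1 - u k| <= C * 2^-1 ^+ k) ->
  exists l, forall k, `|u k - l| <= 2 * C * 2^-1 ^+ k.
Proof.
move=> H.
have C0 : 0 <= C by have := H 0%N; rewrite expr0 mulr1; apply: le_trans.
have p0 k : 0 <= 2^-1 ^+ k :> R by apply: exprn_ge0.
have lo k j : u k - 2 * C * 2^-1 ^+ k <= u (k + j)%N - 2 * C * 2^-1 ^+ (k + j).
  elim: j => [|j IH]; first by rewrite addn0.
  apply: (le_trans IH); rewrite addnS.
  have := H (k + j)%N; rewrite ler_norml => /andP[+ _]; rewrite exprS; lra.
have hi k j : u (k + j)%N + 2 * C * 2^-1 ^+ (k + j) <= u k + 2 * C * 2^-1 ^+ k.
  elim: j => [|j IH]; first by rewrite addn0.
  apply: le_trans IH; rewrite addnS.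
  have := H (k + j)%N; rewrite ler_norml => /andP[_ +]; rewrite exprS; lra.
have key k j : u k - 2 * C * 2^-1 ^+ k <= u j + 2 * C * 2^-1 ^+ j.
  have := lo k j; have := hi j k; rewrite (addnC j).
  have : 0 <= C * 2^-1 ^+ (k + j) by rewrite mulr_ge0.
  lra.
pose A := [set u k - 2 * C * 2^-1 ^+ k | k in [set: nat]].
have hA : has_sup A.
  by split; [exists (u 0%N - 2 * C * 2^-1 ^+ 0), 0%N | exists (u 0%N + 2 * C * 2^-1 ^+ 0) => _ [k _ <-]].
exists (sup A) => k; rewrite ler_norml.
have h1 : u k - 2 * C * 2^-1 ^+ k <= sup A by apply: ub_le_sup; [case: hA|exists k].
have h2 : sup A <= u k + 2 * C * 2^-1 ^+ k.
  by apply: ge_sup => [|_ [j _ <-]]; [case: hA|].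
apply/andP; split; lra.
Qed.

Lemma expR_scaled_derive (m l t : R) :
  is_derive t 1 (fun x => m * expR (l * x)) (m * l * expR (l * t)).
Proof.
have d1 : is_derive t 1 (fun x => l * x) l.
  apply: (is_derive_ext _ _ _ _ _ (is_deriveMl _ _ _ _ _ (is_derive_cstl t l) (is_derive_idl t))) => //.
  by rewrite mul0r add0r mulr1.
have d2 : is_derive t 1 (expR \o (fun x => l * x)) (expR (l * t) * l) by exact: is_derive1_comp.
apply: (is_derive_ext _ _ _ _ _ (is_deriveMl _ _ _ _ _ (is_derive_cstl t m) d2)) => //.
by rewrite /=; ring.
Qed.

Lemma expR_scaled_continuous (m l : R) : continuous (fun x => m * expR (l * x)).
Proof.
move=> t; have [h _] := expR_scaled_derive m l t.
exact/differentiable_continuous/derivable1_diffP.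
Qed.

Lemma expR_scaled_ac a b (m l : R) : 
  ac a b (fun x => m * expR (l * x)) (fun t => m * l * expR (l * t)).
Proof.
apply: ac_C1.
- exact/continuous_subspaceT/expR_scaled_continuous.
- by move=> t _ _; exact: expR_scaled_derive.
have [ab|ba] := leP a b; last by exists 0 => t; lra.
exists (`|m * l| * expR (`|l| * (`|a| + `|b|))) => t at_ tb.
rewrite normrM ler_wpM2l// ger0_norm ?expR_ge0// ler_expR.
apply: (le_trans (ler_norm _)); rewrite normrM ler_wpM2l//.
by rewrite ler_norml; have := ler_norm b; have := ler_norm (- a); rewrite normrN => ? ?;
  have := normr_ge0 a; have := normr_ge0 b; lra.
Qed.

(** Let [m] be the maximum of [|y t| * expR (- (2 * L) * t)], attained at [c]. Integrating [L * |y|]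
    up to [c] yields at most half of [m * expR (2 * L * c) = |y c|], which is absorbed on the left.
    Doubling the rate [L] is what creates this half, hence both factors 2 in the bound. *)
Lemma gronwall y (y' : R -> 'I_N -> R) (L a eta : R) : 0 < L -> 0 <= a -> 0 <= eta ->
  continuous y ->
  (forall t i, 0 < t -> t < 1 -> is_derive t 1 (fun s => y s 0 i) (y' t i)) ->
  (forall t i, 0 < t -> t < 1 -> `|y' t i| <= L * `|y t| + eta) ->
  `|y 0| <= a ->
  forall t, 0 <= t -> t <= 1 -> `|y t| <= 2 * (a + eta) * expR (2 * L).
Proof.
move=> L0 a0 eta0 cy dy by_ ya t t0 t1.
pose f s := `|y s| * expR (- (2 * L) * s).
have cf : continuous f.
  move=> s; apply: cvgM; first by apply: cvg_norm; exact: cy.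
  have := expR_scaled_continuous 1 (- (2 * L)).
  rewrite (_ : (fun x => 1 * _) = fun x => expR (- (2 * L) * x)); first by apply.
  by apply/funext => x; rewrite mul1r.
have [c] := @EVT_max R f 0 1 ler01 (continuous_subspaceT cf).
rewrite in_itv/= => /andP[c0 c1] Hc.
set m := f c.
have ym s : 0 <= s -> s <= 1 -> `|y s| <= m * expR (2 * L * s).
  move=> s0 s1; have := Hc s; rewrite in_itv/= s0 s1 => /(_ isT).
  by rewrite /f mulNr expRN ler_pdivrMr ?expR_gt0.
have m0 : 0 <= m by rewrite /m mulr_ge0// expR_ge0.
(* A primitive of [L * (m * expR (2 * L * s)) + eta], which dominates every component of the
   derivative. *)
pose G s := 2^-1 * m * expR (2 * L * s) + eta * s.
have aG b : ac 0 b G (fun t => 2^-1 * m * (2 * L) * expR (2 * L * t) + eta * 1).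
  by apply: acD; [exact: expR_scaled_ac|apply: acZ; exact: ac_id].
have ay i : ac 0 c (fun s => y s 0 i) (fun s => y' s i).
  apply: ac_C1.
  - by apply: continuous_subspaceT => s; apply: rv_continuous_comp; exact: cy.
  - by move=> s s0 sc; apply: dy => //; exact: lt_le_trans c1.
  - exists (L * (m * expR (2 * L)) + eta) => s s0 sc.
    have s1 : s < 1 by exact: lt_le_trans c1.
    apply: (le_trans (by_ s i s0 s1)); rewrite lerD2r ler_pM2l//.
    apply: (le_trans (ym s (ltW s0) (ltW s1))); rewrite ler_wpM2l// ler_expR.
    by rewrite ler_piMr ?mulr_ge0 ?ltW.
have key s i : 0 < s -> s < c -> `|y' s i| <= 2^-1 * m * (2 * L) * expR (2 * L * s) + eta * 1.
  move=> s0 sc; have s1 : s < 1 by exact: lt_le_trans c1.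
  apply: (le_trans (by_ s i s0 s1)); rewrite mulr1 lerD2r.
  have := ym s (ltW s0) (ltW s1); rewrite -(ler_pM2l L0); lra.
have yc : `|y c| <= a + (G c - G 0).
  apply: rv_norm_le => [|i].
    have : 0 <= G c - G 0.
      have := ac_le _ _ _ _ _ _ c0 (ac_cst 0 c 0) (aG c).
      rewrite subrr; apply; apply: ae_all => s s0 sc.
      apply: addr_ge0; last by rewrite mulr1.
      by rewrite mulr_ge0 ?expR_ge0// mulr_ge0 ?mulr_ge0 // ltW.
    lra.
  have y0 : `|y 0 0 i| <= a by exact: le_trans (rv_norm_ge _ _) ya.
  have h1 : y c 0 i - y 0 0 i <= G c - G 0.
    apply: ac_le c0 (ay i) (aG c) _; apply: ae_all => s s0 sc.
    exact: le_trans (ler_norm _) (key _ _ s0 sc).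
  have h2 : - y c 0 i + y 0 0 i <= G c - G 0.
    have ayN := acB _ _ _ _ _ _ (ac_cst 0 c 0) (ay i).
    have := ac_le _ _ _ _ _ _ c0 ayN (aG c); rewrite !sub0r opprK; apply.
    apply: ae_all => s s0 sc; rewrite sub0r.
    by apply: le_trans (key _ i s0 sc); rewrite -normrN ler_norm.
  by move: y0; rewrite !ler_norml => /andP[? ?]; apply/andP; split; lra.
have mc : m * expR (2 * L * c) = `|y c|.
  by rewrite /m /f mulNr -mulrA expRN mulVf ?mulr1// gt_eqF// expR_gt0.
have m2 : m <= 2 * (a + eta).
  have e1 : 1 <= expR (2 * L * c).
    by rewrite -expR0 ler_expR !mulr_ge0// ltW.
  have h3 : m * expR (2 * L * c) <= 2 * (a + eta).
    move: yc; rewrite -mc /G mulr0 expR0 mulr0 mulr1.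
    have : eta * c <= eta by rewrite ler_piMr.
    lra.
  by apply: le_trans h3; rewrite ler_peMr.
apply: (le_trans (ym t t0 t1)).
apply: ler_pM; rewrite ?expR_ge0//.
by rewrite ler_expR ler_piMr// mulr_ge0// ltW.
Qed.

End ivp.

Lemma mulmxr_continuous (R : realType) (d m : nat) (J : 'M[R]_(d, m)) :
  continuous (mulmxr J : 'rV[R]_d -> 'rV[R]_m).
Proof.
apply: rv_continuousP => k.
have -> : (fun t : 'rV[R]_d => mulmxr J t 0 k) = (fun t => \sum_j t 0 j * J j k).
  by apply/funext => t; rewrite /= mxE.
move=> t; apply: continuous_at_sum => j.
have c1 : {for t, continuous (fun s : 'rV[R]_d => s 0 j)}.
  by apply: (@rv_continuous_comp R d 'rV[R]_d id j t); exact: cvg_id.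
have c2 : {for t, continuous (fun _ : 'rV[R]_d => J j k)} by exact: cst_continuous.
exact: cvgM c1 c2.
Qed.

(** * Picard iteration for globally Lipschitz fields *)

Section picard.
Context {R : realType} {N : nat}.
Variables (H : R -> 'rV[R]_N -> 'rV[R]_N) (L : R) (y0 : 'rV[R]_N).
Hypothesis L0 : 0 < L.
Hypothesis Hc : forall y, continuous y -> continuous (fun t => H t (y t)).
Hypothesis HL : forall t a b, `|H t a - H t b| <= L * `|a - b|.
Implicit Types (y z : R -> 'rV[R]_N) (s t : R).

Let g y (i : 'I_N) s : R := H (clamp 0 1 s) (y (clamp 0 1 s)) 0 i.

Let bmf_g y i : continuous y -> bmf (g y i).
Proof.
move=> cy; apply: (@bmf_clamp _ 0 1 (fun s => H s (y s) 0 i)) => //.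
move=> t; apply: (@continuous_comp _ _ _ (clamp 0 1) (fun s => H s (y s) 0 i)).
  exact: clamp_continuous.
by apply: rv_continuous_comp; apply: Hc.
Qed.

Let P y t : 'rV[R]_N := \row_i (y0 0 i + prim 0 (g y i) (clamp 0 1 t)).

Let cP y : continuous y -> continuous (P y).
Proof.
move=> cy; apply: rv_continuousP => i.
have [_ [K HK]] := bmf_g y i cy.
apply: (@lip_continuous _ _ K) => s t.
have K0 : 0 <= K by apply: le_trans (HK 0).
rewrite !mxE opprD addrACA subrr add0r.
wlog st : s t / s <= t.
  move=> W; case: (leP s t) => [|/ltW]; first exact: W.
  by move=> ts; rewrite distrC (distrC t); exact: W.
apply: (le_trans (prim_lip _ _ _ (bmf_g y i cy) HK _ _ (clamp_mono _ _ _ _ st))).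
by rewrite ler_wpM2l//; apply: le_trans (clamp_lip 0 1 s t); exact: ler_norm.
Qed.

Let P_diff y z (C l : R) : continuous y -> continuous z -> 0 <= l -> 0 <= C ->
  (forall t, 0 <= t -> t <= 1 -> `|y t - z t| <= C * expR (l * t)) ->
  forall t, 0 <= t -> t <= 1 ->
  forall G, ac 0 t G (fun s => L * (C * expR (l * s))) -> G 0 <= G t -> `|P y t - P z t| <= G t - G 0.
Proof.
move=> cy cz l0 C0 yz t t0 t1 G aG Gt; apply: rv_norm_le => [|i]; first lra.
rewrite !mxE opprD addrACA subrr add0r clamp_id//.
have py := prim_ac 0 t _ (bmf_g y i cy); have pz := prim_ac 0 t _ (bmf_g z i cz).
have key s : 0 < s -> s < t -> `|g y i s - g z i s| <= L * (C * expR (l * s)).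
  move=> s0 st; have s1 : s <= 1 by lra.
  rewrite /g (clamp_id 0 1 s (ltW s0) s1).
  have -> : H s (y s) 0 i - H s (z s) 0 i = (H s (y s) - H s (z s)) 0 i by rewrite !mxE.
  apply: (le_trans (rv_norm_ge _ _)); apply: (le_trans (HL _ _ _)).
  by rewrite ler_pM2l//; apply: yz; lra.
have h1 := ac_le _ _ _ _ _ _ t0 (acB _ _ _ _ _ _ py pz) aG.
have h2 := ac_le _ _ _ _ _ _ t0 (acB _ _ _ _ _ _ pz py) aG.
rewrite !prim_start !subr0 in h1 h2; rewrite ler_norml lerNl opprB.
apply/andP; split; [apply: h2|apply: h1]; apply: ae_all => s s0 st.
  by apply: le_trans (key s s0 st); rewrite distrC ler_norm.
by apply: le_trans (key s s0 st); rewrite ler_norm.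
Qed.

Let yk (k : nat) := iter k P (fun=> y0).

Let cyk k : continuous (yk k).
Proof. by elim: k => [t|k IH]; [exact: cvg_cst|exact: cP]. Qed.

Let P_clamp y t : P y t = P y (clamp 0 1 t).
Proof. by apply/rowP => i; rewrite !mxE (clamp_id 0 1 (clamp 0 1 t)) ?clamp_ge ?clamp_le. Qed.

(** In the norm weighted by [expR (2 * L * t)] the Picard operator contracts by 1/2 whatever [L] is,
    so [0, 1] need not be subdivided. *)
Let yk_step : exists2 M : R, 0 <= M & forall k t, 0 <= t -> t <= 1 ->
  `|yk k.+1 t - yk k t| <= M * 2^-1 ^+ k * expR (2 * L * t).
Proof.
have [|c _ Hc'] := @EVT_max R (fun t => `|yk 1 t - yk 0 t|) 0 1 ler01.
  apply: continuous_subspaceT => t; apply: cvg_norm.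
  by apply: cvgB; exact: cyk.
exists `|yk 1 c - yk 0 c| => //; elim=> [|k IH] t t0 t1.
  rewrite expr0 mulr1; apply: (le_trans (Hc' t _)); first by rewrite in_itv/= t0 t1.
  by rewrite ler_peMr// -expR0 ler_expR !mulr_ge0// ltW.
set M := `|yk 1 c - yk 0 c|.
have M00 : 0 <= M by exact: normr_ge0.
have e20 j : 0 <= 2^-1 ^+ j :> R by apply: exprn_ge0; rewrite invr_ge0.
pose G (s : R) := M * 2^-1 ^+ k.+1 * expR (2 * L * s).
have M0 : 0 <= M * 2^-1 ^+ k.+1 by exact: mulr_ge0.
have aG : ac 0 t G (fun s => L * (M * 2^-1 ^+ k * expR (2 * L * s))).
  apply: ac_ae (expR_scaled_ac _ _ _ _) _; apply: ae_all => s _ _.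
  by rewrite exprS; field.
have -> : yk k.+2 t - yk k.+1 t = P (yk k.+1) t - P (yk k) t by [].
have Gle : G 0 <= G t.
  by rewrite /G mulr0 ler_wpM2l// ler_expR !mulr_ge0// ltW.
apply: (le_trans (P_diff (yk k.+1) (yk k) (M * 2^-1 ^+ k) (2 * L) (cyk _) (cyk _) _ _ IH _ t0 t1 G aG Gle)).
- by rewrite mulr_ge0// ltW.
- exact: mulr_ge0.
- by rewrite lerBlDr lerDl /G mulr_ge0// expR_ge0.
Qed.

Lemma ivp_existence : exists y : R -> 'rV[R]_N,
  [/\ continuous y, y 0 = y0 &
     forall t i, 0 < t -> t < 1 -> is_derive t 1 (fun s => y s 0 i) (H t (y t) 0 i)].
Proof.
have [M0 M00 HM0] := yk_step.
pose M := M0 * expR (2 * L).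
have M_ge0 : 0 <= M by rewrite mulr_ge0// expR_ge0.
have HM k t : `|yk k.+1 t - yk k t| <= M * 2^-1 ^+ k.
  have : `|yk k.+1 (clamp 0 1 t) - yk k (clamp 0 1 t)| <= M * 2^-1 ^+ k.
    apply: (le_trans (HM0 k _ (clamp_ge _ _ _) (clamp_le _ _ _ ler01))).
    rewrite /M mulrAC ler_wpM2r ?exprn_ge0// ler_wpM2l// ler_expR.
    by rewrite ler_piMr ?clamp_le// mulr_ge0// ltW.
  by case: k => [|k]; rewrite /yk/= -?P_clamp.
have /choice[l Hl] : forall ti : R * 'I_N, exists l, forall k, `|yk k ti.1 0 ti.2 - l| <= 2 * M * 2^-1 ^+ k.
  move=> [t i] /=; apply: geometric_limit => k; apply: le_trans (HM k t).
  by apply: le_trans (rv_norm_ge _ i); rewrite !mxE.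
pose y t : 'rV[R]_N := \row_i l (t, i).
have yky k t : `|yk k t - y t| <= 2 * M * 2^-1 ^+ k.
  apply: rv_norm_le => [|i]; first by rewrite mulr_ge0 ?exprn_ge0// mulr_ge0.
  by rewrite !mxE; exact: (Hl (t, i)).
have half_small (e : R) : 0 < e -> exists k, 2 * M * 2^-1 ^+ k <= e.
  move=> e0.
  have : (fun k => 2 * M * 2^-1 ^+ k) @ \oo --> (2 * M * 0 : R).
    apply: cvgM; first exact: cvg_cst.
    by apply: cvg_expr; rewrite ger0_norm// invf_lt1// ltr1n.
  rewrite mulr0 => /cvgrPdist_le/(_ _ e0)[k _ /(_ k (leqnn k))].
  by rewrite sub0r normrN => /(le_trans (ler_norm _)) h; exists k.
have cy : continuous y.
  move=> t; apply/cvgrPdist_le => e e0.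
  have e3 : 0 < e / 3 by rewrite divr_gt0.
  have [k Hk] := half_small _ e3.
  have /cvgrPdist_le/(_ _ e3) := cyk k t; apply: filterS => s Hs.
  have -> : y t - y s = - (yk k t - y t) + (yk k t - yk k s) + (yk k s - y s).
    by apply/rowP => i; rewrite !mxE; ring.
  apply: (le_trans (ler_normD _ _)); apply: (@le_trans _ _ (e / 3 + e / 3 + e / 3)); last lra.
  apply: lerD; last exact: le_trans (yky k s) Hk.
  apply: (le_trans (ler_normD _ _)); apply: lerD => //.
  by rewrite normrN; exact: le_trans (yky k t) Hk.
have yP t : 0 <= t -> t <= 1 -> y t = P y t.
  move=> t0 t1; apply/eqP; rewrite -subr_eq0 -normr_le0; apply/ler_addgt0Pl => e e0.
  rewrite addr0.
  (* The iterate is within e/(1+L) of [y], and [P] multiplies the uniform distance by at most [L]: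
     the two errors sum to [e]. *)
  have e3 : 0 < e / (1 + L) by rewrite divr_gt0// addr_gt0.
  have [k Hk] := half_small _ e3.
  have -> : y t - P y t = - (yk k.+1 t - y t) + (P (yk k) t - P y t).
    by rewrite /yk/=; apply/rowP => i; rewrite !mxE; ring.
  apply: (le_trans (ler_normD _ _)).
  rewrite (_ : e = e / (1 + L) + L * (e / (1 + L))); last first.
    by field; rewrite gt_eqF// addr_gt0.
  apply: lerD.
    rewrite normrN; apply: (le_trans (yky _ _)); apply: le_trans Hk.
    by rewrite ler_wpM2l ?mulr_ge0// exprS ler_piMl ?exprn_ge0// invf_le1// ler1n.
  pose C := e / (1 + L).
  have C0 : 0 <= C by rewrite ltW.
  have := P_diff (yk k) y C 0 (cyk _) cy (lexx 0) C0 _ t t0 t1 (fun s => L * C * s).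
  rewrite mulr0 subr0 => W; apply: (le_trans (W _ _ _)).
  - by move=> s s0 s1; rewrite mul0r expR0 mulr1; exact: le_trans (yky _ _) Hk.
  - apply: ac_ae (acZ _ _ _ _ _ (ac_id _ _)) _; apply: ae_all => s _ _.
    by rewrite mul0r expR0 !mulr1.
    by apply: mulr_ge0 => //; apply: mulr_ge0 => //; exact: ltW.
  - by rewrite ler_piMr// mulr_ge0// ltW.
exists y; split => //.
  by rewrite yP//; apply/rowP => i; rewrite !mxE clamp_id// prim_start addr0.
move=> t i t0 t1.
have bg := bmf_g y i cy.
have cg : {for t, continuous (g y i)}.
  apply: (@continuous_comp _ _ _ (clamp 0 1) (fun s => H s (y s) 0 i)).
    exact: clamp_continuous.
  by apply: rv_continuous_comp; apply: Hc.
have dp : is_derive t 1 (prim 0 (g y i)) (g y i t) by exact: (@prim_derive _ 0 1).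
have dyy := is_deriveDl _ _ _ _ _ (is_derive_cstl t (y0 0 i)) dp.
apply: (is_derive_ext (fun s => y s 0 i) _ _ (0 + g y i t)) => //; last first.
  by rewrite add0r /g clamp_id ?ltW.
apply: is_derive_near dyy _; near=> s.
have s0 : 0 <= s by apply: ltW; near: s; exact: lt_nbhsr.
have s1 : s <= 1 by apply: ltW; near: s; exact: lt_nbhsl.
by rewrite yP// !mxE clamp_id.
Unshelve. all: by end_near. Qed.

End picard.

(** * Second order Taylor estimates *)

Section mean_value.
Context {R : realType} {d : nat}.
Local Notation E := 'rV[R]_d.
Local Notation dl i := (delta_mx 0 i : 'rV[R]_d).
Implicit Types (x y z : E) (i j k l : 'I_d) (g : E -> R).

Lemma derivable_line g x i (s : R) : derivable g (x + s *: dl i) (dl i) ->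
  is_derive s 1 (fun t => g (x + t *: dl i)) ('D_(dl i) g (x + s *: dl i)).
Proof.
have E2 : (fun h : R => h^-1 *: ((g \o shift (x + s *: dl i)) (h *: dl i) - g (x + s *: dl i)))
   = (fun h : R => h^-1 *: (((fun t => g (x + t *: dl i)) \o shift s) (h *: 1) -
        (fun t => g (x + t *: dl i)) s)).
  apply/funext => h /=; congr (_ *: (g _ - _)).
  by rewrite [h *: 1]mulr1 scalerDl addrCA.
by move=> H; split; [move: H; rewrite /derivable E2|rewrite /derive E2].
Qed.

Lemma mvt_line g x i (h : R) :
  (forall s : R, `|s| <= `|h| -> derivable g (x + s *: dl i) (dl i)) ->
  exists2 s : R, `|s| <= `|h| &
    g (x + h *: dl i) - g x = 'D_(dl i) g (x + s *: dl i) * h.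
Proof.
move=> H.
pose phi (t : R) := g (x + t *: dl i); pose phi' (t : R) := 'D_(dl i) g (x + t *: dl i).
have D (s : R) : `|s| <= `|h| -> is_derive s 1 phi (phi' s).
  by move=> sh; apply: derivable_line; exact: H.
have C (s : R) : `|s| <= `|h| -> {for s, continuous phi}.
  by move=> /D[+ _]; move=> /derivable1_diffP/differentiable_continuous.
have -> : g x = phi 0 by rewrite /phi scale0r addr0.
rewrite -[g _]/(phi h).
have [h0|h0|<-] := ltgtP 0 h; last by exists 0; rewrite ?normr0// subrr mulr0.
- have D' s : s \in `]0, h[ -> is_derive s 1 phi (phi' s).
    rewrite in_itv/= => /andP[s1 s2]; apply: D.
    by rewrite !gtr0_norm//; lra.
  have C' : {within `[0, h], continuous phi}.
    apply: continuous_in_subspaceT => s; rewrite inE/= in_itv/= => /andP[s1 s2]; apply: C.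
    by rewrite (gtr0_norm h0) ger0_norm//; lra.
  have [c] := MVT h0 D' C'; rewrite in_itv/= => /andP[c1 c2] ->.
  by exists c; [rewrite !gtr0_norm//; lra|rewrite subr0].
- have D' s : s \in `]h, 0[ -> is_derive s 1 phi (phi' s).
    rewrite in_itv/= => /andP[s1 s2]; apply: D.
    by rewrite !ltr0_norm//; lra.
  have C' : {within `[h, 0], continuous phi}.
    apply: continuous_in_subspaceT => s; rewrite inE/= in_itv/= => /andP[s1 s2]; apply: C.
    by rewrite (ltr0_norm h0) ler0_norm//; lra.
  have [c] := MVT h0 D' C'; rewrite in_itv/= => /andP[c1 c2] E0.
  by exists c; [rewrite !ltr0_norm//; lra|rewrite -opprB E0 sub0r mulrN opprK].
Qed.

(** Only partial derivatives are available, so [x] is moved to [y] one coordinate at a time through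
    the points [p m]. In the sup norm all these segments stay in the cube of radius [|y - x|] about
    [x]. The numbers [c k] are the candidate gradient. *)
Lemma mean_value_estimate g x y (c : 'I_d -> R) (e : R) : 0 <= e ->
  (forall z, `|z - x| <= `|y - x| -> forall k, derivable g z (dl k)) ->
  (forall z, `|z - x| <= `|y - x| -> forall k, `|'D_(dl k) g z - c k| <= e) ->
  `|g y - g x - \sum_k c k * (y - x) 0 k| <= d%:R * e * `|y - x|.
Proof.
move=> e0 Hd Hb.
pose p (m : nat) : E := \row_i (if (i < m)%N then y 0 i else x 0 i).
have p0 : p 0%N = x by apply/rowP => i; rewrite !mxE.
have pd : p d = y by apply/rowP => i; rewrite !mxE ltn_ord.
have pS (k : 'I_d) : p k.+1 = p k + (y - x) 0 k *: dl k.
  apply/rowP => i; rewrite !mxE ltnS leq_eqVlt eqxx/=.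
  rewrite -[_ == _ :> nat]/(i == k); case: eqP => [->|ik]/=; last by rewrite mulr0 addr0.
  by rewrite ltnn mulr1 addrC subrK.
have near_p (k : 'I_d) (s : R) : `|s| <= `|(y - x) 0 k| -> `|p k + s *: dl k - x| <= `|y - x|.
  move=> sk; apply: rv_norm_le => // i; rewrite !mxE.
  case: (eqVneq i k) => [->|ik]/=.
    by rewrite ltnn mulr1 addrAC subrr add0r; exact: le_trans sk (rv_norm_ge _ _).
  rewrite mulr0 addr0; case: ifP => _.
    by have := rv_norm_ge (y - x) i; rewrite !mxE.
  by rewrite subrr normr0.
have step (k : 'I_d) : `|g (p k.+1) - g (p k) - c k * (y - x) 0 k| <= e * `|y - x|.
  have [|s sk] := @mvt_line g (p k) k ((y - x) 0 k).
    by move=> s sk; apply: Hd; exact: near_p.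
  rewrite -pS => ->; rewrite -mulrBl normrM; apply: ler_pM => //; last exact: rv_norm_ge.
  by apply: Hb; exact: near_p.
have -> : g y - g x - \sum_k c k * (y - x) 0 k =
    \sum_(k < d) (g (p k.+1) - g (p k) - c k * (y - x) 0 k).
  rewrite big_split/= sumrN; congr (_ + _).
  rewrite -(big_mkord xpredT (fun m => g (p m.+1) - g (p m))) telescope_sumr//.
  by rewrite pd p0.
apply: (le_trans (ler_norm_sum _ _ _)); apply: (le_trans (ler_sum _ (fun k _ => step k))).
by rewrite sumr_const card_ord -mulrA mulr_natl.
Qed.

End mean_value.

Section smooth_estimates.
Context {R : realType} {d m : nat}.
Local Notation E := 'rV[R]_d.
Local Notation dl i := (delta_mx 0 i : 'rV[R]_d).
Implicit Types (x y z : E) (f : E -> 'rV[R]_m).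

Lemma derive_comp f x i (j : 'I_m) : derivable f x (dl i) ->
  'D_(dl i) (fun z => f z 0 j) x = 'D_(dl i) f x 0 j.
Proof. by move=> H; rewrite derive_mx// mxE. Qed.

Lemma derivable_comp f x i (j : 'I_m) : derivable f x (dl i) ->
  derivable (fun z => f z 0 j) x (dl i).
Proof. by move=> /derivable_mxP; apply. Qed.

Lemma mean_value_estimate_rv f x y (c : 'I_d -> 'rV[R]_m) (e : R) : 0 <= e ->
  (forall z, `|z - x| <= `|y - x| -> forall k, derivable f z (dl k)) ->
  (forall z, `|z - x| <= `|y - x| -> forall k, `|'D_(dl k) f z - c k| <= e) ->
  `|f y - f x - \sum_k (y - x) 0 k *: c k| <= d%:R * e * `|y - x|.
Proof.
move=> e0 Hd Hb; apply: rv_norm_le => [|j]; first by rewrite !mulr_ge0.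
have := @mean_value_estimate R d (fun z => f z 0 j) x y (fun k => c k 0 j) e e0.
have -> : (f y - f x - \sum_k (y - x) 0 k *: c k) 0 j =
   f y 0 j - f x 0 j - \sum_k c k 0 j * (y - x) 0 k.
  rewrite !mxE summxE; congr (_ - _).
  by apply: eq_bigr => k _; rewrite !mxE mulrC.
apply.
- by move=> z zx k; apply: derivable_comp; exact: Hd.
- move=> z zx k; rewrite derive_comp; last exact: Hd.
  by have := le_trans (rv_norm_ge _ j) (Hb z zx k); rewrite !mxE.
Qed.

(** The quantitative content of smoothness: bounds of class C^{1,1} and the resulting second order
    expansion, on a closed cube and with a single constant. *)
Record C11_on (x0 : E) (r C : R) f : Prop := {
  C11_bound : forall x, `|x - x0| <= r -> `|f x| <= C;
  C11_dbound : forall x l, `|x - x0| <= r -> `|'D_(dl l) f x| <= C;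
  C11_lip : forall x y, `|x - x0| <= r -> `|y - x0| <= r -> `|f y - f x| <= C * `|y - x|;
  C11_dlip : forall x y l, `|x - x0| <= r -> `|y - x0| <= r ->
     `|'D_(dl l) f y - 'D_(dl l) f x| <= C * `|y - x|;
  C11_quad : forall x y, `|x - x0| <= r -> `|y - x0| <= r ->
     `|f y - f x - \sum_l (y - x) 0 l *: 'D_(dl l) f x| <= C * `|y - x| ^+ 2 }.

(** By continuity the partial derivatives up to order two are bounded near [x0]; the mean value
    estimate turns the bounds of order one and two into Lipschitz bounds, and then into the
    quadratic remainder. *)
Lemma smooth_C11 (O : set E) f x0 : smooth_on O f -> open O -> O x0 ->
  exists r C : R, [/\ 0 < r, 0 <= C, forall x, `|x - x0| <= r -> O x & C11_on x0 r C f].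
Proof.
move=> sf oO Ox0.
have bnd s : exists B : R, \forall z \near x0, `|partials s f z| <= B.
  exists (`|partials s f x0| + 1).
  have [/cvgrPdist_le/(_ _ ltr01) + _] := sf s x0 Ox0.
  apply: filterS => z Hz.
  have := ler_normB (partials s f x0) (partials s f x0 - partials s f z).
  by rewrite opprB addrC subrK => /le_trans; apply; rewrite lerD2l.
have [B0 HB0] := bnd [::].
have /choice[B1 HB1] : forall i, exists B : R, \forall z \near x0, `|partials [:: i] f z| <= B.
  by move=> i; exact: bnd.
have /choice[B2 HB2] : forall ij : 'I_d * 'I_d, exists B : R,
    \forall z \near x0, `|partials [:: ij.1; ij.2] f z| <= B.
  by move=> ij; exact: bnd.
pose B := `|B0| + (\sum_i `|B1 i|) + (\sum_ij `|B2 ij|).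
have S1 : 0 <= \sum_i `|B1 i| by apply: sumr_ge0.
have S2 : 0 <= \sum_ij `|B2 ij| by apply: sumr_ge0.
have B0B : B0 <= B by have := ler_norm B0; rewrite /B; lra.
have B1B i : B1 i <= B.
  have : `|B1 i| <= \sum_i `|B1 i| by rewrite (bigD1 i)//= lerDl sumr_ge0.
  by have := ler_norm (B1 i); have := normr_ge0 B0; rewrite /B; lra.
have B2B i : B2 i <= B.
  have : `|B2 i| <= \sum_i `|B2 i| by rewrite (bigD1 i)//= lerDl sumr_ge0.
  by have := ler_norm (B2 i); have := normr_ge0 B0; rewrite /B; lra.
have Bge0 : 0 <= B by rewrite /B; have := normr_ge0 B0; lra.
have /nbhs_ballP[r0 /= r00 Hr0] : \forall z \near x0, O z /\ [/\ `|f z| <= B,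
    forall i, `|'D_(dl i) f z| <= B &
    forall ij : 'I_d * 'I_d, `|'D_(dl ij.1) ('D_(dl ij.2) f) z| <= B].
  near=> z; split; first by near: z; rewrite near_nbhs; apply: open_nbhs_nbhs.
  split.
  - by apply: le_trans B0B; near: z; exact: HB0.
  - move=> i; apply: le_trans (B1B i); move: i; near: z.
    by apply: filter_forall => i; exact: HB1.
  - move=> i; apply: le_trans (B2B i); move: i; near: z.
    by apply: filter_forall => i; exact: HB2.
have inb z : `|z - x0| <= r0 / 2 -> ball x0 r0 z.
  by move=> H; rewrite -ball_normE/= distrC; apply: (le_lt_trans H); lra.
(* the estimates are taken on a ball so small that the segments used stay in [O] *)
pose r := r0 / 6.
have inr x y z : `|x - x0| <= r -> `|y - x0| <= r -> `|z - x| <= `|y - x| ->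
    ball x0 r0 z.
  move=> hx hy hz; apply: inb.
  have h1 := ler_normD (z - x) (x - x0); rewrite addrA subrK in h1.
  have h2 := ler_normB (y - x0) (x - x0); rewrite opprB addrA subrK in h2.
  rewrite /r in hx hy; lra.
have inr1 x : `|x - x0| <= r -> ball x0 r0 x by move=> hx; apply: (inr x x) => //; rewrite subrr normr0.
have dB : 0 <= d%:R * B by rewrite mulr_ge0.
have ddB : 0 <= d%:R * (d%:R * B) by rewrite mulr_ge0.
pose C := B + d%:R * B + d%:R * (d%:R * B).
have Cge0 : 0 <= C by rewrite /C; lra.
have der z : ball x0 r0 z -> forall k, derivable f z (dl k).
  by move=> /Hr0[Oz _] k; have [_] := sf [::] z Oz; apply.
have der2 z l : ball x0 r0 z -> forall k, derivable ('D_(dl l) f) z (dl k).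
  by move=> /Hr0[Oz _] k; have [_] := sf [:: l] z Oz; apply.
have lipf x y : `|x - x0| <= r -> `|y - x0| <= r -> `|f y - f x| <= d%:R * B * `|y - x|.
  move=> hx hy; have := @mean_value_estimate_rv f x y (fun=> 0) B Bge0.
  rewrite big1 ?subr0; last by move=> i _; rewrite scaler0.
  apply=> z hz k; first by apply: der; exact: inr hz.
  by rewrite subr0; have [_ [_ + _]] := Hr0 z (inr _ _ _ hx hy hz); apply.
have lipd x y l : `|x - x0| <= r -> `|y - x0| <= r ->
    `|'D_(dl l) f y - 'D_(dl l) f x| <= d%:R * B * `|y - x|.
  move=> hx hy; have := @mean_value_estimate_rv ('D_(dl l) f) x y (fun=> 0) B Bge0.
  rewrite big1 ?subr0; last by move=> i _; rewrite scaler0.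
  apply=> z hz k; first by apply: der2; exact: inr hz.
  by rewrite subr0; have [_ [_ _ /(_ (k, l))]] := Hr0 z (inr _ _ _ hx hy hz).
(* The quadratic estimate evaluates derivatives at points [z] with [|z - x| <= |y - x|]. With [x]
   and [y] in the cube of radius r/3 these remain in the cube of radius [r]. *)
exists (r / 3), C; split.
- by rewrite /r !divr_gt0.
- by [].
- move=> x hx; apply: (proj1 (Hr0 x (inr1 x _))); apply: (le_trans hx).
  by rewrite /r; lra.
have r3 x : `|x - x0| <= r / 3 -> `|x - x0| <= r by move=> /le_trans; apply; rewrite /r; lra.
split.
- move=> x /r3/inr1/Hr0[_ [h _ _]]; apply: (le_trans h); rewrite /C; lra.
- move=> x l /r3/inr1/Hr0[_ [_ h _]]; apply: (le_trans (h l)); rewrite /C; lra.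
- move=> x y /r3 hx /r3 hy; apply: (le_trans (lipf _ _ hx hy)).
  by rewrite ler_wpM2r// /C; lra.
- move=> x y l /r3 hx /r3 hy; apply: (le_trans (lipd _ _ l hx hy)).
  by rewrite ler_wpM2r// /C; lra.
- move=> x y hx hy.
  have hz z : `|z - x| <= `|y - x| -> `|z - x0| <= r.
    move=> hz; have h1 := ler_normD (z - x) (x - x0); rewrite addrA subrK in h1.
    have h2 := ler_normB (y - x0) (x - x0); rewrite opprB addrA subrK in h2.
    lra.
  have e0 : 0 <= d%:R * B * `|y - x| by rewrite mulr_ge0.
  have := @mean_value_estimate_rv f x y (fun l => 'D_(dl l) f x) _ e0.
  move=> H; apply: (le_trans (H _ _)).
  + by move=> z /hz; move=> /inr1; exact: der.
  + move=> z zx k; apply: (le_trans (lipd _ _ k (r3 _ hx) (hz _ zx))).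
    by rewrite ler_wpM2l.
  rewrite -mulrA -(mulrA _ `|_|) -expr2 mulrA ler_wpM2r ?exprn_ge0//.
  by rewrite mulrA in ddB; rewrite /C mulrA; lra.
Unshelve. all: by end_near. Qed.

End smooth_estimates.

(** * Null sets and critical values *)

Section null_sets.
Context {R : realType} {d : nat}.
Local Notation E := 'rV[R]_d.
Hypothesis d0 : (0 < d)%N.
Implicit Types (N : set E) (a b : nat -> E).

Lemma box_volume_ge0 (a b : E) : (forall i, a 0 i <= b 0 i) ->
  0 <= \prod_(i < d) (b 0 i - a 0 i).
Proof. by move=> ab; apply: prodr_ge0 => i _; rewrite subr_ge0. Qed.

Lemma lebesgue_nullS (A B : set E) : A `<=` B -> lebesgue_null B -> lebesgue_null A.
Proof.
move=> AB nB e e0; have [a [b [h1 h2 h3]]] := nB e e0.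
by exists a, b; split => //; exact: subset_trans AB h2.
Qed.

Lemma lebesgue_null_bigcup_nat (N : nat -> set E) :
  (forall k, lebesgue_null (N k)) -> lebesgue_null (\bigcup_k N k).
Proof.
move=> HN e e0.
have /choice[ab Hab] : forall k, exists ab : (nat -> E) * (nat -> E),
    [/\ forall j i, ab.1 j 0 i <= ab.2 j 0 i,
        N k `<=` \bigcup_j [set x | forall i, ab.1 j 0 i <= x 0 i <= ab.2 j 0 i] &
        (\sum_(0 <= j <oo) (\prod_(i < d) (ab.2 j 0 i - ab.1 j 0 i))%:E
           <= (e / (2 ^ k.+1)%:R)%:E)%E].
  move=> k; have [|a [b H]] := HN k (e / (2 ^ k.+1)%:R); last by exists (a, b).
  by rewrite divr_gt0// ltr0n expn_gt0.
have /card_set_bijP[g bg] : ([set: nat] #= [set: nat * nat])%card.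
  by rewrite card_eq_sym; exact: card_nat2.
exists (fun m => (ab (g m).1).1 (g m).2), (fun m => (ab (g m).1).2 (g m).2); split.
- by move=> m i; have [h _ _] := Hab (g m).1; exact: h.
- move=> x [k _ Nx]; have [_ /(_ _ Nx)[j _ Hj] _] := Hab k.
  have [m _ Em] : [set g m | m in [set: nat]] (k, j) by have [_ _] := bg; apply.
  by exists m => //=; rewrite Em.
pose v (kj : nat * nat) : \bar R :=
  (\prod_(i < d) ((ab kj.1).2 kj.2 0 i - (ab kj.1).1 kj.2 0 i))%:E.
have v0 kj : (0 <= v kj)%E.
  by rewrite lee_fin; apply: box_volume_ge0; have [] := Hab kj.1.
rewrite -[leLHS]/(\sum_(0 <= m <oo) v (g m))%E nneseries_esumT//.
rewrite -(@reindex_esum R _ _ setT setT g v bg).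
have -> : [set: nat * nat] = [set: nat] `*`` (fun=> [set: nat]).
  by apply/seteqP; split.
have -> : \esum_(j in [set: nat] `*`` (fun=> [set: nat])) v j =
    \esum_(k in [set: nat]) \esum_(j in [set: nat]) v (k, j).
  have := @esum_esum R nat nat setT (fun=> setT) (fun k j => v (k, j)) (fun k j _ _ => v0 (k, j)).
  move=> ->; apply: (@eq_esum R (nat * nat)%type); by case.
rewrite -nneseries_esumT; last by move=> k; apply: esum_ge0.
apply: le_trans (@epsilon_trick0 R e xpredT (ltW e0)).
apply: lee_nneseries => k; first by move=> _ _; apply: esum_ge0.
by move=> _; rewrite -nneseries_esumT//; have [] := Hab k.
Qed.

(** A box reduced to a point has volume 0 because [d] is positive; for [d = 0] the empty product
    would be 1. *)
Lemma lebesgue_null_set0 : lebesgue_null (set0 : set E).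
Proof.
move=> e e0; exists (fun=> 0), (fun=> 0); split => //.
rewrite eseries0; first by rewrite lee_fin ltW.
by move=> k _ _; rewrite (bigD1 (Ordinal d0))//= subrr mul0r.
Qed.

Lemma lebesgue_null_bigcup (T : countType) (N : T -> set E) :
  (forall x, lebesgue_null (N x)) -> lebesgue_null (\bigcup_x N x).
Proof.
move=> HN; apply: (@lebesgue_nullS _ (\bigcup_k (if unpickle k is Some x then N x else set0))).
  by move=> z [x _ Nz]; exists (pickle x) => //; rewrite pickleK.
apply: lebesgue_null_bigcup_nat => k.
by case: unpickle => // ; exact: lebesgue_null_set0.
Qed.

(** The finite family is completed to a sequence by boxes reduced to the origin, of volume 0. *)
Lemma lebesgue_null_finite_cover (A : set E) :
  (forall e : R, 0 < e -> exists (T : finType) (a b : T -> E),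
    [/\ forall t i, a t 0 i <= b t 0 i,
        A `<=` \bigcup_t [set x | forall i, a t 0 i <= x 0 i <= b t 0 i] &
        \sum_t \prod_(i < d) (b t 0 i - a t 0 i) <= e]) -> lebesgue_null A.
Proof.
move=> H e e0; have [T [a [b [h1 h2 h3]]]] := H e e0.
pose n := #|T|.
pose ext (f : T -> E) (m : nat) : E :=
  if (insub m : option 'I_n) is Some k then f (enum_val k) else 0.
exists (ext a), (ext b); split.
- by move=> m i; rewrite /ext; case: insub.
- move=> x /h2[t _ Ht]; exists (enum_rank t) => //=.
  by rewrite /ext valK enum_rankK.
rewrite (@nneseries_split _ _ 0%N n); last first.
  move=> m _; rewrite lee_fin; apply: box_volume_ge0 => i.
  by rewrite /ext; case: insub.
rewrite add0n [X in (_ + X)%E]eseries0 ?adde0; last first.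
  move=> m nm _; rewrite /ext insubF; last by rewrite ltnNge nm.
  by rewrite (bigD1 (Ordinal d0))//= subrr mul0r.
rewrite sumEFin lee_fin; apply: le_trans h3.
rewrite big_mkord (reindex (@enum_val T xpredT))/=; last first.
  by apply: onW_bij; exact: enum_val_bij.
rewrite le_eqVlt; apply/orP; left; apply/eqP; apply: eq_bigr => k _.
by rewrite /ext valK.
Qed.

End null_sets.

(** * Sard's theorem in equal dimensions *)

Section sard.
Context {R : realType} {d : nat}.
Local Notation E := 'rV[R]_d.
Hypothesis d0 : (0 < d)%N.

Lemma norm_mulmx_le (h : E) (L : 'M[R]_d) (C : R) : 0 <= C ->
  (forall i j, `|L i j| <= C) -> `|h *m L| <= d%:R * C * `|h|.
Proof.
move=> C0 HL; apply: rv_norm_le => [|j]; first by rewrite !mulr_ge0.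
rewrite mxE; apply: (le_trans (ler_norm_sum _ _ _)).
apply: (@le_trans _ _ (\sum_(i < d) (C * `|h|))); last first.
  by rewrite sumr_const card_ord -mulrA mulr_natl.
apply: ler_sum => i _; rewrite normrM mulrC; apply: ler_pM => //; exact: rv_norm_ge.
Qed.

(** A covector annihilating the image, divided by its entry of largest modulus. The relation can
    then be solved for coordinate [j] with coefficients of modulus at most 1. *)
Lemma singular_covector (L : 'M[R]_d) : \det L = 0 ->
  exists (a : 'I_d -> R) (j : 'I_d), [/\ a j = 1, forall i, `|a i| <= 1 &
    forall h : E, \sum_i (h *m L) 0 i * a i = 0].
Proof.
move=> dL; have /eqP/det0P[v v0 vL] : \det L^T = 0 by rewrite det_tr.
case: (@arg_maxP _ _ _ (Ordinal d0) xpredT (fun i => `|v 0 i|) isT) => j _ Hj.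
have vj : v 0 j != 0.
  apply: contra_neq v0 => vj; apply/rowP => i; rewrite mxE; apply/eqP.
  by rewrite -normr_le0; have := Hj i isT; rewrite vj normr0.
exists (fun i => v 0 i / v 0 j), j; split.
- by rewrite divff.
- by move=> i; rewrite normrM normfV ler_pdivrMr ?normr_gt0// mul1r; exact: Hj.
move=> h; transitivity ((h *m L *m v^T) 0 0 / v 0 j).
  by rewrite mxE mulr_suml; apply: eq_bigr => i _; rewrite !mxE mulrA.
by rewrite -mulmxA -(trmxK L) -trmx_mul vL trmx0 mulmx0 mxE mul0r.
Qed.

(** The index is an integer part; [M.+1] values are needed because [x = M%:R * s] is allowed. *)
Lemma nat_cell (x s : R) (M : nat) : 0 < s -> 0 <= x -> x <= M%:R * s ->
  exists k : 'I_M.+1, k%:R * s <= x <= k.+1%:R * s.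
Proof.
move=> s0 x0 xM.
have xs0 : 0 <= x / s by rewrite divr_ge0// ltW.
have /andP[h1 h2] := trunc_itv xs0.
have kM : (Num.trunc (x / s) < M.+1)%N.
  rewrite ltnS -(ler_nat R); apply: (le_trans h1).
  by rewrite ler_pdivrMr.
exists (Ordinal kM) => /=.
by rewrite -ler_pdivlMr// h1/= -ler_pdivrMr// ltW.
Qed.

(** Cut the cube of radius [r] into cells of side [s]. The image of a cell has diameter O(s) and
    lies within O(s^2) of a hyperplane, which is solved for one coordinate. It is covered by boxes
    whose sides are all O(s^2), about s^(1-d) of them, of total volume O(s^(d+1)). With about s^(-d)
    cells the whole volume is O(s). [Om] is an arbitrary set, so that a family of selected solutions
    can serve as the domain. *)
Lemma sard (Om : set E) (F : E -> E) (L : E -> 'M[R]_d) (C r : R) :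
  0 <= C -> 0 < r ->
  (forall x, Om x -> `|x| <= r) ->
  (forall x, Om x -> \det (L x) = 0) ->
  (forall x i j, Om x -> `|L x i j| <= C) ->
  (forall x y, Om x -> Om y -> `|F y - F x - (y - x) *m L x| <= C * `|y - x| ^+ 2) ->
  lebesgue_null (F @` Om).
Proof.
move=> C0 r0 Hr Hdet HL HF; apply: lebesgue_null_finite_cover => // e e0.
pose C' := (d%:R + 1) * C.
have C'0 : 0 <= C' by rewrite mulr_ge0// addr_ge0.
(* Chosen so that [G = M * G0] steps of length [sg = s^2] cover the range [-C's, C's] of a
   coordinate of the increment. *)
pose G0 := (Num.trunc (C' / r)).+1.
have HG0 : C' <= G0%:R * r.
  have : 0 <= C' / r by rewrite divr_ge0// ltW.
  by move=> /trunc_itv/andP[_ /ltW]; rewrite ler_pdivrMr.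
(* [s * B] bounds the total side of the [G.+1] steps in a free coordinate, and [D * sg = 2 * w] is
   the thickness in the solved one. [A * s] below bounds the total volume, the factor [(4 * r) ^+ d]
   coming from the number of cells. *)
pose B := 2 * r * (G0%:R + 1) + 1.
have B1 : 1 <= B by rewrite lerDr !mulr_ge0 ?addr_ge0// ltW.
pose D := 2 * (d%:R * (1 + C)).
have D0 : 0 <= D by rewrite !mulr_ge0// addr_ge0.
pose A := (4 * r) ^+ d * B ^+ d * D.
have B0 : 0 <= B by lra.
have A0 : 0 <= A.
  apply: mulr_ge0 => //; apply: mulr_ge0; apply: exprn_ge0 => //.
  by rewrite mulr_ge0// ltW.
(* Large enough for both [s <= 1] and [A * s <= e]. *)
pose M := (Num.trunc (2 * r * (A + 1) / e + 2 * r)).+1.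
have M0 : 0 < M%:R :> R by rewrite ltr0n.
pose s := 2 * r / M%:R.
have s0 : 0 < s by rewrite divr_gt0// mulr_gt0.
have Ms : M%:R * s = 2 * r by rewrite /s mulrC divfK// gt_eqF.
have Ae0 : 0 <= 2 * r * (A + 1) / e by apply: divr_ge0; [nra|exact: ltW].
have Mbig : 2 * r * (A + 1) / e + 2 * r <= M%:R.
  have : 0 <= 2 * r * (A + 1) / e + 2 * r by lra.
  by move=> /trunc_itv/andP[_ /ltW].
have s1 : s <= 1 by rewrite /s ler_pdivrMr// mul1r; lra.
have As : A * s <= e.
  have : 2 * r * (A + 1) / e <= M%:R by lra.
  rewrite ler_pdivrMr// => h.
  rewrite /s mulrA ler_pdivrMr//.
  lra.
pose sg := s ^+ 2.
have sg0 : 0 < sg by rewrite exprn_gt0.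
pose G := (M * G0)%N.
pose cell (k : {ffun 'I_d -> 'I_M.+1}) (x : E) :=
  forall i, (k i)%:R * s <= x 0 i + r <= (k i).+1%:R * s.
have cellP x : Om x -> exists k, cell k x.
  move=> Ox; have Hx i := le_trans (rv_norm_ge x i) (Hr x Ox).
  have /choice[k Hk] : forall i : 'I_d, exists k : 'I_M.+1,
      k%:R * s <= x 0 i + r <= k.+1%:R * s.
    move=> i; have := Hx i; rewrite ler_norml => /andP[h1 h2].
    by apply: nat_cell => //; [lra|rewrite Ms; lra].
  by exists [ffun i => k i] => i; rewrite ffunE.
have cell_near k x y : cell k x -> cell k y -> `|y - x| <= s.
  move=> hx hy; apply: rv_norm_le => [|i]; first exact: ltW.
  have /andP[h1 h2] := hx i; have /andP[h3 h4] := hy i.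
  by rewrite !mxE ler_norml; move: h2 h4; rewrite -natr1 mulrDl mul1r; lra.
(* a base point, a covector killing the image of [L] and its largest entry, for each cell *)
have /choice[base Hbase] : forall k : {ffun 'I_d -> 'I_M.+1},
    exists p : E * (('I_d -> R) * 'I_d),
    (exists x, Om x /\ cell k x) ->
    [/\ Om p.1, cell k p.1, p.2.1 p.2.2 = 1, forall i, `|p.2.1 i| <= 1 &
       forall h : E, \sum_i (h *m L p.1) 0 i * p.2.1 i = 0].
  move=> k; have [[x [Ox kx]]|H] := pselect (exists x, Om x /\ cell k x); last first.
    by exists (0, (fun=> 0, Ordinal d0)).
  have [a [j [h1 h2 h3]]] := singular_covector _ (Hdet x Ox).
  by exists (x, (a, j)).
pose x_ k := (base k).1; pose a_ k := (base k).2.1; pose j_ k := (base k).2.2.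
pose T : finType := ({ffun 'I_d -> 'I_M.+1} * {ffun 'I_d -> 'I_G.+1})%type.
pose c_ (g : {ffun 'I_d -> 'I_G.+1}) i : R := - (C' * s) + (g i)%:R * sg.
(* Half thickness of a slab: [d * C * sg] from the second order remainder and [d * sg] from rounding
   the free coordinates to multiples of [sg]. *)
pose w := d%:R * (1 + C) * sg.
have w0 : 0 <= w by rewrite !mulr_ge0 ?addr_ge0// ltW.
(* The value of coordinate [j_ k] predicted by the annihilating covector, whose entry there is 1,
   from the rounded free coordinates. *)
pose m_ k g := - \sum_(i | i != j_ k) a_ k i * c_ g i.
pose lo (t : T) : E := \row_i (F (x_ t.1) 0 i +
  if i == j_ t.1 then m_ t.1 t.2 - (if t.2 i == ord0 then w else 0) else c_ t.2 i).
(* The index of a box carries a dummy component at [j_ k]. Only its value [ord0] gives a box of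
   positive thickness; the other values give degenerate boxes, so that the sum over all indices
   counts each genuine box once. *)
pose side k (i : 'I_d) (q : 'I_G.+1) : R :=
  if i == j_ k then (if q == ord0 then 2 * w else 0) else sg.
pose hi (t : T) : E := \row_i (lo t 0 i + side t.1 i (t.2 i)).
have side0 k i q : 0 <= side k i q.
  by rewrite /side; case: ifP => _; [case: ifP => _ //; rewrite mulr_ge0|exact: ltW].
exists T, lo, hi; split.
- by move=> t i; rewrite !mxE lerDl.
- move=> _ [x Ox <-]; have [k kx] := cellP x Ox.
  have [Ob kb aj a1 aL] := Hbase k (ex_intro _ x (conj Ox kx)).
  rewrite -/(x_ k) -/(a_ k) -/(j_ k) in Ob kb aj a1 aL.
  pose y := F x - F (x_ k).
  pose rem := y - (x - x_ k) *m L (x_ k).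
  have xs := cell_near _ _ _ kb kx.
  have remC : `|rem| <= C * sg.
    apply: (le_trans (HF _ _ Ob Ox)); rewrite ler_wpM2l//.
    by rewrite /sg lerXn2r// nnegrE// ltW.
  have yC i : `|y 0 i| <= C' * s.
    have -> : y = rem + (x - x_ k) *m L (x_ k) by rewrite /rem subrK.
    apply: (le_trans (rv_norm_ge _ _)); apply: (le_trans (ler_normD _ _)).
    have h1 := norm_mulmx_le (x - x_ k) (L (x_ k)) C C0 (fun i j => HL _ i j Ob).
    have h2 : d%:R * C * `|x - x_ k| <= d%:R * C * s by rewrite ler_wpM2l// mulr_ge0.
    have h3 : C * sg <= C * s.
      by rewrite ler_wpM2l// /sg expr2 ler_piMr// ltW.
    by rewrite /C' mulrDl mul1r; lra.
  have ya : `|\sum_i y 0 i * a_ k i| <= d%:R * C * sg.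
    have -> : \sum_i y 0 i * a_ k i = \sum_i rem 0 i * a_ k i.
      rewrite -[RHS]addr0 -[X in _ = _ + X](aL (x - x_ k)) -big_split/=.
      apply: eq_bigr => i _; rewrite -mulrDl; congr (_ * _).
      by rewrite -[y in LHS](subrK ((x - x_ k) *m L (x_ k))) [LHS]mxE.
    apply: (le_trans (ler_norm_sum _ _ _)).
    apply: (@le_trans _ _ (\sum_(i < d) (C * sg))).
      apply: ler_sum => i _; rewrite normrM -[leRHS]mulr1; apply: ler_pM => //.
      exact: le_trans (rv_norm_ge _ _) remC.
    by rewrite sumr_const card_ord -[_ *+ d]mulr_natl mulrA.
  have /choice[q Hq] : forall i : 'I_d, exists q : 'I_G.+1,
      q%:R * sg <= y 0 i + C' * s <= q.+1%:R * sg.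
    move=> i; have := yC i; rewrite ler_norml => /andP[h1 h2].
    apply: nat_cell => //; first lra.
    have -> : G%:R * sg = 2 * (G0%:R * r) * s.
      by rewrite /G natrM /sg expr2 (mulrC M%:R) mulrACA -mulrA Ms; ring.
    have : C' * s <= G0%:R * r * s by rewrite ler_wpM2r// ltW.
    lra.
  pose g := [ffun i => if i == j_ k then ord0 else q i].
  exists (k, g) => // i; rewrite !mxE /=.
  have Ey : F x 0 i = F (x_ k) 0 i + y 0 i by rewrite /y !mxE addrCA subrr addr0.
  have Hc l : l != j_ k -> c_ g l <= y 0 l <= c_ g l + sg.
    move=> lj; rewrite /c_ /g ffunE (negPf lj); have /andP[h1 h2] := Hq l.
    move: h2; rewrite -natr1 mulrDl mul1r => h2.
    by apply/andP; split; lra.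
  rewrite Ey /side; case: (eqVneq i (j_ k)) => [ij|ij]; last first.
    by have /andP[h1 h2] := Hc i ij; apply/andP; split; lra.
  rewrite {1 2}/g ffunE ij eqxx/=.
  have : `|y 0 (j_ k) - m_ k g| <= w.
    have -> : y 0 (j_ k) - m_ k g = \sum_i y 0 i * a_ k i -
        \sum_(i | i != j_ k) (y 0 i - c_ g i) * a_ k i.
      rewrite (bigD1 (j_ k))//= aj mulr1 /m_ opprK -addrA; congr (_ + _).
      rewrite -sumrB; apply: eq_bigr => l _; ring.
    apply: (le_trans (ler_normB _ _)); rewrite /w mulrDr mulrDl mulr1 addrC.
    apply: lerD => //; apply: (le_trans (ler_norm_sum _ _ _)).
    apply: (@le_trans _ _ (\sum_(i < d) sg)); last first.
      by rewrite sumr_const card_ord mulr_natl.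
    rewrite [leRHS](bigID (fun i => i != j_ k))/= ler_wpDr//.
      by apply: sumr_ge0 => l _; exact: ltW.
    apply: ler_sum => l lj; rewrite normrM -[leRHS]mulr1; apply: ler_pM => //.
    by have /andP[h1 h2] := Hc l lj; rewrite ger0_norm; lra.
  rewrite ler_norml => /andP[h1 h2].
  by apply/andP; split; lra.
have volE t : \prod_(i < d) (hi t 0 i - lo t 0 i) = \prod_(i < d) side t.1 i (t.2 i).
  by apply: eq_bigr => i _; rewrite [hi t 0 i]mxE addrAC subrr add0r.
under eq_bigr do rewrite volE.
rewrite -(pair_bigA _ (fun k (g : {ffun 'I_d -> 'I_G.+1}) => \prod_(i < d) side k i (g i)))/=.
(* The sum over index functions of products of sides is the product over coordinates of sums of
   sides. *)
have inner k : \sum_(g : {ffun 'I_d -> 'I_G.+1}) \prod_(i < d) side k i (g i) <=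
    s ^+ d * (B ^+ d * D * s).
  rewrite -(bigA_distr_bigA (fun i q => side k i q)).
  apply: (@le_trans _ _ (\prod_(i < d) (s * (if i == j_ k then D * s else B)))).
    apply: ler_prod => i _; apply/andP; split.
      by apply: sumr_ge0 => q _; exact: side0.
    rewrite /side; case: ifP => _.
      rewrite (bigD1 ord0)//= big1 ?addr0; last by move=> q /negPf ->.
      by rewrite /w /D /sg expr2 le_eqVlt; apply/orP; left; apply/eqP; ring.
    rewrite sumr_const card_ord -[_ *+ _]mulr_natr /sg expr2 -mulrA.
    rewrite ler_pM2l// /G -natr1 natrM mulrDr mulr1 (mulrC s) mulrAC Ms.
    by rewrite /B; lra.
  rewrite big_split/= prodr_const card_ord ler_wpM2l ?exprn_ge0 ?(ltW s0)//.
  rewrite (bigD1 (j_ k))//= eqxx -(mulrA (B ^+ d)) (mulrC (B ^+ d)).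
  apply: ler_wpM2l; first by apply: mulr_ge0 => //; exact: ltW.
  rewrite (eq_bigr (fun=> B)); last by move=> i /negPf ->.
  rewrite prodr_const; apply: ler_weXn2l => //.
  by apply: (leq_trans (max_card _)); rewrite card_ord.
apply: (le_trans (ler_sum _ (fun k _ => inner k))).
rewrite sumr_const card_ffun !card_ord -[_ *+ _]mulr_natl.
apply: le_trans As.
have -> : A * s = (4 * r) ^+ d * (B ^+ d * D * s) by rewrite /A -!mulrA.
rewrite natrX [leLHS]mulrA -exprMn; apply: ler_wpM2r.
  by apply: mulr_ge0; [apply: mulr_ge0 => //; exact: exprn_ge0|exact: ltW].
apply: lerXn2r; rewrite ?nnegrE ?mulr_ge0 ?(ltW s0) ?(ltW r0)//.
rewrite -natr1 mulrDl Ms mul1r.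
have : s <= M%:R * s by rewrite ler_peMl ?(ltW s0)// ler1n.
by rewrite Ms; lra.
Qed.

End sard.

(** * Geodesics of step two structures *)

Section lagrange.
Context {R : realType}.

(** A Lagrange multiplier rule for quadratic polynomials without the implicit function theorem. As
    the linear part of the constraint is [r * c2], put [r = s ^+ 2 * x] and divide by [s ^+ 2]: the
    intermediate value theorem gives a root [x] bounded independently of small [s]. The objective
    becomes [2 * s * e1] up to O(s^2), and both signs of [s] are allowed. *)
Lemma two_parameter_multiplier (c2 k11 k12 k22 e1 e2 q11 q12 q22 : R) : c2 != 0 ->
  (forall s r : R, r * c2 + s ^+ 2 * k11 + s * r * k12 + r ^+ 2 * k22 = 0 ->
    0 <= 2 * (s * e1 + r * e2) + s ^+ 2 * q11 + s * r * q12 + r ^+ 2 * q22) ->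
  e1 = 0.
Proof.
move=> c20 H.
(* [B * |c2| = |k11| + 1] beats the constant term by 1, and [|s| * D <= 1] keeps the other terms
   below that 1. The constraint then changes sign on [-B, B]. *)
pose B : R := (`|k11| + 1) / `|c2|.
have c2g : 0 < `|c2| by rewrite normr_gt0.
have B0 : 0 < B by rewrite divr_gt0// ltr_wpDl.
pose D : R := B * `|k12| + B ^+ 2 * `|k22| + 1.
have D0 : 0 < D by rewrite ltr_wpDl// addr_ge0 ?mulr_ge0 ?exprn_ge0// ltW.
have root (s : R) : `|s| <= 1 -> `|s| * D <= 1 -> exists2 x : R, `|x| <= B &
    x * c2 + k11 + s * x * k12 + s ^+ 2 * x ^+ 2 * k22 = 0.
  move=> s1 sD.
  pose p (x : R) := x * c2 + k11 + s * x * k12 + s ^+ 2 * x ^+ 2 * k22.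
  have small (x : R) : `|x| <= B -> `|k11 + s * x * k12 + s ^+ 2 * x ^+ 2 * k22| <= B * `|c2|.
    move=> xB; have -> : B * `|c2| = `|k11| + 1 by rewrite /B divfK// gt_eqF.
    rewrite -addrA; apply: (le_trans (ler_normD _ _)); rewrite lerD2l.
    apply: le_trans sD; rewrite mulrDr mulr1; apply: (le_trans (ler_normD _ _)).
    have h1 : `|s * x * k12| <= `|s| * (B * `|k12|).
      by rewrite !normrM -mulrA ler_wpM2l// ler_wpM2r.
    have h2 : `|s ^+ 2 * x ^+ 2 * k22| <= `|s| * (B ^+ 2 * `|k22|).
      have -> : `|s ^+ 2 * x ^+ 2 * k22| = `|s| ^+ 2 * `|x| ^+ 2 * `|k22|.
        by rewrite 2!normrM !normrX.
      rewrite -mulrA; apply: ler_pM; rewrite ?exprn_ge0 ?mulr_ge0 ?exprn_ge0//.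
        by rewrite expr2 ler_piMr.
      by rewrite ler_wpM2r// lerXn2r// nnegrE ltW.
    have := normr_ge0 s; rewrite mulrDr; lra.
  have pc : continuous p.
    move=> x; rewrite /p; do ! (apply: cvgD || apply: cvgM || apply: cvg_cst || exact: cvg_id);
    exact: exprn_continuous.
  have BB : - B <= B by lra.
  have pB x : p x = x * c2 + (k11 + s * x * k12 + s ^+ 2 * x ^+ 2 * k22).
    by rewrite /p !addrA.
  have nB : `|B| <= B by rewrite gtr0_norm.
  have nNB : `|- B| <= B by rewrite normrN.
  have sB := small B nB; have sNB := small (- B) nNB.
  move: sB sNB; rewrite !ler_norml => /andP[h1 h2] /andP[h3 h4].
  have hv : Num.min (p (- B)) (p B) <= 0 <= Num.max (p (- B)) (p B).
    rewrite !pB ge_min le_max.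
    case: (ltgtP 0 c2) c20 => // hc _.
      rewrite gtr0_norm// in h1 h2 h3 h4.
      by apply/andP; split; apply/orP; [left|right]; lra.
    rewrite ltr0_norm// in h1 h2 h3 h4.
    by apply/andP; split; apply/orP; [right|left]; lra.
  have [x] := IVT BB (continuous_subspaceT pc) hv.
  by rewrite in_itv/= => xB px; exists x => //; rewrite ler_norml.
pose C := 2 * (B * `|e2|) + `|q11| + B * `|q12| + B ^+ 2 * `|q22|.
have C0 : 0 <= C by rewrite !addr_ge0 ?mulr_ge0 ?exprn_ge0// ltW.
have main (s : R) : `|s| <= 1 -> `|s| * D <= 1 -> 0 <= 2 * (s * e1) + s ^+ 2 * C.
  move=> s1 sD; have [x xB px] := root s s1 sD.
  have := H s (s ^+ 2 * x).
  have -> : s ^+ 2 * x * c2 + s ^+ 2 * k11 + s * (s ^+ 2 * x) * k12 + (s ^+ 2 * x) ^+ 2 * k22 =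
     s ^+ 2 * (x * c2 + k11 + s * x * k12 + s ^+ 2 * x ^+ 2 * k22) by ring.
  rewrite px mulr0 => /(_ erefl).
  have -> : 2 * (s * e1 + s ^+ 2 * x * e2) + s ^+ 2 * q11 + s * (s ^+ 2 * x) * q12 +
      (s ^+ 2 * x) ^+ 2 * q22 =
     2 * (s * e1) + s ^+ 2 * (2 * (x * e2) + q11 + s * x * q12 + s ^+ 2 * x ^+ 2 * q22) by ring.
  move=> /le_trans; apply; rewrite lerD2l ler_wpM2l ?sqr_ge0//.
  have h1 : x * e2 <= B * `|e2|.
    by apply: (le_trans (ler_norm _)); rewrite normrM ler_wpM2r.
  have h2 : s * x * q12 <= B * `|q12|.
    apply: (le_trans (ler_norm _)); rewrite !normrM ler_wpM2r//.
    by rewrite -[B]mul1r ler_pM.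
  have h3 : s ^+ 2 * x ^+ 2 * q22 <= B ^+ 2 * `|q22|.
    apply: (le_trans (ler_norm _)).
    have -> : `|s ^+ 2 * x ^+ 2 * q22| = `|s| ^+ 2 * `|x| ^+ 2 * `|q22|.
      by rewrite 2!normrM !normrX.
    rewrite ler_wpM2r// -[B ^+ 2]mul1r.
    by rewrite ler_pM ?exprn_ge0// ?exprn_ile1// lerXn2r// nnegrE ltW.
  by have := ler_norm q11; rewrite /C; lra.
apply/eqP; rewrite -normr_le0; apply/ler_addgt0Pl => e e0; rewrite addr0.
(* The first two bounds allow the root to be taken; the third makes the quadratic term [s * C] at
   most [2 * e]. *)
pose s := Num.min 1 (Num.min (D^-1) (2 * e / (C + 1))).
have s0 : 0 < s.
  by rewrite !lt_min ltr01 invr_gt0 D0/= divr_gt0// ?mulr_gt0// ltr_wpDl.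
have s1 : s <= 1 by rewrite ge_min lexx.
have sD : s * D <= 1.
  by rewrite -ler_pdivlMr// mul1r !ge_min lexx orbT.
have sC : s * C <= 2 * e.
  apply: (@le_trans _ _ (s * (C + 1))); first by rewrite ler_pM2l//; lra.
  by rewrite -ler_pdivlMr ?ltr_wpDl// !ge_min lexx !orbT.
have ns : `|s| = s by rewrite gtr0_norm.
have m1 := main s; rewrite ns in m1; have {}m1 := m1 s1 sD.
have m2 := main (- s); rewrite normrN ns in m2; have {}m2 := m2 s1 sD.
have f1 : 0 <= 2 * e1 + s * C.
  by rewrite -(pmulr_rge0 _ s0) mulrDr; apply: le_trans m1 _; rewrite le_eqVlt; apply/orP; left; apply/eqP; ring.
have f2 : 0 <= - 2 * e1 + s * C.
  by rewrite -(pmulr_rge0 _ s0) mulrDr; apply: le_trans m2 _; rewrite le_eqVlt; apply/orP; left; apply/eqP; ring.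
by rewrite ler_norml; apply/andP; split; lra.
Qed.

End lagrange.

Section bilinear.
Context {R : realType} {m : nat}.
Implicit Types (K : 'M[R]_m) (x y z : 'I_m -> R).

Definition bil K x y : R := \sum_i \sum_j x i * K i j * y j.
Definition dot x y : R := \sum_i x i * y i.

Lemma bilDl K x x' y : bil K (fun i => x i + x' i) y = bil K x y + bil K x' y.
Proof.
rewrite /bil -big_split/=; apply: eq_bigr => i _; rewrite -big_split/=.
by apply: eq_bigr => j _; ring.
Qed.

Lemma bilDr K x y y' : bil K x (fun i => y i + y' i) = bil K x y + bil K x y'.
Proof.
rewrite /bil -big_split/=; apply: eq_bigr => i _; rewrite -big_split/=.
by apply: eq_bigr => j _; ring.
Qed.

Lemma bilZl K (s : R) x y : bil K (fun i => s * x i) y = s * bil K x y.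
Proof.
rewrite /bil mulr_sumr; apply: eq_bigr => i _; rewrite mulr_sumr.
by apply: eq_bigr => j _; ring.
Qed.

Lemma bilZr K (s : R) x y : bil K x (fun i => s * y i) = s * bil K x y.
Proof.
rewrite /bil mulr_sumr; apply: eq_bigr => i _; rewrite mulr_sumr.
by apply: eq_bigr => j _; ring.
Qed.

Lemma bil_antisym K x y : bil (K - K^T) x y = bil K x y - bil K y x.
Proof.
rewrite /bil [X in _ = _ - X]exchange_big/= -sumrB; apply: eq_bigr => i _.
by rewrite -sumrB; apply: eq_bigr => j _; rewrite !mxE; ring.
Qed.

Lemma bil_dot K x y : bil K x y = dot x (fun i => \sum_j K i j * y j).
Proof.
by apply: eq_bigr => i _; rewrite mulr_sumr; apply: eq_bigr => j _; rewrite mulrA.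
Qed.

Lemma dotDl x x' y : dot (fun i => x i + x' i) y = dot x y + dot x' y.
Proof. by rewrite /dot -big_split/=; apply: eq_bigr => i _; rewrite mulrDl. Qed.

Lemma dotDr x y y' : dot x (fun i => y i + y' i) = dot x y + dot x y'.
Proof. by rewrite /dot -big_split/=; apply: eq_bigr => i _; rewrite mulrDr. Qed.

Lemma dotZl (s : R) x y : dot (fun i => s * x i) y = s * dot x y.
Proof. by rewrite /dot mulr_sumr; apply: eq_bigr => i _; rewrite mulrA. Qed.

Lemma dotZr (s : R) x y : dot x (fun i => s * y i) = s * dot x y.
Proof. by rewrite /dot mulr_sumr; apply: eq_bigr => i _; rewrite mulrCA. Qed.

Lemma dotC x y : dot x y = dot y x.
Proof. by apply: eq_bigr => i _; rewrite mulrC. Qed.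

Lemma dot_ge0 x : 0 <= dot x x.
Proof. by apply: sumr_ge0 => i _; rewrite -expr2 sqr_ge0. Qed.

Implicit Types (f g : R -> R) (X Y : 'I_m -> R -> R) (a b t : R).

Lemma bmf_bil K X Y : (forall i, bmf (X i)) -> (forall i, bmf (Y i)) ->
  bmf (fun t => bil K (X^~ t) (Y^~ t)).
Proof.
move=> hX hY; apply: bmf_sum => i; apply: bmf_sum => j.
by apply: bmfM => //; apply: bmfM => //; exact: bmf_cst.
Qed.

Lemma bmf_dot X Y : (forall i, bmf (X i)) -> (forall i, bmf (Y i)) ->
  bmf (fun t => dot (X^~ t) (Y^~ t)).
Proof. by move=> hX hY; apply: bmf_sum => i; exact: bmfM. Qed.

Lemma ac_bil a b K X Y X' Y' : (forall i, ac a b (X i) (X' i)) ->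
  (forall i, ac a b (Y i) (Y' i)) ->
  ac a b (fun t => bil K (X^~ t) (Y^~ t))
    (fun t => bil K (X'^~ t) (Y^~ t) + bil K (X^~ t) (Y'^~ t)).
Proof.
move=> hX hY.
have H i j : ac a b (fun t => X i t * K i j * Y j t)
    (fun t => X' i t * K i j * Y j t + X i t * K i j * Y' j t).
  apply: (ac_ae _ _ _ _ _ (acM _ _ _ _ _ _ (acM _ _ _ _ _ _ (hX i) (ac_cst a b (K i j))) (hY j))).
  by apply: ae_all => t _ _; ring.
apply: ac_ae (ac_sum _ _ _ _ _ (fun i => ac_sum _ _ _ _ _ (fun j => H i j))) _.
apply: ae_all => t _ _; rewrite /bil -big_split/=; apply: eq_bigr => i _.
by rewrite -big_split.
Qed.

Lemma primD a b f g : a <= b -> bmf f -> bmf g ->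
  prim a (fun t => f t + g t) b = prim a f b + prim a g b.
Proof.
move=> ab bf bg.
have := ac_eq _ _ _ _ _ _ ab (prim_ac a b _ (bmfD _ _ bf bg))
  (acD _ _ _ _ _ _ (prim_ac a b _ bf) (prim_ac a b _ bg)) (ae_all _ (fun t _ _ => erefl)).
by rewrite !prim_start addr0 !subr0.
Qed.

Lemma primZ a b (k : R) f : a <= b -> bmf f -> prim a (fun t => k * f t) b = k * prim a f b.
Proof.
move=> ab bf.
have := ac_eq _ _ _ _ _ _ ab (prim_ac a b _ (bmfZ k _ bf))
  (acZ _ _ k _ _ (prim_ac a b _ bf)) (ae_all _ (fun t _ _ => erefl)).
by rewrite !prim_start mulr0 !subr0.
Qed.

Lemma prim_eq a b f g : a <= b -> bmf f -> bmf g ->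
  (forall t, a < t -> t < b -> f t = g t) -> prim a f b = prim a g b.
Proof.
move=> ab bf bg fg.
have := ac_eq _ _ _ _ _ _ ab (prim_ac a b _ bf) (prim_ac a b _ bg).
by rewrite !prim_start !subr0; apply; exact: ae_all.
Qed.

Lemma prim_ftc a b F f g : a <= b -> bmf f -> ac a b F g ->
  (forall t, a < t -> t < b -> f t = g t) -> prim a f b = F b - F a.
Proof.
move=> ab bf hF fg.
have := ac_eq _ _ _ _ _ _ ab (prim_ac a b _ bf) hF.
by rewrite !prim_start !subr0; apply; exact: ae_all.
Qed.

Lemma prim_le a b f g : a <= b -> bmf f -> bmf g ->
  (forall t, a < t -> t < b -> f t <= g t) -> prim a f b <= prim a g b.
Proof.
move=> ab bf bg fg.
have := ac_le _ _ _ _ _ _ ab (prim_ac a b _ bf) (prim_ac a b _ bg).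
by rewrite !prim_start !subr0; apply; exact: ae_all.
Qed.

(** Young's inequality [|Y| <= th + th^-1 * |Y|^2] replaces Cauchy-Schwarz: the integral of the
    second term is nonpositive, and [th] is arbitrarily small. *)
Lemma zero_of_energy a b X Y : a <= b -> (forall i, bmf (Y i)) ->
  (forall i, ac a b (X i) (Y i)) -> (forall i, X i a = 0) ->
  prim a (fun t => dot (Y^~ t) (Y^~ t)) b <= 0 ->
  forall i t, a <= t -> t <= b -> X i t = 0.
Proof.
move=> ab bY hX X0 I0 i t at_ tb.
have bD := bmf_dot _ _ bY bY.
have It : prim a (fun t => dot (Y^~ t) (Y^~ t)) t <= 0.
  apply: le_trans I0.
  have := ac_le _ _ _ _ _ _ tb (ac_cst t b 0) (acS _ _ t b _ _ at_ (lexx b) (prim_ac a b _ bD)).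
  rewrite subrr subr_ge0; apply; apply: ae_all => s _ _; exact: dot_ge0.
apply/eqP; rewrite -normr_le0; apply/ler_addgt0Pl => e e0; rewrite addr0.
pose th := e / (t - a + 1).
have ta1 : 0 < t - a + 1 by lra.
have th0 : 0 < th by rewrite divr_gt0.
pose G s := th * s + th^-1 * prim a (fun t => dot (Y^~ t) (Y^~ t)) s.
have aG : ac a t G (fun s => th * 1 + th^-1 * dot (Y^~ s) (Y^~ s)).
  by apply: acD; apply: acZ; [exact: ac_id|exact: prim_ac].
have key s : `|Y i s| <= th * 1 + th^-1 * dot (Y^~ s) (Y^~ s).
  have h1 : `|Y i s| ^+ 2 <= dot (Y^~ s) (Y^~ s).
    rewrite real_normK ?num_real// /dot (bigD1 i)//= -expr2 lerDl.
    by apply: sumr_ge0 => j _; rewrite -expr2 sqr_ge0.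
  have h2 : th^-1 * `|Y i s| ^+ 2 <= th^-1 * dot (Y^~ s) (Y^~ s).
    by rewrite ler_pM2l// invr_gt0.
  apply: le_trans (lerD (lexx (th * 1)) h2).
  rewrite mulr1 -(ler_pM2l th0).
  have -> : th * (th + th^-1 * `|Y i s| ^+ 2) = th * th + `|Y i s| ^+ 2.
    by field; rewrite gt_eqF.
  have := sqr_ge0 (th - `|Y i s|); have := sqr_ge0 (th + `|Y i s|); rewrite !expr2; nra.
have hXt := acS _ _ a t _ _ (lexx a) tb (hX i).
have r1 := ac_le _ _ _ _ _ _ at_ hXt aG.
have r2 := ac_le _ _ _ _ _ _ at_ (acB _ _ _ _ _ _ (ac_cst a t 0) hXt) aG.
have {r1}r1 : X i t <= G t - G a.
  rewrite X0 subr0 in r1; apply: r1; apply: ae_all => s _ _; exact: le_trans (ler_norm _) (key s).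
have {r2}r2 : - X i t <= G t - G a.
  rewrite X0 !sub0r oppr0 subr0 in r2; apply: r2; apply: ae_all => s _ _; rewrite sub0r.
  by apply: le_trans (key s); rewrite -normrN ler_norm.
have Ge : G t - G a <= e.
  rewrite /G prim_start mulr0 addr0.
  have : th^-1 * prim a (fun t => dot (Y^~ t) (Y^~ t)) t <= 0.
    by rewrite pmulr_rle0// invr_gt0.
  have : th * (t - a + 1) = e by rewrite /th divfK// gt_eqF.
  nra.
by rewrite ler_norml; lra.
Qed.

End bilinear.

(** * Minimizers under the area constraint of a step two structure *)

Section step_two_minimizers.
Context {R : realType} {m : nat}.
Variables (K : 'M[R]_m) (a b : R) (U u : 'I_m -> R -> R) (Z : R -> R).
Hypothesis ab : a < b.
Hypothesis bu : forall i, bmf (u i).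
Hypothesis hU : forall i, ac a b (U i) (u i).
Hypothesis hZ : ac a b Z (fun t => bil K (u^~ t) (U^~ t)).
Hypothesis hmin : forall (U' u' : 'I_m -> R -> R) (Z' : R -> R),
  (forall i, bmf (u' i)) -> (forall i, ac a b (U' i) (u' i)) ->
  ac a b Z' (fun t => bil K (u'^~ t) (U'^~ t)) ->
  (forall i, U' i a = U i a) -> (forall i, U' i b = U i b) ->
  Z' a = Z a -> Z' b = Z b ->
  prim a (fun t => dot (u^~ t) (u^~ t)) b <= prim a (fun t => dot (u'^~ t) (u'^~ t)) b.

Let J := K - K^T.
Let cl (X : 'I_m -> R -> R) i t := X i (clamp a b t).
Let leab := ltW ab.

Let bmf_cl X x i : (forall i, ac a b (X i) (x i)) -> bmf (cl X i).
Proof. by move=> hX; apply: (bmf_lip a b (X i)) => //; case: (hX i). Qed.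

Let clE X i t : a < t -> t < b -> cl X i t = X i t.
Proof. by move=> at_ tb; rewrite /cl clamp_id ?ltW. Qed.

Let clE' X t : a < t -> t < b -> (cl X)^~ t = X^~ t.
Proof. by move=> at_ tb; apply/funext => i; rewrite clE. Qed.

Let test (phi psi : 'I_m -> R -> R) := [/\ forall i, bmf (psi i),
  forall i, ac a b (phi i) (psi i), forall i, phi i a = 0 & forall i, phi i b = 0].

(** If [U] is changed by [phi] with derivative [psi] and fixed ends, [Z b] changes by exactly
    [cf psi + kf psi phi]. The linear part involves only the antisymmetric [J], the remaining first
    order terms being an exact derivative. *)
Let cf (psi : 'I_m -> R -> R) := prim a (fun t => bil J (psi^~ t) ((cl U)^~ t)) b.
Let kf (psi phi : 'I_m -> R -> R) := prim a (fun t => bil K (psi^~ t) ((cl phi)^~ t)) b.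
Let qf (psi psi' : 'I_m -> R -> R) := prim a (fun t => dot (psi^~ t) (psi'^~ t)) b.

Let bU i : bmf (cl U i). Proof. exact: bmf_cl hU. Qed.

Let test_min phi psi : test phi psi -> cf psi + kf psi phi = 0 ->
  0 <= 2 * qf u psi + qf psi psi.
Proof.
move=> [bp hp pa pb] ck.
pose U' i t := U i t + phi i t; pose u' i t := u i t + psi i t.
have bu' i : bmf (u' i) by exact: bmfD.
have hU' i : ac a b (U' i) (u' i) by exact: acD.
have bU' i : bmf (cl U' i) by exact: bmf_cl hU'.
have bphi i : bmf (cl phi i) by exact: bmf_cl hp.
pose g t := bil K (u'^~ t) ((cl U')^~ t).
have bg : bmf g by exact: bmf_bil.
pose Z' t := Z a + prim a g t.
have hZ' : ac a b Z' (fun t => bil K (u'^~ t) (U'^~ t)).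
  apply: ac_ae (acD _ _ _ _ _ _ (ac_cst a b (Z a)) (prim_ac a b _ bg)) _.
  by apply: ae_all => t at_ tb; rewrite add0r /g clE'.
have Zb : Z' b = Z b.
  pose g1 t := bil K (u^~ t) ((cl U)^~ t).
  pose g2 t := bil J (psi^~ t) ((cl U)^~ t).
  (* The derivative of [bil K U phi], which vanishes at both ends. *)
  pose g3 t := bil K (u^~ t) ((cl phi)^~ t) + bil K ((cl U)^~ t) (psi^~ t).
  pose g4 t := bil K (psi^~ t) ((cl phi)^~ t).
  have b1 : bmf g1 by exact: bmf_bil.
  have b2 : bmf g2 by exact: bmf_bil.
  have b3 : bmf g3 by apply: bmfD; exact: bmf_bil.
  have b4 : bmf g4 by exact: bmf_bil.
  have b34 := bmfD _ _ b3 b4; have b234 := bmfD _ _ b2 b34; have b1234 := bmfD _ _ b1 b234.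
  have -> : Z' b = Z a + prim a (fun t => g1 t + (g2 t + (g3 t + g4 t))) b.
    congr (_ + _); apply: (prim_eq _ _ _ _ leab bg b1234) => t _ _; rewrite /g /g1 /g2 /g3 /g4.
    have -> : (cl U')^~ t = fun i => cl U i t + cl phi i t by [].
    rewrite /u' bilDl !bilDr bil_antisym; ring.
  rewrite (primD _ _ _ _ leab b1 b234) (primD _ _ _ _ leab b2 b34) (primD _ _ _ _ leab b3 b4).
  have -> : prim a g1 b = Z b - Z a.
    by apply: (prim_ftc _ _ _ _ _ leab b1 hZ) => t at_ tb; rewrite /g1 clE'.
  have -> : prim a g3 b = 0.
    rewrite (prim_ftc _ _ _ _ _ leab b3 (ac_bil _ _ K _ _ _ _ hU hp)).
      have E0 s : (forall i, phi i s = 0) -> bil K (U^~ s) (phi^~ s) = 0.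
        move=> H; apply: big1 => i _; apply: big1 => j _; by rewrite H mulr0.
      by rewrite !E0// subrr.
    by move=> t at_ tb; rewrite /g3 !clE'.
  move: ck; rewrite /cf /kf -/g2 -/g4; lra.
have := hmin U' u' Z' bu' hU' hZ' _ _ _ Zb.
have -> : prim a (fun t => dot (u'^~ t) (u'^~ t)) b =
    prim a (fun t => dot (u^~ t) (u^~ t) + (2 * dot (u^~ t) (psi^~ t) + dot (psi^~ t) (psi^~ t))) b.
  congr (prim a _ b); apply/funext => t; rewrite /u' dotDl !dotDr (dotC (psi^~ t) (u^~ t)); ring.
rewrite !primD ?primZ//; try (by exact: bmf_dot); try (by apply: bmfZ; exact: bmf_dot);
  try (by apply: bmfD; [apply: bmfZ|]; exact: bmf_dot).
rewrite lerDl -/(qf u psi) -/(qf psi psi); apply.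
- by move=> i; rewrite /U' pa addr0.
- by move=> i; rewrite /U' pb addr0.
- by rewrite /Z' prim_start addr0.
Qed.

Let test_comb s r phi1 psi1 phi2 psi2 : test phi1 psi1 -> test phi2 psi2 ->
  test (fun i t => s * phi1 i t + r * phi2 i t) (fun i t => s * psi1 i t + r * psi2 i t).
Proof.
move=> [b1 h1 a1 e1] [b2 h2 a2 e2]; split=> i.
- by apply: bmfD; exact: bmfZ.
- by apply: acD; exact: acZ.
- by rewrite a1 a2 !mulr0 addr0.
- by rewrite e1 e2 !mulr0 addr0.
Qed.

Let prim_comb3 (x y z : R) f g h : bmf f -> bmf g -> bmf h ->
  prim a (fun t => x * f t + y * g t + z * h t) b =
  x * prim a f b + y * prim a g b + z * prim a h b.
Proof.
move=> bf bg bh; rewrite !primD ?primZ//; try (by exact: bmfZ).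
by apply: bmfD; exact: bmfZ.
Qed.

Let cf_comb s r psi1 psi2 : (forall i, bmf (psi1 i)) -> (forall i, bmf (psi2 i)) ->
  cf (fun i t => s * psi1 i t + r * psi2 i t) = s * cf psi1 + r * cf psi2.
Proof.
move=> b1 b2; rewrite /cf -!primZ// -?primD//; try (by apply: bmfZ; exact: bmf_bil);
  try exact: bmf_bil.
by congr (prim a _ b); apply/funext => t; rewrite bilDl !bilZl.
Qed.

(** Varies [u] in the plane spanned by [psi1] and [psi2]; the second direction restores the endpoint
    to which the first contributes only at second order. *)
Let multiplier phi1 psi1 phi2 psi2 : test phi1 psi1 -> test phi2 psi2 ->
  cf psi1 = 0 -> cf psi2 != 0 -> qf u psi1 = 0.
Proof.
move=> t1 t2 c1 c2; have [b1 h1 _ _] := t1; have [b2 h2 _ _] := t2.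
have B1 i : bmf (cl phi1 i) by exact: bmf_cl h1.
have B2 i : bmf (cl phi2 i) by exact: bmf_cl h2.
apply: (@two_parameter_multiplier R (cf psi2) (kf psi1 phi1) (kf psi1 phi2 + kf psi2 phi1)
  (kf psi2 phi2) (qf u psi1) (qf u psi2) (qf psi1 psi1) (2 * qf psi1 psi2) (qf psi2 psi2) c2).
move=> s r Hk.
have := test_min _ _ (test_comb s r _ _ _ _ t1 t2).
rewrite cf_comb// c1 mulr0 add0r.
have -> : kf (fun i t => s * psi1 i t + r * psi2 i t) (fun i t => s * phi1 i t + r * phi2 i t) =
   s ^+ 2 * kf psi1 phi1 + s * r * (kf psi1 phi2 + kf psi2 phi1) + r ^+ 2 * kf psi2 phi2.
  rewrite /kf -primD//; try exact: bmf_bil.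
  rewrite -prim_comb3; try exact: bmf_bil; last by apply: bmfD; exact: bmf_bil.
  congr (prim a _ b); apply/funext => t.
  have -> : (cl (fun i t => s * phi1 i t + r * phi2 i t))^~ t =
    (fun i => s * cl phi1 i t + r * cl phi2 i t) by [].
  rewrite bilDl !bilDr !bilZl !bilZr; ring.
have -> : qf u (fun i t => s * psi1 i t + r * psi2 i t) = s * qf u psi1 + r * qf u psi2.
  rewrite /qf -!primZ// -?primD//; try (by apply: bmfZ; exact: bmf_dot); try exact: bmf_dot.
  by congr (prim a _ b); apply/funext => t; rewrite dotDr !dotZr.
have -> : qf (fun i t => s * psi1 i t + r * psi2 i t) (fun i t => s * psi1 i t + r * psi2 i t) =
   s ^+ 2 * qf psi1 psi1 + s * r * (2 * qf psi1 psi2) + r ^+ 2 * qf psi2 psi2.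
  have -> : 2 * qf psi1 psi2 = prim a (fun t => 2 * dot (psi1^~ t) (psi2^~ t)) b.
    by rewrite primZ//; exact: bmf_dot.
  rewrite /qf -prim_comb3; try exact: bmf_dot; last by apply: bmfZ; exact: bmf_dot.
  congr (prim a _ b); apply/funext => t.
  rewrite dotDl !dotDr !dotZl !dotZr (dotC (psi2^~ t) (psi1^~ t)); ring.
move=> W; have {}W := W (etrans _ Hk).
have {}W : 0 <= 2 * (s * qf u psi1 + r * qf u psi2) + (s ^+ 2 * qf psi1 psi1 +
    s * r * (2 * qf psi1 psi2) + r ^+ 2 * qf psi2 psi2) by apply: W; ring.
by rewrite !addrA in W.
Qed.

Let lin (X : 'I_m -> R -> R) i := (X i b - X i a) / (b - a).
Let dev (X : 'I_m -> R -> R) i t := X i t - (X i a + (t - a) * lin X i).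

Let test_dev X x : (forall i, bmf (x i)) -> (forall i, ac a b (X i) (x i)) ->
  test (dev X) (fun i t => x i t - lin X i).
Proof.
have ba0 : b - a != 0 by rewrite subr_eq0 gt_eqF.
move=> bx hX; split=> i.
- by apply: bmfB => //; exact: bmf_cst.
- have h1 : ac a b (fun t => X i a + (t - a) * lin X i) (fun=> lin X i).
    have := acD _ _ _ _ _ _ (ac_cst a b (X i a))
      (acM _ _ _ _ _ _ (acB _ _ _ _ _ _ (ac_id a b) (ac_cst a b a)) (ac_cst a b (lin X i))).
    move=> h; apply: ac_ae h _; apply: ae_all => t _ _; ring.
  exact: acB.
- by rewrite /dev; ring.
- by rewrite /dev /lin mulrC divfK//; ring.
Qed.

Let qf_const phi psi (l : 'I_m -> R) : test phi psi -> qf psi (fun i _ => l i) = 0.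
Proof.
move=> [bp hp pa pb].
have h : ac a b (fun t => \sum_i phi i t * l i) (fun t => dot (psi^~ t) l).
  apply: ac_sum => i; apply: ac_ae (acM _ _ _ _ _ _ (hp i) (ac_cst a b (l i))) _.
  by apply: ae_all => t _ _; rewrite mulr0 addr0.
rewrite /qf (prim_ftc _ _ _ _ _ leab _ h)//; last by apply: bmf_dot => // i; exact: bmf_cst.
by rewrite !big1 ?subrr// => i _; rewrite ?pa ?pb mul0r.
Qed.

Let qfD x y y' : (forall i, bmf (x i)) -> (forall i, bmf (y i)) -> (forall i, bmf (y' i)) ->
  qf x (fun i t => y i t + y' i t) = qf x y + qf x y'.
Proof.
move=> bx by_ by'; rewrite /qf -primD//; try exact: bmf_dot.
by congr (prim a _ b); apply/funext => t; rewrite dotDr.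
Qed.

Let qfZ x y (s : R) : (forall i, bmf (x i)) -> (forall i, bmf (y i)) ->
  qf x (fun i t => s * y i t) = s * qf x y.
Proof.
move=> bx by_; rewrite /qf -primZ//; try exact: bmf_dot.
by congr (prim a _ b); apply/funext => t; rewrite dotZr.
Qed.

Let qfC x y : qf x y = qf y x.
Proof. by rewrite /qf; congr (prim a _ b); apply/funext => t; rewrite dotC. Qed.

Let JU i t := \sum_j J i j * cl U j t.
Let bJU i : bmf (JU i).
Proof. by apply: bmf_sum => j; apply: bmfZ. Qed.

Let cfE psi : cf psi = qf psi JU.
Proof. by rewrite /cf /qf; congr (prim a _ b); apply/funext => t; rewrite bil_dot. Qed.

Let Q i t := prim a (JU i) t.
Let hQ i : ac a b (Q i) (JU i). Proof. exact: prim_ac. Qed.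

Let cU i : continuous (cl U i).
Proof. by apply: (lip_on_clamp_continuous a b (U i)) => //; case: (hU i). Qed.

Let dQ i t : a < t -> is_derive t 1 (Q i) (JU i t).
Proof.
move=> at_; apply: (@prim_derive _ a b) => //.
apply: continuous_at_sum => j.
by apply: cvgM; [exact: cvg_cst|exact: cU].
Qed.

(** The du Bois-Reymond argument: the deviation of [X] from its chord is itself an admissible
    variation, and constants are orthogonal to all such variations. If its derivative pairs
    nonpositively with [x], then it has zero energy. *)
Let dev0 X x : (forall i, bmf (x i)) -> (forall i, ac a b (X i) (x i)) ->
  qf (fun i t => x i t - lin X i) x <= 0 ->
  forall i t, a <= t -> t <= b -> X i t = X i a + (t - a) * lin X i.
Proof.
move=> bx hX H i t at_ tb; have T := test_dev _ _ bx hX; have [bp hp pa pb] := T.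
suff : dev X i t = 0 by move/eqP; rewrite subr_eq0 => /eqP.
apply: (zero_of_energy _ _ _ _ leab bp hp pa) at_ tb; apply: le_trans H.
have := qf_const _ _ (lin X) T.
rewrite -/(qf (fun i t => x i t - lin X i) (fun i t => x i t - lin X i)) => H0.
rewrite le_eqVlt; apply/orP; left; apply/eqP.
rewrite -[LHS]addr0 -[X in _ + X]H0 -qfD//; last by move=> j; exact: bmf_cst.
by congr (qf _ _); apply/funext => j; apply/funext => s; rewrite subrK.
Qed.

Let affine_derive (X : 'I_m -> R -> R) i (k0 k1 t : R) : a < t -> t < b ->
  (forall t, a <= t -> t <= b -> X i t = k0 + (t - a) * k1) -> is_derive t 1 (X i) k1.
Proof.
move=> at_ tb H.
have d : is_derive t 1 (fun s : R => k0 + (s - a) * k1) k1.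
  have := is_deriveDl _ _ _ _ _ (is_derive_cstl t k0) (is_deriveMl _ _ _ _ _
    (is_deriveBl _ _ _ _ _ (is_derive_idl t) (is_derive_cstl t a)) (is_derive_cstl t k1)).
  by move=> h; apply: (is_derive_ext _ _ _ _ _ h) => //; ring.
apply: is_derive_near d _; near=> s; apply/esym/H; apply: ltW; near: s.
  exact: lt_nbhsr.
exact: lt_nbhsl.
Unshelve. all: by end_near. Qed.

(** If some variation has [cf psi != 0], there is a multiplier [q], and [u - q * J U] is orthogonal
    to all variations, hence constant. Otherwise the constraint is degenerate along the curve: [J U]
    is constant, the chord is an admissible competitor, and minimality makes [U] affine, so that
    [q = 0] serves. *)
Lemma minimizer_ode : exists (c : 'I_m -> R) (q : R), forall i t, a < t -> t < b ->
  is_derive t 1 (U i) (c i + q * \sum_j (K - K^T) i j * U j t).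
Proof.
have [[phi2 [psi2 [t2 c2]]]|nc] := pselect (exists phi psi, test phi psi /\ cf psi != 0).
- pose q := qf u psi2 / cf psi2.
  (* Subtracting the right multiple of [psi2] makes [cf] vanish, as [multiplier] requires. *)
  have eq psi phi : test phi psi -> qf u psi = q * cf psi.
    move=> t1; have [b1 _ _ _] := t1; have [b2 _ _ _] := t2.
    have := multiplier _ _ _ _ (test_comb 1 (- (cf psi / cf psi2)) _ _ _ _ t1 t2) t2.
    rewrite cf_comb// mul1r mulNr divfK// subrr => /(_ erefl c2).
    rewrite qfD//; [|by move=> i; exact: bmfZ|by move=> i; exact: bmfZ].
    by rewrite !qfZ// mul1r /q mulrAC mulNr => /eqP; rewrite subr_eq0 => /eqP ->; field.
  pose X i t := U i t - q * Q i t; pose x i t := u i t - q * JU i t.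
  have bx i : bmf (x i) by apply: bmfB => //; exact: bmfZ.
  have hX i : ac a b (X i) (x i) by apply: acB => //; exact: acZ.
  exists (lin X), q => i t at_ tb.
  have H0 : qf (fun i t => x i t - lin X i) x <= 0.
    have T := test_dev _ _ bx hX; have [bp _ _ _] := T.
    have := eq _ _ T; rewrite cfE qfC => E.
    set psi := (fun i t => x i t - lin X i) in bp E *.
    have -> : qf psi x = qf psi (fun i t => u i t + (- q) * JU i t).
      by congr (qf _ _); apply/funext => j; apply/funext => s; rewrite mulNr.
    rewrite qfD//; last by move=> j; exact: bmfZ.
    by rewrite qfZ// E mulNr subrr.
  have XE := dev0 _ _ bx hX H0.
  have dX := affine_derive X i _ _ t at_ tb (XE i).
  have dqQ := is_deriveMl _ _ _ _ _ (is_derive_cstl t q) (dQ i t at_).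
  apply: (is_derive_ext _ _ _ _ _ (is_deriveDl _ _ _ _ _ dX dqQ)).
    by move=> s; rewrite /X subrK.
  rewrite mul0r add0r; congr (_ + _ * _); apply: eq_bigr => j _; by rewrite clE.
(* The degenerate case: [cf psi] is the pairing of [psi] with [J U], and it vanishes for all
   variations. *)
have cf0 phi psi : test phi psi -> cf psi = 0.
  by move=> T; apply/eqP/negPn/negP => H; apply: nc; exists phi, psi.
have JUc i t : a < t -> t < b -> JU i t = lin Q i.
  move=> at_ tb.
  have H0 : qf (fun i t => JU i t - lin Q i) JU <= 0.
    by rewrite -cfE (cf0 _ _ (test_dev _ _ bJU hQ)).
  have d1 := affine_derive Q i _ _ t at_ tb (dev0 _ _ bJU hQ H0 i).
  have [_ <-] := d1; by have [_ <-] := dQ i t at_.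
have UE : forall i t, a <= t -> t <= b -> U i t = U i a + (t - a) * lin U i.
  apply: dev0 bu hU _.
  have T := test_dev _ _ bu hU; have [bp hp pa pb] := T.
  pose psi i t := u i t - lin U i.
  rewrite -/psi in T bp hp *.
  (* The variation -dev U carries [U] to its chord. *)
  have Tn := test_comb (-1) 0 _ _ _ _ T T.
  pose npsi i t := - 1 * psi i t + 0 * psi i t.
  pose nphi i t := - 1 * dev U i t + 0 * dev U i t.
  rewrite -/npsi -/nphi in Tn.
  have [bn hn na nb] := Tn.
  have psiE i t : u i t = lin U i + psi i t by rewrite /psi addrC subrK.
  (* Half of the symmetric part is an exact derivative. The antisymmetric part vanishes because [J]
     sends [nphi] to 0, both [J U] and its interpolation between the ends being the same
     constant. *)
  have k0 : kf npsi nphi = 0.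
    have bnphi i : bmf (cl nphi i) by exact: bmf_cl hn.
    have -> : kf npsi nphi = 2^-1 * (prim a (fun t => bil J (npsi^~ t) ((cl nphi)^~ t)) b +
       prim a (fun t => bil K (npsi^~ t) ((cl nphi)^~ t) + bil K ((cl nphi)^~ t) (npsi^~ t)) b).
      rewrite -primD//; [|by exact: bmf_bil|by apply: bmfD; exact: bmf_bil].
      rewrite -primZ//; last by apply: bmfD; [exact: bmf_bil|apply: bmfD; exact: bmf_bil].
      rewrite /kf; congr (prim a _ b); apply/funext => t; rewrite bil_antisym.
      by field.
    have -> : prim a (fun t => bil K (npsi^~ t) ((cl nphi)^~ t) + bil K ((cl nphi)^~ t) (npsi^~ t)) b = 0.
      rewrite (prim_ftc _ _ _ _ _ leab _ (ac_bil _ _ K _ _ _ _ hn hn)).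
      - have E0 s : (forall i, nphi i s = 0) -> bil K (nphi^~ s) (nphi^~ s) = 0.
          move=> H; apply: big1 => i _; apply: big1 => j _; by rewrite !H mulr0.
        by rewrite !E0// subrr.
      - by apply: bmfD; exact: bmf_bil.
      - by move=> t at_ tb; rewrite !clE'.
    rewrite addr0 (prim_eq _ _ _ (fun=> 0) leab); first 1 last.
    - exact: bmf_bil.
    - exact: bmf_cst.
    - move=> t at_ tb; rewrite (clE' nphi t at_ tb) bil_dot.
      apply: big1 => i _.
      have hJ : ac a b (fun s => \sum_j J i j * U j s) (fun=> 0).
        split.
          apply: lip_on_sum => j; apply: lip_onM; first exact: lip_on_cst.
          by case: (hU j).
        apply: ae_all => s as_ sb; apply: is_derive_near (is_derive_cstl s (lin Q i)) _.
        near=> x.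
        have ax : a < x by near: x; exact: lt_nbhsr.
        have xb : x < b by near: x; exact: lt_nbhsl.
        by rewrite -(JUc i x ax xb); apply: eq_bigr => j _; rewrite clE.
      have JUE s : a <= s -> s <= b -> \sum_j J i j * U j s = \sum_j J i j * U j a.
        move=> as_ sb; apply/eqP; rewrite -subr_eq0.
        have := ac_eq _ _ _ _ _ _ as_ (acS _ _ _ _ _ _ (lexx a) sb hJ) (ac_cst a s 0)
          (ae_all _ (fun t _ _ => erefl)).
        by rewrite subrr => ->.
      rewrite (_ : \sum_j _ = 0) ?mulr0//.
      have -> : \sum_j J i j * nphi j t = - \sum_j J i j * U j t +
          (\sum_j J i j * U j a + (t - a) / (b - a) *
             (\sum_j J i j * U j b - \sum_j J i j * U j a)).
        rewrite -sumrB mulr_sumr -sumrN -!big_split/=; apply: eq_bigr => j _.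
        by rewrite /nphi /dev /lin; field; rewrite subr_eq0 gt_eqF.
      rewrite (JUE t (ltW at_) (ltW tb)) (JUE b leab (lexx b)) subrr mulr0 addr0.
      by rewrite addrC subrr.
    have -> : prim a (fun=> 0) b = 0.
      have := primZ a b 0 (fun=> 0) leab (bmf_cst 0).
      by rewrite (_ : (fun _ => 0 * 0) = fun=> 0) ?mul0r//; apply/funext => t; rewrite mul0r.
    by rewrite mulr0.
  have M := test_min _ _ Tn.
  rewrite (cf0 _ _ Tn) k0 addr0 in M; have {}M := M erefl.
  have E1 : qf u npsi = - qf psi u.
    have -> : npsi = (fun i t => (-1) * psi i t).
      by apply/funext => i; apply/funext => t; rewrite /npsi mul0r addr0.
    by rewrite qfZ// mulN1r qfC.
  have E2 : qf npsi npsi = qf psi psi.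
    by rewrite /qf; congr (prim a _ b); apply/funext => t; apply: eq_bigr => i _; rewrite /npsi; ring.
  have E3 : qf psi u = qf psi psi.
    have -> : u = (fun i t => lin U i + psi i t) by apply/funext => i; apply/funext => t.
    by rewrite qfD//; [rewrite (qf_const _ _ _ T) add0r|move=> i; exact: bmf_cst].
  by move: M; rewrite E1 E2 E3; lra.
exists (lin U), 0 => i t at_ tb; rewrite mul0r addr0.
exact: affine_derive at_ tb (UE i).
Unshelve. all: by end_near. Qed.

End step_two_minimizers.

Section gluing.
Context {R : realType}.
Implicit Types (a b s t : R) (F : R -> R).

Lemma lip_on_cat a b t F : lip_on a t F -> lip_on t b F -> lip_on a b F.
Proof.
move=> [K HK] [L HL]; exists (Num.max K L) => s u as_ su ub.
have mx (x : R) : 0 <= x -> K * x <= Num.max K L * x /\ L * x <= Num.max K L * x.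
  by move=> x0; rewrite !ler_wpM2r// le_max lexx ?orbT.
have [st|ts] := leP s t; last first.
  have [|_ h] := mx (u - s); first lra.
  by apply: le_trans h; apply: HL => //; exact: ltW.
have [ut|tu] := leP u t.
  have [|h _] := mx (u - s); first lra.
  by apply: le_trans h; exact: HK.
have h1 := HK s t as_ st (lexx t); have h2 := HL t u (lexx t) (ltW tu) ub.
have [|g1 _] := mx (t - s); first lra.
have [|_ g2] := mx (u - t); first lra.
have := ler_normD (F u - F t) (F t - F s); rewrite addrA subrK => h3.
have -> : Num.max K L * (u - s) = Num.max K L * (u - t) + Num.max K L * (t - s) by ring.
lra.
Qed.

Lemma lip_on_local a b F : a <= b ->
  (forall t, a <= t -> t <= b -> exists2 e : R, 0 < e & exists K : R,
    forall s u, a <= s -> s <= b -> a <= u -> u <= b -> `|s - t| < e -> `|u - t| < e ->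
      `|F s - F u| <= K * `|s - u|) -> lip_on a b F.
Proof.
move=> ab H; apply: (cousin a b (fun s u => lip_on s u F)) => //.
  by move=> s t u _ _ _ _; exact: lip_on_cat.
move=> t at_ tb; have [e e0 [K HK]] := H t at_ tb; exists e => // s u as_ st tu ub es ue.
exists K => x y sx xy yu; rewrite -(ger0_norm (_ : 0 <= y - x)) ?subr_ge0//.
by apply: HK; try lra; rewrite ltr_norml; lra.
Qed.

Lemma const_of_derive0 a b F : (forall t, a < t -> t < b -> is_derive t 1 F 0) ->
  forall s t, a < s -> s < b -> a < t -> t < b -> F s = F t.
Proof.
move=> dF s t; wlog st : s t / s <= t.
  move=> H h1 h2 h3 h4; case: (leP s t) => [|/ltW] st; first exact: H.
  by apply/esym/H.
move=> as_ sb at_ tb.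
have h : ac s t F (fun=> 0).
  apply: ac_C1.
  - apply: continuous_in_subspaceT => x; rewrite inE/= in_itv/= => /andP[sx xt].
    have [h _] : is_derive x 1 F 0 by apply: dF; lra.
    exact/differentiable_continuous/derivable1_diffP.
  - by move=> x sx xt; apply: dF; lra.
  - by exists 0 => *; rewrite normr0.
have := ac_eq _ _ _ _ _ _ st h (ac_cst s t 0) (ae_all _ (fun t _ _ => erefl)).
by rewrite subrr => /eqP; rewrite subr_eq0 => /eqP.
Qed.

End gluing.

Section global_ode.
Context {R : realType} {m : nat}.
Implicit Types (s t : R).
Variables (J : 'M[R]_m) (U : 'I_m -> R -> R).
Hypothesis Janti : J^T = - J.
Let mulJ (x : 'I_m -> R) i := \sum_j J i j * x j.
Hypothesis local_ode : forall t, 0 < t -> t < 1 -> exists2 e : R, 0 < e &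
  exists (c : 'I_m -> R) (q : R), forall i s, 0 < s -> s < 1 -> `|s - t| < e ->
    is_derive s 1 (U i) (c i + q * mulJ (U^~ s) i).

Let v i t : R := derive1 (U i) t.

Let vE (i : 'I_m) t (k : R) : is_derive t 1 (U i) k -> v i t = k.
Proof. by move=> [_ <-]; rewrite /v derive1E. Qed.

Let dU i t : 0 < t -> t < 1 -> is_derive t 1 (U i) (v i t).
Proof.
move=> t0 t1; have [e e0 [c [q H]]] := local_ode _ t0 t1.
have h : is_derive t 1 (U i) (c i + q * mulJ (U^~ t) i).
  by apply: H => //; rewrite subrr normr0.
by rewrite (vE _ _ _ h).
Qed.

Let dmulJ (X X' : 'I_m -> R -> R) i t : (forall j, is_derive t 1 (X j) (X' j t)) ->
  is_derive t 1 (fun s => mulJ (X^~ s) i) (mulJ (X'^~ t) i).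
Proof.
move=> dX; apply: is_derive_suml => j.
apply: (is_derive_ext _ _ _ _ _ (is_deriveMl _ _ _ _ _ (is_derive_cstl t (J i j)) (dX j))) => //.
by rewrite mul0r add0r.
Qed.

Let local_v t : 0 < t -> t < 1 -> exists2 e : R, 0 < e & exists q : R,
  forall i s, 0 < s -> s < 1 -> `|s - t| < e -> is_derive s 1 (v i) (q * mulJ (v^~ s) i).
Proof.
move=> t0 t1; have [e e0 [c [q H]]] := local_ode _ t0 t1; exists e => //; exists q => i s s0 s1 st.
have d1 : is_derive s 1 (fun x => c i + q * mulJ (U^~ x) i) (q * mulJ (v^~ s) i).
  have := is_deriveDl _ _ _ _ _ (is_derive_cstl s (c i)) (is_deriveMl _ _ _ _ _ (is_derive_cstl s q)
    (dmulJ U v i s (fun j => dU j s s0 s1))).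
  by move=> h; apply: (is_derive_ext _ _ _ _ _ h) => //; rewrite mul0r !add0r.
apply: is_derive_near d1 _; near=> x.
have x0 : 0 < x by near: x; exact: lt_nbhsr.
have x1 : x < 1 by near: x; exact: lt_nbhsl.
apply/esym/vE/H => //; near: x.
have es : 0 < e - `|s - t| by rewrite subr_gt0.
have /nbhs_ballP : nbhs s (ball s (e - `|s - t|)) by exact: nbhsx_ballx.
move=> [r /= r0 Hr]; apply/nbhs_ballP; exists r => // x /Hr; rewrite /ball/= => h.
have h2 := ler_normD (x - s) (s - t); rewrite addrA subrK (distrC x s) in h2.
lra.
Unshelve. all: by end_near. Qed.

Let dotJ x : dot x (mulJ x) = 0.
Proof.
have : dot x (mulJ x) = bil J x x by rewrite bil_dot.
have : bil J x x = - bil J x x.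
  rewrite {1}/bil exchange_big/= /bil -sumrN; apply: eq_bigr => i _.
  rewrite -sumrN; apply: eq_bigr => j _.
  have -> : J j i = - J i j by have := congr1 (fun X : 'M[R]_m => X i j) Janti; rewrite !mxE.
  ring.
lra.
Qed.

(** The multiplier of one short interval is tied to that of the next by the velocity. With
    [w = J v], the equation [w' = q * J w] and the antisymmetry of [J] keep [|w|^2] constant. If it
    is nonzero, [q] is read off from [v'], hence locally constant and so constant. *)
Lemma global_ode : exists (c : 'I_m -> R) (q : R), forall i t, 0 < t -> t < 1 ->
  is_derive t 1 (U i) (c i + q * mulJ (U^~ t) i).
Proof.
pose w i t := mulJ (v^~ t) i.
have dw t : 0 < t -> t < 1 -> exists q : R, forall i, is_derive t 1 (v i) (q * w i t) /\
    is_derive t 1 (w i) (q * mulJ (w^~ t) i).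
  move=> t0 t1; have [e e0 [q H]] := local_v _ t0 t1.
  have dv i : is_derive t 1 (v i) (q * w i t) by apply: H => //; rewrite subrr normr0.
  exists q => i; split => //.
  have := dmulJ v (fun j t => q * w j t) i t dv; rewrite -/(w i) => h.
  apply: (is_derive_ext _ _ _ _ _ h) => //.
  by rewrite /mulJ mulr_sumr; apply: eq_bigr => j _; rewrite mulrCA.
pose n t := dot (w^~ t) (w^~ t).
have dn t : 0 < t -> t < 1 -> is_derive t 1 n 0.
  move=> t0 t1; have [q H] := dw t t0 t1.
  have := is_derive_suml t m (fun i s => w i s * w i s) _ (fun i => is_deriveMl _ _ _ _ _ (H i).2 (H i).2).
  move=> h; apply: (is_derive_ext _ _ _ _ _ h) => //.
  transitivity (2 * q * dot (w^~ t) (mulJ (w^~ t))); last by rewrite dotJ mulr0.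
  by rewrite /dot mulr_sumr; apply: eq_bigr => i _; ring.
have h0 : 0 < 2^-1 :> R by rewrite invr_gt0.
have h1 : 2^-1 < 1 :> R by rewrite invf_lt1// ltr1n.
have nc t : 0 < t -> t < 1 -> n t = n 2^-1 by move=> t0 t1; exact: (const_of_derive0 0 1 n dn).
suff [q Hq] : exists q : R, forall i t, 0 < t -> t < 1 -> is_derive t 1 (v i) (q * w i t).
  have Hc i t : 0 < t -> t < 1 -> is_derive t 1 (fun s => v i s - q * mulJ (U^~ s) i) 0.
    move=> t0 t1.
    have := is_deriveBl _ _ _ _ _ (Hq i t t0 t1) (is_deriveMl _ _ _ _ _ (is_derive_cstl t q)
      (dmulJ U v i t (fun j => dU j t t0 t1))).
    by move=> h; apply: (is_derive_ext _ _ _ _ _ h) => //; rewrite mul0r add0r -/(w i t) subrr.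
  exists (fun i => v i 2^-1 - q * mulJ (U^~ 2^-1) i), q => i t t0 t1.
  rewrite (const_of_derive0 0 1 _ (Hc i) 2^-1 t)// subrK; exact: dU.
(* When [J v] vanishes identically the velocity is constant and every multiplier fits; 0 is
   taken. *)
have [n0|n0] := eqVneq (n 2^-1) 0.
  exists 0 => i t t0 t1; rewrite mul0r; have [q /(_ i)[h _]] := dw t t0 t1.
  have w0 : w i t = 0.
    have := nc t t0 t1; rewrite n0 /n /dot => /eqP; rewrite psumr_eq0; last first.
      by move=> j _; rewrite -expr2 sqr_ge0.
    by move=> /allP/(_ i); rewrite mem_index_enum => /(_ isT)/=; rewrite mulf_eq0 orbb => /eqP.
  by rewrite w0 mulr0 in h.
(* The coefficient of the projection of [v'] on [w]: it recovers [q] without reference to a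
   subinterval. *)
pose mm t := dot (fun i => derive1 (v i) t) (w^~ t) / n 2^-1.
have mmE t (q : R) : 0 < t -> t < 1 -> (forall i, is_derive t 1 (v i) (q * w i t)) -> mm t = q.
  move=> t0 t1 H; rewrite /mm.
  have -> : (fun i => derive1 (v i) t) = (fun i => q * w i t).
    by apply/funext => i; have [_ <-] := H i; rewrite derive1E.
  by rewrite dotZl -/(n t) nc// mulfK.
have dmm t : 0 < t -> t < 1 -> is_derive t 1 mm 0.
  move=> t0 t1; have [e e0 [q H]] := local_v _ t0 t1.
  apply: is_derive_near (is_derive_cstl t q) _; near=> s.
  have s0 : 0 < s by near: s; exact: lt_nbhsr.
  have s1 : s < 1 by near: s; exact: lt_nbhsl.
  apply/esym/mmE => // i; apply: H => //; rewrite distrC; near: s.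
exists (mm 2^-1) => i t t0 t1; have [q H] := dw t t0 t1.
rewrite (const_of_derive0 0 1 _ dmm 2^-1 t)//.
by rewrite (mmE t q t0 t1 (fun i => (H i).1)); exact: (H i).1.
Unshelve. all: by end_near. Qed.

End global_ode.

Section curve_components.
Context {R : realType} {d : nat}.
Implicit Types (gamma : R -> 'rV[R]_d) (s t : R) (w : 'rV[R]_d).

Lemma derivable_rv_comp gamma t j : derivable gamma t 1 ->
  is_derive t 1 (fun s => gamma s 0 j) (derive1 gamma t 0 j).
Proof.
move=> h; split; first by move/derivable_mxP: h; apply.
by rewrite derive1E derive_mx// mxE.
Qed.

Lemma derivable_rvP gamma t w :
  (forall j, is_derive t 1 (fun s => gamma s 0 j) (w 0 j)) ->
  derivable gamma t 1 /\ derive1 gamma t = w.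
Proof.
move=> h; have dg : derivable gamma t 1.
  by apply/derivable_mxP => i j; rewrite ord1; case: (h j).
split=> //; apply/rowP => j.
by have [_ <-] := derivable_rv_comp gamma t j dg; have [_ <-] := h j.
Qed.

Lemma lip_on_rv (a b : R) gamma : (forall j, lip_on a b (fun t => gamma t 0 j)) ->
  exists2 K : R, 0 <= K & forall s t, a <= s -> s <= b -> a <= t -> t <= b ->
    `|gamma s - gamma t| <= K * `|s - t|.
Proof.
move=> /choice[K HK].
have S0 : 0 <= \sum_j `|K j| by apply: sumr_ge0.
exists (\sum_j `|K j|) => // s t.
wlog st : s t / s <= t.
  move=> H h1 h2 h3 h4; case: (leP s t) => [|/ltW] st; first exact: H.
  by rewrite distrC (distrC s); exact: H.
move=> as_ sb at_ tb; apply: rv_norm_le => [|j]; first by rewrite mulr_ge0.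
rewrite !mxE distrC (distrC s) (ger0_norm (_ : 0 <= t - s)) ?subr_ge0//.
apply: (le_trans (HK j s t as_ st tb)); rewrite ler_wpM2r ?subr_ge0//.
by apply: (le_trans (ler_norm _)); rewrite (bigD1 j)//= lerDl sumr_ge0.
Qed.

End curve_components.

(** * Curves of a step two frame and their controls *)

Section step_two_structure.
Context {R : realType} {m : nat}.
Variables (A B : 'M[R]_m) (fh : 'I_m -> 'rV[R]_(m + 1) -> 'rV[R]_(m + 1)).
Hypothesis uA : A \in unitmx.
Hypothesis HF : forall x, frame_mx fh x = row_mx A (B *m (lsubmx x)^T).
Implicit Types (gamma eta : R -> 'rV[R]_(m + 1)) (s t a b : R).

Let S := frame_structure fh.
Let K := B *m A^T.
Let c0 : chart R 'rV[R]_(m + 1) (m + 1) := Chart setT id id.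

(** Horizontal coordinates divided by [A]: in these the horizontal equation reads U' = u, and the
    vertical one is Z' = [bil K u U] with [K = B *m A^T]. *)
Definition controls_int gamma (i : 'I_m) t : R := (lsubmx (gamma t) *m invmx A) 0 i.
Definition vertical gamma t : R := gamma t 0 (rshift m 0).
Local Notation Uc := controls_int.
Local Notation Zc := vertical.

Let frame_coords (x u : _) : u *m frame_mx fh x *m pinvmx (frame_mx fh x) = u :> 'rV[R]_m.
Proof.
apply: mulmxKp; rewrite HF; apply/row_freeP; exists (col_mx (invmx A) 0).
by rewrite mul_row_col mulmx0 addr0 mulmxV.
Qed.

Let speedE gamma t (x : 'rV[R]_m) : derive1 gamma t = x *m frame_mx fh (gamma t) ->
  speed_sq S gamma t = \sum_i x 0 i * x 0 i.
Proof.
move=> Hv; rewrite /speed_sq.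
set P := [set r | _].
have HP : P (\sum_i x 0 i * x 0 i).
  exists c0; split=> //=; rewrite /velocity/=.
  have -> : derive1 (id \o gamma) t = derive1 gamma t by [].
  by rewrite Hv frame_coords.
have [c [-> _ ->]] : P (get P) by apply: getPex; exists (\sum_i x 0 i * x 0 i).
rewrite /velocity/=; have -> : derive1 (id \o gamma) t = derive1 gamma t by [].
by rewrite Hv frame_coords.
Qed.

Let comp_lip a b gamma : a <= b -> lipschitz_curve S a b gamma ->
  forall j, lip_on a b (fun t => gamma t 0 j).
Proof.
move=> ab H j; apply: lip_on_local => // t at_ tb.
have [|c [e [k [-> e0 He]]]] := H t; first by rewrite in_itv/= at_ tb.
exists e => //; exists k => s u as_ sb au ub st ut.
have [||_ _ +] := He s u _ _ st ut; rewrite ?in_itv/= ?as_ ?sb ?au ?ub// => /(le_trans _); apply.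
by apply: le_trans (rv_norm_ge _ j); rewrite !mxE.
Qed.

Let UcE gamma i t : Uc gamma i t = \sum_j gamma t 0 (lshift 1 j) * invmx A j i.
Proof. by rewrite /Uc mxE; apply: eq_bigr => j _; rewrite mxE. Qed.

Let lip_Uc a b gamma i : (forall j, lip_on a b (fun t => gamma t 0 j)) -> lip_on a b (Uc gamma i).
Proof.
move=> H; rewrite (_ : Uc gamma i = fun t => \sum_j gamma t 0 (lshift 1 j) * invmx A j i).
  by apply: lip_on_sum => j; apply: lip_onM => //; exact: lip_on_cst.
by apply/funext => t; exact: UcE.
Qed.

Let bilK (x : 'rV[R]_m) gamma t : (x *m frame_mx fh (gamma t)) 0 (rshift m 0) =
  bil K (x 0) (fun i => Uc gamma i t).
Proof.
rewrite HF mul_mx_row row_mxEr.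
have -> : lsubmx (gamma t) = (\row_i Uc gamma i t) *m A.
  have -> : \row_i Uc gamma i t = lsubmx (gamma t) *m invmx A by apply/rowP => i; rewrite mxE.
  by rewrite mulmxKV.
rewrite trmx_mul (mulmxA B) -/K mulmxA mxE /bil exchange_big/=.
apply: eq_bigr => j _; rewrite !mxE mulr_suml; apply: eq_bigr => i _; by [].
Qed.

Let tangent_derivs gamma t : tangent_at S gamma t ->
  exists x : 'rV[R]_m, [/\ forall i, is_derive t 1 (Uc gamma i) (x 0 i),
    is_derive t 1 (Zc gamma) (bil K (x 0) (fun i => Uc gamma i t)) &
    speed_sq S gamma t = \sum_i x 0 i * x 0 i].
Proof.
move=> [c [-> _ /= dg /submxP[x Hx]]].
have {}dg : derivable gamma t 1 by exact: dg.
have {}Hx : derive1 gamma t = x *m frame_mx fh (gamma t) by exact: Hx.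
exists x; split; last exact: speedE.
- move=> i; rewrite (_ : Uc gamma i = fun t => \sum_j gamma t 0 (lshift 1 j) * invmx A j i); last first.
    by apply/funext => s; exact: UcE.
  have dj j := is_deriveMl _ _ _ _ _ (derivable_rv_comp gamma t (lshift 1 j) dg) (is_derive_cstl t (invmx A j i)).
  have := is_derive_suml t m _ _ dj => h.
  apply: (is_derive_ext _ _ _ _ _ h) => //.
  have -> : x 0 i = (x *m A *m invmx A) 0 i by rewrite mulmxK.
  rewrite mxE; apply: eq_bigr => j _; rewrite mulr0 addr0; congr (_ * _).
  by rewrite Hx HF mul_mx_row row_mxEl.
- by rewrite -bilK -Hx; exact: derivable_rv_comp.
Qed.

(** The controls come from [lip_derivative_rep], so they are bounded measurable at every time and
    can be varied, although the curve has a velocity only a.e. *)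
Lemma horizontal_controls a b gamma : a < b -> horizontal S a b gamma ->
  exists u : 'I_m -> R -> R, [/\ forall i, bmf (u i),
    forall i, ac a b (Uc gamma i) (u i),
    ac a b (Zc gamma) (fun t => bil K (u^~ t) ((Uc gamma)^~ t)) &
    energy S a b gamma = (2^-1 * prim a (fun t => dot (u^~ t) (u^~ t)) b)%:E].
Proof.
move=> ab [lg tg]; have lj := comp_lip a b gamma (ltW ab) lg.
have lU i := lip_Uc a b gamma i lj.
have /choice[u Hu] : forall i, exists g : R -> R, bmf g /\ forall t l, a < t -> t < b ->
    is_derive t 1 (Uc gamma i) l -> g t = l.
  by move=> i; have [g] := lip_derivative_rep a b _ ab (lU i); exists g.
have {}tg : {ae lebesgue_measure, forall t, a < t -> t < b -> tangent_at S gamma t}.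
  by apply: ae_impl tg => t h at_ tb; apply: h; rewrite in_itv/= !ltW.
have key t : a < t -> t < b -> tangent_at S gamma t -> [/\
    forall i, is_derive t 1 (Uc gamma i) (u i t),
    is_derive t 1 (Zc gamma) (bil K (u^~ t) ((Uc gamma)^~ t)) &
    speed_sq S gamma t = dot (u^~ t) (u^~ t)].
  move=> at_ tb /tangent_derivs[x [h1 h2 h3]].
  have E i : u i t = x 0 i by have [_] := Hu i; apply.
  have Ef : u^~ t = x 0 by apply/funext.
  by rewrite Ef; split => // i; rewrite E.
exists u; split.
- by move=> i; case: (Hu i).
- by move=> i; split => //; apply: ae_impl tg => t h at_ tb; have [] := key t at_ tb (h at_ tb).
- split; first exact: lj.
  by apply: ae_impl tg => t h at_ tb; have [] := key t at_ tb (h at_ tb).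
rewrite /energy (integral_eq_ae a b _ (fun t => dot (u^~ t) (u^~ t))) ?ltW//.
- by apply: bmf_dot => i; case: (Hu i).
- by move=> t; exact: dot_ge0.
- by apply: ae_impl tg => t h at_ tb; have [] := key t at_ tb (h at_ tb).
Qed.

Lemma controls_horizontal a b (U u : 'I_m -> R -> R) (Z : R -> R) : a < b ->
  (forall i, bmf (u i)) -> (forall i, ac a b (U i) (u i)) ->
  ac a b Z (fun t => bil K (u^~ t) (U^~ t)) ->
  let eta t : 'rV[R]_(m + 1) := row_mx ((\row_i U i t) *m A) (const_mx (Z t)) in
  horizontal S a b eta /\
  energy S a b eta = (2^-1 * prim a (fun t => dot (u^~ t) (u^~ t)) b)%:E.
Proof.
move=> ab bu hU [lZ dZ] eta.
have etal t j : eta t 0 (lshift 1 j) = \sum_i U i t * A i j.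
  by rewrite row_mxEl mxE; apply: eq_bigr => i _; rewrite mxE.
have etar t j : eta t 0 (rshift m j) = Z t by rewrite row_mxEr mxE.
have UcU : Uc eta = U.
  apply/funext => i; apply/funext => t; rewrite /Uc /eta row_mxKl mulmxK// mxE //.
have key t : (forall i, is_derive t 1 (U i) (u i t)) ->
    is_derive t 1 Z (bil K (u^~ t) (U^~ t)) ->
    derivable eta t 1 /\ derive1 eta t = (\row_i u i t) *m frame_mx fh (eta t).
  move=> h1 h2; apply: derivable_rvP => j; case: (split_ordP j) => k ->; last first.
    rewrite (ord1 k) bilK UcU.
    rewrite (_ : (fun s => _) = Z); last by apply/funext => s; rewrite etar.
    by rewrite (_ : (\row_i u i t) 0 = u^~ t)//; apply/funext => i; rewrite mxE.
  have dj i := is_deriveMl _ _ _ _ _ (h1 i) (is_derive_cstl t (A i k)).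
  have := is_derive_suml t m _ _ dj => h.
  apply: (is_derive_ext _ _ _ _ _ h); first by move=> s; rewrite etal.
  rewrite HF mul_mx_row row_mxEl mxE; apply: eq_bigr => i _.
  by rewrite mulr0 addr0 mxE.
have le j : lip_on a b (fun t => eta t 0 j).
  case: (split_ordP j) => k ->.
    rewrite (_ : (fun t => _) = fun t => \sum_i U i t * A i k); last by apply/funext => s; rewrite etal.
    by apply: lip_on_sum => i; apply: lip_onM; [case: (hU i)|exact: lip_on_cst].
  by rewrite (_ : (fun t => _) = Z)//; apply/funext => s; rewrite etar.
have aed : {ae lebesgue_measure, forall t, a < t -> t < b ->
    derivable eta t 1 /\ derive1 eta t = (\row_i u i t) *m frame_mx fh (eta t)}.
  apply: ae_impl (ae_and _ _ dZ (ae_forall_ord _ _ (fun i => (hU i).2))) => t [h1 h2] at_ tb.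
  by apply: key; [move=> i; exact: h2|exact: h1].
split.
  split.
    have [k k0 Hk] := lip_on_rv a b eta le.
    move=> t _; exists c0, 1, k; split=> // s s'; rewrite !in_itv/= => /andP[h1 h2] /andP[h3 h4] _ _.
    by split=> //; exact: Hk.
  apply: ae_impl (ae_itv _ _ _ aed) => t h; rewrite in_itv/= => /andP[at_ tb].
  have [h1 h2] := h at_ tb; exists c0; split=> //=.
  have -> : velocity c0 eta t = derive1 eta t by [].
  by rewrite h2 submxMl.
rewrite /energy (integral_eq_ae a b _ (fun t => dot (u^~ t) (u^~ t))) ?ltW//.
- exact: bmf_dot.
- by move=> t; exact: dot_ge0.
- apply: ae_impl aed => t h at_ tb; have [_ h2] := h at_ tb.
  by rewrite (speedE _ _ _ h2); apply: eq_bigr => i _; rewrite !mxE.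
Qed.

Lemma local_minimizer_ode a b gamma : a < b -> horizontal S a b gamma ->
  energy_minimizer S a b gamma ->
  exists (c : 'I_m -> R) (q : R), forall t, a < t -> t < b ->
    (forall i, is_derive t 1 (Uc gamma i) (c i + q * \sum_j (K - K^T) i j * Uc gamma j t)) /\
    is_derive t 1 (Zc gamma)
      (bil K (fun i => c i + q * \sum_j (K - K^T) i j * Uc gamma j t) ((Uc gamma)^~ t)).
Proof.
move=> ab hg mg; have [u [bu hU hZ Eg]] := horizontal_controls a b gamma ab hg.
have gammaE t : gamma t = row_mx ((\row_i Uc gamma i t) *m A) (const_mx (Zc gamma t)).
  rewrite -[LHS]hsubmxK; congr row_mx.
    have -> : \row_i Uc gamma i t = lsubmx (gamma t) *m invmx A by apply/rowP => i; rewrite mxE.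
    by rewrite mulmxKV.
  by apply/rowP => j; rewrite !mxE (ord1 j).
have [|c [q H]] := @minimizer_ode R m K a b (Uc gamma) u (Zc gamma) ab bu hU hZ.
  move=> U' u' Z' bu' hU' hZ' Ua Ub Za Zb.
  have [h1 h2] := controls_horizontal a b U' u' Z' ab bu' hU' hZ'.
  have := mg _ h1; rewrite h2 Eg lee_fin ler_pM2l ?invr_gt0//; apply.
    rewrite gammaE Za; congr (row_mx (_ *m A) _); by apply/rowP => i; rewrite !mxE Ua.
  rewrite gammaE Zb; congr (row_mx (_ *m A) _); by apply/rowP => i; rewrite !mxE Ub.
exists c, q => t at_ tb; split=> [i|]; first exact: H.
(* The vertical coordinate is so far differentiable a.e. only. Its derivative agrees a.e. with the
   continuous [g], so it is a primitive of [g] and differentiable throughout the open interval. *)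
pose v i t := c i + q * \sum_j (K - K^T) i j * Uc gamma j (clamp a b t).
have cU i : continuous (fun t => Uc gamma i (clamp a b t)).
  by apply: (lip_on_clamp_continuous a b (Uc gamma i)); [exact: ltW|case: (hU i)].
have cv i : continuous (v i).
  move=> s; apply: cvgD; first exact: cvg_cst.
  apply: cvgM; first exact: cvg_cst.
  apply: continuous_at_sum => j; apply: cvgM; [exact: cvg_cst|exact: cU].
pose g s := bil K (v^~ s) (fun i => Uc gamma i (clamp a b s)).
have cg : continuous g.
  move=> s; apply: continuous_at_sum => i; apply: continuous_at_sum => j.
  apply: cvgM; last exact: cU.
  by apply: cvgM; [exact: cv|exact: cvg_cst].
have bg : bmf g.
  have -> : g = (fun s => bil K (fun i => c i + q * \sum_j (K - K^T) i j * Uc gamma j s)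
      ((Uc gamma)^~ s)) \o clamp a b by [].
  by apply: bmf_clamp; [exact: ltW|exact: cg].
have dg : is_derive t 1 (prim a g) (g t) by apply: (@prim_derive _ a b) => //; exact: cg.
have ZE s : a <= s -> s <= b -> Zc gamma s = Zc gamma a + prim a g s.
  move=> as_ sb.
  have := ac_eq _ _ _ _ _ _ as_ (acS _ _ a s _ _ (lexx a) sb hZ) (prim_ac a s _ bg).
  rewrite prim_start subr0 => W; rewrite -W; first by rewrite addrC subrK.
  have := ae_forall_ord _ _ (fun i => (hU i).2); apply: ae_impl => x h ax xs.
  have xb : x < b by exact: lt_le_trans sb.
  rewrite /g /v clamp_id ?ltW//; congr (bil K _ _); apply/funext => i.
  by have [_ <-] := h i ax xb; have [_ <-] := H i x ax xb.
have dZ := is_deriveDl _ _ _ _ _ (is_derive_cstl t (Zc gamma a)) dg.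
apply: (is_derive_ext (Zc gamma) _ _ (0 + g t)) => //; last first.
  by rewrite add0r /g /v clamp_id ?ltW.
apply: is_derive_near dZ _; near=> s; apply/esym/ZE; apply: ltW; near: s.
  exact: lt_nbhsr.
exact: lt_nbhsl.
Unshelve. all: by end_near. Qed.

Lemma geodesic_ode gamma : geodesic S gamma ->
  (forall j, lip_on 0 1 (fun t => gamma t 0 j)) /\
  exists (c : 'I_m -> R) (q : R), forall t, 0 < t -> t < 1 ->
    (forall i, is_derive t 1 (Uc gamma i) (c i + q * \sum_j (K - K^T) i j * Uc gamma j t)) /\
    is_derive t 1 (Zc gamma)
      (bil K (fun i => c i + q * \sum_j (K - K^T) i j * Uc gamma j t) ((Uc gamma)^~ t)).
Proof.
move=> [hg _ lm].
have lj := comp_lip 0 1 gamma ler01 hg.1; split => //.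
have loc t : 0 < t -> t < 1 -> exists2 e : R, 0 < e & exists (c : 'I_m -> R) (q : R),
    forall s, 0 < s -> s < 1 -> `|s - t| < e ->
    (forall i, is_derive s 1 (Uc gamma i) (c i + q * \sum_j (K - K^T) i j * Uc gamma j s)) /\
    is_derive s 1 (Zc gamma)
      (bil K (fun i => c i + q * \sum_j (K - K^T) i j * Uc gamma j s) ((Uc gamma)^~ s)).
  move=> t0 t1; have [|e e0 He] := lm t; first by rewrite in_itv/= (ltW t0) (ltW t1).
  pose r := Num.min (e / 2) (Num.min t (1 - t)).
  have r0 : 0 < r by rewrite !lt_min t0 divr_gt0//= subr_gt0.
  have re : r <= e / 2 by rewrite ge_min lexx.
  have rt : r <= t by rewrite !ge_min lexx orbT.
  have r1 : r <= 1 - t by rewrite !ge_min lexx !orbT.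
  have i1 : t - r \in `[0, 1] by rewrite in_itv/=; apply/andP; split; lra.
  have i2 : t + r \in `[0, 1] by rewrite in_itv/=; apply/andP; split; lra.
  have lt : t - r < t + r by lra.
  have hr : horizontal S (t - r) (t + r) gamma.
    have [lg tg] := hg; split.
      move=> s; rewrite in_itv/= => /andP[h1 h2].
      have [|c [e' [k [Ac e'0 H]]]] := lg s; first by rewrite in_itv/=; apply/andP; split; lra.
      exists c, e', k; split=> // x x'; rewrite !in_itv/= => /andP[? ?] /andP[? ?].
      by apply: H; rewrite in_itv/=; apply/andP; split; lra.
    apply: ae_impl tg => s h; rewrite in_itv/= => /andP[h1 h2]; apply: h.
    by rewrite in_itv/=; apply/andP; split; lra.
  have mr : energy_minimizer S (t - r) (t + r) gamma.
    by apply: He => //; rewrite ltr_norml; apply/andP; split; lra.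
  have [c [q H]] := local_minimizer_ode _ _ gamma lt hr mr.
  exists r => //; exists c, q => s s0 s1; rewrite ltr_norml => /andP[h1 h2].
  by apply: H; lra.
have Janti : (K - K^T)^T = - (K - K^T) by rewrite linearB/= trmxK opprB.
have [|c [q H]] := @global_ode R m (K - K^T) (Uc gamma) Janti.
  move=> t t0 t1; have [e e0 [c [q H]]] := loc t t0 t1; exists e => //; exists c, q => i s s0 s1 st.
  by have [h _] := H s s0 s1 st; exact: h.
exists c, q => t t0 t1; split=> [i|]; first exact: H.
have [e e0 [c' [q' H']]] := loc t t0 t1.
have [|h1 h2] := H' t t0 t1; first by rewrite subrr normr0.
suff -> : (fun i => c i + q * \sum_j (K - K^T) i j * Uc gamma j t) =
   (fun i => c' i + q' * \sum_j (K - K^T) i j * Uc gamma j t) by [].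
by apply/funext => i; have [_ <-] := h1 i; have [_ <-] := H i t t0 t1.
Qed.

End step_two_structure.

(** * Persistence of nondegenerate solutions *)

(* [c1conv rho g g0 G]: on the cube of radius [rho], [g eps] tends to [g0] in C^1 as
   [eps] tends to [0+], and [G] is the (Lipschitz) gradient of [g0]; in this form the
   property is visibly stable under sums and products. *)
Section c1_convergence.
Context {R : realType} {N : nat}.
Local Notation E := 'rV[R]_N.
Implicit Types (a b c w : E) (phi psi : R -> E -> R) (g h : E -> R) (G : E -> 'I_N -> R).

Definition app G c w : R := \sum_k G c k * w 0 k.

(** The increment of [g1] from [b] to [a] is compared with the gradient of the limit at a third
    point [c]. This is the form in which two solutions of the perturbed system are compared along a
    solution of the limit, and it asks for no derivative of [g1]. *)
Record c1est (rho C kappa : R) (g1 : E -> R) g0 G : Prop := {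
  c1_val : forall a, `|a| <= rho -> `|g1 a - g0 a| <= kappa;
  c1_der : forall a b c, `|a| <= rho -> `|b| <= rho -> `|c| <= rho ->
    `|g1 a - g1 b - app G c (a - b)| <= (kappa + C * (`|a - c| + `|b - c|)) * `|a - b| }.

Record c1bound (rho C : R) g0 G : Prop := {
  c1_ge0 : 0 <= C;
  c1_bnd : forall a, `|a| <= rho -> `|g0 a| <= C;
  c1_grad : forall c k, `|c| <= rho -> `|G c k| <= C;
  c1_glip : forall c c' k, `|c| <= rho -> `|c'| <= rho -> `|G c k - G c' k| <= C * `|c - c'| }.

Definition c1conv (rho : R) phi g0 G := exists C : R, c1bound rho C g0 G /\
  forall kappa : R, 0 < kappa -> exists2 e1 : R, 0 < e1 &
    forall eps : R, 0 < eps -> eps < e1 -> c1est rho C kappa (phi eps) g0 G.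

Lemma app_bound rho C g0 G c w : c1bound rho C g0 G -> `|c| <= rho ->
  `|app G c w| <= N%:R * C * `|w|.
Proof.
move=> H cr; apply: (le_trans (ler_norm_sum _ _ _)).
apply: (@le_trans _ _ (\sum_(k < N) (C * `|w|))); last first.
  by rewrite sumr_const card_ord -mulrA mulr_natl.
apply: ler_sum => k _; rewrite normrM; apply: ler_pM => //; last exact: rv_norm_ge.
exact: c1_grad H _ _ cr.
Qed.

Lemma c1bound_le rho C C' g0 G : C <= C' -> c1bound rho C g0 G -> c1bound rho C' g0 G.
Proof.
move=> CC [h0 h1 h2 h3]; split.
- exact: le_trans CC.
- by move=> a /h1 psi; exact: le_trans CC.
- by move=> c k /(h2 _ k) psi; exact: le_trans CC.
- by move=> c c' k hc hc'; apply: (le_trans (h3 _ _ k hc hc')); rewrite ler_wpM2r.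
Qed.

Lemma c1est_le rho C C' k k' g1 g0 G : C <= C' -> k <= k' ->
  c1est rho C k g1 g0 G -> c1est rho C' k' g1 g0 G.
Proof.
move=> CC kk [h1 h2]; split.
- by move=> a /h1 psi; exact: le_trans kk.
- move=> a b c ha hb hc; apply: (le_trans (h2 a b c ha hb hc)).
  by rewrite ler_wpM2r// lerD// ler_wpM2r// addr_ge0.
Qed.

Lemma c1conv_const rho (k : R) : c1conv rho (fun _ _ => k) (fun=> k) (fun _ _ => 0).
Proof.
exists `|k|; split.
  split=> //.
  - by move=> *; rewrite normr0.
  - by move=> c c' _ _ _; rewrite subrr normr0 mulr_ge0.
move=> kap k0; exists 1 => // eps _ _; split; first by move=> *; rewrite subrr normr0 ltW.
move=> a b c _ _ _; rewrite /app big1 ?subrr ?subr0 ?normr0; last by move=> *; rewrite mul0r.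
by rewrite mulr_ge0// addr_ge0 ?(ltW k0)// mulr_ge0// addr_ge0.
Qed.

Lemma c1conv_coord rho (i : 'I_N) : 0 <= rho ->
  c1conv rho (fun _ a => a 0 i) (fun a => a 0 i) (fun _ k => (k == i)%:R).
Proof.
move=> r0; exists (rho + 1); split.
  split.
  - by rewrite addr_ge0.
  - move=> a ar; apply: (le_trans (rv_norm_ge a i)); apply: (le_trans ar); by rewrite lerDl.
  - by move=> c k _; case: (k == i); rewrite ?normr1 ?normr0 ?lerDr// addr_ge0.
  - by move=> c c' k _ _; rewrite subrr normr0 mulr_ge0// addr_ge0.
move=> kap k0; exists 1 => // eps _ _; split; first by move=> *; rewrite subrr normr0 ltW.
move=> a b c _ _ _; rewrite /app (bigD1 i)//= eqxx mul1r big1 ?addr0; last first.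
  by move=> k /negPf ->; rewrite mul0r.
rewrite !mxE subrr normr0 mulr_ge0// addr_ge0 ?(ltW k0)//.
by rewrite mulr_ge0 ?addr_ge0.
Qed.

Lemma appD G G' c w : app (fun c k => G c k + G' c k) c w = app G c w + app G' c w.
Proof. by rewrite /app -big_split/=; apply: eq_bigr => k _; rewrite mulrDl. Qed.

Lemma appZ G (s : E -> R) c w : app (fun c k => s c * G c k) c w = s c * app G c w.
Proof. by rewrite /app mulr_sumr; apply: eq_bigr => k _; rewrite mulrA. Qed.

Lemma c1convD rho phi psi g0 h0 G G' : c1conv rho phi g0 G -> c1conv rho psi h0 G' ->
  c1conv rho (fun e a => phi e a + psi e a) (fun a => g0 a + h0 a) (fun c k => G c k + G' c k).
Proof.
move=> [C [bC eC]] [D [bD eD]]; exists (C + D); split.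
  have C0 := c1_ge0 _ _ _ _ bC; have D0 := c1_ge0 _ _ _ _ bD.
  split.
  - exact: addr_ge0.
  - move=> a ar; apply: (le_trans (ler_normD _ _)).
    by apply: lerD; [exact: c1_bnd bC _ ar|exact: c1_bnd bD _ ar].
  - move=> c k cr; apply: (le_trans (ler_normD _ _)).
    by apply: lerD; [exact: c1_grad bC _ _ cr|exact: c1_grad bD _ _ cr].
  - move=> c c' k hc hc'; rewrite opprD addrACA mulrDl; apply: (le_trans (ler_normD _ _)).
    by apply: lerD; [exact: c1_glip bC _ _ _ hc hc'|exact: c1_glip bD _ _ _ hc hc'].
move=> kap k0; have k2 : 0 < kap / 2 by rewrite divr_gt0.
have [e1 e10 H1] := eC _ k2; have [e2 e20 H2] := eD _ k2.
exists (Num.min e1 e2); first by rewrite lt_min e10.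
move=> eps ep; rewrite lt_min => /andP[ep1 ep2].
have [v1 d1] := H1 _ ep ep1; have [v2 d2] := H2 _ ep ep2; split.
- move=> a ar; rewrite opprD addrACA; apply: (le_trans (ler_normD _ _)).
  by rewrite (splitr kap); apply: lerD; [exact: v1|exact: v2].
- move=> a b c ha hb hc; rewrite appD.
  have -> : phi eps a + psi eps a - (phi eps b + psi eps b) - (app G c (a - b) + app G' c (a - b)) =
    (phi eps a - phi eps b - app G c (a - b)) + (psi eps a - psi eps b - app G' c (a - b)) by ring.
  apply: (le_trans (ler_normD _ _)); apply: (le_trans (lerD (d1 a b c ha hb hc) (d2 a b c ha hb hc))).
  by rewrite -mulrDl ler_wpM2r//; lra.
Qed.

Lemma c1conv_sum rho n (phi : 'I_n -> R -> E -> R) (g0 : 'I_n -> E -> R) (G : 'I_n -> E -> 'I_N -> R) :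
  (forall i, c1conv rho (phi i) (g0 i) (G i)) ->
  c1conv rho (fun e a => \sum_i phi i e a) (fun a => \sum_i g0 i a) (fun c k => \sum_i G i c k).
Proof.
elim: n phi g0 G => [|n IH] phi g0 G H.
  have := c1conv_const rho 0.
  rewrite (_ : (fun _ _ => 0) = (fun e a => \sum_(i < 0) phi i e a)); last first.
    by apply/funext => e; apply/funext => a; rewrite big_ord0.
  rewrite (_ : (fun=> 0) = (fun a => \sum_(i < 0) g0 i a)); last first.
    by apply/funext => a; rewrite big_ord0.
  rewrite (_ : (fun _ _ => 0) = (fun c k => \sum_(i < 0) G i c k))//.
  by apply/funext => e; apply/funext => a; rewrite big_ord0.
have := c1convD _ _ _ _ _ _ _ (IH _ _ _ (fun i => H (widen_ord (leqnSn n) i))) (H ord_max).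
rewrite (_ : (fun e a => _) = (fun e a => \sum_(i < n.+1) phi i e a)); last first.
  by apply/funext => e; apply/funext => a; rewrite big_ord_recr.
rewrite (_ : (fun a => _) = (fun a => \sum_(i < n.+1) g0 i a)); last first.
  by apply/funext => a; rewrite big_ord_recr.
rewrite (_ : (fun c k => _ + _) = (fun c k => \sum_(i < n.+1) G i c k))//.
by apply/funext => e; apply/funext => a; rewrite big_ord_recr.
Qed.

Lemma c1_lip0 rho C kappa g1 g0 G a b : c1bound rho C g0 G -> c1est rho C kappa g1 g0 G ->
  `|a| <= rho -> `|b| <= rho -> `|g1 a - g1 b| <= (kappa + C * (2 * rho) + N%:R * C) * `|a - b|.
Proof.
move=> bC [_ d1] ha hb.
have C0 := c1_ge0 _ _ _ _ bC.
have := d1 a b b ha hb hb; rewrite subrr normr0 addr0 => h1.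
have h2 := app_bound _ _ _ _ b (a - b) bC hb.
have := ler_normD (g1 a - g1 b - app G b (a - b)) (app G b (a - b)); rewrite subrK => h3.
have h4 : `|a - b| <= 2 * rho by have := ler_normB a b; lra.
have h5 : (kappa + C * `|a - b|) * `|a - b| <= (kappa + C * (2 * rho)) * `|a - b|.
  by rewrite ler_wpM2r// lerD2l ler_wpM2l.
by rewrite mulrDl; lra.
Qed.

Lemma c1convM rho phi psi g0 h0 G G' : 0 <= rho -> c1conv rho phi g0 G -> c1conv rho psi h0 G' ->
  c1conv rho (fun e a => phi e a * psi e a) (fun a => g0 a * h0 a)
    (fun c k => h0 c * G c k + g0 c * G' c k).
Proof.
move=> r0 [C1 [bC1 eC1]] [D1 [bD1 eD1]].
pose C := Num.max 1 (Num.max C1 D1).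
have CC : C1 <= C by rewrite !le_max lexx orbT.
have DC : D1 <= C by rewrite !le_max lexx !orbT.
have C1' : 1 <= C by rewrite le_max lexx.
have C0 : 0 <= C by exact: le_trans C1'.
have bC := c1bound_le _ _ _ _ _ CC bC1; have bD := c1bound_le _ _ _ _ _ DC bD1.
pose M := 1 + C * (2 * rho) + N%:R * C.
have NC : 0 <= N%:R * C by rewrite mulr_ge0.
have Cr : 0 <= C * (2 * rho) by rewrite !mulr_ge0.
have M0 : 0 <= M by rewrite /M; lra.
have MC : 0 <= M * C by rewrite mulr_ge0.
pose C' := C * C + 2 * (C * M + C * C) + 2 * C * (C + 1) + 2 * N%:R * C * (C + M).
(* A Lipschitz bound for the limit is not part of [c1bound]; it is inherited from the approximations
   by letting [kappa] tend to 0. *)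
have lipg0 (u : R -> E -> R) u0 (V : E -> 'I_N -> R) : c1bound rho C u0 V ->
  (forall kappa : R, 0 < kappa -> exists2 e1 : R, 0 < e1 &
    forall eps : R, 0 < eps -> eps < e1 -> c1est rho C kappa (u eps) u0 V) ->
  forall a b, `|a| <= rho -> `|b| <= rho -> `|u0 a - u0 b| <= M * `|a - b|.
  move=> bu eu a b ha hb; apply/ler_addgt0Pr => e e0.
  pose kap := Num.min 1 (e / 2).
  have k0 : 0 < kap by rewrite lt_min ltr01 divr_gt0.
  have k1 : kap <= 1 by rewrite ge_min lexx.
  have k2 : kap <= e / 2 by rewrite ge_min lexx orbT.
  have [e1 e10 H] := eu _ k0.
  have e12 : e1 / 2 < e1 by lra.
  have e20 : 0 < e1 / 2 by lra.
  have est := H _ e20 e12.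
  have h1 := c1_lip0 _ _ _ _ _ _ _ _ bu est ha hb.
  have h2 := c1_val _ _ _ _ _ _ est a ha; have h3 := c1_val _ _ _ _ _ _ est b hb.
  have h4 : (kap + C * (2 * rho) + N%:R * C) * `|a - b| <= M * `|a - b|.
    by rewrite ler_wpM2r// /M; lra.
  set ug := u (e1 / 2) in h1 h2 h3 *.
  have -> : u0 a - u0 b = (ug a - ug b) - (ug a - u0 a) + (ug b - u0 b) by ring.
  have := ler_normD (ug a - ug b - (ug a - u0 a)) (ug b - u0 b).
  have := ler_normB (ug a - ug b) (ug a - u0 a).
  lra.
have eC : forall kappa : R, 0 < kappa -> exists2 e1 : R, 0 < e1 &
    forall eps : R, 0 < eps -> eps < e1 -> c1est rho C kappa (phi eps) g0 G.
  move=> k /eC1[e e0 H]; exists e => // eps h1 h2.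
  exact: c1est_le CC (lexx k) (H _ h1 h2).
have eD : forall kappa : R, 0 < kappa -> exists2 e1 : R, 0 < e1 &
    forall eps : R, 0 < eps -> eps < e1 -> c1est rho C kappa (psi eps) h0 G'.
  move=> k /eD1[e e0 H]; exists e => // eps h1 h2.
  exact: c1est_le DC (lexx k) (H _ h1 h2).
have lg := lipg0 _ _ _ bC eC; have lh := lipg0 _ _ _ bD eD.
have CM : 0 <= C * M by rewrite mulr_ge0.
have C2 : 0 <= C * C by rewrite mulr_ge0.
have NCCM : 0 <= 2 * N%:R * C * (C + M) by rewrite !mulr_ge0// addr_ge0.
exists C'; split.
  split.
  - by rewrite /C' !addr_ge0// !mulr_ge0// ?addr_ge0.
  - move=> a ar; rewrite normrM; apply: (@le_trans _ _ (C * C)).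
      by apply: ler_pM => //; [exact: c1_bnd bC _ ar|exact: c1_bnd bD _ ar].
    by rewrite /C'; nra.
  - move=> c k cr; apply: (le_trans (ler_normD _ _)); rewrite !normrM.
    apply: (@le_trans _ _ (C * C + C * C)).
      apply: lerD; apply: ler_pM => //.
      + exact: c1_bnd bD _ cr.
      + exact: c1_grad bC _ _ cr.
      + exact: c1_bnd bC _ cr.
      + exact: c1_grad bD _ _ cr.
    by rewrite /C'; nra.
  - move=> c c' k hc hc'.
    have -> : h0 c * G c k + g0 c * G' c k - (h0 c' * G c' k + g0 c' * G' c' k) =
      (h0 c - h0 c') * G c k + h0 c' * (G c k - G c' k) +
      ((g0 c - g0 c') * G' c k + g0 c' * (G' c k - G' c' k)) by ring.
    apply: (@le_trans _ _ ((M * `|c - c'|) * C + C * (C * `|c - c'|) +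
        ((M * `|c - c'|) * C + C * (C * `|c - c'|)))).
      apply: (le_trans (ler_normD _ _)); apply: lerD; apply: (le_trans (ler_normD _ _));
        rewrite !normrM; apply: lerD; apply: ler_pM => //.
      + exact: lh.
      + exact: c1_grad bC _ _ hc.
      + exact: c1_bnd bD _ hc'.
      + exact: c1_glip bC _ _ _ hc hc'.
      + exact: lg.
      + exact: c1_grad bD _ _ hc.
      + exact: c1_bnd bC _ hc'.
      + exact: c1_glip bD _ _ _ hc hc'.
    have -> : M * `|c - c'| * C + C * (C * `|c - c'|) + (M * `|c - c'| * C + C * (C * `|c - c'|)) =
      2 * (C * M + C * C) * `|c - c'| by ring.
    rewrite ler_wpM2r// /C'; nra.
move=> kap k0.
(* The denominator adds up the coefficients of [kk] in the estimates of values and of increments, so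
   that both errors stay below [kap]. *)
pose kk := Num.min 1 (kap / (2 * (C + 1) + 2 * N%:R * C + 2 * C + 1)).
have den : 0 < 2 * (C + 1) + 2 * N%:R * C + 2 * C + 1 by lra.
have kk0 : 0 < kk by rewrite lt_min ltr01 divr_gt0.
have kk1 : kk <= 1 by rewrite ge_min lexx.
have kkk : kk * (2 * (C + 1) + 2 * N%:R * C + 2 * C + 1) <= kap.
  by rewrite -ler_pdivlMr// ge_min lexx orbT.
have [e1 e10 H1] := eC _ kk0; have [e2 e20 H2] := eD _ kk0.
exists (Num.min e1 e2); first by rewrite lt_min e10.
move=> eps ep; rewrite lt_min => /andP[ep1 ep2].
have E1 := H1 _ ep ep1; have E2 := H2 _ ep ep2.
have [v1 d1] := E1; have [v2 d2] := E2.
have bg1 a : `|a| <= rho -> `|phi eps a| <= C + 1.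
  move=> ha; have := v1 a ha; have := c1_bnd _ _ _ _ bC a ha.
  have := ler_normD (phi eps a - g0 a) (g0 a); rewrite subrK; lra.
have bh1 a : `|a| <= rho -> `|psi eps a| <= C + 1.
  move=> ha; have := v2 a ha; have := c1_bnd _ _ _ _ bD a ha.
  have := ler_normD (psi eps a - h0 a) (h0 a); rewrite subrK; lra.
split.
- move=> a ha.
  have -> : phi eps a * psi eps a - g0 a * h0 a = (phi eps a - g0 a) * psi eps a + g0 a * (psi eps a - h0 a) by ring.
  apply: (@le_trans _ _ (kk * (C + 1) + C * kk)).
    apply: (le_trans (ler_normD _ _)); rewrite !normrM; apply: lerD; apply: ler_pM => //.
    + exact: v1.
    + exact: bh1.
    + exact: c1_bnd bC _ ha.
    + exact: v2.
  have : 0 <= kk * C by rewrite mulr_ge0// ltW.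
  have : 0 <= kk * (2 * N%:R * C) by rewrite mulr_ge0 ?(ltW kk0)//; lra.
  lra.
- move=> a b c ha hb hc.
  have -> : app (fun c k => h0 c * G c k + g0 c * G' c k) c (a - b) =
     h0 c * app G c (a - b) + g0 c * app G' c (a - b) by rewrite appD !appZ.
  set x := app G c (a - b); set y := app G' c (a - b).
  have -> : phi eps a * psi eps a - phi eps b * psi eps b - (h0 c * x + g0 c * y) =
    psi eps a * (phi eps a - phi eps b - x) + (psi eps a - h0 c) * x +
    (phi eps b * (psi eps a - psi eps b - y) + (phi eps b - g0 c) * y) by ring.
  set D := `|a - c| + `|b - c|.
  have D0 : 0 <= D by rewrite addr_ge0.
  have hhc : `|psi eps a - h0 c| <= kk + M * D.
    have -> : psi eps a - h0 c = (psi eps a - h0 a) + (h0 a - h0 c) by ring.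
    apply: (le_trans (ler_normD _ _)); apply: lerD; first exact: v2.
    by apply: (le_trans (lh a c ha hc)); rewrite ler_wpM2l// lerDl.
  have hgc : `|phi eps b - g0 c| <= kk + M * D.
    have -> : phi eps b - g0 c = (phi eps b - g0 b) + (g0 b - g0 c) by ring.
    apply: (le_trans (ler_normD _ _)); apply: lerD; first exact: v1.
    by apply: (le_trans (lg b c hb hc)); rewrite ler_wpM2l// lerDr.
  have hx : `|x| <= N%:R * C * `|a - b| by exact: app_bound bC hc.
  have hy : `|y| <= N%:R * C * `|a - b| by exact: app_bound bD hc.
  apply: (@le_trans _ _ ((C + 1) * ((kk + C * D) * `|a - b|) + (kk + M * D) * (N%:R * C * `|a - b|) +
     ((C + 1) * ((kk + C * D) * `|a - b|) + (kk + M * D) * (N%:R * C * `|a - b|)))).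
    apply: (le_trans (ler_normD _ _)); apply: lerD; apply: (le_trans (ler_normD _ _));
      rewrite !normrM; apply: lerD; apply: ler_pM => //.
    + exact: bh1.
    + exact: d1.
    + exact: bg1.
    + exact: d2.
  have -> : (C + 1) * ((kk + C * D) * `|a - b|) + (kk + M * D) * (N%:R * C * `|a - b|) +
     ((C + 1) * ((kk + C * D) * `|a - b|) + (kk + M * D) * (N%:R * C * `|a - b|)) =
     (kk * (2 * (C + 1) + 2 * N%:R * C) + (2 * C * (C + 1) + 2 * N%:R * C * M) * D) * `|a - b| by ring.
  rewrite ler_wpM2r//; apply: lerD.
    apply: le_trans kkk; rewrite ler_pM2l//; lra.
  rewrite ler_wpM2r// /C'.
  have : 2 * N%:R * C * (C + M) = 2 * N%:R * C * C + 2 * N%:R * C * M by ring.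
  have : 0 <= 2 * N%:R * C * C by rewrite !mulr_ge0.
  lra.
Qed.

End c1_convergence.

Section cube_tools.
Context {R : realType}.

Lemma uniform_threshold (n : nat) (P : 'I_n -> R -> Prop) :
  (forall i, exists2 e : R, 0 < e & forall x, 0 < x -> x < e -> P i x) ->
  exists2 e : R, 0 < e & forall i x, 0 < x -> x < e -> P i x.
Proof.
elim: n P => [|n IH] P H; first by exists 1 => // -[].
have [e1 e10 H1] := H ord0; have [e2 e20 H2] := IH _ (fun i => H (lift ord0 i)).
exists (Num.min e1 e2); first by rewrite lt_min e10.
move=> i x x0; rewrite lt_min => /andP[x1 x2].
by case: (unliftP ord0 i) => [j|] ->; [exact: H2|exact: H1].
Qed.

Context {N : nat}.
Implicit Types (a b : 'rV[R]_N).

(** A 1-Lipschitz retraction onto a cube in the sup norm. Composing a field with it gives a globally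
    Lipschitz field, to which [ivp_existence] applies. *)
Definition clampv (rho : R) a : 'rV[R]_N := \row_i clamp (- rho) rho (a 0 i).

Lemma clampv_norm rho a : 0 <= rho -> `|clampv rho a| <= rho.
Proof.
move=> r0; apply: rv_norm_le => // i; rewrite mxE ler_norml clamp_ge/=.
by apply: clamp_le; lra.
Qed.

Lemma clampv_id rho a : `|a| <= rho -> clampv rho a = a.
Proof.
move=> ar; apply/rowP => i; rewrite mxE clamp_id//;
by have := le_trans (rv_norm_ge a i) ar; rewrite ler_norml => /andP[].
Qed.

Lemma clampv_lip rho a b : `|clampv rho a - clampv rho b| <= `|a - b|.
Proof.
apply: rv_norm_le => // i; rewrite !mxE; apply: (le_trans (clamp_lip _ _ _ _)).
by have := rv_norm_ge (a - b) i; rewrite !mxE.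
Qed.

Lemma lip_comp_continuous (F : 'rV[R]_N -> 'rV[R]_N) (L : R) (y : R -> 'rV[R]_N) : 0 <= L ->
  (forall a b, `|F a - F b| <= L * `|a - b|) -> continuous y -> continuous (fun t => F (y t)).
Proof.
move=> L0 HL cy t; apply/cvgrPdist_le => e e0.
have e1 : 0 < e / (L + 1) by rewrite divr_gt0// ltr_wpDl.
have /cvgrPdist_le/(_ _ e1) := cy t; apply: filterS => s Hs.
apply: (le_trans (HL _ _)); apply: (@le_trans _ _ (L * (e / (L + 1)))); first by rewrite ler_wpM2l.
rewrite mulrA ler_pdivrMr ?ltr_wpDl// mulrC ler_pM2l//; lra.
Qed.

Lemma curve_bounded (y : R -> 'rV[R]_N) : continuous y ->
  exists2 rho : R, 0 <= rho & forall t, 0 <= t -> t <= 1 -> `|y t| <= rho.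
Proof.
move=> cy; have [|c _ Hc] := @EVT_max R (fun t => `|y t|) 0 1 ler01.
  by apply: continuous_subspaceT => t; apply: cvg_norm; exact: cy.
by exists `|y c| => // t t0 t1; apply: Hc; rewrite in_itv/= t0 t1.
Qed.

End cube_tools.

(** * Variational equation, endpoint estimates and Newton's iteration *)

Section persistence.
Context {R : realType} {d : nat}.
Local Notation N := (d + d)%N.
Local Notation E := 'rV[R]_(d + d).
Variables (H : R -> E -> E) (H0 : E -> E) (DH : 'I_(d + d) -> E -> 'I_(d + d) -> R).
Hypothesis convH : forall rho : R, 0 <= rho -> forall i,
  c1conv rho (fun e a => H e a 0 i) (fun a => H0 a 0 i) (DH i).
Implicit Types (y w : R -> E) (a b c : E) (s t : R).

Definition vec_est (rho C kappa : R) (F1 : E -> E) :=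
  forall i, c1est rho C kappa (fun a => F1 a 0 i) (fun a => H0 a 0 i) (DH i).

Definition sol (F : E -> E) y := continuous y /\
  forall t i, 0 < t -> t < 1 -> is_derive t 1 (fun s => y s 0 i) (F (y t) 0 i).

Definition vsol y w := continuous w /\
  forall t i, 0 < t -> t < 1 -> is_derive t 1 (fun s => w s 0 i) (app (DH i) (y t) (w t)).

Definition stays (rho : R) y := forall t, 0 <= t -> t <= 1 -> `|y t| <= rho.

(** One constant for all components. The limit satisfies its own estimate with [kappa = 0], by
    passing to the limit in the estimates for [H eps]. *)
Lemma uniform_estimates rho : 0 <= rho -> exists2 C : R, 0 < C &
  [/\ forall i, c1bound rho C (fun a => H0 a 0 i) (DH i), vec_est rho C 0 H0 &
    forall kappa : R, 0 < kappa -> exists2 e1 : R, 0 < e1 &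
      forall eps : R, 0 < eps -> eps < e1 -> vec_est rho C kappa (H eps)].
Proof.
move=> r0; have /choice[Ci HC] := convH _ r0.
have Ci0 i : 0 <= Ci i := c1_ge0 _ _ _ _ (HC i).1.
pose C := 1 + \sum_i Ci i.
have S0 : 0 <= \sum_i Ci i by apply: sumr_ge0.
have CiC i : Ci i <= C.
  by rewrite /C (bigD1 i)//= addrCA lerDl addr_ge0// sumr_ge0.
have step kappa : 0 < kappa -> exists2 e1 : R, 0 < e1 &
      forall eps : R, 0 < eps -> eps < e1 -> vec_est rho C kappa (H eps).
  move=> k0; have [i|e e0 He] := @uniform_threshold R N (fun i eps =>
      c1est rho C kappa (fun a => H eps a 0 i) (fun a => H0 a 0 i) (DH i)).
    have [e e0 He] := (HC i).2 _ k0; exists e => // x x0 xe.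
    exact: c1est_le (CiC i) (lexx _) (He _ x0 xe).
  by exists e => // eps h1 h2 i; exact: He.
exists C; first by rewrite /C; lra.
split=> //; first by move=> i; exact: c1bound_le (CiC i) (HC i).1.
move=> i; split; first by move=> *; rewrite subrr normr0.
move=> a b c ha hb hc; rewrite add0r; apply/ler_addgt0Pr => e e0.
have ab0 : 0 < `|a - b| + 2 by rewrite ltr_wpDl.
pose kap := e / (`|a - b| + 2).
have k0 : 0 < kap by rewrite divr_gt0.
have [e1 e10 He1] := step _ k0.
have e12 : e1 / 2 < e1 by lra.
have e20 : 0 < e1 / 2 by lra.
have [v1 d1] := He1 _ e20 e12 i.
have h1 := d1 a b c ha hb hc; have h2 := v1 a ha; have h3 := v1 b hb.
set u := fun a => H (e1 / 2) a 0 i in h1 h2 h3.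
set D := app (DH i) c (a - b) in h1 *.
have -> : H0 a 0 i - H0 b 0 i - D = (u a - u b - D) - (u a - H0 a 0 i) + (u b - H0 b 0 i) by ring.
have g1 := ler_normD (u a - u b - D - (u a - H0 a 0 i)) (u b - H0 b 0 i).
have g2 := ler_normB (u a - u b - D) (u a - H0 a 0 i).
have g3 : kap * (`|a - b| + 2) = e by rewrite /kap divfK// gt_eqF.
move: h1; rewrite mulrDl => h1.
have -> : e = kap * `|a - b| + kap + kap by rewrite -g3; ring.
lra.
Qed.

Lemma app_sub (G : E -> 'I_N -> R) c (x y : E) : app G c (x - y) = app G c x - app G c y.
Proof. by rewrite /app -sumrB; apply: eq_bigr => k _; rewrite !mxE mulrBr. Qed.

Lemma vec_est_lip rho C kappa F1 a b : 0 <= rho -> 0 <= kappa -> 0 <= C ->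
  (forall i, c1bound rho C (fun a => H0 a 0 i) (DH i)) -> vec_est rho C kappa F1 ->
  `|a| <= rho -> `|b| <= rho ->
  `|F1 a - F1 b| <= (kappa + C * (2 * rho) + N%:R * C + 1) * `|a - b|.
Proof.
move=> r0 k0 C0 bC eF ha hb.
have X : 0 <= kappa + C * (2 * rho) + N%:R * C.
  by rewrite !addr_ge0// !mulr_ge0.
apply: rv_norm_le => [|i]; first by apply: mulr_ge0 => //; lra.
rewrite !mxE; apply: (le_trans (c1_lip0 _ _ _ _ _ _ _ _ (bC i) (eF i) ha hb)).
by rewrite ler_wpM2r//; lra.
Qed.

Lemma sol_lip rho C kappa F1 y1 y2 : 0 <= rho -> 0 <= kappa -> 0 <= C ->
  (forall i, c1bound rho C (fun a => H0 a 0 i) (DH i)) -> vec_est rho C kappa F1 ->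
  sol F1 y1 -> sol F1 y2 -> stays rho y1 -> stays rho y2 ->
  forall t, 0 <= t -> t <= 1 -> `|y1 t - y2 t| <=
    2 * `|y1 0 - y2 0| * expR (2 * (kappa + C * (2 * rho) + N%:R * C + 1)).
Proof.
move=> r0 k0 C0 bC eF [c1 d1] [c2 d2] s1 s2 t t0 t1.
have X : 0 <= kappa + C * (2 * rho) + N%:R * C.
  by rewrite !addr_ge0// !mulr_ge0.
have := @gronwall R N (fun t => y1 t - y2 t) (fun t i => F1 (y1 t) 0 i - F1 (y2 t) 0 i)
  (kappa + C * (2 * rho) + N%:R * C + 1) `|y1 0 - y2 0| 0.
rewrite addr0; apply=> //.
- by lra.
- by move=> s; apply: cvgB; [exact: c1|exact: c2].
- move=> s i s0 s1'.
  rewrite (_ : (fun s => _) = fun s => y1 s 0 i - y2 s 0 i); last by apply/funext => x; rewrite !mxE.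
  by apply: is_deriveBl; [exact: d1|exact: d2].
- move=> s i s0 s1'; rewrite addr0.
  have -> : F1 (y1 s) 0 i - F1 (y2 s) 0 i = (F1 (y1 s) - F1 (y2 s)) 0 i by rewrite !mxE.
  apply: (le_trans (rv_norm_ge _ _)); apply: vec_est_lip eF _ _ => //.
    by apply: s1; exact: ltW.
  by apply: s2; exact: ltW.
Qed.

(** An initial variation of momentum alone: positions occupy the left block of phase space, momenta
    the right one. *)
Definition unitp (j : 'I_d) : E := delta_mx 0 (rshift d j).

Lemma unitpE j k : unitp j 0 k = (k == rshift d j)%:R.
Proof. by rewrite /unitp mxE. Qed.

Lemma vsol_bound rho C y w : 0 <= rho -> 0 < C ->
  (forall i, c1bound rho C (fun a => H0 a 0 i) (DH i)) -> stays rho y -> vsol y w ->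
  forall t, 0 <= t -> t <= 1 -> `|w t| <= 2 * `|w 0| * expR (2 * (N%:R * C + 1)).
Proof.
move=> r0 C0 bC sy [cw dw] t t0 t1.
have X : 0 <= N%:R * C by rewrite mulr_ge0// ltW.
have := @gronwall R N w (fun t i => app (DH i) (y t) (w t)) (N%:R * C + 1) `|w 0| 0.
rewrite addr0; apply=> //; first lra.
move=> s i s0 s1; rewrite addr0.
apply: (le_trans (app_bound _ _ _ _ _ _ (bC i) (sy s (ltW s0) (ltW s1)))).
by rewrite ler_wpM2r//; lra.
Qed.

(** The difference of two solutions minus the matching combination of variational solutions starts
    at 0, and Gronwall bounds it by its defect. With [F1 = H0] and [yh = y2] this gives the second
    order expansion of the endpoint; with [F1 = H eps] it gives the contraction in Newton's
    iteration. *)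
Lemma variational_estimate rho C kappa sigma F1 y1 y2 yh (W : 'I_d -> R -> E) :
  0 <= rho -> 0 <= kappa -> 0 < C -> 0 <= sigma ->
  (forall i, c1bound rho C (fun a => H0 a 0 i) (DH i)) -> vec_est rho C kappa F1 ->
  sol F1 y1 -> sol F1 y2 -> stays rho y1 -> stays rho y2 -> stays rho yh ->
  (forall t, 0 <= t -> t <= 1 -> `|y1 t - yh t| + `|y2 t - yh t| <= sigma) ->
  (forall j, vsol yh (W j) /\ W j 0 = unitp j) ->
  lsubmx (y1 0) = lsubmx (y2 0) ->
  `|y1 1 - y2 1 - \sum_j (y1 0 - y2 0) 0 (rshift d j) *: W j 1| <=
    4 * (kappa + C * sigma) * expR (2 * (kappa + C * (2 * rho) + N%:R * C + 1)) *
      expR (2 * (N%:R * C + 1)) * `|y1 0 - y2 0|.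
Proof.
move=> r0 k0 C0 sg0 bC eF S1 S2 s1 s2 sh hs HW Hq.
have lipE := sol_lip _ _ _ _ _ _ r0 k0 (ltW C0) bC eF S1 S2 s1 s2.
have [c1 d1] := S1; have [c2 d2] := S2.
set X := expR (2 * (kappa + _ + _ + 1)) in lipE *.
set Y := expR (2 * (N%:R * C + 1)).
pose D j := (y1 0 - y2 0) 0 (rshift d j).
pose V t := \sum_j D j *: W j t.
have VE t i : V t 0 i = \sum_j D j * W j t 0 i.
  by rewrite summxE; apply: eq_bigr => j _; rewrite mxE.
have NC : 0 <= N%:R * C by rewrite mulr_ge0// ltW.
have X0 : 0 <= X by exact: expR_ge0.
(* The defect: [kappa + C * sigma] for freezing the gradient along [yh], times the Lipschitz bound
   for [y1 - y2] from [sol_lip]. *)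
pose eta := (kappa + C * sigma) * (2 * `|y1 0 - y2 0| * X).
have kC : 0 <= kappa + C * sigma by rewrite addr_ge0// mulr_ge0// ltW.
have eta0 : 0 <= eta by rewrite !mulr_ge0.
have key : `|y1 1 - y2 1 - V 1| <= 2 * (0 + eta) * expR (2 * (N%:R * C + 1)).
  apply: (@gronwall R N (fun t => y1 t - y2 t - V t)
    (fun t i => F1 (y1 t) 0 i - F1 (y2 t) 0 i - app (DH i) (yh t) (V t)) (N%:R * C + 1) 0 eta) => //.
  - by lra.
  - apply: rv_continuousP => i t.
    rewrite (_ : (fun s => _) = fun s => y1 s 0 i - y2 s 0 i - \sum_j D j * W j s 0 i); last first.
      by apply/funext => s; rewrite !mxE VE.
    apply: cvgB; first apply: cvgB.
    + by apply: rv_continuous_comp; exact: c1.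
    + by apply: rv_continuous_comp; exact: c2.
    + apply: continuous_at_sum => j; apply: cvgM; first exact: cvg_cst.
      by apply: rv_continuous_comp; exact: (HW j).1.1.
  - move=> t i t0 t1.
    rewrite (_ : (fun s => _) = fun s => y1 s 0 i - y2 s 0 i - \sum_j D j * W j s 0 i); last first.
      by apply/funext => s; rewrite !mxE VE.
    apply: is_deriveBl; first by apply: is_deriveBl; [exact: d1|exact: d2].
    have dj j := is_deriveMl _ _ _ _ _ (is_derive_cstl t (D j)) ((HW j).1.2 t i t0 t1).
    apply: (is_derive_ext _ _ _ _ _ (is_derive_suml t d _ _ dj)) => //.
    rewrite /app.
    transitivity (\sum_j \sum_k DH i (yh t) k * (D j * W j t 0 k)).
      apply: eq_bigr => j _; rewrite mul0r add0r mulr_sumr; apply: eq_bigr => k _.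
      by rewrite mulrCA.
    by rewrite exchange_big/=; apply: eq_bigr => k _; rewrite VE mulr_sumr.
  - move=> t i t0 t1; have t0' := ltW t0; have t1' := ltW t1.
    have -> : F1 (y1 t) 0 i - F1 (y2 t) 0 i - app (DH i) (yh t) (V t) =
      (F1 (y1 t) 0 i - F1 (y2 t) 0 i - app (DH i) (yh t) (y1 t - y2 t)) +
      app (DH i) (yh t) (y1 t - y2 t - V t) by rewrite (app_sub _ _ (y1 t - y2 t) (V t)); ring.
    apply: (le_trans (ler_normD _ _)); rewrite addrC; apply: lerD.
      apply: (le_trans (app_bound _ _ _ _ _ _ (bC i) (sh t t0' t1'))).
      by rewrite ler_wpM2r//; lra.
    apply: (le_trans (c1_der _ _ _ _ _ _ (eF i) _ _ _ (s1 t t0' t1') (s2 t t0' t1') (sh t t0' t1'))).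
    apply: ler_pM => //.
    + by rewrite addr_ge0// mulr_ge0 ?(ltW C0)// addr_ge0.
    + by rewrite lerD2l ler_pM2l//; exact: hs.
    + exact: lipE.
  - rewrite (_ : _ - V 0 = 0) ?normr0//.
    apply/eqP; rewrite subr_eq0; apply/eqP/rowP => k; rewrite VE.
    case: (split_ordP k) => l ->.
      rewrite big1; last first.
        move=> j _; by rewrite (HW j).2 unitpE eq_lrshift mulr0.
      by have := congr1 (fun x : 'rV[R]_d => x 0 l) Hq; rewrite !mxE => ->; rewrite subrr.
    rewrite (bigD1 l)//= big1 ?addr0; last first.
      move=> j jl; rewrite (HW j).2 unitpE (inj_eq (@rshift_inj _ _)).
      by rewrite eq_sym (negPf jl) mulr0.
    by rewrite (HW l).2 unitpE eqxx mulr1.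
apply: (le_trans key); rewrite le_eqVlt; apply/orP; left; apply/eqP.
by rewrite /eta /Y; ring.
Qed.

Lemma vsol_existence y (w0 : E) : continuous y -> exists w, vsol y w /\ w 0 = w0.
Proof.
move=> cy; have [rho r0 Hr] := curve_bounded y cy.
have [C C0 [bC _ _]] := uniform_estimates rho r0.
pose yc t := y (clamp 0 1 t).
have cyc : continuous yc.
  by move=> t; apply: (@continuous_comp _ _ _ (clamp 0 1) y); [exact: clamp_continuous|exact: cy].
have ycr t : `|yc t| <= rho by apply: Hr; [exact: clamp_ge|exact: clamp_le].
have NC : 0 <= N%:R * C by rewrite mulr_ge0// ltW.
have cDH i k : continuous (fun t => DH i (yc t) k).
  move=> t; apply/cvgrPdist_le => e e0.
  have e1 : 0 < e / C by rewrite divr_gt0.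
  have /cvgrPdist_le/(_ _ e1) := cyc t; apply: filterS => s Hs.
  apply: (le_trans (c1_glip _ _ _ _ (bC i) _ _ k (ycr t) (ycr s))).
  by rewrite mulrC -ler_pdivlMr.
have [|||w [cw w0' dw]] := @ivp_existence R N (fun t (v : E) => \row_i app (DH i) (yc t) v) (N%:R * C + 1) w0.
- by lra.
- move=> w cw; apply: rv_continuousP => i t.
  rewrite (_ : (fun s => _) = fun s => \sum_k DH i (yc s) k * w s 0 k); last first.
    by apply/funext => s; rewrite mxE.
  apply: continuous_at_sum => k; apply: cvgM; first exact: cDH.
  by apply: rv_continuous_comp; exact: cw.
- move=> t a b; apply: rv_norm_le => [|i]; first by apply: mulr_ge0 => //; lra.
  rewrite !mxE -app_sub; apply: (le_trans (app_bound _ _ _ _ _ _ (bC i) (ycr t))).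
  by rewrite ler_wpM2r//; lra.
exists w; split=> //; split=> // t i t0 t1.
by have := dw t i t0 t1; rewrite mxE /yc clamp_id ?ltW.
Qed.

(* The matrix of the derivative of the endpoint map p(0) |-> q(1). *)
Definition endpoint_mx (W : 'I_d -> R -> E) : 'M[R]_d := \matrix_(j, k) W j 1 0 (lshift d k).

Lemma lsubmx_comb (W : 'I_d -> R -> E) (D : 'I_d -> R) :
  lsubmx (\sum_j D j *: W j 1) = (\row_j D j) *m endpoint_mx W.
Proof.
apply/rowP => k; rewrite !mxE summxE; apply: eq_bigr => j _; by rewrite !mxE.
Qed.

Lemma lsubmx_norm (a : E) : `|lsubmx a| <= `|a|.
Proof. by apply: rv_norm_le => // i; rewrite mxE; exact: rv_norm_ge. Qed.

Lemma rsubmx_norm (a b : E) : lsubmx a = lsubmx b -> `|a - b| = `|rsubmx a - rsubmx b|.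
Proof.
move=> ab; apply/eqP; rewrite eq_le; apply/andP; split.
  apply: rv_norm_le => // i; case: (split_ordP i) => k ->.
    by have := congr1 (fun x : 'rV[R]_d => x 0 k) ab; rewrite !mxE => ->; rewrite subrr normr0.
  by have := rv_norm_ge (rsubmx a - rsubmx b) k; rewrite !mxE.
apply: rv_norm_le => // i; have := rv_norm_ge (a - b) (rshift d i); by rewrite !mxE.
Qed.

(** Taking [sigma] proportional to the distance of the initial momenta makes the remainder
    quadratic. In particular, equal initial momenta give equal endpoints. *)
Lemma endpoint_quadratic rho : 0 <= rho -> exists2 C : R, 0 <= C &
  forall y1 y2 (W : 'I_d -> R -> E), sol H0 y1 -> sol H0 y2 -> stays rho y1 -> stays rho y2 ->
  lsubmx (y1 0) = lsubmx (y2 0) -> (forall j, vsol y2 (W j) /\ W j 0 = unitp j) ->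
  (forall i j, `|endpoint_mx W i j| <= C) /\
  `|lsubmx (y1 1) - lsubmx (y2 1) - (rsubmx (y1 0) - rsubmx (y2 0)) *m endpoint_mx W| <=
    C * `|rsubmx (y1 0) - rsubmx (y2 0)| ^+ 2.
Proof.
move=> r0; have [C C0 [bC eC _]] := uniform_estimates rho r0.
set X := expR (2 * (0 + C * (2 * rho) + N%:R * C + 1)).
set Y := expR (2 * (N%:R * C + 1)).
have X0 : 0 < X by exact: expR_gt0.
have Y0 : 0 < Y by exact: expR_gt0.
have P0 : 0 <= 4 * (C * (2 * X)) * X * Y by rewrite !mulr_ge0// ltW.
have P1 : 0 <= 2 * Y by rewrite mulr_ge0// ltW.
exists (4 * (C * (2 * X)) * X * Y + 2 * Y); first exact: addr_ge0.
move=> y1 y2 W S1 S2 s1 s2 Hq HW; split.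
  move=> i j; rewrite mxE; apply: (le_trans (rv_norm_ge _ _)).
  apply: (le_trans (vsol_bound _ _ _ _ r0 C0 bC s2 (HW i).1 1 ler01 (lexx 1))).
  rewrite (HW i).2 -/Y; apply: (@le_trans _ _ (2 * Y)); last lra.
  rewrite ler_wpM2r ?(ltW Y0)// -[leRHS]mulr1 ler_pM2l//.
  by apply: rv_norm_le => // k; rewrite mxE; case: (_ && _); rewrite ?normr1 ?normr0.
set D := `|rsubmx (y1 0) - rsubmx (y2 0)|.
have ED : `|y1 0 - y2 0| = D by exact: rsubmx_norm.
have D0 : 0 <= D by exact: normr_ge0.
have lipE := sol_lip _ _ _ _ _ _ r0 (lexx 0) (ltW C0) bC eC S1 S2 s1 s2.
rewrite ED -/X in lipE.
have sg0 : 0 <= 2 * D * X by rewrite !mulr_ge0// ltW.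
have := variational_estimate _ _ _ _ _ _ _ _ _ r0 (lexx 0) C0 sg0 bC eC S1 S2 s1 s2 s2 _ HW Hq.
rewrite ED -/X -/Y => V.
have {V}V : `|y1 1 - y2 1 - \sum_j (y1 0 - y2 0) 0 (rshift d j) *: W j 1| <=
    4 * (0 + C * (2 * D * X)) * X * Y * D.
  by apply: V => t t0 t1; rewrite subrr normr0 addr0; exact: lipE.
have -> : lsubmx (y1 1) - lsubmx (y2 1) - (rsubmx (y1 0) - rsubmx (y2 0)) *m endpoint_mx W =
    lsubmx (y1 1 - y2 1 - \sum_j (y1 0 - y2 0) 0 (rshift d j) *: W j 1).
  rewrite 2!linearB/= lsubmx_comb; congr (_ - _ *m _).
  by apply/rowP => j; rewrite !mxE.
apply: (le_trans (lsubmx_norm _)); apply: (le_trans V).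
have -> : 4 * (0 + C * (2 * D * X)) * X * Y * D = 4 * (C * (2 * X)) * X * Y * D ^+ 2 by ring.
by rewrite ler_wpM2r ?exprn_ge0//; lra.
Qed.

Lemma small_positive (x y : R) : 0 < x -> 0 <= y -> exists2 z : R, 0 < z & z * y <= x.
Proof.
move=> x0 y0; exists (x / (y + 1)); first by rewrite divr_gt0// ltr_wpDl.
by rewrite mulrAC ler_pdivrMr ?ltr_wpDl// ler_pM2l//; lra.
Qed.

(** Newton's iteration with the inverse derivative frozen at the limit solution. On a small ball of
    initial momenta it contracts by 1/2, and its fixed point is a solution of the perturbed system
    with the prescribed endpoint. *)
Lemma persistence yh (W : 'I_d -> R -> E) : sol H0 yh ->
  (forall j, vsol yh (W j) /\ W j 0 = unitp j) -> endpoint_mx W \in unitmx ->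
  forall sigma : R, 0 < sigma -> exists2 e1 : R, 0 < e1 &
  forall eps : R, 0 < eps -> eps < e1 -> exists y, [/\ sol (H eps) y,
    lsubmx (y 0) = lsubmx (yh 0), lsubmx (y 1) = lsubmx (yh 1) &
    forall t, 0 <= t -> t <= 1 -> `|y t - yh t| <= sigma].
Proof.
move=> Sh HW uL sigma sg0; have [ch dh] := Sh.
have [rho0 r00 Hr0] := curve_bounded yh ch.
pose rho := rho0 + 1.
have r0 : 0 <= rho by rewrite /rho; lra.
have sh : stays rho yh by move=> t t0 t1; have := Hr0 t t0 t1; rewrite /rho; lra.
have [C C0 [bC _ eC]] := uniform_estimates rho r0.
have NC : 0 <= N%:R * C by rewrite mulr_ge0// ltW.
have Cr : 0 <= C * (2 * rho) by rewrite !mulr_ge0// ltW.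
pose L1 := 1 + C * (2 * rho) + N%:R * C + 1.
have L10 : 0 < L1 by rewrite /L1; lra.
pose X := expR (2 * L1).
have X1 : 1 <= X by rewrite -expR0 ler_expR mulr_ge0// ltW.
have X0 : 0 < X by exact: expR_gt0.
pose Y := expR (2 * (N%:R * C + 1)).
have Y0 : 0 < Y by exact: expR_gt0.
pose Li := invmx (endpoint_mx W).
pose M := 1 + \sum_i \sum_j `|Li i j|.
have M0 : 0 <= M by rewrite addr_ge0// sumr_ge0// => i _; exact: sumr_ge0.
have LiM i j : `|Li i j| <= M.
  apply: (@le_trans _ _ (\sum_j `|Li i j|)).
    by rewrite (bigD1 j)//= lerDl sumr_ge0.
  rewrite /M [X in _ <= 1 + X](bigD1 i)//= addrCA lerDl addr_ge0// sumr_ge0// => k _.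
  exact: sumr_ge0.
pose dM := d%:R * M.
have dM0 : 0 <= dM by rewrite mulr_ge0.
have mulLi (x : 'rV[R]_d) : `|x *m Li| <= dM * `|x| by exact: norm_mulmx_le.
have K0 : 0 <= 4 * X * Y * dM by rewrite !mulr_ge0// ltW.
have quarter : 0 < 4^-1 :> R by rewrite invr_gt0.
have [s1 s10 Hs1] := small_positive _ _ quarter (mulr_ge0 K0 (mulr_ge0 (ler0n R 2) (ltW C0))).
(* The bound by [s1] makes the variation of the gradient contribute at most 1/4 to the contraction
   factor; the bound by 1 keeps the solutions in the cube of radius [rho0 + 1]. *)
pose sg := Num.min s1 (Num.min sigma 1).
have sg0' : 0 < sg by rewrite !lt_min s10 sg0/=.
have sgs : sg <= sigma by rewrite !ge_min lexx orbT.
have sg1 : sg <= 1 by rewrite !ge_min lexx !orbT.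
have sgK : sg * (4 * X * Y * dM * (2 * C)) <= 4^-1.
  apply: le_trans Hs1; rewrite ler_wpM2r ?ge_min ?lexx//.
  by rewrite mulr_ge0// mulr_ge0// ltW.
(* Solutions stay within [2 * (r + kap) * X] of [yh]; with [kap <= r] this is at most [sg]. *)
pose r := sg / (4 * X).
have X4 : 0 < 4 * X by rewrite mulr_gt0.
have rr0 : 0 < r by rewrite divr_gt0.
have rX : r * (4 * X) = sg by rewrite /r divfK// gt_eqF.
have [k1 k10 Hk1] := small_positive _ _ quarter K0.
have XdM : 0 <= 4 * X * dM by rewrite !mulr_ge0// ltW.
have [k2 k20 Hk2] := small_positive _ _ rr0 XdM.
(* [k1] leaves the other quarter of the contraction factor to the perturbation of the field; [k2]
   makes the first Newton step at most r/2. *)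
pose kap := Num.min 1 (Num.min r (Num.min k1 k2)).
have kap0 : 0 < kap by rewrite !lt_min ltr01 rr0 k10.
have kap1 : kap <= 1 by rewrite !ge_min lexx.
have kapr : kap <= r by rewrite !ge_min lexx !orbT.
have kapk1 : kap * (4 * X * Y * dM) <= 4^-1.
  by apply: le_trans Hk1; rewrite ler_wpM2r// !ge_min lexx !orbT.
have kapk2 : kap * (4 * X * dM) <= r.
  by apply: le_trans Hk2; rewrite ler_wpM2r// !ge_min lexx !orbT.
have [e1 e10 He1] := eC _ kap0.
exists e1 => // eps ep ep1; have est := He1 _ ep ep1.
pose F1 := H eps.
have X' : expR (2 * (kap + C * (2 * rho) + N%:R * C + 1)) <= X.
  by rewrite ler_expR /L1; lra.
(* The cut-off field has solutions for every initial momentum; for momenta within [r] of [lh] they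
   stay in the cube and solve the original equation. *)
pose Fc (a : E) := F1 (clampv rho a).
have Lip a b : `|Fc a - Fc b| <= L1 * `|a - b|.
  apply: (le_trans (vec_est_lip _ _ _ _ _ _ r0 (ltW kap0) (ltW C0) bC est
    (clampv_norm rho a r0) (clampv_norm rho b r0))).
  apply: ler_pM => //; [by rewrite !addr_ge0// ltW|by rewrite /L1; lra|exact: clampv_lip].
pose ini (l : 'rV[R]_d) : E := row_mx (lsubmx (yh 0)) l.
have /choice[Ysol HY] : forall l : 'rV[R]_d, exists y : R -> E, sol Fc y /\ y 0 = ini l.
  move=> l; have [|||y [cy y0 dy]] := @ivp_existence R N (fun _ => Fc) L1 (ini l).
  - exact: L10.
  - by move=> y cy; apply: lip_comp_continuous (ltW L10) Lip cy.
  - by move=> _; exact: Lip.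
  by exists y.
pose lh := rsubmx (yh 0).
have inih : ini lh = yh 0 by rewrite /ini /lh hsubmxK.
have inid l l' : `|ini l - ini l'| = `|l - l'|.
  by rewrite rsubmx_norm /ini ?row_mxKl// !row_mxKr.
have close l : forall t, 0 <= t -> t <= 1 ->
    `|Ysol l t - yh t| <= 2 * (`|l - lh| + kap) * X.
  have [[cy dy] y0] := HY l.
  apply: (@gronwall R N (fun t => Ysol l t - yh t)
    (fun t i => Fc (Ysol l t) 0 i - H0 (yh t) 0 i) L1 `|l - lh| kap) => //.
  - exact: ltW.
  - by move=> t; apply: cvgB; [exact: cy|exact: ch].
  - move=> t i t0 t1.
    rewrite (_ : (fun s => _) = fun s => Ysol l s 0 i - yh s 0 i); last by apply/funext => s; rewrite !mxE.
    by apply: is_deriveBl; [exact: dy|exact: dh].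
  - move=> t i t0 t1; have hh := sh t (ltW t0) (ltW t1).
    have -> : Fc (Ysol l t) 0 i - H0 (yh t) 0 i =
      (Fc (Ysol l t) - Fc (yh t)) 0 i + (F1 (yh t) 0 i - H0 (yh t) 0 i).
      by rewrite !mxE /Fc (clampv_id rho (yh t) hh); ring.
    apply: (le_trans (ler_normD _ _)); apply: lerD; last exact: c1_val _ _ _ _ _ _ (est i) _ hh.
    exact: le_trans (rv_norm_ge _ _) (Lip _ _).
  - by rewrite y0 -inih inid.
have close_sg l : `|l - lh| <= r -> forall t, 0 <= t -> t <= 1 -> `|Ysol l t - yh t| <= sg.
  move=> lr t t0 t1; apply: (le_trans (close l t t0 t1)).
  rewrite -rX; have : (`|l - lh| + kap) * X <= (r + r) * X by rewrite ler_pM2r// lerD.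
  lra.
have stay l : `|l - lh| <= r -> stays rho (Ysol l).
  move=> lr t t0 t1; have := close_sg l lr t t0 t1; have := Hr0 t t0 t1.
  have := ler_normD (Ysol l t - yh t) (yh t); rewrite subrK /rho; lra.
have solF l : `|l - lh| <= r -> sol F1 (Ysol l).
  move=> lr; have [[cy dy] y0] := HY l; split=> // t i t0 t1.
  by have := dy t i t0 t1; rewrite /Fc clampv_id//; apply: stay => //; exact: ltW.
pose Fe l := lsubmx (Ysol l 1).
have lhr : `|lh - lh| <= r by rewrite subrr normr0 ltW.
have diffF l l' : `|l - lh| <= r -> `|l' - lh| <= r ->
    `|(Fe l - Fe l' - (l - l') *m endpoint_mx W) *m Li| <= 2^-1 * `|l - l'|.
  move=> lr l'r.
  have [_ yl0] := HY l; have [_ yl0'] := HY l'.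
  have Hq : lsubmx (Ysol l 0) = lsubmx (Ysol l' 0) by rewrite yl0 yl0' /ini !row_mxKl.
  have sg2 : 0 <= 2 * sg by rewrite mulr_ge0// ltW.
  have hs t : 0 <= t -> t <= 1 -> `|Ysol l t - yh t| + `|Ysol l' t - yh t| <= 2 * sg.
    by move=> t0 t1; have := close_sg l lr t t0 t1; have := close_sg l' l'r t t0 t1; lra.
  have := variational_estimate _ _ _ _ _ _ _ _ _ r0 (ltW kap0) C0 sg2 bC est (solF l lr) (solF l' l'r)
    (stay l lr) (stay l' l'r) sh hs HW Hq.
  rewrite yl0 yl0' inid -/Y => V.
  have -> : Fe l - Fe l' - (l - l') *m endpoint_mx W =
    lsubmx (Ysol l 1 - Ysol l' 1 - \sum_j (ini l - ini l') 0 (rshift d j) *: W j 1).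
    rewrite 2!linearB/= lsubmx_comb; congr (_ - _ *m _).
    have E2 l0 j : ini l0 0 (rshift d j) = l0 0 j by rewrite /ini row_mxEr.
    apply/rowP => j; transitivity (ini l 0 (rshift d j) - ini l' 0 (rshift d j)).
      by rewrite !E2 !mxE.
    by rewrite [RHS]mxE [RHS]mxE; congr (_ + _); rewrite [RHS]mxE.
  apply: (le_trans (mulLi _)).
  apply: (@le_trans _ _ (dM * (4 * (kap + C * (2 * sg)) * X * Y * `|l - l'|))).
    rewrite ler_wpM2l//; apply: (le_trans (lsubmx_norm _)); apply: (le_trans V).
    rewrite ler_wpM2r// ler_wpM2r ?(ltW Y0)// ler_wpM2l//.
    by rewrite mulr_ge0// addr_ge0 ?(ltW kap0)// !mulr_ge0// ltW.
  rewrite mulrA ler_wpM2r//.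
  have -> : dM * (4 * (kap + C * (2 * sg)) * X * Y) =
    kap * (4 * X * Y * dM) + sg * (4 * X * Y * dM * (2 * C)) by ring.
  lra.
(* A fixed point of [T] hits the target because [Li] is invertible. *)
pose T l := l - (Fe l - lsubmx (yh 1)) *m Li.
have Tdiff l l' : `|l - lh| <= r -> `|l' - lh| <= r -> `|T l - T l'| <= 2^-1 * `|l - l'|.
  move=> lr l'r.
  have -> : T l - T l' = - ((Fe l - Fe l' - (l - l') *m endpoint_mx W) *m Li).
    rewrite (mulmxBl (Fe l - Fe l')) mulmxK// /T.
    have -> : (Fe l - Fe l') *m Li = (Fe l - lsubmx (yh 1)) *m Li - (Fe l' - lsubmx (yh 1)) *m Li.
      by rewrite -mulmxBl; congr (_ *m _); rewrite opprB addrA subrK.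
    by apply/rowP => i; rewrite !mxE; ring.
  by rewrite normrN; exact: diffF.
have Th : `|T lh - lh| <= r / 2.
  rewrite /T addrAC subrr add0r normrN; apply: (le_trans (mulLi _)).
  rewrite /Fe -linearB/=.
  have h1 := close lh 1 ler01 (lexx 1); rewrite subrr normr0 add0r in h1.
  have h2 : dM * `|lsubmx (Ysol lh 1 - yh 1)| <= dM * (2 * kap * X).
    by rewrite ler_wpM2l//; exact: le_trans (lsubmx_norm _) h1.
  lra.
pose it k := iter k T lh.
have p0 k : 0 <= 2^-1 ^+ k :> R by rewrite exprn_ge0.
have itP k : `|it k - lh| <= r * (1 - 2^-1 ^+ k) /\ `|it k.+1 - it k| <= r / 2 * 2^-1 ^+ k.
  elim: k => [|k [IH1 IH2]].
    by rewrite expr0 subrr normr0 mulr1 subrr mulr0.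
  have h1 : `|it k.+1 - lh| <= r * (1 - 2^-1 ^+ k.+1).
    have := ler_normD (it k.+1 - it k) (it k - lh); rewrite addrA subrK exprS => h.
    lra.
  split=> //.
  have ball k' : `|it k' - lh| <= r * (1 - 2^-1 ^+ k') -> `|it k' - lh| <= r.
    by move=> /le_trans; apply; rewrite -[leRHS]mulr1 ler_pM2l// gerBl.
  have -> : it k.+2 - it k.+1 = T (it k.+1) - T (it k) by [].
  apply: (le_trans (Tdiff _ _ (ball _ h1) (ball _ IH1))).
  by rewrite exprS mulrCA ler_pM2l// invr_gt0.
have /choice[l Hl] : forall i, exists l, forall k, `|it k 0 i - l| <= 2 * (r / 2) * 2^-1 ^+ k.
  move=> i; apply: geometric_limit => k; apply: le_trans (itP k).2.
  by have := rv_norm_ge (it k.+1 - it k) i; rewrite !mxE.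
pose ls : 'rV[R]_d := \row_i l i.
have itl k : `|it k - ls| <= r * 2^-1 ^+ k.
  apply: rv_norm_le => [|i]; first by rewrite mulr_ge0// ltW.
  by rewrite !mxE; have := Hl i k; rewrite (mulrC 2) divfK.
have lsr : `|ls - lh| <= r by have := itl 0%N; rewrite expr0 mulr1 /it/= distrC.
have itr k : `|it k - lh| <= r.
  by apply: (le_trans (itP k).1); rewrite -[leRHS]mulr1 ler_pM2l// gerBl.
have fixT : T ls = ls.
  apply/eqP; rewrite -subr_eq0 -normr_le0; apply/ler_addgt0Pl => e e0; rewrite addr0.
  have [k Hk] : exists k, r * 2^-1 ^+ k <= e.
    have : (fun k => r * 2^-1 ^+ k) @ \oo --> (r * 0 : R).
      apply: cvgM; first exact: cvg_cst.
      by apply: cvg_expr; rewrite ger0_norm// invf_lt1// ltr1n.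
    rewrite mulr0 => /cvgrPdist_le/(_ _ e0)[k _ /(_ k (leqnn k))].
    by rewrite sub0r normrN => /(le_trans (ler_norm _)) h; exists k.
  have -> : T ls - ls = (T ls - T (it k)) + (it k.+1 - ls) by rewrite addrA subrK.
  apply: (le_trans (ler_normD _ _)).
  have h1 := Tdiff _ _ lsr (itr k); have h2 := itl k; have h3 := itl k.+1.
  rewrite distrC in h2; rewrite exprS in h3.
  lra.
exists (Ysol ls); split.
- exact: solF.
- by rewrite (HY ls).2 /ini row_mxKl.
- have : (Fe ls - lsubmx (yh 1)) *m Li = 0.
    move: fixT; rewrite /T => /eqP; rewrite subr_eq -[X in X == _]addr0.
    by rewrite (inj_eq (addrI ls)) eq_sym => /eqP.
  move=> /(congr1 (mulmxr (endpoint_mx W))); rewrite /= mulmxKV// mul0mx => /eqP.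
  by rewrite subr_eq0 => /eqP.
- by move=> t t0 t1; apply: le_trans sgs; exact: close_sg.
Qed.

End persistence.

(** * Hamiltonian systems of the rescaled frames *)

Section c1_closure.
Context {R : realType} {N : nat}.
Local Notation E := 'rV[R]_N.
Implicit Types (phi psi : R -> E -> R) (g h : E -> R).

(** The gradient is chosen before the radius, as the single [DH] in [convH] requires. *)
Definition cc phi g := exists G, forall rho : R, 0 <= rho -> c1conv rho phi g G.

Lemma cc_const (k : R) : cc (fun _ _ => k) (fun=> k).
Proof. by eexists => rho _; exact: c1conv_const. Qed.

Lemma cc_coord (i : 'I_N) : cc (fun _ a => a 0 i) (fun a => a 0 i).
Proof. by eexists => rho r0; exact: c1conv_coord. Qed.

Lemma ccM phi psi g h : cc phi g -> cc psi h ->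
  cc (fun e a => phi e a * psi e a) (fun a => g a * h a).
Proof.
by move=> [G HG] [G' HG']; eexists => rho r0; exact: (c1convM _ _ _ _ _ _ _ r0 (HG _ r0) (HG' _ r0)).
Qed.

Lemma cc_sum n (phi : 'I_n -> R -> E -> R) (g : 'I_n -> E -> R) :
  (forall i, cc (phi i) (g i)) -> cc (fun e a => \sum_i phi i e a) (fun a => \sum_i g i a).
Proof.
by move=> /choice[G HG]; eexists => rho r0; apply: c1conv_sum => i; exact: HG.
Qed.

Lemma ccN phi g : cc phi g -> cc (fun e a => - phi e a) (fun a => - g a).
Proof.
move=> H; have := ccM _ _ _ _ (cc_const (-1)) H.
rewrite (_ : (fun e a => -1 * phi e a) = fun e a => - phi e a); last first.
  by apply/funext => e; apply/funext => a; rewrite mulN1r.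
by rewrite (_ : (fun a => -1 * g a) = fun a => - g a)//; apply/funext => a; rewrite mulN1r.
Qed.

(** The coefficients of the rescaled frame have affine limits. The gradient is then constant, and
    only the rate O(eps) at 0 and on increments has to be checked. *)
Lemma cc_affine phi g (c : 'I_N -> R) :
  (forall a, g a = g 0 + \sum_k c k * a 0 k) ->
  (forall rho : R, 0 <= rho -> exists2 D : R, 0 <= D & exists2 e0 : R, 0 < e0 &
    forall eps : R, 0 < eps -> eps < e0 ->
     `|phi eps 0 - g 0| <= D * eps /\
     forall a b : E, `|a| <= rho -> `|b| <= rho ->
       `|phi eps a - phi eps b - \sum_k c k * (a - b) 0 k| <= D * eps * `|a - b|) ->
  cc phi g.
Proof.
move=> gE H; exists (fun _ => c) => rho r0; have [D D0 [e0 e00 He]] := H rho r0.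
pose S := \sum_k `|c k|.
have S0 : 0 <= S by apply: sumr_ge0.
have cS k : `|c k| <= S by rewrite /S (bigD1 k)//= lerDl sumr_ge0.
have gb (a : E) : `|\sum_k c k * a 0 k| <= S * `|a|.
  apply: (le_trans (ler_norm_sum _ _ _)); rewrite /S mulr_suml; apply: ler_sum => k _.
  by rewrite normrM ler_wpM2l//; exact: rv_norm_ge.
pose C := `|g 0| + S * rho + S.
have Sr : 0 <= S * rho by rewrite mulr_ge0.
exists C; split.
  split.
  - by rewrite /C; have := normr_ge0 (g 0); lra.
  - move=> a ar; rewrite gE; apply: (le_trans (ler_normD _ _)).
    have : S * `|a| <= S * rho by rewrite ler_wpM2l.
    have := gb a; rewrite /C; lra.
  - by move=> a k _; have := cS k; rewrite /C; have := normr_ge0 (g 0); lra.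
  - move=> a b k _ _; rewrite subrr normr0 mulr_ge0// /C.
    by have := normr_ge0 (g 0); lra.
move=> kap k0.
have [z z0 Hz] := small_positive _ _ k0 (mulr_ge0 D0 (addr_ge0 ler01 r0)).
exists (Num.min e0 z); first by rewrite lt_min e00.
move=> eps ep; rewrite lt_min => /andP[ep0 epz].
have [h1 h2] := He _ ep ep0.
have small : D * eps * (1 + rho) <= kap.
  have h : D * (1 + rho) * eps <= D * (1 + rho) * z.
    by apply: ler_wpM2l; [apply: mulr_ge0 => //; exact: addr_ge0|exact: ltW].
  lra.
have Dep : 0 <= D * eps by rewrite mulr_ge0// ltW.
have z1 : `|0 : E| <= rho by rewrite normr0.
split.
- move=> a ar; have := h2 a 0 ar z1; rewrite subr0 => h3.
  have -> : phi eps a - g a = (phi eps a - phi eps 0 - \sum_k c k * a 0 k) + (phi eps 0 - g 0).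
    by rewrite gE; ring.
  apply: (le_trans (ler_normD _ _)); apply: le_trans small.
  have : D * eps * `|a| <= D * eps * rho by rewrite ler_wpM2l.
  lra.
- move=> a b x ha hb hx; apply: (le_trans (h2 a b ha hb)); rewrite ler_wpM2r//.
  have C0 : 0 <= C by rewrite /C; have := normr_ge0 (g 0); lra.
  have : 0 <= C * (`|a - x| + `|b - x|) by rewrite mulr_ge0// addr_ge0.
  have : 0 <= D * eps * rho by rewrite mulr_ge0.
  lra.
Qed.

End c1_closure.

Section hamiltonian.
Context {R : realType} {m d : nat}.

Definition ham_h (phi : 'I_m -> 'I_d -> 'rV[R]_d -> R) (y : 'rV[R]_(d + d)) j : R :=
  \sum_k y 0 (rshift d k) * phi j k (lsubmx y).

(** The Hamiltonian vector field of half the sum of the squares of [ham_h], provided that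
    [Gam j k l] is the l-th partial derivative of [phi j k]. Keeping [Gam] as a separate argument
    lets its convergence be checked coefficient by coefficient. *)
Definition ham (phi : 'I_m -> 'I_d -> 'rV[R]_d -> R) (Gam : 'I_m -> 'I_d -> 'I_d -> 'rV[R]_d -> R)
    (y : 'rV[R]_(d + d)) : 'rV[R]_(d + d) :=
  row_mx (\row_k \sum_j ham_h phi y j * phi j k (lsubmx y))
         (\row_l - \sum_j ham_h phi y j * \sum_k y 0 (rshift d k) * Gam j k l (lsubmx y)).

Lemma ham_cc (phi : R -> 'I_m -> 'I_d -> 'rV[R]_d -> R) phi0 Gam Gam0 :
  (forall j k, cc (fun e (y : 'rV[R]_(d + d)) => phi e j k (lsubmx y)) (fun y => phi0 j k (lsubmx y))) ->
  (forall j k l, cc (fun e (y : 'rV[R]_(d + d)) => Gam e j k l (lsubmx y)) (fun y => Gam0 j k l (lsubmx y))) ->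
  exists DH, forall rho : R, 0 <= rho -> forall i,
    c1conv rho (fun e a => ham (phi e) (Gam e) a 0 i) (fun a => ham phi0 Gam0 a 0 i) (DH i).
Proof.
move=> Hphi HGam.
suff /choice[DH H] : forall i, cc (fun e a => ham (phi e) (Gam e) a 0 i) (fun a => ham phi0 Gam0 a 0 i).
  by exists DH => rho r0 i; exact: H.
have Hh j : cc (fun e y => ham_h (phi e) y j) (fun y => ham_h phi0 y j).
  by apply: cc_sum => k; apply: ccM; [exact: cc_coord|exact: Hphi].
move=> i; case: (split_ordP i) => k ->.
  rewrite (_ : (fun e a => _) = fun e a => \sum_j ham_h (phi e) a j * phi e j k (lsubmx a)); last first.
    by apply/funext => e; apply/funext => a; rewrite row_mxEl mxE.
  rewrite (_ : (fun a => _) = fun a => \sum_j ham_h phi0 a j * phi0 j k (lsubmx a)); last first.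
    by apply/funext => a; rewrite row_mxEl mxE.
  by apply: cc_sum => j; apply: ccM.
rewrite (_ : (fun e a => _) = fun e a => - \sum_j ham_h (phi e) a j *
    \sum_l a 0 (rshift d l) * Gam e j l k (lsubmx a)); last first.
  by apply/funext => e; apply/funext => a; rewrite row_mxEr mxE.
rewrite (_ : (fun a => _) = fun a => - \sum_j ham_h phi0 a j *
    \sum_l a 0 (rshift d l) * Gam0 j l k (lsubmx a)); last first.
  by apply/funext => a; rewrite row_mxEr mxE.
apply: ccN; apply: cc_sum => j; apply: ccM => //.
by apply: cc_sum => l; apply: ccM; [exact: cc_coord|exact: HGam].
Qed.

End hamiltonian.

Section rescaled_frame.
Context {R : realType} {n : nat}.
Local Notation m := (2 * n)%N.
Local Notation d := (2 * n + 1)%N.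
Local Notation E := 'rV[R]_(2 * n + 1).
Variables (f : 'I_(2 * n) -> E -> E) (r C : R).
Hypothesis r0 : 0 < r.
Hypothesis C0 : 0 <= C.
Hypothesis fC : forall i, C11_on 0 r C (f i).
Hypothesis f0 : forall i, f i 0 0 (rshift m 0) = 0.
Local Notation dl l := (delta_mx 0 l : E).

Lemma split_lshift (i : 'I_m) : fintype.split (lshift 1 i) = inl i.
Proof. exact: (unsplitK (inl i)). Qed.

Lemma split_rshift (i : 'I_1) : fintype.split (rshift m i) = inr i.
Proof. exact: (unsplitK (inr i)). Qed.

Definition wt (eps : R) (k : 'I_d) : R := if fintype.split k is inl _ then eps else eps ^+ 2.

Lemma wt_l eps (i : 'I_m) : wt eps (lshift 1 i) = eps.
Proof. by rewrite /wt split_lshift. Qed.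

Lemma wt_r eps (i : 'I_1) : wt eps (rshift m i) = eps ^+ 2.
Proof. by rewrite /wt split_rshift. Qed.

Lemma wt_gt0 eps k : 0 < eps -> 0 < wt eps k.
Proof. by move=> e0; rewrite /wt; case: fintype.split => // _; exact: exprn_gt0. Qed.

Lemma wt_le eps k : 0 < eps -> eps <= 1 -> wt eps k <= eps.
Proof. by move=> e0 e1; rewrite /wt; case: fintype.split => // _; rewrite expr2 ler_piMr// ltW. Qed.

Lemma dilationE (eps : R) (x : E) k : dilation eps x 0 k = wt eps k * x 0 k.
Proof.
rewrite /dilation; case: (split_ordP k) => i ->; first by rewrite row_mxEl wt_l !mxE.
by rewrite row_mxEr wt_r !mxE.
Qed.

Lemma dilationB (eps : R) (x y : E) : dilation eps x - dilation eps y = dilation eps (x - y).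
Proof. by apply/rowP => k; rewrite [RHS]dilationE [LHS]mxE [X in _ + X = _]mxE !dilationE !mxE mulrBr. Qed.

Lemma dilation_norm (eps : R) (x : E) : 0 < eps -> eps <= 1 -> `|dilation eps x| <= eps * `|x|.
Proof.
move=> e0 e1; apply: rv_norm_le => [|k]; first by rewrite mulr_ge0// ltW.
rewrite dilationE normrM; apply: ler_pM => //; last exact: rv_norm_ge.
by rewrite gtr0_norm ?wt_gt0// wt_le.
Qed.

Lemma dilation0 (eps : R) : dilation eps 0 = 0 :> E.
Proof. by apply/rowP => k; rewrite dilationE !mxE mulr0. Qed.

Lemma dilationK (eps : R) (x : E) : 0 < eps -> dilation eps^-1 (dilation eps x) = x.
Proof.
move=> e0; apply/rowP => k; rewrite !dilationE mulrA (_ : wt eps^-1 k * wt eps k = 1) ?mul1r//.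
by rewrite /wt; case: fintype.split => _; rewrite -?exprMn mulVf ?expr1n// gt_eqF.
Qed.

(** Component [k] of the rescaled frame vector [eps (delta_(1/eps))_* f_j] at [q]. [Geps] is its
    partial derivative in direction [l], by the chain rule. *)
Definition feps (eps : R) j k (q : E) : R := eps * (wt eps k)^-1 * f j (dilation eps q) 0 k.
Definition Geps (eps : R) j k l (q : E) : R :=
  eps * (wt eps k)^-1 * wt eps l * 'D_(dl l) (f j) (dilation eps q) 0 k.

Definition frame_A : 'M[R]_m := \matrix_(j, i) f j 0 0 (lshift 1 i).
Definition frame_B : 'M[R]_m := \matrix_(j, l) 'D_(dl (lshift 1 l)) (f j) 0 0 (rshift m 0).
Local Notation A := frame_A.
Local Notation B := frame_B.

Definition phi0 (j : 'I_m) (k : 'I_d) (q : E) : R :=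
  if fintype.split k is inl i then A j i else \sum_l B j l * q 0 (lshift 1 l).
Definition Gam0 (j : 'I_m) (k l : 'I_d) (q : E) : R :=
  if fintype.split k is inl i then 0 else if fintype.split l is inl l' then B j l' else 0.

Let small_eps (rho : R) : 0 <= rho -> exists2 e0 : R, 0 < e0 & forall eps, 0 < eps -> eps < e0 ->
  eps <= 1 /\ forall q : E, `|q| <= rho -> `|dilation eps q - 0| <= r.
Proof.
move=> rho0; have [z z0 Hz] := small_positive _ _ r0 rho0.
exists (Num.min 1 z); first by rewrite lt_min ltr01.
move=> eps e0; rewrite lt_min => /andP[e1 ez]; split; first exact: ltW.
move=> q qr; rewrite subr0; apply: (le_trans (dilation_norm _ _ e0 (ltW e1))).
apply: le_trans Hz; apply: ler_pM => //; exact: ltW.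
Qed.

Let vec_comp (x y : E) k (e : R) : `|x - y| <= e -> `|x 0 k - y 0 k| <= e.
Proof. by move=> h; have := le_trans (rv_norm_ge (x - y) k) h; rewrite !mxE. Qed.

Let dil_diff (eps : R) (a b : E) : 0 < eps -> eps <= 1 ->
  `|dilation eps a - dilation eps b| <= eps * `|a - b|.
Proof. by move=> e0 e1; rewrite dilationB; exact: dilation_norm. Qed.

Let lsub_diff (a b : 'rV[R]_(d + d)) : `|lsubmx a - lsubmx b| <= `|a - b|.
Proof. by rewrite -linearB/=; exact: lsubmx_norm. Qed.

Let lsub_le (a : 'rV[R]_(d + d)) (rho : R) : `|a| <= rho -> `|lsubmx a| <= rho.
Proof. by move=> h; exact: le_trans (lsubmx_norm a) h. Qed.

Let sum0 (N : nat) (a : 'rV[R]_N) : \sum_(k < N) (fun=> 0) k * a 0 k = 0.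
Proof. by apply: big1 => k _; rewrite mul0r. Qed.

Let nball0 : `|(0 : E) - 0| <= r. Proof. by rewrite subrr normr0 ltW. Qed.

(** For horizontal components the factors [eps] cancel and the Lipschitz bound suffices. For the
    vertical one a factor [eps^-1] remains; it is compensated because the component vanishes at 0,
    and the second order expansion leaves an error O(eps). *)
Lemma feps_cc j k : cc (fun e (y : 'rV[R]_(d + d)) => feps e j k (lsubmx y))
  (fun y => phi0 j k (lsubmx y)).
Proof.
case: (split_ordP k) => i ->.
- apply: (@cc_affine _ _ _ _ (fun=> 0)).
    by move=> a; rewrite sum0 addr0 /phi0 !split_lshift.
  move=> rho rho0; have [e0 e00 He] := small_eps _ rho0.
  exists C => //; exists e0 => // eps ep ep0; have [e1 Hb] := He _ ep ep0.
  have fE q : feps eps j (lshift 1 i) q = f j (dilation eps q) 0 (lshift 1 i).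
    by rewrite /feps wt_l mulfV ?mul1r// gt_eqF.
  split.
    rewrite fE linear0 dilation0 /phi0 split_lshift mxE subrr normr0.
    by rewrite mulr_ge0// ltW.
  move=> a b ha hb; rewrite sum0 subr0 !fE; apply: vec_comp.
  apply: (le_trans (C11_lip _ _ _ _ (fC j) _ _ (Hb _ (lsub_le _ _ hb)) (Hb _ (lsub_le _ _ ha)))).
  rewrite -mulrA ler_wpM2l//; apply: (le_trans (dil_diff _ _ _ ep e1)).
  by rewrite ler_wpM2l ?(ltW ep).
- rewrite (ord1 i).
  pose c (K : 'I_(d + d)) : R := if fintype.split K is inl k then
    (if fintype.split k is inl l then B j l else 0) else 0.
  have cE (a : 'rV[R]_(d + d)) : \sum_K c K * a 0 K = \sum_l B j l * (lsubmx a) 0 (lshift 1 l).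
    rewrite big_split_ord/= [X in _ + X]big1 ?addr0; last first.
      by move=> l _; rewrite /c (unsplitK (inr l : 'I_d + 'I_d)) mul0r.
    have cl k' : c (lshift d k') = if fintype.split k' is inl l then B j l else 0.
      by rewrite /c (unsplitK (inl k' : 'I_d + 'I_d)).
    rewrite big_split_ord/= [X in _ + X]big1 ?addr0; last first.
      by move=> l _; rewrite cl split_rshift mul0r.
    by apply: eq_bigr => l _; rewrite cl split_lshift !mxE.
  have Bz : \sum_l B j l * (0 : E) 0 (lshift 1 l) = 0.
    by apply: big1 => l _; rewrite !mxE mulr0.
  apply: (@cc_affine _ _ _ _ c).
    by move=> a; rewrite cE /phi0 !split_rshift linear0 Bz add0r.
  move=> rho rho0; have [e0 e00 He] := small_eps _ rho0.
  have [dd ddE dd0] : exists2 dd : R, dd = d%:R & 0 <= dd by exists d%:R.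
  pose D := C * (2 * rho) + dd * C * rho + C.
  have D1 : 0 <= C * (2 * rho) by rewrite !mulr_ge0.
  have D2 : 0 <= dd * C * rho by rewrite !mulr_ge0.
  have Dge0 : 0 <= D by rewrite /D; apply: addr_ge0 => //; exact: addr_ge0.
  exists D => //.
  exists e0 => // eps ep ep0; have [e1 Hb] := He _ ep ep0.
  have epn : eps != 0 by rewrite gt_eqF.
  have fE q : feps eps j (rshift m 0) q = eps^-1 * f j (dilation eps q) 0 (rshift m 0).
    by rewrite /feps wt_r; congr (_ * _); field.
  split.
    rewrite fE linear0 dilation0 f0 mulr0 /phi0 split_rshift Bz subrr normr0.
    by rewrite mulr_ge0 ?(ltW ep)// /D; lra.
  move=> a0 b0 ha hb; rewrite cE !fE.
  set a := lsubmx a0; set b := lsubmx b0.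
  pose x := dilation eps a; pose y := dilation eps b.
  have hx : `|x - 0| <= r by apply: Hb; exact: lsub_le.
  have hy : `|y - 0| <= r by apply: Hb; exact: lsub_le.
  have xy : `|x - y| <= eps * `|a - b| by exact: dil_diff.
  have ab0 : `|a - b| <= `|a0 - b0| by exact: lsub_diff.
  have ab2 : `|a - b| <= 2 * rho.
    have := ler_normB a b; have := lsub_le _ _ ha; have := lsub_le _ _ hb; rewrite -/a -/b; lra.
  (* The increment is linearized at [y] ([q1]), the derivative is moved to the origin ([q2]), and
     its vertical direction, of weight [eps ^+ 2], is split off ([q3]). After division by [eps] all
     errors are O(eps). *)
  have q1 : `|f j x 0 (rshift m 0) - f j y 0 (rshift m 0) -
      \sum_l (x - y) 0 l * 'D_(dl l) (f j) y 0 (rshift m 0)| <= C * `|x - y| ^+ 2.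
    have := le_trans (rv_norm_ge _ (rshift m 0)) (C11_quad _ _ _ _ (fC j) _ _ hy hx).
    rewrite !mxE summxE; under eq_bigr do rewrite mxE; by [].
  have q2 : `|\sum_l (x - y) 0 l * 'D_(dl l) (f j) y 0 (rshift m 0) -
      \sum_l (x - y) 0 l * 'D_(dl l) (f j) 0 0 (rshift m 0)| <= dd * (`|x - y| * (C * `|y|)).
    rewrite -sumrB; apply: (le_trans (ler_norm_sum _ _ _)).
    apply: (@le_trans _ _ (\sum_(l < d) (`|x - y| * (C * `|y|)))); last first.
      by rewrite sumr_const card_ord ddE mulr_natl.
    apply: ler_sum => l _; rewrite -mulrBr normrM; apply: ler_pM => //; first exact: rv_norm_ge.
    by apply: vec_comp; have := C11_dlip _ _ _ _ (fC j) _ _ l nball0 hy; rewrite !subr0.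
  have q3 : \sum_l (x - y) 0 l * 'D_(dl l) (f j) 0 0 (rshift m 0) =
      eps * (\sum_l B j l * (a - b) 0 (lshift 1 l)) +
      eps ^+ 2 * ((a - b) 0 (rshift m 0) * 'D_(dl (rshift m 0)) (f j) 0 0 (rshift m 0)).
    rewrite /x /y dilationB big_split_ord/= big_ord1 dilationE wt_r -mulrA; congr (_ + _).
    rewrite mulr_sumr; apply: eq_bigr => l _; rewrite dilationE wt_l [B j l]mxE; ring.
  set z := (a - b) 0 (rshift m 0) * _ in q3.
  have hz : `|z| <= C * `|a - b|.
    rewrite /z normrM mulrC; apply: ler_pM => //; last exact: rv_norm_ge.
    exact: le_trans (rv_norm_ge _ _) (C11_dbound _ _ _ _ (fC j) _ _ nball0).
  set fx := f j x 0 (rshift m 0) in q1 *; set fy := f j y 0 (rshift m 0) in q1 *.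
  set S1 := \sum_l _ * 'D_(dl l) (f j) y 0 _ in q1 q2.
  set S2 := \sum_l _ * 'D_(dl l) (f j) 0 0 _ in q2 q3.
  have -> : lsubmx (a0 - b0) = a - b by rewrite linearB.
  set S3 := \sum_l B j l * _ in q3 *.
  have -> : eps^-1 * fx - eps^-1 * fy - S3 = eps^-1 * ((fx - fy - S1) + (S1 - S2)) + eps * z.
    by rewrite q3; field.
  have ei : 0 < eps^-1 by rewrite invr_gt0.
  have yb : `|y| <= eps * rho.
    apply: (le_trans (dilation_norm _ _ ep e1)); rewrite ler_pM2l//; exact: lsub_le.
  have t1 : C * `|x - y| ^+ 2 <= eps ^+ 2 * (C * (2 * rho) * `|a - b|).
    apply: (@le_trans _ _ (C * (eps * `|a - b|) ^+ 2)).
      by rewrite ler_wpM2l// lerXn2r// nnegrE// mulr_ge0// ltW.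
    have -> : eps ^+ 2 * (C * (2 * rho) * `|a - b|) = C * (eps ^+ 2 * ((2 * rho) * `|a - b|)) by ring.
    by rewrite ler_wpM2l// exprMn ler_wpM2l ?exprn_ge0 ?(ltW ep)// expr2 ler_wpM2r.
  have t2 : dd * (`|x - y| * (C * `|y|)) <= eps ^+ 2 * (dd * C * rho * `|a - b|).
    have -> : eps ^+ 2 * (dd * C * rho * `|a - b|) = dd * ((eps * `|a - b|) * (C * (eps * rho))) by ring.
    rewrite ler_wpM2l//; apply: ler_pM => //; first by rewrite mulr_ge0.
    by rewrite ler_wpM2l.
  apply: (le_trans (ler_normD _ _)).
  rewrite (normrM eps) (normrM eps^-1) (gtr0_norm ep) (gtr0_norm ei).
  have t3 : eps^-1 * `|fx - fy - S1 + (S1 - S2)| <=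
      eps^-1 * (eps ^+ 2 * ((C * (2 * rho) + dd * C * rho) * `|a - b|)).
    rewrite ler_pM2l//; apply: (le_trans (ler_normD _ _)).
    have := le_trans q1 t1; have := le_trans q2 t2; lra.
  have t4 : eps^-1 * (eps ^+ 2 * ((C * (2 * rho) + dd * C * rho) * `|a - b|)) =
      eps * ((C * (2 * rho) + dd * C * rho) * `|a - b|) by field.
  have t5 : eps * `|z| <= eps * (C * `|a - b|) by rewrite ler_pM2l.
  apply: (@le_trans _ _ (D * eps * `|a - b|)).
    by rewrite /D; lra.
  by rewrite ler_wpM2l// mulr_ge0 ?(ltW ep)// /D; lra.
Qed.

(** The factor [eps * (wt eps k)^-1 * wt eps l] is 1 when [k] is vertical and [l] horizontal, the
    only case with a possibly nonzero limit, and [eps] or [eps ^+ 2] otherwise. *)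
Lemma Geps_cc j k l : cc (fun e (y : 'rV[R]_(d + d)) => Geps e j k l (lsubmx y))
  (fun y => Gam0 j k l (lsubmx y)).
Proof.
apply: (@cc_affine _ _ _ _ (fun=> 0)).
  by move=> a; rewrite sum0 addr0 /Gam0.
move=> rho rho0; have [e0 e00 He] := small_eps _ rho0.
exists C => //; exists e0 => // eps ep ep0; have [e1 Hb] := He _ ep ep0.
have epn : eps != 0 by rewrite gt_eqF.
have lipD q q' : `|q| <= rho -> `|q'| <= rho ->
    `|'D_(dl l) (f j) (dilation eps q) 0 k - 'D_(dl l) (f j) (dilation eps q') 0 k| <= C * (eps * `|q - q'|).
  move=> hq hq'; apply: vec_comp.
  apply: (le_trans (C11_dlip _ _ _ _ (fC j) _ _ l (Hb _ hq') (Hb _ hq))).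
  by rewrite ler_wpM2l//; exact: dil_diff.
have coef : `|eps * (wt eps k)^-1 * wt eps l| <= 1.
  rewrite gtr0_norm ?mulr_gt0 ?invr_gt0 ?wt_gt0//.
  case: (split_ordP k) => i ->; case: (split_ordP l) => i' ->; rewrite ?wt_l ?wt_r.
  - by rewrite mulfV// mul1r.
  - by rewrite mulfV// mul1r expr2 mulr_ile1// ltW.
  - by rewrite (_ : eps * (eps ^+ 2)^-1 * eps = 1)//; field.
  - by rewrite mulfVK ?expf_neq0.
split; last first.
  move=> a b ha hb; rewrite sum0 subr0 /Geps -mulrBr normrM -[leRHS]mul1r.
  apply: ler_pM => //; apply: (le_trans (lipD _ _ (lsub_le _ _ ha) (lsub_le _ _ hb))).
  by rewrite -mulrA ler_wpM2l// ler_wpM2l ?(ltW ep)//; exact: lsub_diff.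
rewrite linear0 /Geps dilation0.
have Db : `|'D_(dl l) (f j) 0 0 k| <= C.
  exact: le_trans (rv_norm_ge _ _) (C11_dbound _ _ _ _ (fC j) _ _ nball0).
case: (split_ordP k) => i Ek; rewrite Ek in Db *; case: (split_ordP l) => i' El; rewrite El in Db *;
  rewrite /Gam0 ?split_lshift ?split_rshift ?wt_l ?wt_r ?subr0.
- rewrite mulfV// mul1r normrM mulrC (gtr0_norm ep); exact: ler_wpM2r (ltW ep) _ _ Db.
- rewrite mulfV// mul1r normrM mulrC; apply: ler_pM => //.
  by rewrite gtr0_norm ?exprn_gt0// expr2 ler_piMr// ltW.
- rewrite (_ : eps * (eps ^+ 2)^-1 * eps = 1); last by field.
  by rewrite (ord1 i) mul1r mxE subrr normr0 mulr_ge0// ltW.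
- by rewrite mulfVK ?expf_neq0// normrM mulrC (gtr0_norm ep) ler_wpM2r// ltW.
Qed.

End rescaled_frame.

(** * The nilpotent approximation, its extremals and their rescaling *)

Section nilpotent_limit.
Context {R : realType} {n : nat}.
Local Notation m := (2 * n)%N.
Local Notation d := (2 * n + 1)%N.
Local Notation E := 'rV[R]_(2 * n + 1).
Variables (f : 'I_(2 * n) -> E -> E) (r C : R).
Hypothesis r0 : 0 < r.
Hypothesis C0 : 0 <= C.
Hypothesis fC : forall i, C11_on 0 r C (f i).
Hypothesis f0 : forall i, f i 0 0 (rshift m 0) = 0.
Local Notation dl l := (delta_mx 0 l : E).
Local Notation A := (frame_A f).
Local Notation B := (frame_B f).

Lemma wtV (eps : R) (k : 'I_d) : wt eps^-1 k = (wt eps k)^-1.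
Proof. by rewrite /wt; case: fintype.split => // _; rewrite exprVn. Qed.

Lemma diff_dilation (eps : R) (x v : E) : 'd (dilation eps) x v = dilation eps v.
Proof.
pose D : 'M[R]_d := diag_mx (\row_k wt eps k).
have dE : dilation eps = mulmxr D.
  apply/funext => z; apply/rowP => k; rewrite dilationE /= mul_mx_diag !mxE mulrC.
  by [].
rewrite dE diff_lin//.
exact: mulmxr_continuous.
Qed.

Lemma nilpotent_frameE j x k : nilpotent_frame f j x 0 k = phi0 f j k x.
Proof.
suff cv : (eps *: vf_pushforward (dilation eps^-1) (dilation eps) (f j) x
   @[eps --> 0^'+]) --> (\row_k phi0 f j k x : E).
  by rewrite /nilpotent_frame (cvg_lim (@norm_hausdorff _ _) cv) mxE.
have /choice[e He] : forall k, exists G, forall rho : R, 0 <= rho -> c1conv rho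
    (fun e (y : 'rV[R]_(d + d)) => feps f e j k (lsubmx y)) (fun y => phi0 f j k (lsubmx y)) G.
  by move=> k'; exact: (feps_cc f r C r0 C0 fC f0 j k').
apply/cvgrPdist_le => eta eta0.
have /(@uniform_threshold R d (fun k eps => `|phi0 f j k x - feps f eps j k x| <= eta)) [e1 e10 He1] :
  forall i : 'I_d, exists2 e1 : R, 0 < e1 & forall eps, 0 < eps -> eps < e1 ->
    `|phi0 f j i x - feps f eps j i x| <= eta.
  move=> i; have [C' [_ H]] := He i `|x| (normr_ge0 x).
  have [e1 e10 He1] := H _ eta0; exists e1 => // eps ep ep1.
  have [v _] := He1 _ ep ep1; rewrite distrC.
  (* The convergence is stated on phase space; zero momentum is taken. *)
  have := v (row_mx x 0); rewrite row_mxKl; apply.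
  apply: rv_norm_le => // k'; case: (split_ordP k') => l ->.
    by rewrite row_mxEl; exact: rv_norm_ge.
  by rewrite row_mxEr mxE normr0.
near=> eps; have ep : 0 < eps by near: eps; exact: nbhs_right_gt.
have ep1 : eps < e1 by near: eps; exact: nbhs_right_lt.
apply: rv_norm_le; first exact: ltW.
move=> k'; rewrite /vf_pushforward diff_dilation.
have -> : ((\row_k phi0 f j k x : E) - eps *: dilation eps^-1 (f j (dilation eps x))) 0 k' =
    phi0 f j k' x - feps f eps j k' x; last exact: He1.
rewrite [LHS]mxE [X in X + _]mxE; congr (_ + _); rewrite [LHS]mxE; congr (- _).
by rewrite [LHS]mxE dilationE wtV /feps mulrA.
Unshelve. all: by end_near. Qed.

Lemma phi0_l j i x : phi0 f j (lshift 1 i) x = A j i.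
Proof. by rewrite /phi0 split_lshift. Qed.

Lemma phi0_r j i x : phi0 f j (rshift m i) x = \sum_l B j l * x 0 (lshift 1 l).
Proof. by rewrite /phi0 split_rshift. Qed.

Lemma nilpotent_frame_mx x : frame_mx (nilpotent_frame f) x = row_mx A (B *m (lsubmx x)^T).
Proof.
apply/matrixP => j k; rewrite [LHS]mxE nilpotent_frameE /phi0.
case: (split_ordP k) => i ->.
  by rewrite row_mxEl.
rewrite (ord1 i) row_mxEr mxE; apply: eq_bigr => l _; by congr (_ * _); rewrite [RHS]mxE [RHS]mxE.
Qed.

Hypothesis uA : A \in unitmx.

(** The multiplier [q] becomes the conserved vertical momentum, and the horizontal momentum is
    determined by requiring that the functions [ham_h] equal the controls. *)
Lemma hat_geodesic_sol gamma : geodesic (nilpotent_approximation f) gamma -> 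
  (forall t, t <= 0 -> gamma t = gamma 0) -> (forall t, 1 <= t -> gamma t = gamma 1) ->
  exists y : R -> 'rV[R]_(d + d), sol (ham (phi0 f) (Gam0 f)) y /\
    forall t, lsubmx (y t) = gamma t.
Proof.
move=> gg g0 g1.
have [lg [c [q H]]] := geodesic_ode A B (nilpotent_frame f) uA nilpotent_frame_mx gamma gg.
pose U t : 'rV[R]_m := lsubmx (gamma t) *m invmx A.
pose K := B *m A^T.
pose crow : 'rV[R]_m := \row_i c i.
(* Pairing with the frame gives [c - q * U K] from [px] and [q * U K^T] from the vertical momentum,
   which together are the controls [v]. *)
pose px t : 'rV[R]_m := crow *m (invmx A)^T - q *: (U t *m B).
pose p t : E := row_mx (px t) (const_mx q).
pose y t : 'rV[R]_(d + d) := row_mx (gamma t) (p t).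
have yl t : lsubmx (y t) = gamma t by rewrite row_mxKl.
have yr t k : y t 0 (rshift d k) = p t 0 k by rewrite row_mxEr.
have UE t i : controls_int A gamma i t = U t 0 i by [].
have xE t : lsubmx (gamma t) = U t *m A by rewrite /U mulmxKV.
pose v t i := c i + q * \sum_j (K - K^T) i j * U t 0 j.
have hE t j : ham_h (phi0 f) (y t) j = v t j.
  rewrite /ham_h; under eq_bigr do rewrite yr yl.
  rewrite big_split_ord/= big_ord1 phi0_r /p row_mxEr [const_mx q _ _]mxE.
  have -> : \sum_l B j l * gamma t 0 (lshift 1 l) = (U t *m K^T) 0 j.
    rewrite /K trmx_mul trmxK mulmxA -xE mxE; apply: eq_bigr => l _.
    by rewrite [lsubmx _ _ _]mxE [B^T _ _]mxE mulrC.
  rewrite (eq_bigr (fun i => px t 0 i * A^T i j)); last first.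
    by move=> i _; rewrite row_mxEl phi0_l [A^T i j]mxE.
  have -> : \sum_i px t 0 i * A^T i j = (px t *m A^T) 0 j by rewrite mxE.
  have -> : px t *m A^T = crow - q *: (U t *m K).
    rewrite /px mulmxBl -mulmxA -trmx_mul mulmxV// trmx1 mulmx1 -scalemxAl -(mulmxA (U t)).
    by [].
  rewrite /v !mxE -addrA; congr (_ + _).
  have -> : \sum_i (K - K^T) j i * U t 0 i = \sum_i U t 0 i * K^T i j - \sum_i U t 0 i * K i j.
    by rewrite -sumrB; apply: eq_bigr => i _; rewrite !mxE; ring.
  rewrite mulrBr addrC; congr (_ + _).
have dU (t : R) i : 0 < t -> t < 1 -> is_derive t 1 (fun s => U s 0 i) (v t i).
  by move=> t0 t1; have [h _] := H t t0 t1; exact: h.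
(* [sol] asks for continuity on the whole line; the clauses on [gamma] outside [0, 1] identify it
   with its composition with [clamp 0 1]. *)
have cg : continuous gamma.
  apply: rv_continuousP => k.
  rewrite (_ : (fun t => _) = (fun t => gamma t 0 k) \o clamp 0 1); last first.
    apply/funext => t /=; have [t0|t0] := leP t 0.
      by rewrite g0// (g0 (clamp 0 1 t))// /clamp ge_max lexx ge_min t0 orbT.
    have [t1|t1] := leP 1 t; last by rewrite clamp_id ?ltW.
    by rewrite g1// (g1 (clamp 0 1 t))// /clamp (min_idPl t1) le_max lexx orbT.
  exact: lip_on_clamp_continuous.
have cU i : continuous (fun t => U t 0 i).
  move=> t; rewrite (_ : (fun s => _) = fun s => \sum_j gamma s 0 (lshift 1 j) * invmx A j i); last first.
    by apply/funext => s; rewrite mxE; apply: eq_bigr => j _; rewrite mxE.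
  apply: continuous_at_sum => j; apply: cvgM; last exact: cvg_cst.
  by apply: rv_continuous_comp; exact: cg.
have pxE t l : px t 0 l = (crow *m (invmx A)^T) 0 l - q * \sum_i U t 0 i * B i l.
  by rewrite /px [LHS]mxE [X in _ + X]mxE [X in _ - X]mxE [X in _ - _ * X]mxE.
exists y; split=> //; split.
  apply: rv_continuousP => k; case: (split_ordP k) => i -> t.
    rewrite (_ : (fun s => _) = fun s => gamma s 0 i); last by apply/funext => s; rewrite row_mxEl.
    by apply: rv_continuous_comp; exact: cg.
  case: (split_ordP i) => l ->.
    rewrite (_ : (fun s => _) = fun s => (crow *m (invmx A)^T) 0 l - q * \sum_i U s 0 i * B i l); last first.
      by apply/funext => s; rewrite row_mxEr /p row_mxEl pxE.
    apply: cvgB; first exact: cvg_cst.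
    apply: cvgM; first exact: cvg_cst.
    by apply: continuous_at_sum => j; apply: cvgM; [exact: cU|exact: cvg_cst].
  rewrite (_ : (fun s => _) = fun=> q); first exact: cvg_cst.
  by apply/funext => s; rewrite row_mxEr /p row_mxEr mxE.
move=> t k t0 t1.
have dsum (a : 'I_m -> R) : is_derive t 1 (fun s => \sum_i U s 0 i * a i) (\sum_i v t i * a i).
  apply: is_derive_suml => i.
  apply: (is_derive_ext _ _ _ _ _ (is_deriveMl _ _ _ _ _ (dU t i t0 t1) (is_derive_cstl t (a i)))) => //.
  by rewrite mulr0 addr0.
case: (split_ordP k) => i ->; rewrite /ham ?row_mxEl ?row_mxEr mxE yl; last first.
  case: (split_ordP i) => l ->.
    rewrite (_ : (fun s => _) = fun s => (crow *m (invmx A)^T) 0 l - q * \sum_i U s 0 i * B i l); last first.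
      by apply/funext => s; rewrite yr /p row_mxEl pxE.
    apply: (is_derive_ext _ _ _ _ _ (is_deriveBl _ _ _ _ _ (is_derive_cstl t _)
      (is_deriveMl _ _ _ _ _ (is_derive_cstl t q) (dsum (B^~ l))))) => //.
    rewrite mul0r !add0r; congr (- _); rewrite mulr_sumr; apply: eq_bigr => j _.
    rewrite hE mulrCA; congr (_ * _).
    rewrite big_split_ord/= big1 ?add0r; last first.
      by move=> k' _; rewrite /Gam0 split_lshift mulr0.
    by rewrite big_ord1 yr /p row_mxEr [const_mx q _ _]mxE /Gam0 split_rshift split_lshift.
  rewrite (_ : (fun s => _) = fun=> q); last by apply/funext => s; rewrite yr /p row_mxEr mxE.
  rewrite big1 ?oppr0; first exact: is_derive_cstl.
  move=> j _; rewrite big1 ?mulr0// => k' _; rewrite /Gam0.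
  by case: (fintype.split k') => _; rewrite ?split_rshift mulr0.
rewrite (_ : (fun s => _) = fun s => gamma s 0 i); last by apply/funext => s; rewrite row_mxEl.
under eq_bigr do rewrite hE.
case: (split_ordP i) => l ->.
  under eq_bigr do rewrite phi0_l.
  apply: (is_derive_ext _ _ _ _ _ (dsum (A^~ l))) => // s.
  have := congr1 (fun x : 'rV[R]_m => x 0 l) (xE s); rewrite [lsubmx _ _ _]mxE => ->.
  by rewrite [RHS]mxE.
rewrite (ord1 l); have [_ h] := H t t0 t1.
apply: (is_derive_ext _ _ _ _ _ h) => //.
rewrite bil_dot; apply: eq_bigr => j _; congr (_ * _); rewrite phi0_r.
have -> : \sum_l B j l * gamma t 0 (lshift 1 l) = (U t *m K^T) 0 j.
  rewrite /K trmx_mul trmxK mulmxA -xE mxE; apply: eq_bigr => l' _.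
  by rewrite [lsubmx _ _ _]mxE [B^T _ _]mxE mulrC.
by rewrite mxE; apply: eq_bigr => l' _; rewrite [K^T _ _]mxE mulrC.
Qed.

(** Normal extremals of the unscaled frame: [Q] is the projection and [P] the covector. *)
Record extremal (Q P : R -> E) : Prop := {
  ext_cQ : continuous Q;
  ext_cP : continuous P;
  ext_Q : forall (t : R) k, 0 < t -> t < 1 -> is_derive t 1 (fun s => Q s 0 k)
    (\sum_j (\sum_i P t 0 i * f j (Q t) 0 i) * f j (Q t) 0 k);
  ext_P : forall (t : R) l, 0 < t -> t < 1 -> is_derive t 1 (fun s => P s 0 l)
    (- \sum_j (\sum_i P t 0 i * f j (Q t) 0 i) * \sum_k P t 0 k * 'D_(dl l) (f j) (Q t) 0 k) }.

(** Momenta transform contragrediently to positions, by [(wt eps l)^-1]. In the transported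
    coordinates the rescaled Hamiltonian is [eps ^+ 2] times the original one, and as it is
    quadratic in the momentum, multiplying [P] by [eps ^+ 2] absorbs this factor. *)
Lemma rescaled_extremal (eps : R) (y : R -> 'rV[R]_(d + d)) : 0 < eps ->
  sol (ham (feps f eps) (Geps f eps)) y ->
  extremal (fun t => dilation eps (lsubmx (y t)))
    (fun t => \row_l (eps ^+ 2 * (wt eps l)^-1 * y t 0 (rshift d l))).
Proof.
move=> ep [cy dy]; have epn : eps != 0 by rewrite gt_eqF.
have wn k : wt eps k != 0 by rewrite gt_eqF// wt_gt0.
pose Q t := dilation eps (lsubmx (y t)).
pose P t : E := \row_l (eps ^+ 2 * (wt eps l)^-1 * y t 0 (rshift d l)).
have QE s k : Q s 0 k = wt eps k * y s 0 (lshift d k) by rewrite /Q dilationE mxE.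
have hE t j : \sum_i P t 0 i * f j (Q t) 0 i = eps * ham_h (feps f eps) (y t) j.
  rewrite /ham_h mulr_sumr; apply: eq_bigr => i _; rewrite mxE /feps -/(Q t); ring.
split; rewrite -/Q -/P.
- apply: rv_continuousP => k t.
  rewrite (_ : (fun s => _) = fun s => wt eps k * y s 0 (lshift d k)); last by apply/funext => s; rewrite QE.
  by apply: cvgM; [exact: cvg_cst|apply: rv_continuous_comp; exact: cy].
- apply: rv_continuousP => k t.
  rewrite (_ : (fun s => _) = fun s => eps ^+ 2 * (wt eps k)^-1 * y s 0 (rshift d k)); last first.
    by apply/funext => s; rewrite mxE.
  by apply: cvgM; [exact: cvg_cst|apply: rv_continuous_comp; exact: cy].
- move=> t k t0 t1; have := dy t (lshift d k) t0 t1; rewrite row_mxEl mxE => h.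
  apply: (is_derive_ext _ _ _ _ _ (is_deriveMl _ _ _ _ _ (is_derive_cstl t (wt eps k)) h)).
    by move=> s; rewrite QE.
  rewrite mul0r add0r mulr_sumr; apply: eq_bigr => j _; rewrite hE /feps -/(Q t).
  have := wn k => ?; by field.
- move=> t l t0 t1; have := dy t (rshift d l) t0 t1; rewrite row_mxEr mxE => h.
  apply: (is_derive_ext _ _ _ _ _ (is_deriveMl _ _ _ _ _ (is_derive_cstl t (eps ^+ 2 * (wt eps l)^-1)) h)).
    by move=> s; rewrite mxE.
  rewrite mul0r add0r mulrN; congr (- _); rewrite mulr_sumr; apply: eq_bigr => j _; rewrite hE.
  rewrite [LHS]mulrCA -[RHS]mulrA [RHS]mulrCA; congr (_ * _); rewrite !mulr_sumr.
  apply: eq_bigr => k _; rewrite mxE /Geps -/(Q t).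
  have := wn l => ?; have := wn k => ?; by field; apply/andP.
Qed.

End nilpotent_limit.

(** * Local optimality of extremals *)

Section second_variation.
Context {R : realType} {m d : nat}.
Local Notation E := 'rV[R]_d.
Variables (f : 'I_m -> E -> E) (x0 : E) (r C Pm : R).
Hypothesis C0 : 0 <= C.
Hypothesis Pm0 : 0 <= Pm.
Hypothesis fC : forall j, C11_on x0 r C (f j).
Local Notation dl l := (delta_mx 0 l : E).
Implicit Types (a b s t : R) (w : 'I_m -> R -> R).

Definition hcov (Q P : R -> E) (j : 'I_m) t : R := \sum_i P t 0 i * f j (Q t) 0 i.

Let sum_bound (N : nat) (g : 'I_N -> R) (K : R) : (forall i, `|g i| <= K) ->
  `|\sum_i g i| <= N%:R * K.
Proof.
move=> H; apply: (le_trans (ler_norm_sum _ _ _)).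
by apply: (le_trans (ler_sum _ (fun i _ => H i))); rewrite sumr_const card_ord mulr_natl.
Qed.

Let H := d%:R * (Pm * C).
Let Hge0 : 0 <= H. Proof. by rewrite !mulr_ge0. Qed.

Let f_comp j (x : E) k : `|x - x0| <= r -> `|f j x 0 k| <= C.
Proof. by move=> xr; exact: le_trans (rv_norm_ge _ _) (C11_bound _ _ _ _ (fC j) _ xr). Qed.

Lemma hcov_bound Q P j t : `|Q t - x0| <= r -> `|P t| <= Pm -> `|hcov Q P j t| <= H.
Proof.
move=> Qr Pr; apply: sum_bound => i; rewrite normrM; apply: ler_pM => //; last exact: f_comp.
exact: le_trans (rv_norm_ge _ _) Pr.
Qed.

(** Young's inequality integrated, with [th] chosen at the end; [m%:R + 1] instead of [m%:R] keeps
    the divisor positive. *)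
Let cauchy_schwarz a b w : a < b -> (forall j, bmf (w j)) ->
  prim a (fun t => \sum_j `|w j t|) b ^+ 2 <= (m%:R + 1) * (b - a) * prim a (fun t => dot (w^~ t) (w^~ t)) b.
Proof.
move=> ab bw; set I := prim a (fun t => \sum_j `|w j t|) b; set W := prim a (fun t => dot _ _) b.
have bI : bmf (fun t => \sum_j `|w j t|) by apply: bmf_sum => j; exact: bmf_norm.
have bW : bmf (fun t => dot (w^~ t) (w^~ t)) by exact: bmf_dot.
have tau0 : 0 < b - a by rewrite subr_gt0.
have m1 : 0 < m%:R + 1 :> R by rewrite ltr_wpDl.
have key (th : R) : 2 * th * I <= m%:R * th ^+ 2 * (b - a) + W.
  have h := ac_le _ _ _ _ _ _ (ltW ab) (acZ _ _ (2 * th) _ _ (prim_ac a b _ bI))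
    (acD _ _ _ _ _ _ (acZ _ _ (m%:R * th ^+ 2) _ _ (ac_id a b)) (prim_ac a b _ bW)).
  rewrite !prim_start mulr0 subr0 addr0 -/I -/W in h.
  have -> : m%:R * th ^+ 2 * (b - a) + W = m%:R * th ^+ 2 * b + W - m%:R * th ^+ 2 * a by ring.
  apply: h; apply: ae_all => t _ _.
  have -> : m%:R * th ^+ 2 * 1 = \sum_(j < m) th ^+ 2 by rewrite sumr_const card_ord mulr1 mulr_natl.
  rewrite /dot -big_split/= mulr_sumr; apply: ler_sum => j _.
  have := sqr_ge0 (th - `|w j t|); have : `|w j t| ^+ 2 = w j t * w j t by rewrite real_normK ?num_real.
  rewrite !expr2; nra.
pose th := I / ((m%:R + 1) * (b - a)).
have mt : 0 < (m%:R + 1) * (b - a) by rewrite mulr_gt0.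
have thI : th * ((m%:R + 1) * (b - a)) = I by rewrite /th divfK// gt_eqF.
have k := key th.
have e1 : m%:R * th ^+ 2 * (b - a) <= th * I.
  rewrite -thI.
  have -> : th * (th * ((m%:R + 1) * (b - a))) = m%:R * th ^+ 2 * (b - a) + th ^+ 2 * (b - a) by ring.
  by rewrite lerDl mulr_ge0 ?sqr_ge0// ltW.
have e2 : th * I <= W by lra.
have -> : I ^+ 2 = (m%:R + 1) * (b - a) * (th * I) by rewrite mulrA [in RHS]mulrC (mulrC _ th) thI expr2.
by rewrite ler_pM2l.
Qed.

Let K2 := 2 * (m%:R * (H * (d%:R * (Pm * (C * (2 * C) ^+ 2)))) + d%:R * (Pm * (C * (2 * C)))).
Let K2ge0 : 0 <= K2.
Proof. by rewrite !mulr_ge0// addr_ge0// !mulr_ge0// ?exprn_ge0// mulr_ge0. Qed.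

(** Let [w] be the difference of the controls and [I] its L^1 norm. The first variation of the
    energy at an extremal is bounded below by a multiple of [- I ^+ 2], and [I ^+ 2] is at most
    [(m + 1) * (b - a)] times the energy of [w]. On short intervals the term [|w|^2] therefore
    wins. *)
Lemma second_variation : exists2 tau0 : R, 0 < tau0 &
  forall a b (Q P y : R -> E) (v : 'I_m -> R -> R), a < b -> b - a <= tau0 ->
  (forall t, a <= t -> t <= b -> `|Q t - x0| <= r) ->
  (forall t, a <= t -> t <= b -> `|P t| <= Pm) ->
  (forall t, a <= t -> t <= b -> `|y t - x0| <= r) ->
  (forall k, ac a b (fun t => Q t 0 k) (fun t => \sum_j hcov Q P j t * f j (Q t) 0 k)) ->
  (forall l, ac a b (fun t => P t 0 l)
     (fun t => - \sum_j hcov Q P j t * \sum_k P t 0 k * 'D_(dl l) (f j) (Q t) 0 k)) ->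
  (forall j, bmf (v j)) ->
  (forall j, bmf (hcov Q P j \o clamp a b)) ->
  (forall k, ac a b (fun t => y t 0 k) (fun t => \sum_j v j t * f j (y t) 0 k)) ->
  y a = Q a -> y b = Q b ->
  prim a (fun t => dot (fun j => hcov Q P j (clamp a b t)) (fun j => hcov Q P j (clamp a b t))) b <=
  prim a (fun t => dot (v^~ t) (v^~ t)) b.
Proof.
have half0 : 0 < 2^-1 :> R by rewrite invr_gt0 ltr0n.
(* [t1] lets half of the maximal deviation be absorbed in [m0I]; [t2] makes [K2 * (m + 1) * (b - a)]
   at most 1. *)
have [t1 t10 Ht1] := small_positive 2^-1 (m%:R * (H * C)) half0 (mulr_ge0 (ler0n R m) (mulr_ge0 Hge0 C0)).
have m1 : 0 < m%:R + 1 :> R by rewrite ltr_wpDl.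
have [t2 t20 Ht2] := small_positive 1 (K2 * (m%:R + 1)) ltr01 (mulr_ge0 K2ge0 (ltW m1)).
exists (Num.min 1 (Num.min t1 t2)); first by rewrite !lt_min ltr01 t10 t20.
move=> a b Q P y v ab; rewrite !le_min => /and3P[tau1 taut1 taut2] Qr Pr yr aQ aP bv bh ay ya yb.
pose h j t := hcov Q P j (clamp a b t).
have hE j t : a < t -> t < b -> h j t = hcov Q P j t by move=> at_ tb; rewrite /h clamp_id ?ltW.
pose w j t := v j t - h j t.
have bw j : bmf (w j) by apply: bmfB; [exact: bv|exact: bh].
pose I := prim a (fun t => \sum_j `|w j t|) b.
pose W := prim a (fun t => dot (w^~ t) (w^~ t)) b.
have bI : bmf (fun t => \sum_j `|w j t|) by apply: bmf_sum => j; exact: bmf_norm.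
have bW : bmf (fun t => dot (w^~ t) (w^~ t)) by exact: bmf_dot.
have bwh : bmf (fun t => dot (w^~ t) (h^~ t)) by exact: bmf_dot.
have tau0 : 0 < b - a by rewrite subr_gt0.
have leab := ltW ab.
have I0 : 0 <= I.
  have := ac_le _ _ _ _ _ _ leab (ac_cst a b 0) (prim_ac a b _ bI).
  by rewrite prim_start !subr0 -/I; apply; apply: ae_all => t _ _; apply: sumr_ge0.
pose xi k t := y t 0 k - Q t 0 k.
have axi k := acB _ _ _ _ _ _ (ay k) (aQ k).
pose nx t := `|y (clamp a b t) - Q (clamp a b t)|.
have cn : continuous nx.
  move=> t; apply: cvg_norm; apply: (@rv_continuousP R d R (fun t => y (clamp a b t) - Q (clamp a b t))) => k.
  rewrite (_ : (fun t => _) = (xi k) \o clamp a b); last by apply/funext => s; rewrite !mxE.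
  by apply: lip_on_clamp_continuous => //; case: (axi k).
have [ts] := @EVT_max R nx a b leab (continuous_subspaceT cn).
rewrite in_itv/= => /andP[ats tsb] Hmax.
pose m0 := nx ts.
have xim t : a <= t -> t <= b -> `|y t - Q t| <= m0.
  move=> at_ tb; have := Hmax t; rewrite in_itv/= at_ tb => /(_ isT).
  by rewrite /nx clamp_id.
have m00 : 0 <= m0 by rewrite /m0 /nx.
have hb j t : a <= t -> t <= b -> `|hcov Q P j t| <= H.
  by move=> at_ tb; apply: hcov_bound; [exact: Qr|exact: Pr].
have fd j k t : a <= t -> t <= b -> `|f j (y t) 0 k - f j (Q t) 0 k| <= C * m0.
  move=> at_ tb; have := C11_lip _ _ _ _ (fC j) _ _ (Qr t at_ tb) (yr t at_ tb).
  have := rv_norm_ge (f j (y t) - f j (Q t)) k; rewrite !mxE => h1 h2.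
  apply: (le_trans h1); apply: (le_trans h2); rewrite ler_wpM2l//; exact: xim.
(* The deviation of the trajectories is controlled by that of the controls: the equation is
   integrated up to the time [ts] of largest deviation and the Lipschitz term absorbed. *)
have m0I : m0 <= 2 * C * I.
  pose G t := m%:R * (H * C) * m0 * t + C * prim a (fun t => \sum_j `|w j t|) t.
  have aG : ac a ts G (fun t => m%:R * (H * C) * m0 * 1 + C * \sum_j `|w j t|).
    by apply: acD; apply: acZ; [exact: ac_id|exact: prim_ac].
  have Its : prim a (fun t => \sum_j `|w j t|) ts <= I.
    have := ac_le _ _ _ _ _ _ tsb (ac_cst ts b 0) (acS _ _ ts b _ _ ats (lexx b) (prim_ac a b _ bI)).
    by rewrite subrr subr_ge0; apply; apply: ae_all => t _ _; apply: sumr_ge0.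
  have bound k t : a < t -> t < ts ->
      `|\sum_j v j t * f j (y t) 0 k - \sum_j hcov Q P j t * f j (Q t) 0 k| <=
      m%:R * (H * C) * m0 * 1 + C * \sum_j `|w j t|.
    move=> at_ tts; have tb : t < b by exact: lt_le_trans tsb.
    have -> : \sum_j v j t * f j (y t) 0 k - \sum_j hcov Q P j t * f j (Q t) 0 k =
       \sum_j hcov Q P j t * (f j (y t) 0 k - f j (Q t) 0 k) + \sum_j w j t * f j (y t) 0 k.
      rewrite -sumrB -big_split/=; apply: eq_bigr => j _; rewrite /w hE//; ring.
    apply: (le_trans (ler_normD _ _)); apply: lerD.
      have -> : m%:R * (H * C) * m0 * 1 = m%:R * (H * (C * m0)) by ring.
      apply: sum_bound => j; rewrite normrM; apply: ler_pM => //; [apply: hb|apply: fd]; exact: ltW.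
    apply: (le_trans (ler_norm_sum _ _ _)); rewrite mulr_sumr; apply: ler_sum => j _.
    rewrite normrM mulrC; apply: ler_pM => //; apply: f_comp; apply: yr; exact: ltW.
  have Gts : G ts - G a <= 2^-1 * m0 + C * I.
    rewrite /G prim_start mulr0 addr0.
    have : C * prim a (fun t => \sum_j `|w j t|) ts <= C * I by rewrite ler_wpM2l.
    have : m%:R * (H * C) * m0 * (ts - a) <= 2^-1 * m0.
      have : (ts - a) * (m%:R * (H * C)) <= 2^-1.
        apply: le_trans Ht1; rewrite ler_wpM2r ?mulr_ge0//; lra.
      move=> hh; have := ler_wpM2r m00 hh; lra.
    lra.
  have : m0 <= G ts - G a.
    rewrite /m0 /nx clamp_id//; apply: rv_norm_le => [|k].
      have := ac_le _ _ _ _ _ _ ats (ac_cst a ts 0) aG; rewrite subrr; apply.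
      apply: ae_all => t _ _; apply: addr_ge0; rewrite ?mulr1; first by rewrite !mulr_ge0.
      by rewrite mulr_ge0// sumr_ge0.
    have xk := acS _ _ a ts _ _ (lexx a) tsb (axi k).
    have r1 := ac_le _ _ _ _ _ _ ats xk aG.
    have r2 := ac_le _ _ _ _ _ _ ats (acB _ _ _ _ _ _ (ac_cst a ts 0) xk) aG.
    rewrite ya subrr in r1 r2; rewrite !mxE.
    have {}r1 : y ts 0 k - Q ts 0 k <= G ts - G a.
      rewrite subr0 in r1; apply: r1; apply: ae_all => t at_ tts.
      exact: le_trans (ler_norm _) (bound k t at_ tts).
    have {}r2 : - (y ts 0 k - Q ts 0 k) <= G ts - G a.
      rewrite !sub0r oppr0 subr0 in r2; apply: r2; apply: ae_all => t at_ tts.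
      by rewrite sub0r; apply: le_trans (bound k t at_ tts); rewrite -normrN ler_norm.
    by rewrite ler_norml; apply/andP; split; lra.
  lra.
(* The first variation vanishes along an extremal: differentiate the pairing of [P]
   with the deviation [y - Q]; the remainder is quadratic in the deviation. *)
have first_var : - prim a (fun t => dot (w^~ t) (h^~ t)) b <=
    m%:R * (H * (d%:R * (Pm * (C * m0 ^+ 2)))) * (b - a) + d%:R * (Pm * (C * m0)) * I.
  pose K3 := m%:R * (H * (d%:R * (Pm * (C * m0 ^+ 2)))).
  pose K4 := d%:R * (Pm * (C * m0)).
  have aPhi := ac_sum a b d _ _ (fun k => acM _ _ _ _ _ _ (aP k) (axi k)).
  have aG : ac a b (fun t => prim a (fun t => dot (w^~ t) (h^~ t)) t + (K3 * t + K4 * prim a (fun t => \sum_j `|w j t|) t))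
    (fun t => dot (w^~ t) (h^~ t) + (K3 * 1 + K4 * \sum_j `|w j t|)).
    by apply: acD; [exact: prim_ac|apply: acD; apply: acZ; [exact: ac_id|exact: prim_ac]].
  have := ac_le _ _ _ _ _ _ leab aPhi aG.
  rewrite !prim_start.
  have z s : y s = Q s -> \sum_(i < d) P s 0 i * (y s 0 i - Q s 0 i) = 0.
    by move=> ->; apply: big1 => i _; rewrite subrr mulr0.
  rewrite !z// subrr -/I => W1.
  suff : {ae lebesgue_measure, forall t, a < t -> t < b ->
      \sum_(i < d) (- (\sum_j hcov Q P j t * \sum_k P t 0 k * 'D_(dl i) (f j) (Q t) 0 k) *
        (y t 0 i - Q t 0 i) + P t 0 i *
        (\sum_j v j t * f j (y t) 0 i - \sum_j hcov Q P j t * f j (Q t) 0 i)) <=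
      dot (w^~ t) (h^~ t) + (K3 * 1 + K4 * \sum_j `|w j t|)}.
    by move=> /W1; rewrite -/K3 -/K4; lra.
  apply: ae_all => t at_ tb; have at' := ltW at_; have tb' := ltW tb.
  pose rem j k := f j (y t) 0 k - f j (Q t) 0 k - \sum_l (y t 0 l - Q t 0 l) * 'D_(dl l) (f j) (Q t) 0 k.
  have -> : \sum_(i < d) (- (\sum_j hcov Q P j t * \sum_k P t 0 k * 'D_(dl i) (f j) (Q t) 0 k) *
        (y t 0 i - Q t 0 i) + P t 0 i *
        (\sum_j v j t * f j (y t) 0 i - \sum_j hcov Q P j t * f j (Q t) 0 i)) =
     dot (w^~ t) (h^~ t) + (\sum_j hcov Q P j t * \sum_k P t 0 k * rem j k +
       \sum_j w j t * \sum_k P t 0 k * (f j (y t) 0 k - f j (Q t) 0 k)).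
    transitivity (\sum_j (w j t * hcov Q P j t + (hcov Q P j t * (\sum_k P t 0 k * rem j k) +
        w j t * \sum_k P t 0 k * (f j (y t) 0 k - f j (Q t) 0 k)))); last first.
      rewrite big_split/= big_split/=; congr (_ + _); apply: eq_bigr => j _; by rewrite hE.
    have remS j : \sum_k P t 0 k * rem j k = \sum_k P t 0 k * (f j (y t) 0 k - f j (Q t) 0 k) -
        \sum_l (y t 0 l - Q t 0 l) * \sum_k P t 0 k * 'D_(dl l) (f j) (Q t) 0 k.
      rewrite (eq_bigr (fun k => P t 0 k * (f j (y t) 0 k - f j (Q t) 0 k) -
          \sum_l (y t 0 l - Q t 0 l) * (P t 0 k * 'D_(dl l) (f j) (Q t) 0 k))); last first.
        move=> k _; rewrite /rem mulrBr mulr_sumr; congr (_ - _); apply: eq_bigr => l _; ring.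
      rewrite sumrB exchange_big/=; congr (_ - _); apply: eq_bigr => l _; by rewrite mulr_sumr.
    have fS j : \sum_k P t 0 k * (f j (y t) 0 k - f j (Q t) 0 k) =
        \sum_k P t 0 k * f j (y t) 0 k - hcov Q P j t.
      by rewrite /hcov -sumrB; apply: eq_bigr => k _; rewrite mulrBr.
    rewrite big_split/=.
    have -> : \sum_(i < d) - (\sum_j hcov Q P j t * \sum_k P t 0 k * 'D_(dl i) (f j) (Q t) 0 k) *
        (y t 0 i - Q t 0 i) =
      - \sum_j hcov Q P j t * \sum_l (y t 0 l - Q t 0 l) * \sum_k P t 0 k * 'D_(dl l) (f j) (Q t) 0 k.
      rewrite -sumrN.
      rewrite (eq_bigr (fun i => \sum_j - (hcov Q P j t * ((y t 0 i - Q t 0 i) *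
         \sum_k P t 0 k * 'D_(dl i) (f j) (Q t) 0 k)))); last first.
        by move=> i _; rewrite mulNr mulr_suml -sumrN; apply: eq_bigr => j _; congr (- _); ring.
      rewrite exchange_big/=; apply: eq_bigr => j _; by rewrite mulr_sumr sumrN.
    have -> : \sum_(i < d) P t 0 i *
        (\sum_j v j t * f j (y t) 0 i - \sum_j hcov Q P j t * f j (Q t) 0 i) =
      \sum_j (v j t * (\sum_k P t 0 k * f j (y t) 0 k) - hcov Q P j t * hcov Q P j t).
      rewrite (eq_bigr (fun i => \sum_j (v j t * (P t 0 i * f j (y t) 0 i) -
          hcov Q P j t * (P t 0 i * f j (Q t) 0 i)))); last first.
        by move=> i _; rewrite -sumrB mulr_sumr; apply: eq_bigr => j _; ring.
      rewrite exchange_big/=; apply: eq_bigr => j _; by rewrite sumrB !mulr_sumr.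
    rewrite addrC -sumrB; apply: eq_bigr => j _; rewrite remS fS /w hE//; ring.
  rewrite lerD2l mulr1; apply: lerD.
    apply: (le_trans (ler_norm _)); apply: sum_bound => j; rewrite normrM; apply: ler_pM => //.
      exact: hb.
    apply: sum_bound => k; rewrite normrM; apply: ler_pM => //.
      exact: le_trans (rv_norm_ge _ _) (Pr t at' tb').
    have q := le_trans (rv_norm_ge _ k) (C11_quad _ _ _ _ (fC j) _ _ (Qr t at' tb') (yr t at' tb')).
    have {}q : `|rem j k| <= C * `|y t - Q t| ^+ 2.
      apply: le_trans q; rewrite !mxE summxE /rem; under [X in _ <= `|_ - X|]eq_bigr do rewrite !mxE.
      by [].
    apply: (le_trans q); rewrite ler_wpM2l// lerXn2r ?nnegrE//; exact: xim.
  apply: (le_trans (ler_norm _)); apply: (le_trans (ler_norm_sum _ _ _)).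
  rewrite mulr_sumr; apply: ler_sum => j _; rewrite normrM mulrC; apply: ler_pM => //.
  apply: sum_bound => k; rewrite normrM; apply: ler_pM => //; last exact: fd.
  exact: le_trans (rv_norm_ge _ _) (Pr t at' tb').
(* The exact expansion of the energy of [v = h + w]. *)
have vv : prim a (fun t => dot (v^~ t) (v^~ t)) b =
    prim a (fun t => dot (h^~ t) (h^~ t)) b + (2 * prim a (fun t => dot (w^~ t) (h^~ t)) b + W).
  have bhh : bmf (fun t => dot (h^~ t) (h^~ t)) by exact: bmf_dot.
  rewrite -primZ// -primD//; last exact: bmfZ.
  rewrite -primD//; last by apply: bmfD => //; exact: bmfZ.
  congr (prim a _ b); apply/funext => t.
  rewrite /dot mulr_sumr -!big_split/=; apply: eq_bigr => j _; rewrite /w; ring.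
rewrite vv lerDl.
have cs : I ^+ 2 <= (m%:R + 1) * (b - a) * W by exact: cauchy_schwarz.
have m0sq : m0 ^+ 2 <= (2 * C) ^+ 2 * I ^+ 2.
  by rewrite -exprMn lerXn2r// nnegrE// !mulr_ge0.
have i1 : m%:R * (H * (d%:R * (Pm * (C * m0 ^+ 2)))) * (b - a) <=
    m%:R * (H * (d%:R * (Pm * (C * (2 * C) ^+ 2)))) * I ^+ 2.
  apply: (@le_trans _ _ (m%:R * (H * (d%:R * (Pm * (C * m0 ^+ 2)))))).
    rewrite ler_piMr// !mulr_ge0// exprn_ge0//.
  have -> : m%:R * (H * (d%:R * (Pm * (C * (2 * C) ^+ 2)))) * I ^+ 2 =
     m%:R * (H * (d%:R * (Pm * (C * ((2 * C) ^+ 2 * I ^+ 2))))) by ring.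
  by do 5 (rewrite ler_wpM2l//).
have i2 : d%:R * (Pm * (C * m0)) * I <= d%:R * (Pm * (C * (2 * C))) * I ^+ 2.
  have -> : d%:R * (Pm * (C * (2 * C))) * I ^+ 2 = d%:R * (Pm * (C * (2 * C * I))) * I by ring.
  by rewrite ler_wpM2r//; do 3 (rewrite ler_wpM2l//).
have i3 : 2 * (m%:R * (H * (d%:R * (Pm * (C * m0 ^+ 2)))) * (b - a) + d%:R * (Pm * (C * m0)) * I) <=
    K2 * I ^+ 2 by rewrite /K2; lra.
have W0 : 0 <= W.
  have := ac_le _ _ _ _ _ _ leab (ac_cst a b 0) (prim_ac a b _ bW).
  by rewrite prim_start !subr0 -/W; apply; apply: ae_all => t _ _; exact: dot_ge0.
have i4 : K2 * I ^+ 2 <= W.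
  apply: (@le_trans _ _ (K2 * ((m%:R + 1) * (b - a) * W))); first by rewrite ler_wpM2l.
  have : (b - a) * (K2 * (m%:R + 1)) <= 1.
    by apply: le_trans Ht2; rewrite ler_wpM2r// mulr_ge0// (ltW m1).
  move=> /(ler_wpM2r W0); rewrite mul1r; apply: le_trans.
  by rewrite le_eqVlt; apply/orP; left; apply/eqP; ring.
lra.
Qed.

(** Uses [|w| <= 1 + w^2]. Read backwards: on a short interval, a curve that moves a fixed distance
    must spend a fixed amount of energy. *)
Lemma exit_bound a s (y : R -> E) w : a <= s ->
  (forall t, a <= t -> t <= s -> `|y t - x0| <= r) -> (forall j, bmf (w j)) ->
  (forall k, ac a s (fun t => y t 0 k) (fun t => \sum_j w j t * f j (y t) 0 k)) ->
  `|y s - y a| <= C * (m%:R * (s - a) + prim a (fun t => dot (w^~ t) (w^~ t)) s).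
Proof.
move=> as_ yr bw ay.
have bW : bmf (fun t => dot (w^~ t) (w^~ t)) by exact: bmf_dot.
pose G t := C * (m%:R * t + prim a (fun t => dot (w^~ t) (w^~ t)) t).
have aG : ac a s G (fun t => C * (m%:R * 1 + dot (w^~ t) (w^~ t))).
  by apply: acZ; apply: acD; [apply: acZ; exact: ac_id|exact: prim_ac].
have GE : C * (m%:R * (s - a) + prim a (fun t => dot (w^~ t) (w^~ t)) s) = G s - G a.
  rewrite /G prim_start; ring.
have bound k t : a < t -> t < s -> `|\sum_j w j t * f j (y t) 0 k| <= C * (m%:R * 1 + dot (w^~ t) (w^~ t)).
  move=> at_ ts; have -> : m%:R * 1 = \sum_(j < m) 1 :> R by rewrite sumr_const card_ord mulr1.
  rewrite /dot -big_split/= mulr_sumr; apply: (le_trans (ler_norm_sum _ _ _)); apply: ler_sum => j _.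
  rewrite normrM mulrC; apply: ler_pM => //; first by apply: f_comp; apply: yr; exact: ltW.
  have := sqr_ge0 (`|w j t| - 2^-1); have : `|w j t| ^+ 2 = w j t * w j t by rewrite real_normK ?num_real.
  rewrite !expr2; nra.
rewrite GE; apply: rv_norm_le => [|k].
  have := ac_le _ _ _ _ _ _ as_ (ac_cst a s 0) aG; rewrite subrr; apply.
  by apply: ae_all => t _ _; rewrite mulr_ge0// addr_ge0 ?dot_ge0// mulr1.
have r1 := ac_le _ _ _ _ _ _ as_ (ay k) aG.
have r2 := ac_le _ _ _ _ _ _ as_ (acB _ _ _ _ _ _ (ac_cst a s 0) (ay k)) aG.
rewrite !mxE.
have {}r1 : y s 0 k - y a 0 k <= G s - G a.
  by apply: r1; apply: ae_all => t at_ ts; exact: le_trans (ler_norm _) (bound k t at_ ts).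
have {}r2 : - (y s 0 k - y a 0 k) <= G s - G a.
  have -> : - (y s 0 k - y a 0 k) = 0 - y s 0 k - (0 - y a 0 k) by ring.
  apply: r2; apply: ae_all => t at_ ts.
  by rewrite sub0r; apply: le_trans (bound k t at_ ts); rewrite -normrN ler_norm.
by rewrite ler_norml; apply/andP; split; lra.
Qed.

End second_variation.

(** * Curves in charts *)

Section differentiable_C11.
Context {R : realType} {m d : nat}.
Local Notation E := 'rV[R]_d.
Implicit Types f : E -> 'rV[R]_m.

(** Links the Frechet differential, in which the coherence of charts is stated, with partial
    derivatives; the quadratic remainder at [x0] is an o(h). *)
Lemma C11_diff f x0 (r C : R) : 0 < r -> C11_on x0 r C f ->
  differentiable f x0 /\
  forall v, 'd f x0 v = v *m \matrix_l 'D_(delta_mx 0 l : E) f x0.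
Proof.
move=> r0 fC; pose J := \matrix_l 'D_(delta_mx 0 l : E) f x0.
have cJ : continuous (mulmxr J : E -> 'rV[R]_m) := mulmxr_continuous _ _ _ J.
have := @diff_unique R E 'rV[R]_m f (mulmxr J) x0 cJ; rewrite eqaddoP.
have oJ (e : R) : 0 < e -> \forall h \near (0 : E),
    `|(f \o shift x0) h - ((cst (f x0) : E -> 'rV[R]_m) h + h *m J)| <= e * `|h|.
  move=> e0.
  have small (u : R) : 0 < u -> \forall h \near (0 : E), `|h| <= u.
    move=> u0; apply/nbhs_normP; exists u => //= h.
    by rewrite /ball_/= sub0r normrN => /ltW.
  near=> h.
  have hr : `|h| <= r.
    near: h; exact: small.
  have he : C * `|h| <= e.
    rewrite (le_trans (ler_norm _))// normrM normr_id.
    apply: (@le_trans _ _ ((`|C| + 1) * `|h|)); first by rewrite ler_wpM2r// lerDl.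
    rewrite mulrC -ler_pdivlMr ?ltr_wpDl//.
    near: h; apply: small; rewrite divr_gt0// ltr_wpDl//.
  rewrite /= /cst.
  have hx : `|h + x0 - x0| <= r by rewrite addrK.
  have x0r : `|x0 - x0| <= r by rewrite subrr normr0 ltW.
  have := C11_quad _ _ _ _ fC _ _ x0r hx.
  rewrite addrK opprD addrA.
  have -> : \sum_l h 0 l *: 'D_(delta_mx 0 l : E) f x0 = h *m J.
    by rewrite mulmx_sum_row; apply: eq_bigr => l _; rewrite rowK.
  move=> /le_trans; apply; rewrite expr2 mulrA ler_wpM2r//.
move=> /(_ oJ) dE.
split; last by move=> v; rewrite dE.
by apply/diff_locallyP; rewrite dE; split => //; apply/eqaddoP.
Unshelve. all: by end_near. Qed.

End differentiable_C11.

Section charts.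
Context {R : realType} {M : topologicalType} {d : nat}.
Variable S : sr_data R M d.
Hypothesis hM : smooth_manifold (sr_atlas S).
Hypothesis hC : sr_coherent S.
Hypothesis hg : sr_smooth_metric S.
Local Notation A := (sr_atlas S).
Local Notation E := 'rV[R]_d.
Implicit Types (c : chart R M d) (eta : R -> M) (a b s t : R).

Lemma atlas_wf c : A c -> chart_wf c.
Proof. by case: hM => _ _ [h _] _ _; exact: h. Qed.

Lemma cinvK c p : A c -> cdom c p -> cinv c (ccoord c p) = p.
Proof. by move=> /atlas_wf[_ _ h _ _]; exact: h. Qed.

Lemma cimg_cinv c x : A c -> cimg c x -> cdom c (cinv c x) /\ ccoord c (cinv c x) = x.
Proof. by move=> Ac [p cp <-]; rewrite cinvK. Qed.

Lemma overlap_open c1 c2 : A c1 -> A c2 -> open (ccoord c1 @` (cdom c1 `&` cdom c2)).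
Proof.
move=> A1 A2; have [op1 oi1 k1 _ ci1] := atlas_wf _ A1; have [op2 _ _ _ _] := atlas_wf _ A2.
rewrite openE => x [p [p1 p2] <-]; rewrite /interior.
have im : cimg c1 (ccoord c1 p) by exists p.
have n1 : nbhs (ccoord c1 p) (cimg c1) by exact: open_nbhs_nbhs.
have n2 : nbhs (ccoord c1 p) (cinv c1 @^-1` cdom c2).
  by apply: (ci1 _ im); rewrite k1//; exact: open_nbhs_nbhs.
apply: filterS (filterI n1 n2) => y [/(cimg_cinv _ _ A1)[y1 y2] y3].
by exists (cinv c1 y).
Qed.

Lemma transition_C11 c1 c2 p : A c1 -> A c2 -> cdom c1 p -> cdom c2 p ->
  exists r C : R, [/\ 0 < r, 0 <= C,
    forall x, `|x - ccoord c1 p| <= r -> cimg c1 x /\ cdom c2 (cinv c1 x) &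
    C11_on (ccoord c1 p) r C (transition c1 c2)].
Proof.
move=> A1 A2 p1 p2.
have sm : smoothly_compatible c1 c2 by case: hM => _ _ _ h _; exact: h.
have [r [C [r0 C0 sub H]]] := smooth_C11 _ _ (ccoord c1 p) sm (overlap_open _ _ A1 A2) (ex_intro2 _ _ p (conj p1 p2) erefl).
exists r, C; split => // x /sub [q [q1 q2] <-].
by rewrite cinvK//; split => //; exists q.
Qed.

Lemma lipschitz_curve_continuous a b eta : a <= b -> lipschitz_curve S a b eta ->
  continuous (eta \o clamp a b).
Proof.
move=> ab leta t.
have ct : clamp a b t \in `[a, b] by rewrite in_itv/= clamp_ge clamp_le.
have [c [e [K [Ac e0 H]]]] := leta _ ct.
have [_ _ _ _ ci] := atlas_wf _ Ac.
have [dt _ _] : [/\ cdom c (eta (clamp a b t)), cdom c (eta (clamp a b t)) & `|ccoord c (eta (clamp a b t)) - ccoord c (eta (clamp a b t))| <= K * `|clamp a b t - clamp a b t| ].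
  by apply: H => //; rewrite subrr normr0.
have near1 s : `|s - t| < e -> cdom c (eta (clamp a b s)) /\
    `|ccoord c (eta (clamp a b t)) - ccoord c (eta (clamp a b s))| <= `|K| * `|s - t|.
  move=> st; have cs : clamp a b s \in `[a, b] by rewrite in_itv/= clamp_ge clamp_le.
  have cle := clamp_lip a b t s.
  have [_ d2 h] : [/\ cdom c (eta (clamp a b t)), cdom c (eta (clamp a b s)) &
      `|ccoord c (eta (clamp a b t)) - ccoord c (eta (clamp a b s))| <= K * `|clamp a b t - clamp a b s| ].
    by apply: H => //; [rewrite subrr normr0|exact: le_lt_trans st].
  split => //; apply: (le_trans h); apply: (le_trans (ler_norm _)).
  by rewrite normrM normr_id ler_wpM2l// distrC.
have cc : {for t, continuous (fun s => ccoord c (eta (clamp a b s)))}.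
  apply/cvgrPdist_le => u u0; near=> s.
  have [_ h] : cdom c (eta (clamp a b s)) /\
    `|ccoord c (eta (clamp a b t)) - ccoord c (eta (clamp a b s))| <= `|K| * `|s - t|.
    apply: near1; rewrite distrC; near: s; exact: cvgr_dist_lt.
  apply: (le_trans h); apply: (@le_trans _ _ ((`|K| + 1) * `|s - t|)).
    by rewrite ler_wpM2r// lerDl.
  rewrite mulrC -ler_pdivlMr ?ltr_wpDl// distrC ltW//.
  by near: s; apply: cvgr_dist_lt => //; rewrite divr_gt0// ltr_wpDl.
have cf : cinv c (ccoord c (eta (clamp a b s))) @[s --> t] --> cinv c (ccoord c (eta (clamp a b t))).
  by apply: (continuous_comp cc); apply: ci; exists (eta (clamp a b t)).
rewrite cinvK// in cf; apply: cvg_trans cf.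
apply: near_eq_cvg; apply/nbhs_ballP; exists e => //= s; rewrite /ball/= distrC => st.
by rewrite cinvK//; have [] := near1 s st.
Unshelve. all: by end_near. Qed.

(** The definition of a Lipschitz curve provides some chart near each time; the transition to [c] is
    locally Lipschitz, and the local bounds are glued by compactness. *)
Lemma lipschitz_curve_chart c a s b eta : A c -> a <= s -> s <= b ->
  lipschitz_curve S a b eta -> (forall t, a <= t -> t <= s -> cdom c (eta t)) ->
  forall k, lip_on a s (fun t => ccoord c (eta t) 0 k).
Proof.
move=> Ac as_ sb leta hin k; apply: lip_on_local => // t at_ ts.
have tab : t \in `[a, b] by rewrite in_itv/= at_ (le_trans ts sb).
have [c1 [e [K [A1 e0 H]]]] := leta _ tab.
have [dt _ _] : [/\ cdom c1 (eta t), cdom c1 (eta t) & `|ccoord c1 (eta t) - ccoord c1 (eta t)| <= K * `|t - t| ].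
  by apply: H => //; rewrite subrr normr0.
have [r [C [r0 C0 sub HC]]] := transition_C11 _ _ _ A1 Ac dt (hin t at_ ts).
pose e' := Num.min e (r / (`|K| + 1)).
have K1 : 0 < `|K| + 1 by rewrite ltr_wpDl.
exists e'; first by rewrite lt_min e0 divr_gt0.
exists (C * `|K|) => s1 u1 as1 s1s au1 u1s s1t u1t.
have in_ v : a <= v -> v <= s -> v \in `[a, b] by move=> av vs; rewrite in_itv/= av (le_trans vs sb).
have lt1 v : `|v - t| < e' -> `|v - t| < e /\ `|v - t| < r / (`|K| + 1) by rewrite lt_min => /andP[].
have ballr v : a <= v -> v <= s -> `|v - t| < e' -> cdom c1 (eta v) /\ `|ccoord c1 (eta v) - ccoord c1 (eta t)| <= r.
  move=> av vs /lt1[ve vr].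
  have [dv _ h] : [/\ cdom c1 (eta v), cdom c1 (eta t) & `|ccoord c1 (eta v) - ccoord c1 (eta t)| <= K * `|v - t| ].
    by apply: H => //; [exact: in_|rewrite subrr normr0].
  split => //; apply: (le_trans h); apply: (@le_trans _ _ ((`|K| + 1) * `|v - t|)).
    by rewrite ler_wpM2r// (le_trans (ler_norm _))// lerDl.
  by rewrite mulrC -ler_pdivlMr// ltW.
have [ds1 bs1] := ballr _ as1 s1s s1t; have [du1 bu1] := ballr _ au1 u1s u1t.
have hK : `|ccoord c1 (eta s1) - ccoord c1 (eta u1)| <= K * `|s1 - u1|.
  by have [] := H s1 u1 (in_ _ as1 s1s) (in_ _ au1 u1s) (lt1 _ s1t).1 (lt1 _ u1t).1.
have := C11_lip _ _ _ _ HC _ _ bu1 bs1.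
rewrite /transition/= !cinvK// => hl.
have := rv_norm_ge (ccoord c (eta s1) - ccoord c (eta u1)) k; rewrite !mxE => /le_trans; apply.
apply: (le_trans hl); rewrite -mulrA ler_wpM2l//; apply: (le_trans hK).
by rewrite ler_wpM2r// ler_norm.
Qed.

Lemma metric_ge0 c p v : A c -> cdom c p -> sr_distr S c p v -> 0 <= sr_metric S c p v v.
Proof.
move=> Ac cp Dv; have [hlin _ hpos] := hg.1 c p Ac cp.
have [v0|] := eqVneq v 0; last by move=> vn; rewrite ltW// hpos.
have := hlin 1 v v v Dv Dv Dv; rewrite v0 scaler0 add0r mul1r => h; lra.
Qed.

(** The chain rule for transition maps. It also shows that the value selected by [get] in [speed_sq]
    is the one computed in any chart; continuity of the curve keeps nearby points in the chart where
    it is differentiated. *)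
Lemma tangent_chart c eta t : {for t, continuous eta} -> tangent_at S eta t ->
  A c -> cdom c (eta t) ->
  [/\ derivable (ccoord c \o eta) t 1, sr_distr S c (eta t) (velocity c eta t) &
      sr_metric S c (eta t) (velocity c eta t) (velocity c eta t) = speed_sq S eta t].
Proof.
move=> ceta [c1 [A1 d1 der1 D1]].
have key c2 : A c2 -> cdom c2 (eta t) -> derivable (ccoord c2 \o eta) t 1 /\
    velocity c2 eta t = 'd (transition c1 c2) (ccoord c1 (eta t)) (velocity c1 eta t).
  move=> A2 d2.
  have [r [C [r0 C0 sub HC]]] := transition_C11 _ _ _ A1 A2 d1 d2.
  have [dif _] := C11_diff _ _ _ _ r0 HC.
  have d1' := (derivable1_diffP _ _).1 der1.
  have dif' : differentiable (transition c1 c2 \o (ccoord c1 \o eta)) t by exact: differentiable_comp.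
  have neq : \near t, (transition c1 c2 \o (ccoord c1 \o eta)) t = (ccoord c2 \o eta) t.
    have [op1 _ _ _ _] := atlas_wf _ A1.
    have : nbhs t (eta @^-1` cdom c1) by apply: ceta; exact: open_nbhs_nbhs.
    by apply: filterS => s ds; rewrite /transition/= cinvK.
  have der2 : derivable (transition c1 c2 \o (ccoord c1 \o eta)) t 1 by apply/derivable1_diffP.
  split; first exact: near_eq_derivable der2.
  rewrite /velocity !derive1E -(near_eq_derive _ neq) deriveE// diff_comp//=.
  by rewrite [in RHS]deriveE.
move=> Ac dc; have [derc velc] := key c Ac dc.
have gE c2 : A c2 -> cdom c2 (eta t) ->
    sr_metric S c2 (eta t) (velocity c2 eta t) (velocity c2 eta t) =
    sr_metric S c1 (eta t) (velocity c1 eta t) (velocity c1 eta t).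
  move=> A2 d2; have [_ ->] := key c2 A2 d2.
  by have [_ ->] := hC c1 c2 (eta t) A1 A2 d1 d2.
split => //.
  by rewrite velc; apply/(hC c1 c (eta t) A1 Ac d1 dc).1.
rewrite gE// /speed_sq; set X := [set r | _].
have [c2 [A2 d2 ->]] : X (get X).
  by apply: (@getI _ X (sr_metric S c1 (eta t) (velocity c1 eta t) (velocity c1 eta t))); exists c1.
by rewrite gE.
Qed.

End charts.

Section matrix_continuity.
Context {R : realType} {T : topologicalType}.
Implicit Type t : T.

Lemma continuous_at_ext t (g h : T -> R) :
  {for t, continuous g} -> g =1 h -> {for t, continuous h}.
Proof. by move=> cg /funext <-. Qed.

Lemma continuous_at_prod t (n : nat) (g : 'I_n -> T -> R) :
  (forall i, {for t, continuous (g i)}) -> {for t, continuous (fun s => \prod_i g i s)}.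
Proof.
elim: n g => [|n IH] g hg.
  apply: (continuous_at_ext _ (fun=> 1)) => [|s]; last by rewrite big_ord0.
  exact: cst_continuous.
apply: (continuous_at_ext _ (fun s => \prod_(i < n) g (widen_ord (leqnSn n) i) s * g ord_max s)) => [|s].
  by apply: cvgM; [apply: IH => i; exact: hg|exact: hg].
by rewrite big_ord_recr.
Qed.

Lemma continuous_at_sum_seq t (I : Type) (r : seq I) (g : I -> T -> R) :
  (forall i, {for t, continuous (g i)}) -> {for t, continuous (fun s => \sum_(i <- r) g i s)}.
Proof.
move=> hg; elim: r => [|i r IH].
  apply: (continuous_at_ext _ (fun=> 0)) => [|s]; last by rewrite big_nil.
  exact: cst_continuous.
apply: (continuous_at_ext _ (fun s => g i s + \sum_(i <- r) g i s)) => [|s]; last by rewrite big_cons.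
by apply: cvgD => //; exact: hg.
Qed.

Lemma continuous_at_det t (n : nat) (A : T -> 'M[R]_n) :
  (forall i j, {for t, continuous (fun s => A s i j)}) ->
  {for t, continuous (fun s => \det (A s))}.
Proof.
move=> hA; apply: continuous_at_sum_seq => p; apply: cvgM; first exact: cst_continuous.
by apply: continuous_at_prod => i.
Qed.

Lemma continuous_at_invmx t (n : nat) (A : T -> 'M[R]_n) i j :
  (forall i j, {for t, continuous (fun s => A s i j)}) -> (forall s, A s \in unitmx) ->
  {for t, continuous (fun s => invmx (A s) i j)}.
Proof.
move=> hA uA.
have -> : (fun s => invmx (A s) i j) = (fun s => (\det (A s))^-1 *
    ((-1) ^+ (j + i) * \det (row' j (col' i (A s))))).
  by apply/funext => s; rewrite /invmx uA !mxE.
apply: cvgM; last first.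
  apply: cvgM; first exact: cst_continuous.
  apply: continuous_at_det => i' j'.
  by apply: (continuous_at_ext _ _ _ (hA (lift j i') (lift i j'))) => s; rewrite !mxE.
apply: cvgV; last exact: continuous_at_det.
by move: (uA t); rewrite unitmxE unitfE.
Qed.

End matrix_continuity.

Section frame.
Context {R : realType} {M : topologicalType} {k d : nat}.
Variables (S : sr_data R M d) (c : chart R M d) (f : 'I_k -> 'rV[R]_d -> 'rV[R]_d).
Hypothesis hM : smooth_manifold (sr_atlas S).
Hypothesis hC : sr_coherent S.
Hypothesis hg : sr_smooth_metric S.
Hypothesis Ac : sr_atlas S c.
Hypothesis hf : orthonormal_frame S c f.
Local Notation E := 'rV[R]_d.
Local Notation F := (frame_mx f).
Implicit Types (x : E) (u : 'rV[R]_k) (eta : R -> M) (a b s t : R).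

Lemma frame_metric x u : cimg c x ->
  sr_metric S c (cinv c x) (u *m F x) (u *m F x) = \sum_i u 0 i * u 0 i.
Proof.
move=> cx; have [cp _] := cimg_cinv _ hM _ _ Ac cx.
have [hlin hsym _] := hg.1 c (cinv c x) Ac cp.
have [DE ort] := hf.2 x cx.
have Df i : sr_distr S c (cinv c x) (f i x).
  by rewrite DE /= -(rowK (fun i => f i x) i) row_sub.
have Dlin (s : seq 'I_k) (v : 'I_k -> R) : sr_distr S c (cinv c x) (\sum_(i <- s) v i *: f i x).
  rewrite DE /=; apply: summx_sub => i _; apply: scalemx_sub.
  by move: (Df i); rewrite DE.
have D0 : sr_distr S c (cinv c x) 0 by rewrite DE/= sub0mx.
have g0 w : sr_distr S c (cinv c x) w -> sr_metric S c (cinv c x) 0 w = 0.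
  by move=> Dw; have := hlin 1 0 0 w D0 D0 Dw; rewrite scaler0 add0r mul1r => h; lra.
have gl (s : seq 'I_k) (v : 'I_k -> R) w : sr_distr S c (cinv c x) w ->
   sr_metric S c (cinv c x) (\sum_(i <- s) v i *: f i x) w =
   \sum_(i <- s) v i * sr_metric S c (cinv c x) (f i x) w.
  move=> Dw; elim: s => [|i s IH]; first by rewrite !big_nil g0.
  by rewrite !big_cons hlin// IH.
have uE : u *m F x = \sum_i u 0 i *: f i x.
  by rewrite mulmx_sum_row; apply: eq_bigr => i _; rewrite rowK.
rewrite uE gl//; apply: eq_bigr => i _; congr (_ * _).
rewrite hsym// gl//.
rewrite (bigD1 i)//= ort eqxx mulr1 big1 ?addr0// => j ji.
by rewrite ort (negbTE ji) mulr0.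
Qed.

Lemma frame_free x u : cimg c x -> u *m F x = 0 -> u = 0.
Proof.
move=> cx uF.
have h : \sum_i u 0 i * u 0 i = 0.
  rewrite -(frame_metric _ _ cx) uF; have := frame_metric _ 0 cx; rewrite mul0mx => ->.
  by rewrite big1// => i _; rewrite mxE mul0r.
apply/rowP => i; rewrite mxE; apply/eqP; rewrite -[_ == _]orbb -mulf_eq0; apply/eqP.
by move: h => /psumr_eq0P; apply => // j _; rewrite -expr2 sqr_ge0.
Qed.

(** The Euclidean Gram matrix of the coordinate vectors, invertible since an orthonormal frame is
    free. It yields a right inverse of the frame matrix that depends continuously on the point. *)
Lemma gram_unit x : cimg c x -> F x *m (F x)^T \in unitmx.
Proof.
move=> cx; rewrite -row_free_unit; apply: inj_row_free => u uG.
apply: (frame_free _ _ cx).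
have h : \sum_i (u *m F x) 0 i * (u *m F x) 0 i = 0.
  transitivity ((u *m F x *m (u *m F x)^T) 0 0).
    by rewrite [RHS]mxE; apply: eq_bigr => i _; rewrite [(_^T) _ _]mxE.
  by rewrite trmx_mul mulmxA -(mulmxA u) uG mul0mx mxE.
apply/rowP => i; rewrite [RHS]mxE; apply/eqP; rewrite -[_ == _]orbb -mulf_eq0; apply/eqP.
by move: h => /psumr_eq0P; apply => // j _; rewrite -expr2 sqr_ge0.
Qed.

(** The controls are the bounded measurable representatives of the coordinate velocities times the
    continuous right inverse [X] of the frame matrix. They are defined up to [s] only, as the curve
    may leave the chart afterwards. *)
Lemma competitor_controls a s b eta : a < s -> s <= b -> horizontal S a b eta ->
  (forall t, a <= t -> t <= s -> cdom c (eta t)) ->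
  exists v : 'I_k -> R -> R, [/\ forall j, bmf (v j),
    forall l, ac a s (fun t => ccoord c (eta t) 0 l)
      (fun t => \sum_j v j t * f j (ccoord c (eta t)) 0 l) &
    {ae lebesgue_measure, forall t, a < t -> t < s ->
      speed_sq S eta t = dot (v^~ t) (v^~ t)}].
Proof.
move=> as_ sb [leta teta] hin; have ab : a <= b by exact: le_trans (ltW as_) sb.
have las := ltW as_.
pose y t := ccoord c (eta t).
have ly l : lip_on a s (fun t => y t 0 l).
  exact: (lipschitz_curve_chart _ hM _ _ _ _ _ Ac las sb leta hin).
have cy : continuous (fun t => y (clamp a s t)).
  apply: rv_continuousP => l; exact: (lip_on_clamp_continuous _ _ _ las (ly l)).
have /choice[yd Hyd] : forall l, exists g, bmf g /\
    forall t z, a < t -> t < s -> is_derive t 1 (fun t => y t 0 l) z -> g t = z.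
  by move=> l; have [g bg Hg] := lip_derivative_rep _ _ _ as_ (ly l); exists g.
have yimg t : cimg c (y (clamp a s t)).
  by exists (eta (clamp a s t)) => //; apply: hin; [exact: clamp_ge|exact: clamp_le].
have cF t i l : {for t, continuous (fun t => F (y (clamp a s t)) i l)}.
  have cf : {for y (clamp a s t), continuous (f i)} by have [] := hf.1 i [::] _ (yimg t).
  have := continuous_comp (cy t) cf => /(@rv_continuous_comp R d R _ l t).
  by move=> h; apply: (continuous_at_ext _ _ _ h) => t'; rewrite /= mxE.
pose G t := F (y (clamp a s t)) *m (F (y (clamp a s t)))^T.
pose X t := (F (y (clamp a s t)))^T *m invmx (G t).
have cX t l j : {for t, continuous (fun t => X t l j)}.
  apply: (continuous_at_ext _ (fun t => \sum_i F (y (clamp a s t)) i l * invmx (G t) i j)) => [|t']; last first.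
    by rewrite /X [RHS]mxE; apply: eq_bigr => i _; rewrite [in RHS]mxE.
  apply: continuous_at_sum => i; apply: cvgM; first exact: cF.
  apply: continuous_at_invmx => [i' j'|t']; last exact: gram_unit.
  apply: (continuous_at_ext _ (fun t => \sum_l' F (y (clamp a s t)) i' l' * F (y (clamp a s t)) j' l')) => [|t']; last first.
    by rewrite /G [RHS]mxE; apply: eq_bigr => l' _; rewrite [(_^T) _ _]mxE.
  by apply: continuous_at_sum => l'; apply: cvgM; exact: cF.
have bX l j : bmf (fun t => X t l j).
  have := bmf_clamp a s (fun t => X t l j) las.
  have -> : (fun t => X t l j) \o clamp a s = (fun t => X t l j).
    apply/funext => t /=; rewrite /X /G.
    by rewrite (clamp_id a s (clamp a s t) (clamp_ge _ _ _) (clamp_le _ _ _ las)).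
  apply => t; exact: cX.
pose v j t := \sum_l yd l t * X t l j.
have main t : a < t -> t < s -> tangent_at S eta t ->
    (forall l, is_derive t 1 (fun t => y t 0 l) (\sum_j v j t * f j (y t) 0 l)) /\
    speed_sq S eta t = dot (v^~ t) (v^~ t).
  move=> at_ ts tan; have tb : t < b by exact: lt_le_trans ts sb.
  have ceta : {for t, continuous eta}.
    have := lipschitz_curve_continuous _ hM _ _ _ ab leta t.
    rewrite /continuous_at/= clamp_id ?(ltW at_) ?(ltW tb)//; apply: cvg_trans.
    apply: near_eq_cvg; near=> s0 => /=; rewrite clamp_id// ltW//; near: s0; [exact: lt_nbhsr|exact: lt_nbhsl].
  have dt : cdom c (eta t) by apply: hin; exact: ltW.
  have [der D met] := tangent_chart _ hM hC _ _ _ ceta tan Ac dt.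
  have yt : cimg c (y t) by exists (eta t).
  have cE : clamp a s t = t by rewrite clamp_id// ltW.
  have := D; have [DE _] := hf.2 _ yt; rewrite {1}/y (cinvK S hM)// in DE; rewrite DE => /submxP[u uE].
  have ydE l : yd l t = (u *m F (y t)) 0 l.
    by have [_ h] := Hyd l; rewrite (h t _ at_ ts (derivable_rv_comp _ _ l der)) -uE.
  have vE : (fun j => v j t) = (fun j => u 0 j).
    apply/funext => j; rewrite /v; transitivity ((u *m F (y t) *m X t) 0 j).
      by rewrite [RHS]mxE; apply: eq_bigr => l _; rewrite ydE.
    by rewrite /X /G cE -mulmxA (mulmxA (F _)) mulmxV ?gram_unit// mulmx1.
  split => [l|].
    have := derivable_rv_comp _ _ l der; rewrite -[derive1 _ _]/(velocity c eta t) uE.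
    suff -> : (u *m F (y t)) 0 l = \sum_j v j t * f j (y t) 0 l by [].
    rewrite mxE; apply: eq_bigr => j _; rewrite [in LHS]mxE.
    by rewrite -[v j t]/((fun j => v j t) j) vE.
  have := frame_metric _ u yt; rewrite {1}/y (cinvK S hM)// -uE met => ->.
  by rewrite vE.
exists v; split.
- by move=> j; apply: bmf_sum => l; apply: bmfM => //; have [] := Hyd l.
- move=> l; split; first exact: ly.
  apply: ae_impl teta => t ht at_ ts; apply: (main t at_ ts _).1; apply: ht.
  by rewrite in_itv/= ltW//= ltW// (lt_le_trans ts).
- apply: ae_impl teta => t ht at_ ts; apply: (main t at_ ts _).2; apply: ht.
  by rewrite in_itv/= ltW//= ltW// (lt_le_trans ts).
Unshelve. all: by end_near. Qed.

End frame.

(** The exit time is the infimum of the times spent outside the open [G]; the exit point is a limit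
    of points of [G], hence lies in the closed [K]. *)
Lemma first_exit (R : realType) (M : topologicalType) (zeta : R -> M) (a b : R) (G K : set M) :
  continuous zeta -> open G -> closed K -> G `<=` K -> G (zeta a) ->
  (forall t, a <= t -> t <= b -> G (zeta t)) \/
  exists s, [/\ a < s, s <= b, forall t, a <= t -> t < s -> G (zeta t), K (zeta s) & ~ G (zeta s)].
Proof.
move=> cz oG cK GK Ga; apply/or_asboolP; rewrite -implyNb; apply/implyP => /asboolPn nG; apply/asboolP.
pose Z := [set t | [/\ a <= t, t <= b & ~ G (zeta t)]].
have [z Zz] : exists t, Z t.
  apply: contrapT => nZ; apply: nG => t at_ tb; apply: contrapT => nGt; apply: nZ; by exists t.
have lbZ : lbound Z a by move=> t [].
have hi : has_inf Z by split; [exists z|exists a].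
pose s := inf Z.
have as_ : a <= s by apply: lb_le_inf => //; exists z.
have sz : s <= z by apply: ge_inf => //; exists a.
have sb : s <= b by case: Zz => _ zb _; exact: le_trans sz zb.
have Gt t : a <= t -> t < s -> G (zeta t).
  move=> at_ ts; apply: contrapT => nGt.
  have : s <= t by apply: ge_inf; [exists a|split => //; exact: le_trans (ltW ts) sb].
  by rewrite leNgt ts.
have near_s (V : set M) : open V -> V (zeta s) -> exists2 e : R, 0 < e & forall t, `|s - t| < e -> V (zeta t).
  move=> oV Vs; have : nbhs s (zeta @^-1` V) by apply: cz; exact: open_nbhs_nbhs.
  by move=> /nbhs_ballP[e /= e0 He]; exists e => // t; exact: He.
have nGs : ~ G (zeta s).
  move=> Gs; have [e e0 He] := near_s G oG Gs.
  have [t Zt tse] := inf_adherent e0 hi.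
  have st : s <= t by apply: ge_inf => //; exists a.
  by case: Zt => _ _; apply; apply: He; rewrite ler0_norm; rewrite -/s in tse; lra.
have lt_as : a < s by rewrite lt_neqAle as_ andbT; apply/eqP => E; apply: nGs; rewrite -E.
exists s; split => //; apply: contrapT => nK.
have [e e0 He] := near_s (~` K) (closed_openC cK) nK.
pose t := Num.max a (s - e / 2).
have ts : t < s by rewrite gt_max lt_as/=; lra.
apply: (He t); last by apply: GK; apply: Gt => //; rewrite le_max lexx.
have : s - e / 2 <= t by rewrite le_max lexx orbT.
by move=> h; rewrite gtr0_norm; lra.
Qed.

Lemma C11_on_mono (R : realType) (d m : nat) (f : 'rV[R]_d -> 'rV[R]_m) x0 x0' (r r' C C' : R) :
  (forall x, `|x - x0'| <= r' -> `|x - x0| <= r) -> C <= C' ->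
  C11_on x0 r C f -> C11_on x0' r' C' f.
Proof.
move=> up CC H.
have cc (x y : R) : 0 <= y -> x <= C * y -> x <= C' * y by move=> y0 /le_trans; apply; rewrite ler_wpM2r.
split.
- by move=> x /up xr; exact: le_trans (C11_bound _ _ _ _ H _ xr) CC.
- by move=> x l /up xr; exact: le_trans (C11_dbound _ _ _ _ H _ _ xr) CC.
- by move=> x y /up xr /up yr; apply: cc => //; exact: (C11_lip _ _ _ _ H _ _ xr yr).
- by move=> x y l /up xr /up yr; apply: cc => //; exact: (C11_dlip _ _ _ _ H _ _ _ xr yr).
- by move=> x y /up xr /up yr; apply: cc; rewrite ?exprn_ge0//; exact: (C11_quad _ _ _ _ H _ _ xr yr).
Qed.

Lemma smooth_C11_family (R : realType) (k d m : nat) (f : 'I_k -> 'rV[R]_d -> 'rV[R]_m) (O : set 'rV[R]_d) x0 :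
  (forall i, smooth_on O (f i)) -> open O -> O x0 ->
  exists r C : R, [/\ 0 < r, 0 <= C, forall x, `|x - x0| <= r -> O x & forall i, C11_on x0 r C (f i)].
Proof.
move=> sf oO Ox0.
have [r0 r00 sub0] : exists2 r : R, 0 < r & forall x, `|x - x0| <= r -> O x.
  have : nbhs x0 O by exact: open_nbhs_nbhs.
  move=> /nbhs_normP[e /= e0 He]; exists (e / 2); first lra.
  by move=> x xe; apply: He; rewrite /ball_/= distrC; lra.
have /choice[rC HrC] : forall i, exists p : R * R, [/\ 0 < p.1, 0 <= p.2 & C11_on x0 p.1 p.2 (f i)].
  by move=> i; have [r [C [h1 h2 _ h4]]] := smooth_C11 _ _ _ (sf i) oO Ox0; exists (r, C).
exists (\big[Num.min/r0]_i (rC i).1), (\sum_i (rC i).2); split.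
- by apply: (big_ind (fun x : R => 0 < x)) => // [x y x0' y0|i _]; [rewrite lt_min x0' y0|case: (HrC i)].
- by apply: sumr_ge0 => i _; case: (HrC i).
- by move=> x xr; apply: sub0; apply: (le_trans xr); exact: bigmin_le_id.
- move=> i; have [_ _] := HrC i; apply: C11_on_mono.
    by move=> x /le_trans; apply; exact: bigmin_le.
  by rewrite (bigD1 i)//= lerDl sumr_ge0// => j _; case: (HrC j).
Qed.

Section extremals.
Context {R : realType} {M : topologicalType} {n : nat}.
Local Notation d := (2 * n + 1)%N.
Local Notation k := (2 * n)%N.
Local Notation E := 'rV[R]_d.
Variables (S : sr_data R M d) (c : chart R M d) (f : 'I_k -> E -> E).
Hypothesis hM : smooth_manifold (sr_atlas S).
Hypothesis hC : sr_coherent S.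
Hypothesis hg : sr_smooth_metric S.
Hypothesis Ac : sr_atlas S c.
Hypothesis hf : orthonormal_frame S c f.
Variables (Q P : R -> E).
Hypothesis eQP : extremal f Q P.
Hypothesis Qin : forall t, 0 <= t -> t <= 1 -> cimg c (Q t).
Local Notation dl l := (delta_mx 0 l : E).
Local Notation h := (hcov f Q P).
Local Notation F := (frame_mx f).
Implicit Types (a b s t : R).

(** The clamp realizes the normalization in [geodesics_joining], constant values outside [0, 1]. *)
Definition lift_curve t : M := cinv c (Q (clamp 0 1 t)).
Local Notation gamma := lift_curve.

Let cl_in t : cimg c (Q (clamp 0 1 t)).
Proof. by apply: Qin; [exact: clamp_ge|exact: clamp_le]. Qed.

Let cQ t : {for t, continuous (fun s => Q (clamp 0 1 s))}.
Proof. by apply: continuous_comp; [exact: clamp_continuous|exact: (ext_cQ _ _ _ eQP)]. Qed.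

Let cf t j l : {for t, continuous (fun s => f j (Q (clamp 0 1 s)) 0 l)}.
Proof.
have cfj : {for Q (clamp 0 1 t), continuous (f j)} by have [] := hf.1 j [::] _ (cl_in t).
exact: (@rv_continuous_comp R d R _ l t (continuous_comp (cQ t) cfj)).
Qed.

Let cD t j l i : {for t, continuous (fun s => 'D_(dl i) (f j) (Q (clamp 0 1 s)) 0 l)}.
Proof.
have cfj : {for Q (clamp 0 1 t), continuous ('D_(dl i) (f j))} by have [] := hf.1 j [:: i] _ (cl_in t).
exact: (@rv_continuous_comp R d R _ l t (continuous_comp (cQ t) cfj)).
Qed.

Let cP t l : {for t, continuous (fun s => P (clamp 0 1 s) 0 l)}.
Proof.
apply: (@rv_continuous_comp R d R (fun s => P (clamp 0 1 s)) l t).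
by apply: continuous_comp; [exact: clamp_continuous|exact: (ext_cP _ _ _ eQP)].
Qed.

Let ch t j : {for t, continuous (fun s => h j (clamp 0 1 s))}.
Proof. by apply: continuous_at_sum => i; apply: cvgM; [exact: cP|exact: cf]. Qed.

Let bounded_cont (G : R -> R) : continuous (G \o clamp 0 1) ->
  exists K : R, forall t, 0 < t -> t < 1 -> `|G t| <= K.
Proof.
move=> /(bmf_clamp 0 1 G ler01)[_ [K HK]]; exists K => t t0 t1.
by have := HK t; rewrite /= clamp_id// ltW.
Qed.

Lemma extremal_ac_Q l : ac 0 1 (fun t => Q t 0 l) (fun t => \sum_j h j t * f j (Q t) 0 l).
Proof.
apply: ac_C1; last 1 first.
- apply: bounded_cont => t; apply: continuous_at_sum => j; apply: cvgM; [exact: ch|exact: cf].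
- apply: continuous_subspaceT => t; apply: (@rv_continuous_comp R d R Q l t); exact: (ext_cQ _ _ _ eQP).
- by move=> t t0 t1; exact: (ext_Q _ _ _ eQP).
Qed.

Lemma extremal_ac_P l : ac 0 1 (fun t => P t 0 l)
  (fun t => - \sum_j h j t * \sum_i P t 0 i * 'D_(dl l) (f j) (Q t) 0 i).
Proof.
apply: ac_C1; last 1 first.
- apply: bounded_cont => t; apply: cvgN; apply: continuous_at_sum => j; apply: cvgM; first exact: ch.
  by apply: continuous_at_sum => i; apply: cvgM; [exact: cP|exact: cD].
- apply: continuous_subspaceT => t; apply: (@rv_continuous_comp R d R P l t); exact: (ext_cP _ _ _ eQP).
- by move=> t t0 t1; exact: (ext_P _ _ _ eQP).
Qed.

Let bh a b j : 0 <= a -> a <= b -> b <= 1 -> bmf (h j \o clamp a b).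
Proof.
move=> a0 ab b1; apply: bmf_clamp => //.
have -> : h j \o clamp a b = (fun s => h j (clamp 0 1 s)) \o clamp a b.
  apply/funext => t /=; rewrite (clamp_id 0 1)//; first exact: le_trans a0 (clamp_ge _ _ _).
  exact: le_trans (clamp_le _ _ _ ab) b1.
by move=> t; apply: continuous_comp; [exact: clamp_continuous|exact: ch].
Qed.

Let coordE t : ccoord c (gamma t) = Q (clamp 0 1 t).
Proof. by have [_] := cimg_cinv _ hM _ _ Ac (cl_in t). Qed.

Let gdom t : cdom c (gamma t).
Proof. by have [] := cimg_cinv _ hM _ _ Ac (cl_in t). Qed.

Lemma lift_curve_lipschitz : lipschitz_curve S 0 1 gamma.
Proof.
have [K K0 HK] := lip_on_rv 0 1 Q (fun l => (extremal_ac_Q l).1).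
move=> t _; exists c, 1, K; split => // s s' /[!in_itv]/= /andP[s0 s1] /andP[s'0 s'1] _ _.
split; [exact: gdom|exact: gdom|].
by rewrite !coordE !clamp_id//; exact: HK.
Qed.

Let cgamma : continuous gamma.
Proof.
have := lipschitz_curve_continuous _ hM _ _ _ ler01 lift_curve_lipschitz.
suff -> : gamma \o clamp 0 1 = gamma by [].
by apply/funext => t; rewrite /gamma /= (clamp_id 0 1 (clamp 0 1 t)) ?clamp_ge ?clamp_le.
Qed.

Let vel t : 0 < t -> t < 1 -> derivable (ccoord c \o gamma) t 1 /\
  velocity c gamma t = (\row_j h j t) *m F (Q t).
Proof.
move=> t0 t1; apply: derivable_rvP => l.
have dQ : is_derive t 1 (fun s => Q s 0 l) (((\row_j h j t) *m F (Q t)) 0 l).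
  rewrite mxE; apply: (is_derive_ext _ _ _ _ _ (ext_Q _ _ _ eQP t l t0 t1)) => //.
  by apply: eq_bigr => j _; rewrite !mxE.
apply: (is_derive_near _ _ _ _ dQ); near=> s.
rewrite /= coordE clamp_id// ltW//; near: s; [exact: lt_nbhsr|exact: lt_nbhsl].
Unshelve. all: by end_near. Qed.

Let tangent t : 0 < t -> t < 1 -> tangent_at S gamma t.
Proof.
move=> t0 t1; have [der velE] := vel t t0 t1.
exists c; split => //; rewrite velE.
have t01 : cimg c (Q t) by apply: Qin; exact: ltW.
have [DE _] := hf.2 _ t01.
have -> : gamma t = cinv c (Q t) by rewrite /gamma clamp_id// ltW.
by rewrite DE /= submxMl.
Qed.

Lemma lift_curve_horizontal : horizontal S 0 1 gamma.
Proof.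
split; first exact: lift_curve_lipschitz.
apply: ae_impl (ae_itv 0 1 _ (ae_all _ tangent)) => t ht /[!in_itv]/= /andP[]; exact: ht.
Qed.

Let speed t : 0 < t -> t < 1 -> speed_sq S gamma t = dot (h^~ t) (h^~ t).
Proof.
move=> t0 t1; have [_ _ <-] := tangent_chart _ hM hC _ _ _ (cgamma t) (tangent t t0 t1) Ac (gdom t).
have [_ ->] := vel t t0 t1.
have t01 : cimg c (Q t) by apply: Qin; exact: ltW.
have -> : gamma t = cinv c (Q t) by rewrite /gamma clamp_id// ltW.
rewrite (frame_metric _ _ _ hM hg Ac hf)//; apply: eq_bigr => j _; by rewrite !mxE.
Qed.

Lemma lift_curve_energy a b : 0 <= a -> a <= b -> b <= 1 ->
  energy S a b gamma = (2^-1 * prim a (fun t => dot (fun j => h j (clamp a b t)) (fun j => h j (clamp a b t))) b)%:E.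
Proof.
move=> a0 ab b1; rewrite /energy EFinM; congr (_ * _)%E.
apply: integral_eq_ae => //.
- by apply: (@bmf_dot R k (fun j t => h j (clamp a b t)) (fun j t => h j (clamp a b t))) => j; exact: bh.
- by move=> t; exact: dot_ge0.
- apply: ae_all => t at_ tb; rewrite clamp_id ?(ltW at_) ?(ltW tb)//; apply: speed.
    exact: le_lt_trans at_.
  exact: lt_le_trans b1.
Qed.

Let prim_cst a b (x : R) : a <= b -> prim a (fun=> x) b = x * (b - a).
Proof.
move=> ab; rewrite (prim_ftc a b (fun t => x * t) _ (fun=> x * 1) ab (bmf_cst x)) ?mulrBr//.
  by apply: acZ; exact: ac_id.
by move=> t _ _; rewrite mulr1.
Qed.

(** A competitor either stays in a coordinate cube about [Q t0], where the second variation estimate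
    applies, or leaves it. In the latter case it travels at least r/2 in a short time, and its
    energy up to the exit exceeds that of the extremal. *)
Lemma lift_curve_locally_minimizes t0 : 0 <= t0 -> t0 <= 1 -> exists2 e : R, 0 < e &
  forall a b, 0 <= a -> b <= 1 -> a < b -> `|a - t0| < e -> `|b - t0| < e ->
    energy_minimizer S a b gamma.
Proof.
move=> t00 t01; pose x0 := Q t0.
have [opc oimg _ ccont cicont] := atlas_wf _ hM _ Ac.
have [r [C [r0 C0 sub fC]]] := smooth_C11_family _ _ _ _ f _ x0 hf.1 oimg (Qin t0 t00 t01).
have [Pm Pm0 HPm] := curve_bounded _ (ext_cP _ _ _ eQP).
have [tau tau0 SV] := second_variation f x0 r C Pm C0 Pm0 fC.
pose H := d%:R * (Pm * C).
have H0 : 0 <= H by rewrite !mulr_ge0.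
(* If the competitor were cheaper, its displacement up to the exit would be at most
   [2 * e1 * B <= r / 4], whereas it exceeds r/2, the extremal lying in the half cube. *)
pose B := C * (k%:R + k%:R * H ^+ 2).
have B0 : 0 <= B by rewrite mulr_ge0// addr_ge0// mulr_ge0// sqr_ge0.
have r8 : 0 < r / 8 by rewrite divr_gt0.
have [e1 e10 He1] := small_positive _ _ r8 B0.
have r2 : 0 < r / 2 by rewrite divr_gt0.
have [e2 e20 He2] : exists2 e : R, 0 < e & forall s, `|s - t0| < e -> `|Q s - x0| < r / 2.
  have /cvgrPdist_lt/(_ _ r2)/nbhs_ballP[e /= e0 He] := ext_cQ _ _ _ eQP t0.
  by exists e => // s st; rewrite distrC; apply: He; rewrite /ball/= distrC.
exists (Num.min e2 (Num.min e1 (tau / 2))); first by rewrite !lt_min e20 e10 divr_gt0.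
move=> a b a0 b1 ab; rewrite !lt_min => /and3P[a1 a2 a3] /and3P[b1' b2 b3].
have bal : b - a <= tau by move: a3 b3; rewrite !ltr_norml => /andP[? ?] /andP[? ?]; lra.
have bae : b - a <= 2 * e1 by move: a2 b2; rewrite !ltr_norml => /andP[? ?] /andP[? ?]; lra.
have lab := ltW ab.
have Qr t : a <= t -> t <= b -> `|Q t - x0| < r / 2.
  move=> at_ tb; apply: He2; move: a1 b1'; rewrite !ltr_norml => /andP[? ?] /andP[? ?].
  by apply/andP; split; lra.
have Qr' t : a <= t -> t <= b -> `|Q t - x0| <= r by move=> at_ tb; have := Qr t at_ tb; lra.
have Pr t : a <= t -> t <= b -> `|P t| <= Pm.
  by move=> at_ tb; apply: HPm; [exact: le_trans a0 at_|exact: le_trans tb b1].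
have bhab j := bh a b j a0 lab b1.
pose Eg := prim a (fun t => dot (fun j => h j (clamp a b t)) (fun j => h j (clamp a b t))) b.
have bhh : bmf (fun t => dot (fun j => h j (clamp a b t)) (fun j => h j (clamp a b t))).
  by apply: (@bmf_dot R k (fun j t => h j (clamp a b t)) (fun j t => h j (clamp a b t))) => j; exact: bhab.
have EgH : Eg <= k%:R * H ^+ 2 * (b - a).
  rewrite -prim_cst//; apply: prim_le => //; first exact: bmf_cst.
  move=> t at_ tb; rewrite clamp_id ?(ltW at_) ?(ltW tb)//.
  have -> : k%:R * H ^+ 2 = \sum_(j < k) H ^+ 2 by rewrite sumr_const card_ord mulr_natl.
  apply: ler_sum => j _; rewrite -expr2 -[X in X <= _]real_normK ?num_real//.
  rewrite lerXn2r ?nnegrE//.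
  by apply: (hcov_bound f x0 r C Pm fC); [apply: Qr'|apply: Pr]; exact: ltW.
move=> eta heta etaa etab.
rewrite lift_curve_energy// -/Eg /energy EFinM; apply: lee_wpmul2l; first by rewrite lee_fin invr_ge0.
have [leta teta] := heta.
pose zeta := eta \o clamp a b.
have czeta : continuous zeta by exact: (lipschitz_curve_continuous _ hM).
have zetaE t : a <= t -> t <= b -> zeta t = eta t by move=> at_ tb; rewrite /zeta/= clamp_id.
(* The image of the closed cube is compact, hence closed in the Hausdorff space [M]: the competitor
   cannot leave the chart without first reaching the boundary of the cube. *)
pose K := cinv c @` [set x | `|x - x0| <= r].
pose G := cdom c `&` ccoord c @^-1` [set x | `|x - x0| < r].
have KP p : K p -> cdom c p /\ `|ccoord c p - x0| <= r.
  by move=> [x xr <-]; have [? ->] := cimg_cinv _ hM _ _ Ac (sub x xr).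
have cK : closed K.
  apply: compact_closed; first by case: hM.
  apply: continuous_compact.
    apply: (@continuous_in_subspaceT _ _ [set x | `|x - x0| <= r]) => x /[!inE] xr.
    exact: cicont (sub x xr).
  apply: bounded_closed_compact.
    exists (`|x0| + r); split; first exact: num_real.
    move=> N rN x /= xr; rewrite -(subrK x0 x) (le_trans (ler_normD _ _))//; lra.
  have := @closed_ball_closed R E x0 r; rewrite closed_ballE//.
  by rewrite (_ : closed_ball_ _ _ _ = [set x | `|x - x0| <= r])//; apply/seteqP; split => x /=; rewrite /closed_ball_/= distrC.
have opG : open G.
  rewrite openE => p [cp pr]; rewrite /interior; apply: filterI; first exact: open_nbhs_nbhs.
  apply: (ccont p cp); apply/nbhs_ballP; exists (r - `|ccoord c p - x0|); first by rewrite /= subr_gt0.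
  move=> x /=; rewrite -ball_normE/= => px.
  have -> : x - x0 = (ccoord c p - x0) - (ccoord c p - x) by apply/rowP => i; rewrite !mxE; ring.
  apply: (le_lt_trans (ler_normB _ _)); lra.
have GK : G `<=` K by move=> p [cp /= pr]; exists (ccoord c p) => /=; [exact: ltW|rewrite (cinvK S hM)].
have ga : gamma a = cinv c (Q a) by rewrite /gamma clamp_id// (le_trans lab).
have gb : gamma b = cinv c (Q b) by rewrite /gamma clamp_id// (le_trans a0).
have Qa : cimg c (Q a) by apply: Qin => //; exact: le_trans lab b1.
have Qb : cimg c (Q b) by apply: Qin => //; exact: le_trans a0 lab.
have ya : ccoord c (eta a) = Q a by rewrite etaa ga; have [_] := cimg_cinv _ hM _ _ Ac Qa.
have yb : ccoord c (eta b) = Q b by rewrite etab gb; have [_] := cimg_cinv _ hM _ _ Ac Qb.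
have Ga : G (zeta a).
  rewrite zetaE//; split; first by rewrite etaa.
  by rewrite /= ya; have := Qr a (lexx a) lab; lra.
(* After the exit the competitor may be in any chart; all that is used there is that its speed is
   nonnegative. *)
have sp0 : {ae lebesgue_measure, forall t, a < t -> t < b -> 0 <= speed_sq S eta t}.
  apply: ae_impl teta => t ht at_ tb.
  have tan : tangent_at S eta t by apply: ht; rewrite in_itv/= !ltW.
  have ceta : {for t, continuous eta}.
    have := czeta t; rewrite /continuous_at zetaE ?(ltW at_) ?(ltW tb)//; apply: cvg_trans.
    apply: near_eq_cvg; near=> s => /=; rewrite zetaE// ltW//; near: s; [exact: lt_nbhsr|exact: lt_nbhsl].
  have [c1 [A1 d1 _ _]] := tan.
  have [_ D1 <-] := tangent_chart _ hM hC _ _ _ ceta tan A1 d1.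
  exact: metric_ge0.
have ge_energy s (v : 'I_k -> R -> R) : a < s -> s <= b -> (forall j, bmf (v j)) ->
    {ae lebesgue_measure, forall t, a < t -> t < s -> speed_sq S eta t = dot (v^~ t) (v^~ t)} ->
    ((prim a (fun t => dot (v^~ t) (v^~ t)) s)%:E <=
     \int[lebesgue_measure]_(t in `[a, b]) (speed_sq S eta t)%:E)%E.
  move=> as_ sb bv sE; apply: integral_ge_ae => //; first exact: ltW.
  - exact: bmf_dot.
  - by move=> t; exact: dot_ge0.
  - by apply: ae_impl sE => t st at_ ts; rewrite st.
have [inG|[s [as_ sb Gs Ks nGs]]] := first_exit _ _ zeta a b G K czeta opG cK GK Ga.
  have din t : a <= t -> t <= b -> cdom c (eta t).
    by move=> at_ tb; rewrite -zetaE//; have [] := inG t at_ tb.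
  have [v [bv acv spv]] := competitor_controls _ _ _ hM hC hg Ac hf _ _ _ _ ab (lexx b) heta din.
  apply: le_trans (ge_energy b v ab (lexx b) bv spv); rewrite lee_fin.
  apply: (SV a b Q P (fun t => ccoord c (eta t)) v) => //.
  - by move=> t at_ tb; rewrite -zetaE//; have [_ /ltW] := inG t at_ tb.
  - by move=> l; exact: (acS _ _ _ _ _ _ a0 b1 (extremal_ac_Q l)).
  - by move=> l; exact: (acS _ _ _ _ _ _ a0 b1 (extremal_ac_P l)).
have inK t : a <= t -> t <= s -> K (eta t).
  move=> at_ ts; have tb : t <= b by exact: le_trans sb.
  rewrite -zetaE//; move: ts; rewrite le_eqVlt => /predU1P[->//|ts].
  by apply: GK; exact: Gs.
have din t : a <= t -> t <= s -> cdom c (eta t) by move=> at_ ts; have [] := KP _ (inK t at_ ts).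
have [v [bv acv spv]] := competitor_controls _ _ _ hM hC hg Ac hf _ _ _ _ as_ sb heta din.
apply: le_trans (ge_energy s v as_ sb bv spv); rewrite lee_fin.
have yr t : a <= t -> t <= s -> `|ccoord c (eta t) - x0| <= r.
  by move=> at_ ts; have [] := KP _ (inK t at_ ts).
have := exit_bound f x0 r C C0 fC a s (fun t => ccoord c (eta t)) v (ltW as_) yr bv acv.
set I := prim _ _ s => ex.
have far : r / 2 < `|ccoord c (eta s) - ccoord c (eta a)|.
  have : ~ (`|ccoord c (eta s) - x0| < r).
    move=> hs; apply: nGs; rewrite zetaE ?(ltW as_)//; split => //.
    by apply: din => //; exact: ltW.
  move=> /negP; rewrite -leNgt => hs.
  have qa := Qr a (lexx a) lab; rewrite -ya in qa.
  have : `|ccoord c (eta s) - x0| <= `|ccoord c (eta s) - ccoord c (eta a)| + `|ccoord c (eta a) - x0|.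
    by rewrite -(subrKA (ccoord c (eta a))); exact: ler_normD.
  lra.
(* If [I < Eg], then [I] is at most [k * H ^+ 2 * (b - a)], which contradicts the distance
   travelled. *)
have [//|EI] := leP Eg I.
have kk : 0 <= k%:R :> R := ler0n R k.
have i1 : k%:R * (s - a) + I <= (k%:R + k%:R * H ^+ 2) * (2 * e1).
  have i2 : k%:R * (s - a) <= k%:R * (2 * e1) by rewrite ler_wpM2l//; lra.
  have i3 : k%:R * H ^+ 2 * (b - a) <= k%:R * H ^+ 2 * (2 * e1).
    by rewrite ler_wpM2l// mulr_ge0// sqr_ge0.
  rewrite mulrDl; lra.
have i4 := ler_wpM2l C0 i1.
have i5 : C * ((k%:R + k%:R * H ^+ 2) * (2 * e1)) = 2 * (e1 * B) by rewrite /B; ring.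
lra.
Unshelve. all: by end_near. Qed.

Lemma extremal_geodesic : (exists s t, [/\ 0 <= s, s <= 1, 0 <= t, t <= 1 & Q s <> Q t]) ->
  geodesic S gamma.
Proof.
move=> [s [t [s0 s1 t0 t1 Qst]]]; split; first exact: lift_curve_horizontal.
  exists s, t; rewrite !in_itv/= s0 s1 t0 t1; split => // /(congr1 (ccoord c)).
  by rewrite !coordE !clamp_id.
move=> u /[!in_itv]/= /andP[u0 u1]; have [e e0 He] := lift_curve_locally_minimizes u u0 u1.
by exists e => // a b /[!in_itv]/= /andP[a0 _] /andP[_ b1]; exact: He.
Qed.

End extremals.

(** * Critical endpoints *)

Section critical_values.
Context {R : realType} {d : nat}.
Hypothesis d0 : (0 < d)%N.
Local Notation E := 'rV[R]_d.
Variables (H : R -> 'rV[R]_(d + d) -> 'rV[R]_(d + d)) (H0 : 'rV[R]_(d + d) -> 'rV[R]_(d + d)).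
Variable DH : 'I_(d + d) -> 'rV[R]_(d + d) -> 'I_(d + d) -> R.
Hypothesis convH : forall rho : R, 0 <= rho -> forall i,
  c1conv rho (fun e a => H e a 0 i) (fun a => H0 a 0 i) (DH i).

Definition critical_flow (y : R -> 'rV[R]_(d + d)) (W : 'I_d -> R -> 'rV[R]_(d + d)) : Prop :=
  [/\ sol H0 y, lsubmx (y 0) = 0, forall j, vsol DH y (W j) /\ W j 0 = unitp j &
      \det (endpoint_mx W) = 0].

Definition critical_value (x : E) : Prop :=
  exists y W, critical_flow y W /\ lsubmx (y 1) = x.

(** [tau] stands for a change of chart: nullity is required in every chart, and Sard's theorem is
    applied to the composed map directly. *)
Lemma critical_values_null (tau : E -> E) x0 (r C : R) : C11_on x0 r C tau ->
  lebesgue_null (tau @` (critical_value `&` [set x | `|x - x0| <= r])).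
Proof.
move=> tC.
(* The solutions are sorted by a bound [N], since the constants of [endpoint_quadratic] depend on
   the size of the solutions; a countable union remains. *)
pose Om (N : nat) (l : E) (yW : (R -> 'rV[R]_(d + d)) * ('I_d -> R -> 'rV[R]_(d + d))) :=
  [/\ critical_flow yW.1 yW.2, rsubmx (yW.1 0) = l, stays N%:R yW.1 & `|lsubmx (yW.1 1) - x0| <= r].
apply: (@lebesgue_nullS R d _ (\bigcup_N [set tau (lsubmx (yW.1 1)) | yW in [set yW | Om N (rsubmx (yW.1 0)) yW]])).
  move=> _ [x [[y [W [cyW yx]]] xr] <-].
  have cy : continuous y by case: cyW => -[].
  have [rho rho0 Hrho] := curve_bounded _ cy.
  exists (Num.truncn rho).+1 => //; exists (y, W); last by rewrite yx.
  split => //=; last by rewrite yx.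
  by move=> t t0 t1; apply: (le_trans (Hrho t t0 t1)); apply: ltW; exact: truncnS_gt.
apply: lebesgue_null_bigcup_nat => N.
(* One critical solution is selected for each initial momentum that has one; the value on other
   momenta is a dummy. *)
have /choice[z Hz] : forall l, exists yW, (exists yW', Om N l yW') -> Om N l yW.
  move=> l; have [[yW HyW]|n] := pselect (exists yW, Om N l yW); first by exists yW.
  by exists (fun=> 0, fun _ _ => 0).
have [C1 C10 HC1] := endpoint_quadratic H H0 DH convH N%:R (ler0n R N).
pose Dom := [set l | exists yW', Om N l yW'].
pose X l := lsubmx ((z l).1 1).
(* The selection loses no endpoint, because the quadratic estimate makes the endpoint depend on the
   initial momentum only. *)
have uniqX yW : Om N (rsubmx (yW.1 0)) yW -> Dom (rsubmx (yW.1 0)) /\ X (rsubmx (yW.1 0)) = lsubmx (yW.1 1).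
  move=> O1; have Dl : Dom (rsubmx (yW.1 0)) by exists yW.
  split => //; have O2 := Hz _ Dl.
  have [[s1 l1 v1 _] _ st1 _] := O1; have [[s2 l2 v2 _] r2 st2 _] := O2.
  have [_] := HC1 _ _ _ s2 s1 st2 st1 (etrans l2 (esym l1)) v1.
  rewrite r2 subrr mul0mx subr0 normr0 expr0n mulr0 normr_le0 subr_eq0 => /eqP; exact.
apply: (@lebesgue_nullS R d _ ((tau \o X) @` Dom)).
  move=> _ [yW O1 <-]; have [D1 X1] := uniqX _ O1.
  by exists (rsubmx (yW.1 0)) => //=; rewrite X1.
pose J x := \matrix_l 'D_(delta_mx 0 l : E) tau x.
(* The derivative of the composed map, singular because its first factor is. *)
pose L l := endpoint_mx (z l).2 *m J (X l).
pose C' := `|C|.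
have C'0 : 0 <= C' by exact: normr_ge0.
have tC' : C11_on x0 r C' tau by apply: C11_on_mono tC; rewrite ?ler_norm.
have Jb x i j : `|x - x0| <= r -> `|J x i j| <= C'.
  by move=> xr; rewrite mxE; exact: le_trans (rv_norm_ge _ _) (C11_dbound _ _ _ _ tC' _ _ xr).
have Xr l : Dom l -> `|X l - x0| <= r by move=> /Hz[].
have quadX l l' : Dom l -> Dom l' ->
  (forall i j, `|endpoint_mx (z l).2 i j| <= C1) /\
  `|X l' - X l - (l' - l) *m endpoint_mx (z l).2| <= C1 * `|l' - l| ^+ 2.
  move=> /Hz[[s1 l1 v1 _] r1 st1 _] /Hz[[s2 l2 v2 _] r2 st2 _].
  have := HC1 _ _ _ s2 s1 st2 st1 (etrans l2 (esym l1)) v1; by rewrite r1 r2.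
have normD l : Dom l -> `|l| <= N%:R + 1.
  move=> /Hz[_ rl st _]; rewrite -rl; have h := st 0 (lexx 0) ler01.
  apply: (@le_trans _ _ N%:R); last by rewrite lerDl.
  apply: rv_norm_le => [|i]; first exact: ler0n.
  by rewrite mxE; exact: le_trans (rv_norm_ge _ _) h.
pose A1 := d%:R * C1 + C1 * (2 * (N%:R + 1)).
have A10 : 0 <= A1 by rewrite addr_ge0// !mulr_ge0// addr_ge0.
have lipX l l' : Dom l -> Dom l' -> `|X l' - X l| <= A1 * `|l' - l|.
  move=> Dl Dl'; have [eb eq] := quadX _ _ Dl Dl'.
  rewrite -(subrK ((l' - l) *m endpoint_mx (z l).2) (X l' - X l)).
  apply: (le_trans (ler_normD _ _)); rewrite mulrDl addrC; apply: lerD.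
    exact: norm_mulmx_le.
  apply: (le_trans eq); rewrite expr2 [leLHS]mulrA ler_wpM2r// ler_wpM2l//.
  apply: (le_trans (ler_normB _ _)); have := normD _ Dl; have := normD _ Dl'; lra.
pose K := C' * A1 ^+ 2 + d%:R * C' * C1 + d%:R * (C1 * C').
have K1 : 0 <= C' * A1 ^+ 2 by rewrite mulr_ge0// sqr_ge0.
have K2 : 0 <= d%:R * C' * C1 by rewrite !mulr_ge0.
have K3 : 0 <= d%:R * (C1 * C') by rewrite !mulr_ge0.
apply: (sard d0 Dom (tau \o X) L K (N%:R + 1)).
- by rewrite !addr_ge0.
- by rewrite ltr_wpDl.
- exact: normD.
- by move=> l /Hz[[_ _ _ dt] _ _ _]; rewrite det_mulmx dt mul0r.
- move=> l i j Dl; have [eb _] := quadX _ _ Dl Dl.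
  apply: (@le_trans _ _ (d%:R * (C1 * C'))); last by rewrite /K; lra.
  rewrite mxE; apply: (le_trans (ler_norm_sum _ _ _)).
  have -> : d%:R * (C1 * C') = \sum_(i < d) C1 * C' by rewrite sumr_const card_ord mulr_natl.
  by apply: ler_sum => a _; rewrite normrM; apply: ler_pM => //; apply: Jb; exact: Xr.
- move=> l l' Dl Dl'; have [eb eq] := quadX _ _ Dl Dl'; rewrite /L /=.
  pose u := X l' - X l - (l' - l) *m endpoint_mx (z l).2.
  have -> : tau (X l') - tau (X l) - (l' - l) *m (endpoint_mx (z l).2 *m J (X l)) =
      (tau (X l') - tau (X l) - (X l' - X l) *m J (X l)) + u *m J (X l).
    by rewrite /u (mulmxBl (X l' - X l)) mulmxA addrA subrK.
  apply: (le_trans (ler_normD _ _)); rewrite /K mulrDl [leRHS]addrC -[leLHS]add0r; apply: lerD.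
    by rewrite mulr_ge0// sqr_ge0.
  rewrite mulrDl; apply: lerD.
    have := C11_quad _ _ _ _ tC' _ _ (Xr _ Dl) (Xr _ Dl').
    have -> : \sum_l0 (X l' - X l) 0 l0 *: 'D_(delta_mx 0 l0 : E) tau (X l) = (X l' - X l) *m J (X l).
      by rewrite mulmx_sum_row; apply: eq_bigr => a _; rewrite rowK.
    move=> /le_trans; apply; rewrite -mulrA -exprMn ler_wpM2l// lerXn2r ?nnegrE ?mulr_ge0//.
    exact: lipX.
  apply: (le_trans (norm_mulmx_le u (J (X l)) C' C'0 _)) => [i j|]; first by apply: Jb; exact: Xr.
  by rewrite -[leRHS]mulrA ler_wpM2l// mulr_ge0.
Qed.

End critical_values.

Section critical_points.
Context {R : realType} {M : topologicalType} {d : nat}.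
Hypothesis d0 : (0 < d)%N.
Local Notation E := 'rV[R]_d.
Variables (S : sr_data R M d) (c : chart R M d).
Hypothesis hM : smooth_manifold (sr_atlas S).
Hypothesis Ac : sr_atlas S c.

Lemma rat_rV_dense (x : E) (e : R) : 0 < e -> exists q : 'rV[rat]_d, `|x - map_mx ratr q| <= e.
Proof.
move=> e0; have /choice[q Hq] : forall i, exists q : rat, `|x 0 i - ratr q| <= e.
  move=> i; have : x 0 i < x 0 i + e by rewrite ltrDl.
  move=> /rat_in_itvoo[q]; rewrite in_itv/= => /andP[q1 q2]; exists q.
  by rewrite ler0_norm; lra.
exists (\row_i q i); apply: rv_norm_le => [|i]; first exact: ltW.
by rewrite !mxE.
Qed.

(** The overlap with another chart is covered by countably many rational cubes on each of which the
    transition map satisfies C^{1,1} bounds. *)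
Lemma chart_null (Z : set E) :
  (forall (tau : E -> E) x0 (r C : R), C11_on x0 r C tau ->
     lebesgue_null (tau @` (Z `&` [set x | `|x - x0| <= r]))) ->
  measure_zero (sr_atlas S) (cdom c `&` ccoord c @^-1` Z).
Proof.
move=> HZ c' Ac'; pose tau := transition c c'.
pose ctr (p : 'rV[rat]_d * nat) : E := map_mx ratr p.1.
pose rad (p : 'rV[rat]_d * nat) : R := p.2.+1%:R^-1.
pose good p := exists C, C11_on (ctr p) (rad p) C tau.
pose Nn p := [set z | good p /\ (tau @` (Z `&` [set x | `|x - ctr p| <= rad p])) z].
apply: (@lebesgue_nullS R d _ (\bigcup_p Nn p)); last first.
  apply: lebesgue_null_bigcup => // p; have [[C HC]|ng] := pselect (good p).
    by apply: lebesgue_nullS (HZ _ _ _ _ HC) => z [].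
  by apply: (@lebesgue_nullS R d _ set0); [move=> z []|exact: lebesgue_null_set0].
move=> _ [p [[cp Zp] cp'] <-].
have [r [C [r0 C0 _ HC]]] := transition_C11 _ hM _ _ _ Ac Ac' cp cp'.
(* With radius at most r/2 and centre within that radius of the point, the rational cube lies in the
   cube of radius [r] where the bounds hold. *)
have [k Hk] : exists k : nat, k.+1%:R^-1 <= r / 2.
  exists (Num.truncn (r / 2)^-1); rewrite -[leRHS]invrK lef_pV2 ?posrE ?ltr0n ?invr_gt0 ?divr_gt0//.
  by apply: ltW; exact: truncnS_gt.
have [q Hq] := rat_rV_dense (ccoord c p) k.+1%:R^-1 (ltac:(by rewrite invr_gt0 ltr0n)).
exists (q, k) => //; split.
  exists C; apply: C11_on_mono HC => // x; rewrite /ctr /rad/= => xq.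
  rewrite -(subrKA (map_mx ratr q)); apply: (le_trans (ler_normD _ _)).
  by rewrite [X in _ + X <= _]distrC (le_trans (lerD xq Hq))// (le_trans (lerD Hk Hk))// -splitr.
by exists (ccoord c p) => //=; rewrite /tau /transition/= (cinvK S hM).
Qed.

End critical_points.

(** * Counting geodesics *)

Section counting_seq.
Context {R : realType} {T : choiceType}.
Implicit Types (X : set T) (s : seq T).

Lemma counting_ge X s : uniq s -> (forall x, x \in s -> X x) ->
  ((size s)%:R%:E <= counting X :> \bar R)%E.
Proof.
move=> us sX; rewrite /counting; case: asboolP => [fX|_]; last by rewrite leey.
rewrite lee_fin ler_nat; apply: uniq_leq_size => // x /sX Xx.
by rewrite in_fset_set// inE.
Qed.

Lemma counting_le X (l : \bar R) :
  (forall s, uniq s -> (forall x, x \in s -> X x) -> ((size s)%:R%:E <= l)%E) ->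
  (counting X <= l)%E.
Proof.
move=> H; rewrite /counting; case: asboolP => [fX|iX].
  by apply: H => // x; rewrite in_fset_set// inE.
rewrite leye_eq; apply/eqP/eqyP => A A0.
have [B BX sB] := infinite_set_fset (Num.truncn A).+1 iX.
have h := H (finmap.enum_fset B) (finmap.fset_uniq B) (fun x xB => BX x xB).
apply: (le_trans _ h); rewrite lee_fin (le_trans (ltW (truncnS_gt A)))// ler_nat//.
Qed.

End counting_seq.

Lemma limf_einf_right_ge (R : realType) (g : R -> \bar R) (l : \bar R) (e : R) : 0 < e ->
  (forall x, 0 < x -> x < e -> (l <= g x)%E) -> (l <= limf_einf g 0^'+)%E.
Proof.
move=> e0 H.
have nb : \forall x \near 0^'+, 0 < x < e.
  near=> x; apply/andP; split; near: x; [exact: nbhs_right_gt|exact: nbhs_right_lt].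
rewrite limf_einfE; apply: ereal_sup_ge.
exists (ereal_inf (g @` [set x | 0 < x < e])); first by exists [set x | 0 < x < e].
by apply/ereal_infP => _ [x /= /andP[x0 xe] <-]; exact: H.
Unshelve. all: by end_near. Qed.

Section lifting.
Context {R : realType} {n : nat} {M : topologicalType}.
Local Notation d := (2 * n + 1)%N.
Local Notation k := (2 * n)%N.
Local Notation E := 'rV[R]_d.
Variables (S : sr_data R M d) (p0 : M) (c : chart R M d) (f : 'I_k -> E -> E).
Hypothesis hM : smooth_manifold (sr_atlas S).
Hypothesis hC : sr_coherent S.
Hypothesis hg : sr_smooth_metric S.
Hypothesis hc : adapted S p0 c.
Hypothesis hf : orthonormal_frame S c f.

Let Ac : sr_atlas S c. Proof. by case: hc. Qed.
Let cp0 : cdom c p0. Proof. by case: hc. Qed.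
Let c0 : ccoord c p0 = 0. Proof. by case: hc. Qed.
Let img0 : cimg c 0. Proof. by exists p0. Qed.
Let inv0 : cinv c 0 = p0. Proof. by rewrite -c0 (cinvK S hM). Qed.

Lemma adapted_frame_vertical i : f i 0 0 (rshift k 0) = 0.
Proof.
have [DE _] := hf.2 _ img0; case: hc => _ _ _; rewrite -inv0 DE => D0.
have : [set v | (v <= frame_mx f 0)%MS] (f i 0) by rewrite /= -(rowK (fun i => f i 0) i) row_sub.
by rewrite D0 => -[u _ <-]; rewrite row_mxEr mxE.
Qed.

(** The frame vectors at the origin have no vertical part, so a relation between their horizontal
    parts is a relation between the vectors themselves. *)
Lemma adapted_frame_unit : frame_A f \in unitmx.
Proof.
rewrite -row_free_unit; apply: inj_row_free => u uA.
apply: (frame_free _ _ _ hM hg Ac hf _ _ img0); apply/rowP => l.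
rewrite [RHS]mxE mxE; case: (split_ordP l) => j ->.
  transitivity ((u *m frame_A f) 0 j); last by rewrite uA mxE.
  by rewrite [RHS]mxE; apply: eq_bigr => i _; rewrite !mxE.
by rewrite big1// => i _; rewrite (ord1 j) mxE adapted_frame_vertical mulr0.
Qed.

Variables (r C : R).
Hypothesis r0 : 0 < r.
Hypothesis C0 : 0 <= C.
Hypothesis sub : forall x, `|x - 0| <= r -> cimg c x.
Hypothesis fC : forall i, C11_on 0 r C (f i).
Variable DH : 'I_(d + d) -> 'rV[R]_(d + d) -> 'I_(d + d) -> R.
Hypothesis convH : forall rho : R, 0 <= rho -> forall i,
  c1conv rho (fun e a => ham (feps f e) (Geps f e) a 0 i) (fun a => ham (phi0 f) (Gam0 f) a 0 i) (DH i).

Lemma geodesic_lifting x gamma (sigma : R) :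
  ~ critical_value (ham (phi0 f) (Gam0 f)) DH x ->
  geodesics_joining (nilpotent_approximation f) setT 0 x gamma -> 0 < sigma ->
  exists2 e : R, 0 < e & forall eps, 0 < eps -> eps < e ->
    exists2 g, geodesics_joining S (cdom c) p0 (cinv c (dilation eps x)) g &
      forall t, 0 <= t -> t <= 1 -> `|dilation eps^-1 (ccoord c (g t)) - gamma t| <= sigma.
Proof.
move=> ncrit [geo g0 g1 _ [gl gr]] sigma0.
have [y [sy yg]] := hat_geodesic_sol f r C r0 C0 fC adapted_frame_vertical adapted_frame_unit gamma geo gl gr.
have cy : continuous y by case: sy.
have /choice[W HW] : forall j, exists w, vsol DH y w /\ w 0 = unitp j.
  by move=> j; exact: (vsol_existence _ _ _ convH).
have uW : endpoint_mx W \in unitmx.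
  rewrite unitmxE unitfE; apply/eqP => dt; apply: ncrit; exists y, W; split; last by rewrite yg.
  by split => //; rewrite yg.
have [_ [s [t [s01 t01 gst]]] _] := geo.
move: s01 t01; rewrite !in_itv/= => /andP[s0 s1] /andP[t0 t1].
pose dlt := `|gamma s - gamma t|.
have dlt0 : 0 < dlt by rewrite normr_gt0 subr_eq0; apply/eqP.
(* Two curve values at distance [dlt] stay distinct after a displacement by a third of it: the
   lifted curve is not constant. *)
pose sg := Num.min sigma (dlt / 3).
have sg0 : 0 < sg by rewrite lt_min sigma0 divr_gt0.
have sgs : sg <= sigma by rewrite ge_min lexx.
have sgd : sg <= dlt / 3 by rewrite ge_min lexx orbT.
have [e1 e10 He1] := persistence _ _ _ convH y W sy HW uW sg sg0.
have [rho rho0 Hrho] := curve_bounded _ cy.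
have rs0 : 0 <= rho + sg by rewrite addr_ge0// ltW.
(* Rescaling by [eps < e2] brings the perturbed curve into the cube where the frame is
   controlled. *)
have [e2 e20 He2] := small_positive r (rho + sg) r0 rs0.
exists (Num.min e1 (Num.min e2 1)); first by rewrite !lt_min e10 e20 ltr01.
move=> eps ep; rewrite !lt_min => /and3P[epe1 epe2 ep1].
have [z [sz z0 z1 zy]] := He1 eps ep epe1.
have ext := rescaled_extremal f eps z ep sz.
set Q := (fun t => dilation eps (lsubmx (z t))) in ext.
have zg u : 0 <= u -> u <= 1 -> `|lsubmx (z u) - gamma u| <= sg.
  move=> u0 u1; rewrite -yg; apply: le_trans (zy u u0 u1).
  have -> : lsubmx (z u) - lsubmx (y u) = lsubmx (z u - y u) by apply/rowP => i; rewrite !mxE.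
  exact: lsubmx_norm.
have Qin u : 0 <= u -> u <= 1 -> cimg c (Q u).
  move=> u0 u1; apply: sub; rewrite subr0; apply: (le_trans (dilation_norm _ _ ep (ltW ep1))).
  apply: le_trans He2; apply: ler_pM => //; [exact: ltW|exact: ltW|].
  apply: (le_trans (lsubmx_norm _)); rewrite -(subrK (y u) (z u)); apply: (le_trans (ler_normD _ _)).
  by rewrite addrC; apply: lerD; [exact: Hrho|exact: zy].
have coordQ u : 0 <= u -> u <= 1 -> ccoord c (lift_curve c Q u) = Q u.
  by move=> u0 u1; rewrite /lift_curve clamp_id//; have [_] := cimg_cinv _ hM _ _ Ac (Qin u u0 u1).
have Qst : Q s <> Q t.
  move=> /(congr1 (dilation eps^-1)); rewrite !dilationK// => zst.
  have h1 := zg s s0 s1; have h2 := zg t t0 t1; rewrite zst in h1.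
  have : dlt <= `|lsubmx (z t) - gamma s| + `|lsubmx (z t) - gamma t|.
    by rewrite /dlt -(subrKA (lsubmx (z t))) (le_trans (ler_normD _ _))// distrC.
  lra.
exists (lift_curve c Q); last first.
  move=> u u0 u1; rewrite coordQ// dilationK//; exact: le_trans (zg u u0 u1) sgs.
split.
- apply: (extremal_geodesic _ _ _ hM hC hg Ac hf Q _ ext Qin); by exists s, t.
- by rewrite /lift_curve clamp_id// /Q z0 yg g0 dilation0.
- by rewrite /lift_curve clamp_id// /Q z1 yg g1.
- move=> u /[!in_itv]/= /andP[u0 u1]; rewrite /lift_curve clamp_id//.
  by have [] := cimg_cinv _ hM _ _ Ac (Qin u u0 u1).
- split=> u hu; rewrite /lift_curve; congr (cinv c (Q _)).
    by rewrite /clamp (min_idPr (le_trans hu ler01)) !max_l.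
  by rewrite /clamp (min_idPl hu) minxx.
Qed.

Lemma geodesic_count x : ~ critical_value (ham (phi0 f) (Gam0 f)) DH x ->
  (num_geodesics (nilpotent_approximation f) setT (0%R : E) x <=
   limf_einf (fun eps : R => num_geodesics S (cdom c) p0 (cinv c (dilation eps x))) 0%R^'+)%E.
Proof.
move=> ncrit; apply: counting_le => s us sX.
pose G (i : 'I_(size s)) := nth (fun=> 0) s i.
have Gin i : geodesics_joining (nilpotent_approximation f) setT 0 x (G i) by apply: sX; exact: mem_nth.
have Ginj : injective G by move=> i j /eqP; rewrite nth_uniq// => /eqP/val_inj.
have /choice[tt Htt] : forall ij : 'I_(size s) * 'I_(size s), exists t : R,
    [/\ 0 <= t, t <= 1 & ij.1 != ij.2 -> G ij.1 t != G ij.2 t].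
  move=> [i j] /=; have [ij|ij] := eqVneq i j; first by exists 0; rewrite lexx ler01.
  apply: contrapT => nex; move/eqP: ij; apply; apply: Ginj.
  have E01 t : 0 <= t -> t <= 1 -> G i t = G j t.
    by move=> t0 t1; apply/eqP/negPn/negP => neq; apply: nex; exists t.
  (* Both curves are constant outside [0, 1], so that agreement on [0, 1] makes them equal as
     functions. *)
  have [_ _ _ _ [il ir]] := Gin i; have [_ _ _ _ [jl jr]] := Gin j.
  apply/funext => t; have [t0|/ltW t0] := leP 0 t; last by rewrite il// jl// E01.
  have [t1|/ltW t1] := leP t 1; first exact: E01.
  by rewrite ir// jr// E01.
(* A third of the smallest distance between two of the geodesics at a time where they differ: lifts
   within [sg], after rescaling, remain distinct. *)
pose sg := \big[Num.min/1]_(ij : 'I_(size s) * 'I_(size s) | ij.1 != ij.2)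
  (`|G ij.1 (tt ij) - G ij.2 (tt ij)| / 3).
have sg0 : 0 < sg.
  apply: (big_ind (fun x : R => 0 < x)) => // [a b a0 b0|ij hij]; first by rewrite lt_min a0 b0.
  by rewrite divr_gt0// normr_gt0 subr_eq0; have [_ _] := Htt ij; apply.
have [e e0 He] := uniform_threshold _ _ (fun i => geodesic_lifting x (G i) sg ncrit (Gin i) sg0).
apply: (limf_einf_right_ge _ _ _ e e0) => eps ep epe.
have /choice[g Hg] : forall i, exists g, geodesics_joining S (cdom c) p0 (cinv c (dilation eps x)) g /\
      forall t, 0 <= t -> t <= 1 -> `|dilation eps^-1 (ccoord c (g t)) - G i t| <= sg.
  by move=> i; have [g h1 h2] := He i eps ep epe; exists g.
have ginj : injective g.
  move=> i j gij; apply/eqP/negPn/negP => ij.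
  have [t0 t1 _] := Htt (i, j); have [_ h1] := Hg i; have [_ h2] := Hg j.
  have {}h1 := h1 _ t0 t1; have {}h2 := h2 _ t0 t1; rewrite gij in h1.
  have sgle : sg <= `|G i (tt (i, j)) - G j (tt (i, j))| / 3.
    exact: (bigmin_le_cond 1 (fun ij : 'I_(size s) * 'I_(size s) => `|G ij.1 (tt ij) - G ij.2 (tt ij)| / 3) (j:=(i, j)) ij).
  have : `|G i (tt (i, j)) - G j (tt (i, j))| <= sg + sg.
    set u := dilation _ _ in h1 h2; rewrite -(subrKA u).
    by apply: (le_trans (ler_normD _ _)); rewrite distrC; apply: lerD.
  have : 0 < `|G i (tt (i, j)) - G j (tt (i, j))| by lra.
  lra.
have -> : size s = size [seq g i | i <- enum 'I_(size s)] by rewrite size_map size_enum_ord.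
apply: counting_ge; first by rewrite map_inj_uniq// enum_uniq.
by move=> _ /mapP[i _ ->]; have [] := Hg i.
Qed.

End lifting.

Theorem theorem7 (R : realType) (n : nat) (M : topologicalType)
  (S : sr_data R M (2 * n + 1)) (p0 : M) (c : chart R M (2 * n + 1))
  (f : 'I_(2 * n) -> 'rV[R]_(2 * n + 1) -> 'rV[R]_(2 * n + 1))
  (hS : contact_sub_riemannian S)
  (hc : adapted S p0 c)
  (hf : orthonormal_frame S c f)
  (hfb : forall i, bounded_with_derivatives (cimg c) (f i)) :
  let nu (p : M) := num_geodesics S (cdom c) p0 p in
  let nu_hat (x : 'rV[R]_(2 * n + 1)) :=
    num_geodesics (nilpotent_approximation f) setT 0 x in
  let delta (eps : R) (p : M) := cinv c (dilation eps (ccoord c p)) in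
  exists V N : set M,
    [/\ nbhs p0 V, V `<=` cdom c, measure_zero (sr_atlas S) N &
        forall p, V p -> ~ N p ->
          (nu_hat (ccoord c p)
             <= limf_einf (fun eps : R => nu (delta eps p)) 0^'+)%E].

Proof.
move=> nu nu_hat delta; case: hS => -[hM _] hC _ _ hg.
have [Ac cp0 c0 _] := hc; have [opc oimg _ _ _] := atlas_wf _ hM _ Ac.
have img0 : cimg c 0 by exists p0.
have [r [C [r0 C0 sub fC]]] := smooth_C11_family _ _ _ _ f _ 0 hf.1 oimg img0.
have f0 := adapted_frame_vertical _ _ _ _ hM hc hf.
have [DH convH] := ham_cc _ _ _ _ (feps_cc f r C r0 C0 fC f0) (Geps_cc f r C r0 C0 fC).
have d0 : (0 < 2 * n + 1)%N by rewrite addn1.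
(* The dilated point enters every cube about the origin as [eps] tends to 0, so the whole chart
   domain can be taken for [V]. *)
exists (cdom c), (cdom c `&` ccoord c @^-1` critical_value (ham (phi0 f) (Gam0 f)) DH); split.
- exact: open_nbhs_nbhs.
- by [].
- by apply: (chart_null d0 _ _ hM Ac) => tau x0 r' C' tC; exact: (critical_values_null d0 _ _ _ convH _ _ _ _ tC).
- move=> p cp nN; apply: (geodesic_count _ _ _ _ hM hC hg hc hf r C r0 C0 sub fC DH convH).
  by move=> crit; apply: nN.
Qed.
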